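(* Let $k\ge 2$ be an integer, let $S_k:=\{(x,y,z)\in\mathbb C^3 : xy=z^k\}$, and let $m:=[k/2]$ be the integral part of $k/2$. Then \begin{align*} & \beta_{S_k}^1=\alpha_{S_k}^1=\Omega_{S_k}^1/\text{torsion}+\mathcal O_{S_k}\cdot \frac{x\,dy}{z^m},\\ & \alpha_{S_k}^2=\Omega_{S_k}^2/\text{torsion}+\mathcal O_{S_k}\cdot\frac{dx\wedge dy}{z^{m-1}},\\ & \beta_{S_k}^2=\alpha_{S_k}^2[1]=\Omega_{S_k}^2/\text{torsion}+\mathcal O_{S_k}\cdot\frac{dx\wedge dy}{z^{m}}. \end{align*}
   Context: For a reduced pure dimensional complex space $X$ with singular set $S(X)$: $\Omega_X^{\bullet}$ is the graded sheaf of holomorphic (Kähler) differential forms. $L_X^q$ is the sheaf of meromorphic $q$-forms on $X$ which become holomorphic on any desingularization of $X$, i.e. $L_X^q=\tau_*\Omega^q_{\tilde X}$ for any desingularization $\tau:\tilde X\to X$; it is coherent, and $L_X^\bullet$ is stable by exterior product and by the de Rham differential $d$. $\alpha_X^q\subset L_X^q$ is the coherent subsheaf of sections $\sigma$ which locally on $X$ can be written, on the complement of $S(X)$, as a finite sum $\sigma=\sum_j\rho_j\,\omega_j$ with $\omega_j$ holomorphic $q$-forms (sections of $\Omega_X^q$) and $\rho_j$ functions that are $\mathscr C^\infty$ on the complement of $S(X)$ and bounded near $S(X)$. (Equivalently, $\sigma$ is locally a root of a monic polynomial $z^k+\sum_{h=1}^kS_hz^{k-h}$ with $S_h$ a section of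 the degree $h$ symmetric power of $\Omega_X^q/\text{torsion}$.) Put $\alpha_X^\bullet[0]:=\alpha_X^\bullet$ and for $p,q\ge0$ $$\alpha_X^q[p+1]:=\sum_{r=0}^{q}\alpha_X^r[p]\wedge\alpha_X^{q-r}[p]+\sum_{r=0}^{q-1}\alpha_X^r[p]\wedge d\big(\alpha_X^{q-r-1}[p]\big)\subset L_X^q .$$ The sequence $(\alpha_X^\bullet[p])_{p\ge 0}$ is increasing, and $\beta_X^{\bullet}:=\bigcup_{p\ge0}\alpha_X^\bullet[p]$. *)

(* Defs.v *)
From HB Require Import structures.
From mathcomp Require Export all_boot all_order all_algebra.
From mathcomp Require Export all_classical all_reals all_analysis.
From mathcomp Require Export complex.

Set Implicit Arguments.
Unset Strict Implicit.
Unset Printing Implicit Defensive.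

Export Order.TTheory GRing.Theory Num.Theory numFieldNormedType.Exports.

Local Open Scope classical_set_scope.
Local Open Scope complex_scope.
Local Open Scope ring_scope.

(* Complex spaces are subsets X of C^N (with the reduced structure), together
   with their pure dimension n. *)

(* R[i] as a normed space over itself, as MathComp-Analysis does for an abstract
   numClosedFieldType. *)
#[warnings="-redundant-canonical-projection"]
HB.instance Definition _ (R : realType) := NormedModule.copy R[i] R[i]^o.

Section Forms.
Variables (R : realType) (N : nat).
Local Notation C := R[i].
Local Notation V := 'rV[C]_N.

(* A q-form attaches to a point and to a list of q vectors a scalar; its values
   on lists of another length are irrelevant.  The degree is a parameter of the
   operations below, not of the type. *)
Definition form := V -> seq V -> C.

Definition holo_at (W : normedModType C) (p : V) (f : V -> W) : Prop :=
  \forall x \near p, differentiable f x.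

Definition alternating (q : nat) (a : seq V -> C) : Prop :=
  (forall (s1 s2 : seq V) (c : C) (u v : V), (size s1 + (size s2).+1)%N = q ->
     a (s1 ++ (c *: u + v) :: s2) = c * a (s1 ++ u :: s2) + a (s1 ++ v :: s2))
  /\ (forall s : seq V, size s = q -> ~~ uniq s -> a s = 0).

Definition holo_form (q : nat) (p : V) (w : form) : Prop :=
  (\forall x \near p, alternating q (w x)) /\
  (forall s : seq V, size s = q -> holo_at p (w^~ s : V -> C)).

(* Shuffle formula: the vectors selected by the mask m go to the r-form a, the
   others to b, and the sign is that of the corresponding shuffle. *)
Definition mask_inversions (m : bitseq) : nat :=
  \sum_(j < size m | nth false m j) count negb (take j m).

Definition wedge (r : nat) (a b : form) : form := fun x s =>
  \sum_(m : (size s).-tuple bool | count id m == r)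
    (-1) ^+ mask_inversions m * a x (mask m s) * b x (mask (map negb m) s).

(* (dw)_x(v_0, .., v_q) = sum_i (-1)^i D_(v_i) w(v_0, .., ^v_i, .., v_q) at x,
   the v_i being constant vector fields. *)
Definition extd (w : form) : form := fun x s =>
  \sum_(i < size s)
    (-1) ^+ i * 'd (w^~ (take i s ++ drop i.+1 s) : V -> C) x s`_i.

Definition dcoord (i : 'I_N) : form := fun _ s => (head 0 s) 0 i.

(* Real C^k functions on R^M, and C^oo functions on C^N = R^(2N). *)
Fixpoint Ck (M k : nat) (D : set 'rV[R]_M) (f : 'rV[R]_M -> R) : Prop :=
  match k with
  | 0 => forall x, D x -> {for x, continuous f}
  | k'.+1 => (forall x, D x -> differentiable f x) /\
             (forall v, Ck k' D (fun x => 'd f x v))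
  end.

Definition cvec (w : 'rV[R]_(N + N)) : V :=
  \row_j (w 0 (lshift N j) +i* w 0 (rshift N j)).

Definition smooth_at (x : V) (f : V -> C) : Prop :=
  exists2 D : set 'rV[R]_(N + N), open D /\ (exists2 w, D w & cvec w = x) &
    forall k, Ck k D (fun w => complex.Re (f (cvec w))) /\
              Ck k D (fun w => complex.Im (f (cvec w))).

Section Space.
Variables (n : nat) (X : set V).

(* X is near p a complex submanifold of dimension n. *)
Definition reg : set V := [set p | X p /\
  exists g : V -> 'rV[C]_(N - n),
    [/\ holo_at p g, (forall u, exists v, 'd g p v = u) &
        \forall x \near p, X x <-> g x = 0]].

Definition sing : set V := X `\` reg.

Definition tangent (x : V) : set V := [set v |
  forall f : V -> C, holo_at x f -> (\forall y \near x, X y -> f y = 0) ->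
    'd f x v = 0].

(* Denominators: holomorphic germs whose zero set is nowhere dense in X, i.e.
   non zero-divisors. *)
Definition nonzerodiv (p : V) (h : V -> C) : Prop :=
  holo_at p h /\ \forall x \near p, X x -> closure [set y | X y /\ h y != 0] x.

Definition same_at (q : nat) (x : V) (a b : form) : Prop :=
  forall s, size s = q -> (forall v, v \in s -> tangent x v) -> a x s = b x s.

(* A germ at p of meromorphic q-form on X is represented by a form whose values
   on the polar set (and at the singular points) are meaningless: two forms are
   identified when they agree, on vectors tangent to X, off the zeros of a
   denominator. *)
Definition meq (q : nat) (p : V) (a b : form) : Prop :=
  exists2 h, nonzerodiv p h &
    \forall x \near p, reg x -> h x != 0 -> same_at q x a b.

(* A subsheaf of the sheaf of meromorphic q-forms, given by its stalks: F p a
   says that a represents a germ of F at p. *)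
Definition subsheaf := V -> form -> Prop.

Definition subsheaf_eq (F G : subsheaf) : Prop :=
  forall p a, X p -> (F p a <-> G p a).

Definition mero (q : nat) : subsheaf := fun p a =>
  exists h w, [/\ nonzerodiv p h, holo_form q p w &
                  meq q p a (fun x s => w x s / h x)].

(* Omega^q / torsion, as the image of Omega^q in the meromorphic forms. *)
Definition Omega_tf (q : nat) : subsheaf := fun p a =>
  exists2 w, holo_form q p w & meq q p a w.

(* F = Omega^q / torsion + O . theta *)
Definition Omega_tf_plus (q : nat) (theta : form) : subsheaf := fun p a =>
  exists w f, [/\ holo_form q p w, holo_at p (f : V -> C) &
                  meq q p a (fun x s => w x s + f x * theta x s)].

(* b is the exterior derivative of the q-form a. *)
Definition is_extd (q : nat) (p : V) (a b : form) : Prop :=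
  exists2 h, nonzerodiv p h &
    \forall x \near p, reg x -> h x != 0 ->
      exists w, [/\ holo_form q x w,
                    (\forall y \near x, reg y -> same_at q y a w) &
                    same_at q.+1 x b (extd w)].

(* Finite sums of elements of G. *)
Definition msum (q : nat) (p : V) (G : form -> Prop) (a : form) : Prop :=
  exists (J : nat) (t : 'I_J -> form), (forall j, G (t j)) /\
    meq q p a (fun x s => \sum_(j < J) t j x s).

End Space.
End Forms.

Section Desingularization.
Variable R : realType.
Local Notation C := R[i].

(* Complex manifolds of dimension n: (cmap i, cinv i) are the charts and their
   inverses. *)
Record cmanifold (n : nat) := CManifold {
  carrier : topologicalType;
  chart : Type;
  cdom : chart -> set carrier;
  cmap : chart -> carrier -> 'rV[C]_n;
  cinv : chart -> 'rV[C]_n -> carrier;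
  carrier_hausdorff : hausdorff_space carrier;
  cdom_open : forall i, open (cdom i);
  cdom_cover : forall u, exists i, cdom i u;
  cimg_open : forall i, open (cmap i @` cdom i);
  cmapK : forall i u, cdom i u -> cinv i (cmap i u) = u;
  cmap_continuous : forall i u, cdom i u -> {for u, continuous (cmap i)};
  cinv_continuous : forall i u, cdom i u ->
    {for cmap i u, continuous (cinv i)};
  chart_holo : forall i j u, cdom i u -> cdom j u ->
    holo_at (cmap i u) (cmap j \o cinv i)
}.

Section Space.
Variables (N n : nat) (X : set 'rV[C]_N).
Local Notation V := 'rV[C]_N.

Definition desingularization (M : cmanifold n) (tau : carrier M -> V) : Prop :=
  [/\ (forall u, X (tau u)) /\
      (forall i u, cdom i u -> holo_at (cmap i u) (tau \o cinv i)),
      (* tau is proper *)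
      (forall K, compact K -> K `<=` X -> compact (tau @^-1` K)),
      (* tau is a modification along the singular set of X *)
      dense (tau @^-1` (reg n X)) &
      (* tau is biholomorphic over the regular part of X *)
      exists g : V -> carrier M,
        [/\ (forall x, reg n X x -> tau (g x) = x),
            (forall u, reg n X (tau u) -> g (tau u) = u) &
            forall x, reg n X x -> exists i (f : V -> 'rV[C]_n),
              holo_at x f /\ \forall y \near x, X y ->
                cdom i (g y) /\ cmap i (g y) = f y]].

(* The pullback of the meromorphic form a extends to a holomorphic q-form on
   tau^-1(U) for some neighbourhood U of p; the extension eta is given in each
   chart, and is unique, hence compatible with changes of charts. *)
Definition pullback_holo (q : nat) (p : V) (a : form R N)
    (M : cmanifold n) (tau : carrier M -> V) : Prop :=
  exists (h : V -> C) (U : set V), [/\ nonzerodiv X p h, nbhs p U &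
    forall i, exists eta : form R n, forall u, cdom i u -> U (tau u) ->
      holo_form q (cmap i u) eta /\
      (reg n X (tau u) -> h (tau u) != 0 ->
       forall s, size s = q ->
         eta (cmap i u) s =
         a (tau u) (map ('d (tau \o cinv i : 'rV[C]_n -> V) (cmap i u)) s))].

Definition Lsheaf (q : nat) : subsheaf R N := fun p a =>
  mero n X q p a /\
  forall (M : cmanifold n) (tau : carrier M -> V),
    desingularization tau -> pullback_holo q p a tau.

(* C^oo near p on the complement of sing X, bounded near sing X. *)
Definition smooth_bounded (p : V) (rho : V -> C) : Prop :=
  (\forall x \near p, reg n X x ->
     exists2 f : V -> C, smooth_at x f & \forall y \near x, X y -> rho y = f y)
  /\
  (\forall x \near p, sing n X x ->
     exists B : R, \forall y \near x, reg n X y -> `|rho y| <= B%:C).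

Definition alpha (q : nat) : subsheaf R N := fun p a =>
  Lsheaf q p a /\
  exists (J : nat) (rho : 'I_J -> V -> C) (w : 'I_J -> form R N),
    [/\ forall j, smooth_bounded p (rho j), forall j, holo_form q p (w j) &
        meq n X q p a (fun x s => \sum_(j < J) rho j x * w j x s)].

Fixpoint alpha_iter (m q : nat) : subsheaf R N := fun p a =>
  match m with
  | 0 => alpha q p a
  | m'.+1 => msum n X q p (fun t =>
      (exists r b c, [/\ (r <= q)%N, alpha_iter m' r p b,
          alpha_iter m' (q - r) p c & t = wedge r b c]) \/
      (exists r b c dc, [/\ (r < q)%N, alpha_iter m' r p b,
          alpha_iter m' (q - r - 1) p c, is_extd n X (q - r - 1) p c dc &
          t = wedge r b dc])) a
  end.

Definition beta (q : nat) : subsheaf R N := fun p a =>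
  exists m, alpha_iter m q p a.

End Space.
End Desingularization.

Section Surface.
Variable R : realType.
Local Notation C := R[i].

Definition xc (p : 'rV[C]_3) : C := p 0 0.
Definition yc (p : 'rV[C]_3) : C := p 0 1.
Definition zc (p : 'rV[C]_3) : C := p 0 2.

Definition Sk (k : nat) : set 'rV[C]_3 := [set p | xc p * yc p = zc p ^+ k].

Definition dx : form R 3 := @dcoord R 3 0.
Definition dy : form R 3 := @dcoord R 3 1.

(* x dy / z^m and dx /\ dy / z^m as meromorphic forms: their values at z = 0
   are meaningless. *)
Definition xdy_over_z (m : nat) : form R 3 := fun p s =>
  xc p * dy p s / zc p ^+ m.

Definition dxdy_over_z (m : nat) : form R 3 := fun p s =>
  wedge 1 dx dy p s / zc p ^+ m.

End Surface.

Arguments Sk R k : clear implicits.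

(* Main.v *)
Require Import Defs.
From HB Require Import structures.
From mathcomp Require Import ring lra zify.

Set Implicit Arguments.
Unset Strict Implicit.
Unset Printing Implicit Defensive.

Local Open Scope classical_set_scope.
Local Open Scope complex_scope.
Local Open Scope ring_scope.

(* On [X = {xy = z^k}] the tangent fields [ea = k x d/dx + z d/dz] and
   [eb = k y d/dy + z d/dz] commute and span the tangent planes where [z <> 0],
   so a form is known from its values on them: the 1-form
   [f1 dx + f2 dy + f3 dz + f x dy / z^m] takes the values [k x f1 + z f3] and
   [k y f2 + z f3 + k z^(k-m) f], and [dx dy / z^j] takes the value
   [k^2 z^(k-j)] on [(ea, eb)].

   Upper bound: the coefficients of a section of alpha are holomorphic off the
   origin and bounded, hence of the form [c(z) + x P(x, z) + y Q(y, z)] (Laurent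
   expansion in [x] along the curves [z = const]).  The bounds on the sections,
   tested on the axes and at the points [|x| = |y| = |z|^(k/2)], give the
   divisibilities by [z] which characterize the stalk at the origin.

   Lower bound: the coefficients [z^(k-m) conj y / N], [z^(k-m) conj x / N] and
   [|x|^2 / N], with [N = |x|^2 + |y|^2], are bounded.  On a chart of a
   desingularization [F1 F2 = F3^k], whence [F1 dF2 = O(F3^m)] and
   [dF1 dF2 = O(F3^(m-1))], so that the Riemann extension theorem makes the
   pullbacks holomorphic.

   Products and derivatives of sections are then computed on [(ea, eb)]; the
   only new generator is [d(x dy / z^m) = (1 - m/k) dx dy / z^m], and the
   process stops after one step. *)

(** * Complex differentiation *)

(** The exponents come from the points |x| = |y| = |z|^(k/2) of X. There the values of a section of
    alpha^1 on [ea] and on [eb] differ by O(|z|^(k/2)), and the value of a section of alpha^2 on the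
    pair is O(|z|^(k/2+1)); orders in z are integers, so these round up to k - m and k - m + 1. The
    obstacle is the origin, where X has no coordinates: the splitting c + x P + y Q replaces them.
    It also shows that a bounded function holomorphic off the origin extends, so alpha^0 is the
    sheaf of holomorphic functions. Off the origin (x, z) or (y, z) are coordinates, and a
    continuous function that is generically a quotient g / h is holomorphic by Riemann extension,
    used in the form |g| <= K |h|. The iteration stops because a section of degree 2 can afterwards
    only be multiplied by functions, while a product of two sections of alpha^1 has at worst the
    denominator z^m, the square of x dy / z^m being zero. *)

Section Norm.
Variable R : realType.
Local Notation C := R[i].

(** Norms over [C] are elements of [C]. Their real parts are used throughout, so that estimates take
    place in the ordered field [R], where linear arithmetic applies. *)
Definition nm (W : normedModType C) (w : W) : R := complex.Re `|w|.

Section Gen.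
Variable W : normedModType C.
Implicit Types (u v w : W).

Lemma nmE w : `|w| = (nm w)%:C.
Proof. by rewrite /nm RRe_real // normr_real. Qed.
Lemma nm_ge0 w : 0 <= nm w.
Proof. by rewrite -ler0c -nmE. Qed.
Lemma nm0 : nm (0 : W) = 0.
Proof. by rewrite /nm normr0. Qed.
Lemma nm0_eq0 w : (nm w == 0) = (w == 0).
Proof. by rewrite -[RHS]normr_eq0 nmE eq_complex /= eqxx andbT. Qed.
Lemma nm_gt0 w : (0 < nm w) = (w != 0).
Proof. by rewrite lt_def nm_ge0 andbT nm0_eq0. Qed.
Lemma nmN w : nm (- w) = nm w.
Proof. by rewrite /nm normrN. Qed.
Lemma nmD u v : nm (u + v) <= nm u + nm v.
Proof. by rewrite -lecR rmorphD /= -!nmE ler_normD. Qed.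
Lemma nmB u v : nm (u - v) <= nm u + nm v.
Proof. by rewrite -(nmN v) nmD. Qed.
Lemma nm_distC u v : nm (u - v) = nm (v - u).
Proof. by rewrite -nmN opprB. Qed.
Lemma nm_dist u v : nm u - nm v <= nm (u - v).
Proof. by rewrite lerBlDr; apply: le_trans (nmD _ _); rewrite subrK. Qed.
Lemma nm_near u v w d : nm (w - v) < d - nm (v - u) -> nm (w - u) < d.
Proof.
by rewrite ltrBrDr; apply: le_lt_trans; apply: le_trans (nmD _ _); rewrite addrA subrK.
Qed.
Lemma nmZ (c : C) w : nm (c *: w) = nm c * nm w.
Proof.
have: `|c *: w| = `|c| * `|w| by rewrite normrZ.
by rewrite !nmE -rmorphM => /complexI.
Qed.

Lemma nearnP (p : W) (P : W -> Prop) : (\forall x \near p, P x) <->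
  exists2 e : R, 0 < e & forall x, nm (x - p) < e -> P x.
Proof.
rewrite nbhs_normP; split=> [[e /= e0 H]|[e e0 H]].
  have er : e = (complex.Re e)%:C by rewrite RRe_real // gtr0_real.
  exists (complex.Re e); first by rewrite -ltcR -er.
  by move=> x xe; apply: H; rewrite /= -opprB normrN nmE er ltcR.
exists e%:C => /=; first by rewrite ltcR.
by move=> x /=; rewrite -opprB normrN nmE ltcR => /H.
Qed.

End Gen.

Lemma nmM (a b : C) : nm (a * b) = nm a * nm b.
Proof.
have: `|a * b| = `|a| * `|b| by rewrite normrM.
by rewrite !nmE -rmorphM => /complexI.
Qed.
Lemma nm1 : nm (1 : C) = 1.
Proof. by rewrite /nm normr1. Qed.
Lemma nmV (a : C) : nm a^-1 = (nm a)^-1.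
Proof.
have [->|a0] := eqVneq a 0; first by rewrite invr0 nm0 invr0.
apply: (mulfI (x := nm a)); first by rewrite nm0_eq0.
by rewrite -nmM divff // divff ?nm0_eq0 // nm1.
Qed.
Lemma nmX (a : C) n : nm (a ^+ n) = nm a ^+ n.
Proof. by elim: n => [|n IH]; rewrite ?expr0 ?nm1 // !exprS nmM IH. Qed.
Lemma nmR (a : R) : nm (a%:C : C) = `|a|.
Proof. by rewrite /nm normc_def /= expr0n addr0 sqrtr_sqr. Qed.
Lemma nm_Re (a : C) : `|complex.Re a| <= nm a.
Proof. by rewrite -lecR -nmE normc_ge_Re. Qed.
Lemma nm_Im (a : C) : `|complex.Im a| <= nm a.
Proof.
have := nm_Re (- 'i * a); rewrite nmM nmN.
have -> : nm ('i : C) = 1 by rewrite /nm normc_def /= expr0n add0r expr1n sqrtr1.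
by rewrite mul1r; case: a => x y /=; rewrite !(mul0r, mulN1r,oppr0,sub0r,opprK,addr0,add0r).
Qed.
Lemma nm_ReIm (a : C) : nm a <= `|complex.Re a| + `|complex.Im a|.
Proof.
rewrite {1}[a]complexE; apply: (le_trans (nmD _ _)); rewrite nmM !nmR.
have -> : nm ('i : C) = 1 by rewrite /nm normc_def /= expr0n add0r expr1n sqrtr1.
by rewrite mul1r.
Qed.

Section Diff.
Variables W W' : normedModType C.
Implicit Types (f : W -> W') (x : W).

Lemma bounded_linear_nm (L : {linear W -> W'}) : continuous L ->
  exists2 K : R, 0 < K & forall v, nm (L v) <= K * nm v.
Proof.
move=> /linear_bounded_continuous /linear_boundedP H.
have [M [Mr HM]] := H.
have er : M = (complex.Re M)%:C by rewrite RRe_real.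
exists (`|complex.Re M| + 1); first by rewrite ltr_wpDl.
move=> v; rewrite -lecR rmorphM /= -!nmE; apply: HM.
by rewrite er ltcR; apply: (le_lt_trans (ler_norm _)); rewrite ltrDl.
Qed.

Lemma differentiable_nm f x : differentiable f x ->
  (exists2 K : R, 0 < K & forall v, nm ('d f x v) <= K * nm v) /\
  forall e : R, 0 < e -> exists2 d : R, 0 < d & forall h, nm h < d ->
    nm (f (x + h) - f x - 'd f x h) <= e * nm h.
Proof.
move=> df; split; first exact: bounded_linear_nm (diff_continuous df).
move=> e e0; have [_ /eqaddoP H] := (diff_locallyP x f).1 df.
have /H/nearnP[d d0 Hd] : 0 < e%:C :> C by rewrite ltcR.
exists d => // h hd; have := Hd h; rewrite subr0 => /(_ hd).
by rewrite !nmE -rmorphM lecR /= !fctE /= [h + x]addrC opprD addrA.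
Qed.

(** The bound by [K] supplies the continuity of [L], without which a linear map with a small
    remainder would not be the differential. *)
Lemma is_diff_nm f x (L : W -> W') (K : R) : linear L ->
  (forall v, nm (L v) <= K * nm v) ->
  (forall e : R, 0 < e -> exists2 d : R, 0 < d & forall h, nm h < d ->
    nm (f (x + h) - f x - L h) <= e * nm h) ->
  differentiable f x /\ forall v, 'd f x v = L v.
Proof.
move=> Ll LK H.
pose Lm := GRing.isLinear.Build _ _ _ _ L Ll.
pose LL : {linear W -> W'} := HB.pack L Lm.
have Lc : continuous LL.
  apply/linear_bounded_continuous/linear_boundedP.
  exists K%:C; split; first by rewrite complex_real.
  move=> r Kr v; apply: (@le_trans _ _ (K%:C * `|v|)).
    by rewrite !nmE -rmorphM lecR; apply: LK.
  by apply: ler_wpM2r => //; apply: ltW.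
have Ho : f \o shift x = cst (f x) + LL +o_ (0 : W) id.
  apply/eqaddoP => e e0; have er : e = (complex.Re e)%:C by rewrite RRe_real // gtr0_real.
  have /H[d d0 Hd] : 0 < complex.Re e by rewrite -ltcR -er.
  apply/nearnP; exists d => // h; rewrite subr0 => /Hd.
  rewrite !nmE er -rmorphM lecR /= !fctE /= [h + x]addrC opprD addrA //.
have dE := diff_unique Lc Ho.
split; last by move=> v; rewrite dE.
by apply/diff_locallyP; rewrite dE.
Qed.

Lemma differentiable_lip f x : differentiable f x -> exists2 K : R, 0 < K &
  exists2 d : R, 0 < d & forall h, nm h < d -> nm (f (x + h) - f x) <= K * nm h.
Proof.
move=> /differentiable_nm[[K K0 HK] /(_ 1 ltr01)[d d0 Hd]].
exists (K + 1); first by rewrite addr_gt0.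
exists d => // h /Hd Hh; rewrite -(subrK ('d f x h) (_ - _)).
apply: (le_trans (nmD _ _)); rewrite mulrDl addrC lerD //; exact: HK.
Qed.

Lemma near_eq_diff f g x : (\forall y \near x, f y = g y) -> differentiable f x ->
  differentiable g x /\ forall v, 'd g x v = 'd f x v.
Proof.
move=> /nearnP[d d0 Hd] /differentiable_nm[[K K0 HK] H].
apply: (@is_diff_nm g x _ K) => //; first exact: linearP.
move=> e /H[d' d'0 Hd']; exists (Num.min d d'); first by rewrite lt_min d0.
move=> h; rewrite lt_min => /andP[h1 h2]; rewrite -!Hd ?subrr ?nm0 //; first exact: Hd'.
by rewrite addrC addKr.
Qed.

Lemma continuous_nm f x : {for x, continuous f} <->
  forall e : R, 0 < e -> exists2 d : R, 0 < d & forall y, nm (y - x) < d ->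
    nm (f y - f x) < e.
Proof.
split=> [H e e0|H P /nearnP[e e0 He]].
  have /H/nearnP[d d0 Hd] : nbhs (f x) [set y | nm (y - f x) < e].
    by apply/nearnP; exists e.
  by exists d.
have [d d0 Hd] := H e e0.
by apply/nearnP; exists d => // y /Hd /He.
Qed.

End Diff.
Arguments is_diff_nm {W W' f x} L K.

Section Alg.
Variable W : normedModType C.

(* [cdf] and [cd] seal differentiability and the differential of scalar
   functions: the two normed module structures carried by [C] are convertible,
   but comparing them is expensive. *)
Definition cdf_ (f : W -> C) (x : W) : Prop := differentiable f x.
Definition cd_ (f : W -> C) (x v : W) : C := 'd f x v.
Fact cdf_key : unit. Proof. exact: tt. Qed.
Definition cdf := locked_with cdf_key cdf_.
Definition cd := locked_with cdf_key cd_.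
Implicit Types (f g : W -> C) (x v : W).

Lemma cdfE f x : cdf f x = differentiable f x.
Proof. by rewrite /cdf unlock. Qed.
Lemma cdE f x v : cd f x v = 'd f x v.
Proof. by rewrite /cd unlock. Qed.

Lemma cdfM f g x : cdf f x -> cdf g x -> cdf (fun y => f y * g y) x.
Proof. by rewrite !cdfE => hf hg; refine (@differentiableM _ _ f g x hf hg). Qed.
Lemma cdfD f g x : cdf f x -> cdf g x -> cdf (fun y => f y + g y) x.
Proof. by rewrite !cdfE => hf hg; refine (@differentiableD _ _ _ f g x hf hg). Qed.
Lemma cdfN f x : cdf f x -> cdf (fun y => - f y) x.
Proof. by rewrite !cdfE => hf; refine (@differentiableN _ _ _ f x hf). Qed.
Lemma cdfB f g x : cdf f x -> cdf g x -> cdf (fun y => f y - g y) x.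
Proof. by move=> hf hg; apply: cdfD => //; apply: cdfN. Qed.
Lemma cdfV f x : cdf f x -> f x != 0 -> cdf (fun y => (f y)^-1) x.
Proof. by rewrite !cdfE => hf h; refine (@differentiableV _ _ f x hf h). Qed.
Lemma cdf_cst (c : C) x : cdf (fun _ => c) x.
Proof. by rewrite cdfE; exact: differentiable_cst. Qed.
Lemma cdf_div f g x : cdf f x -> cdf g x -> g x != 0 -> cdf (fun y => f y / g y) x.
Proof. by move=> hf hg h; apply: cdfM => //; apply: cdfV. Qed.
Lemma cdfX f n x : cdf f x -> cdf (fun y => f y ^+ n) x.
Proof.
move=> hf; elim: n => [|n IH].
  by rewrite (_ : (fun _ => _) = fun=> 1); [exact: cdf_cst|apply/funext => y; rewrite expr0].
rewrite (_ : (fun _ => _) = fun y => f y * f y ^+ n); first exact: cdfM.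
by apply/funext => y; rewrite exprS.
Qed.
Lemma cdM f g x v : cdf f x -> cdf g x ->
  cd (fun y => f y * g y) x v = f x * cd g x v + g x * cd f x v.
Proof.
rewrite !cdE !cdfE => hf hg.
by have := @diffM _ _ f g x hf hg => /(congr1 (fun h => h v)).
Qed.
Lemma cdD f g x v : cdf f x -> cdf g x ->
  cd (fun y => f y + g y) x v = cd f x v + cd g x v.
Proof.
rewrite !cdE !cdfE => hf hg.
by have := @diffD _ _ _ f g x hf hg => /(congr1 (fun h => h v)).
Qed.
Lemma cdN f x v : cdf f x -> cd (fun y => - f y) x v = - cd f x v.
Proof.
rewrite !cdE !cdfE => hf.
by have := @diffN _ _ C f x hf => /(congr1 (fun h => h v)).
Qed.
Lemma cdB f g x v : cdf f x -> cdf g x ->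
  cd (fun y => f y - g y) x v = cd f x v - cd g x v.
Proof. by move=> hf hg; rewrite cdD ?cdN //; apply: cdfN. Qed.
Lemma cd_cst (c : C) x v : cd (fun _ : W => c) x v = 0.
Proof. by rewrite cdE (@diff_cst _ W C c x). Qed.
Lemma cdX f n x v : cdf f x ->
  cd (fun y => f y ^+ n) x v = n%:R * f x ^+ n.-1 * cd f x v.
Proof.
move=> hf; elim: n => [|n IH].
  rewrite (_ : (fun y => f y ^+ 0) = fun=> 1); first by rewrite cd_cst !mul0r.
  by apply/funext => y; rewrite expr0.
rewrite (_ : (fun y => f y ^+ n.+1) = fun y => f y * f y ^+ n); last first.
  by apply/funext => y; rewrite exprS.
rewrite cdM //; last exact: cdfX.
rewrite IH; case: n {IH} => [|n] /=; first by rewrite !expr0; ring.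
by rewrite -[n.+2]addn1 natrD exprS; ring.
Qed.

Lemma cdZ f (c : C) x v : cdf f x -> cd (fun y => c * f y) x v = c * cd f x v.
Proof. by move=> hf; rewrite cdM ?cd_cst ?mulr0 ?addr0 //; apply: cdf_cst. Qed.

Lemma cd_lin f x (c : C) u v : cd f x (c *: u + v) = c * cd f x u + cd f x v.
Proof. by rewrite !cdE linearP. Qed.

Lemma cdf_near f g x : (\forall y \near x, f y = g y) -> cdf f x -> cdf g x.
Proof. by rewrite !cdfE => H /(near_eq_diff H)[]. Qed.
Lemma cd_near f g x v : (\forall y \near x, f y = g y) -> cdf f x -> cd g x v = cd f x v.
Proof. by rewrite cdfE !cdE => H /(near_eq_diff H)[]. Qed.

Lemma cdf_cont f x : cdf f x -> forall e : R, 0 < e ->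
  exists2 d : R, 0 < d & forall y, nm (y - x) < d -> nm (f y - f x) < e.
Proof. by rewrite cdfE => /differentiable_continuous /continuous_nm. Qed.

Lemma cdf_nm f x : cdf f x ->
  (exists2 K : R, 0 < K & forall v, nm (cd f x v) <= K * nm v) /\
  forall e : R, 0 < e -> exists2 d : R, 0 < d & forall h, nm h < d ->
    nm (f (x + h) - f x - cd f x h) <= e * nm h.
Proof.
rewrite cdfE => /differentiable_nm[[K K0 HK] H]; split.
  by exists K => // v; rewrite cdE.
by move=> e /H[d d0 Hd]; exists d => // h; rewrite cdE; apply: Hd.
Qed.

Lemma is_cd_nm f x (L : W -> C) (K : R) :
  (forall c u v, L (c *: u + v) = c * L u + L v) ->
  (forall v, nm (L v) <= K * nm v) ->
  (forall e : R, 0 < e -> exists2 d : R, 0 < d & forall h, nm h < d ->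
    nm (f (x + h) - f x - L h) <= e * nm h) ->
  cdf f x /\ forall v, cd f x v = L v.
Proof.
move=> Ll LK H; have [h1 h2] := @is_diff_nm W C f x L K Ll LK H.
by rewrite cdfE; split => // v; rewrite cdE.
Qed.

Lemma cdf_lip f x : cdf f x -> exists2 K : R, 0 < K &
  exists2 d : R, 0 < d & forall h, nm h < d -> nm (f (x + h) - f x) <= K * nm h.
Proof. by rewrite cdfE => /differentiable_lip. Qed.

Lemma cdf_linear (L : W -> C) (K : R) x :
  (forall c u v, L (c *: u + v) = c * L u + L v) ->
  (forall v, nm (L v) <= K * nm v) -> cdf L x /\ forall v, cd L x v = L v.
Proof.
move=> Ll LK; apply: (@is_cd_nm L x L K) => // e e0; exists 1 => // h _.
rewrite -[x + h]/(x + h) -[x]scale1r Ll scale1r mul1r [_ + L h]addrC addrK subrr nm0.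
by rewrite mulr_ge0 ?nm_ge0 // ltW.
Qed.

End Alg.

Section Comp.
Variables (U W : normedModType C).
Implicit Types (f : U -> W) (g : W -> C).
Lemma cdf_comp f g x : differentiable f x -> cdf g (f x) -> cdf (fun y => g (f y)) x.
Proof. by rewrite !cdfE => hf hg; exact: differentiable_comp. Qed.
Lemma cd_comp f g x v : differentiable f x -> cdf g (f x) ->
  cd (fun y => g (f y)) x v = cd g (f x) ('d f x v).
Proof.
rewrite !cdE cdfE => hf hg; have := @diff_comp _ _ _ _ f g x hf hg.
by move=> /(congr1 (fun h => h v)).
Qed.
End Comp.
End Norm.

(** * Cauchy's theory *)

Section Integral.
Variable R : realType.
Local Notation C := R[i].
Local Notation Re := complex.Re.
Local Notation Im := complex.Im.
Let mu : measure _ _ := @lebesgue_measure R.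
Implicit Types (a b c : R) (f g : R -> C).

Definition ccont f (t : R) : Prop := forall e : R, 0 < e ->
  exists2 d : R, 0 < d & forall s, `|s - t| < d -> nm (f s - f t) < e.

Definition Rint a b (f : R -> R) : R := \int[mu]_(t in `[a, b]) f t.
Definition cint a b f : C := Rint a b (fun t => Re (f t)) +i* Rint a b (fun t => Im (f t)).

Definition rcont (f : R -> R) (t : R) : Prop := forall e : R, 0 < e ->
  exists2 d : R, 0 < d & forall s, `|s - t| < d -> `|f s - f t| < e.

Lemma rcontP f t : rcont (fun t => Re (f t)) t /\ rcont (fun t => Im (f t)) t <-> ccont f t.
Proof.
split=> [[H1 H2] e e0|H].
  have [|d1 d10 Hd1] := H1 (e / 2); first by rewrite divr_gt0.
  have [|d2 d20 Hd2] := H2 (e / 2); first by rewrite divr_gt0.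
  exists (Num.min d1 d2); first by rewrite lt_min d10.
  move=> s; rewrite lt_min => /andP[/Hd1 h1 /Hd2 h2].
  apply: (le_lt_trans (nm_ReIm _)); rewrite !raddfB /= [e]splitr.
  exact: ltrD.
split=> e /H[d d0 Hd]; exists d => // s /Hd; apply: le_lt_trans.
  by rewrite -raddfB nm_Re.
by rewrite -raddfB nm_Im.
Qed.

Lemma rcont_continuous (f : R -> R) t : rcont f t <-> {for t, continuous (f : R -> R^o)}.
Proof.
split=> [H|H e e0].
  apply/(@cvgrPdist_lt _ R^o) => e /H[d d0 Hd].
  apply/nbhs_ballP; exists d => //= s; rewrite /ball /= distrC => /Hd.
  by rewrite distrC.
have /(@cvgrPdist_lt _ R^o) /(_ _ e0) /nbhs_ballP[d /= d0 Hd] := H.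
by exists d => // s sd; rewrite distrC; apply: Hd; rewrite /ball /= distrC.
Qed.

Lemma rcont_integrable (f : R -> R) a b : (forall t, a <= t <= b -> rcont f t) ->
  mu.-integrable `[a, b] (EFin \o f).
Proof.
move=> H; apply: continuous_compact_integrable; first exact: segment_compact.
apply: continuous_in_subspaceT => t /set_mem /=; rewrite in_itv /= => /H.
by move/rcont_continuous.
Qed.

Lemma RintD a b (f g : R -> R) : (forall t, a <= t <= b -> rcont f t) ->
  (forall t, a <= t <= b -> rcont g t) ->
  Rint a b (fun t => f t + g t) = Rint a b f + Rint a b g.
Proof.
by move=> hf hg; rewrite /Rint RintegralD //; apply: rcont_integrable.
Qed.
Lemma RintZ a b (f : R -> R) k : (forall t, a <= t <= b -> rcont f t) ->
  Rint a b (fun t => k * f t) = k * Rint a b f.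
Proof. by move=> hf; rewrite /Rint RintegralZl //; apply: rcont_integrable. Qed.

Lemma Rint_cst a b k : a <= b -> Rint a b (fun=> k) = k * (b - a).
Proof.
move=> ab; rewrite /Rint Rintegral_cst //=; rewrite lebesgue_measure_itv /= lte_fin.
case: ltrP => // ba; have -> : a = b by apply/eqP; rewrite eq_le ab ba.
by rewrite subrr.
Qed.

Lemma ext_Rint a b (f g : R -> R) : (forall t, a <= t <= b -> f t = g t) ->
  Rint a b f = Rint a b g.
Proof.
by move=> H; apply: eq_Rintegral => t /set_mem /=; rewrite in_itv /= => /H.
Qed.

Lemma Rint_split a b c (f : R -> R) : a <= c <= b -> (forall t, a <= t <= b -> rcont f t) ->
  Rint a b f = Rint a c f + Rint c b f.
Proof.
move=> /andP[ac cb] H; have If := rcont_integrable H.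
rewrite /Rint -[X in _ = _ + X]Rintegral_itv_obnd_cbnd; last first.
  by apply: integrableS If => // t /=; rewrite !in_itv /= => /andP[/ltW /(le_trans ac) ->].
by rewrite -(Rintegral_itvB If) ?bnd_simp // addrC subrK.
Qed.

Lemma Rint_norm a b (f : R -> R) M : a <= b -> (forall t, a <= t <= b -> rcont f t) ->
  (forall t, a <= t <= b -> `|f t| <= M) -> `|Rint a b f| <= M * (b - a).
Proof.
move=> ab H HM; have If := rcont_integrable H.
apply: (le_trans (le_normr_Rintegral _ If)) => //.
rewrite -(Rint_cst M ab); apply: le_Rintegral => //.
- by have /integrable_norm := If.
- by apply: rcont_integrable => t _ e e0; exists 1 => // s _; rewrite subrr normr0.
Qed.

Definition seg (P : R -> Prop) a b := forall t, a <= t <= b -> P t.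

Lemma ccont_cst (z : C) t : ccont (fun=> z) t.
Proof. by move=> e e0; exists 1 => // s _; rewrite subrr nm0. Qed.
Lemma ccontD f g t : ccont f t -> ccont g t -> ccont (fun t => f t + g t) t.
Proof.
move=> hf hg e e0; have e2 : 0 < e / 2 by rewrite divr_gt0.
have [d1 d10 H1] := hf _ e2; have [d2 d20 H2] := hg _ e2.
exists (Num.min d1 d2); first by rewrite lt_min d10.
move=> s; rewrite lt_min => /andP[/H1 h1 /H2 h2].
rewrite opprD addrACA; apply: (le_lt_trans (nmD _ _)).
by rewrite [e]splitr ltrD.
Qed.
Lemma ccontM f g t : ccont f t -> ccont g t -> ccont (fun t => f t * g t) t.
Proof.
move=> hf hg e e0.
pose A := nm (f t) + 1; pose B := nm (g t) + 1.
have A0 : 0 < A by rewrite ltr_wpDl ?nm_ge0.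
have B0 : 0 < B by rewrite ltr_wpDl ?nm_ge0.
have [|d1 d10 H1] := hf (Num.min 1 (e / 2 / B)); first by rewrite lt_min ltr01 !divr_gt0.
have [|d2 d20 H2] := hg (e / 2 / A); first by rewrite !divr_gt0.
exists (Num.min d1 d2); first by rewrite lt_min d10.
move=> s; rewrite lt_min => /andP[/H1 h1 /H2 h2].
have -> : f s * g s - f t * g t = f s * (g s - g t) + (f s - f t) * g t by ring.
apply: (le_lt_trans (nmD _ _)); rewrite !nmM.
move: h1; rewrite lt_min => /andP[h11 h12].
have fs : nm (f s) < A.
  by have := nm_dist (f s) (f t); rewrite /A; lra.
rewrite [e]splitr; apply: ler_ltD.
  rewrite -[e / 2](@divfK _ A) ?gt_eqF // mulrC; apply: ler_pM; rewrite ?nm_ge0 // ltW //.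
rewrite -[e / 2](@divfK _ B) ?gt_eqF //.
apply: (@le_lt_trans _ _ (nm (f s - f t) * B)).
  by rewrite ler_wpM2l ?nm_ge0 // /B lerDl.
by rewrite ltr_pM2r.
Qed.
Lemma ccontN f t : ccont f t -> ccont (fun t => - f t) t.
Proof.
move=> H e /H[d d0 Hd]; exists d => // s /Hd; by rewrite -opprD nmN.
Qed.
Lemma ccont_cdf (F : C -> C) f t : ccont f t -> cdf F (f t) -> ccont (fun t => F (f t)) t.
Proof.
move=> hf hF e /(cdf_cont hF)[d /hf[d' d'0 H'] Hd].
by exists d' => // s /H' /Hd.
Qed.

Lemma cintD a b f g : seg (ccont f) a b -> seg (ccont g) a b ->
  cint a b (fun t => f t + g t) = cint a b f + cint a b g.
Proof.
move=> hf hg.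
have h1 : seg (rcont (fun t => Re (f t))) a b by move=> t /hf/rcontP[].
have h2 : seg (rcont (fun t => Im (f t))) a b by move=> t /hf/rcontP[].
have h3 : seg (rcont (fun t => Re (g t))) a b by move=> t /hg/rcontP[].
have h4 : seg (rcont (fun t => Im (g t))) a b by move=> t /hg/rcontP[].
apply/eqP; rewrite eq_complex /= -!RintD //.
by apply/andP; split; apply/eqP; apply: ext_Rint => t _; rewrite raddfD.
Qed.
Lemma ext_cint a b f g : (forall t, a <= t <= b -> f t = g t) -> cint a b f = cint a b g.
Proof.
by move=> H; apply/eqP; rewrite eq_complex /=; apply/andP; split; apply/eqP; apply: ext_Rint => t /H ->.
Qed.
Lemma cintZ a b f (k : C) : seg (ccont f) a b ->
  cint a b (fun t => k * f t) = k * cint a b f.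
Proof.
move=> hf; case: k => x y.
have h1 : seg (rcont (fun t => Re (f t))) a b by move=> t /hf/rcontP[].
have h2 : seg (rcont (fun t => Im (f t))) a b by move=> t /hf/rcontP[].
have Z : forall (r : R) t, ccont (fun=> r%:C) t by move=> r t; exact: ccont_cst.
have g1 r : seg (rcont (fun t => r * Re (f t))) a b.
  move=> t /hf ht; have /rcontP[] := ccontM (Z r t) ht.
  suff -> : (fun t => Re (r%:C * f t)) = (fun t => r * Re (f t)) by [].
  by apply/funext => s; case: (f s) => u v /=; rewrite mul0r subr0.
have g2 r : seg (rcont (fun t => r * Im (f t))) a b.
  move=> t /hf ht; have /rcontP[_] := ccontM (Z r t) ht.
  suff -> : (fun t => Im (r%:C * f t)) = (fun t => r * Im (f t)) by [].
  by apply/funext => s; case: (f s) => u v /=; rewrite mul0r addr0.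
apply/eqP; rewrite eq_complex /=; apply/andP; split; apply/eqP.
  rewrite -mulNr -!RintZ // -RintD //; [|exact: g1|exact: g2].
  by apply: ext_Rint => t _; case: (f t) => u v /=; ring.
rewrite -!RintZ // -RintD //; [|exact: g2|exact: g1].
by apply: ext_Rint => t _; case: (f t) => u v /=; ring.
Qed.
Lemma cint_cst a b (k : C) : a <= b -> cint a b (fun=> k) = k * (b - a)%:C.
Proof.
by move=> ab; rewrite /cint !Rint_cst //; case: k => x y /=; apply/eqP; rewrite eq_complex /=; apply/andP; split; apply/eqP; ring.
Qed.
Lemma cint_split a b c f : a <= c <= b -> seg (ccont f) a b ->
  cint a b f = cint a c f + cint c b f.
Proof.
move=> acb H; apply/eqP; rewrite eq_complex /=.
by rewrite -!Rint_split ?eqxx // => t /H/rcontP[].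
Qed.
(** The factor 2 comes from bounding the real and the imaginary part separately; it propagates to
    all later constants. *)
Lemma cint_nm a b f M : a <= b -> seg (ccont f) a b ->
  (forall t, a <= t <= b -> nm (f t) <= M) -> nm (cint a b f) <= 2 * M * (b - a).
Proof.
move=> ab H HM; apply: (le_trans (nm_ReIm _)) => /=.
rewrite -mulrA mulr_natl mulr2n; apply: lerD; apply: Rint_norm => // t /[dup] /H/rcontP[] // _ _ /HM.
  exact/le_trans/nm_Re.
exact/le_trans/nm_Im.
Qed.
Lemma cintN a b f : seg (ccont f) a b -> cint a b (fun t => - f t) = - cint a b f.
Proof.
move=> H; rewrite -mulN1r -cintZ //; by apply: ext_cint => t _; rewrite mulN1r.
Qed.
Lemma cintB a b f g : seg (ccont f) a b -> seg (ccont g) a b ->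
  cint a b (fun t => f t - g t) = cint a b f - cint a b g.
Proof.
by move=> hf hg; rewrite cintD ?cintN // => t /hg; exact: ccontN.
Qed.

End Integral.

(** * Goursat's theorem for rectangles *)

Section Goursat.
Variable R : realType.
Local Notation C := R[i].
Local Notation Re := complex.Re.
Local Notation Im := complex.Im.
Variable g : C -> C.
Implicit Types (a b c d x y t : R).

(** The integral of g(w) dw along the boundary, counterclockwise, with opposite sides grouped under
    one integral. *)
Definition rect (a b c d : R) : C :=
  cint a b (fun t => g (t +i* c) - g (t +i* d)) +
  'i * cint c d (fun t => g (b +i* t) - g (a +i* t)).

Definition holo_rect a b c d : Prop :=
  forall x y, a <= x <= b -> c <= y <= d -> cdf g (x +i* y).

Lemma ccont_h x y : ccont (fun t : R => t +i* y : C) x.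
Proof.
move=> e e0; exists e => // s; apply: le_lt_trans.
apply: (le_trans (nm_ReIm _)) => /=.
by rewrite subrr normr0 addr0.
Qed.
Lemma ccont_v x y : ccont (fun t : R => x +i* t : C) y.
Proof.
move=> e e0; exists e => // s; apply: le_lt_trans.
apply: (le_trans (nm_ReIm _)) => /=.
by rewrite subrr normr0 add0r.
Qed.

Lemma holo_h a b c d y : holo_rect a b c d -> c <= y <= d ->
  seg (ccont (fun t => g (t +i* y))) a b.
Proof. by move=> H yb t tb; apply: ccont_cdf (ccont_h _ _) _; apply: H. Qed.
Lemma holo_v a b c d x : holo_rect a b c d -> a <= x <= b ->
  seg (ccont (fun t => g (x +i* t))) c d.
Proof. by move=> H xb t tb; apply: ccont_cdf (ccont_v _ _) _; apply: H. Qed.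

Lemma rectE a b c d : a <= b -> c <= d -> holo_rect a b c d -> rect a b c d =
  cint a b (fun t => g (t +i* c)) - cint a b (fun t => g (t +i* d)) +
  'i * (cint c d (fun t => g (b +i* t)) - cint c d (fun t => g (a +i* t))).
Proof.
move=> ab cd H; rewrite /rect !cintB //.
- by apply: holo_v H _; lra.
- by apply: holo_v H _; lra.
- by apply: holo_h H _; lra.
- by apply: holo_h H _; lra.
Qed.

Lemma holo_sub a b c d a' b' c' d' : a <= a' -> b' <= b -> c <= c' -> d' <= d ->
  holo_rect a b c d -> holo_rect a' b' c' d'.
Proof. by move=> h1 h2 h3 h4 H x y xb yb; apply: H; lra. Qed.

Lemma rect_splith a b c d e : a <= e <= b -> c <= d -> holo_rect a b c d ->
  rect a b c d = rect a e c d + rect e b c d.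
Proof.
move=> /andP[ae eb] cd H; have ab := le_trans ae eb.
have h1 : holo_rect a e c d by apply: holo_sub H.
have h2 : holo_rect e b c d by apply: holo_sub H.
rewrite (rectE ab cd H) (rectE ae cd h1) (rectE eb cd h2).
rewrite (@cint_split _ a b e (fun t => g (t +i* c))) ?ae //; last first.
  by apply: holo_h H _; lra.
rewrite (@cint_split _ a b e (fun t => g (t +i* d))) ?ae //; last first.
  by apply: holo_h H _; lra.
ring.
Qed.
Lemma rect_splitv a b c d e : a <= b -> c <= e <= d -> holo_rect a b c d ->
  rect a b c d = rect a b c e + rect a b e d.
Proof.
move=> ab /andP[ce ed] H; have cd := le_trans ce ed.
have h1 : holo_rect a b c e by apply: holo_sub H.
have h2 : holo_rect a b e d by apply: holo_sub H.
rewrite (rectE ab cd H) (rectE ab ce h1) (rectE ab ed h2).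
rewrite (@cint_split _ c d e (fun t => g (b +i* t))) ?ce //; last first.
  by apply: holo_v H _; lra.
rewrite (@cint_split _ c d e (fun t => g (a +i* t))) ?ce //; last first.
  by apply: holo_v H _; lra.
ring.
Qed.

Lemma cd_mul (f : C -> C) (x h : C) : cd f x h = h * cd f x 1.
Proof.
have := cd_lin f x h 1 0; rewrite addr0 -[h *: 1]/(h * 1) mulr1 => ->.
by rewrite (_ : cd f x 0 = 0) ?addr0 //; rewrite cdE linear0.
Qed.

(** Subtract from [g] its first-order expansion at [x +i* y]: the affine part has boundary integral
    zero, and on the rectangle the remainder is at most [e] times the half-perimeter [l]. *)
Lemma rect_small a b c d x y e dl : a <= x <= b -> c <= y <= d -> 0 < e ->
  holo_rect a b c d -> (b - a) + (d - c) < dl ->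
  (forall h, nm h < dl ->
    nm (g ((x +i* y) + h) - g (x +i* y) - cd g (x +i* y) h) <= e * nm h) ->
  nm (rect a b c d) <= 8 * e * ((b - a) + (d - c)) ^+ 2.
Proof.
move=> xb yb e0 H Hl Hd; set l := _ + _ in Hl *.
set w : C := x +i* y; set B := cd g w 1.
pose r (z : C) := g z - g w - B * (z - w).
have rE z : g z = g w + B * (z - w) + r z by rewrite /r; ring.
have ab : a <= b by lra.
have cd : c <= d by lra.
have Hr x' y' : a <= x' <= b -> c <= y' <= d -> nm (r (x' +i* y')) <= e * l.
  move=> x'b y'b; set h := (x' +i* y') - w.
  have hl : nm h <= l.
    by apply: (le_trans (nm_ReIm _)); rewrite /l /=; apply: lerD; rewrite ler_norml; lra.
  have wh : w + h = x' +i* y' by rewrite /h addrC subrK.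
  have := Hd h (le_lt_trans hl Hl); rewrite -/w wh cd_mul -/B [h * B]mulrC.
  move=> /le_trans; apply.
  by rewrite ler_wpM2l // ltW.
have E1 : cint a b (fun t => g (t +i* c) - g (t +i* d)) =
    B * 'i * (c - d)%:C * (b - a)%:C + cint a b (fun t => r (t +i* c) - r (t +i* d)).
  have D1 : seg (ccont (fun t => g (t +i* c) - g (t +i* d))) a b.
    move=> t tb; apply: ccontD; first by apply: (holo_h H) => //; lra.
    by apply: ccontN; apply: (holo_h H) => //; lra.
  rewrite -cint_cst // -cintD; first 1 last.
  - by move=> t _; exact: ccont_cst.
  - have -> : (fun t => r (t +i* c) - r (t +i* d)) =
       (fun t => (g (t +i* c) - g (t +i* d)) + (- (B * 'i * (c - d)%:C))).
      apply/funext => t; rewrite /r.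
      have -> : t +i* d - w = (t +i* c - w) - 'i * (c - d)%:C by rewrite /w; simpc; congr (_ +i* _); ring.
      ring.
    by move=> t tb; apply: ccontD; [exact: D1|exact: ccont_cst].
  apply: ext_cint => t _; rewrite /r.
  have -> : t +i* d - w = (t +i* c - w) - 'i * (c - d)%:C by rewrite /w; simpc; congr (_ +i* _); ring.
  ring.
have E2 : cint c d (fun t => g (b +i* t) - g (a +i* t)) =
    B * (b - a)%:C * (d - c)%:C + cint c d (fun t => r (b +i* t) - r (a +i* t)).
  have D1 : seg (ccont (fun t => g (b +i* t) - g (a +i* t))) c d.
    move=> t tb; apply: ccontD; first by apply: (holo_v H) => //; lra.
    by apply: ccontN; apply: (holo_v H) => //; lra.
  rewrite -cint_cst // -cintD; first 1 last.
  - by move=> t _; exact: ccont_cst.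
  - have -> : (fun t => r (b +i* t) - r (a +i* t)) =
       (fun t => (g (b +i* t) - g (a +i* t)) + (- (B * (b - a)%:C))).
      apply/funext => t; rewrite /r.
      have -> : b +i* t - w = (a +i* t - w) + (b - a)%:C by rewrite /w; simpc; congr (_ +i* _); ring.
      ring.
    by move=> t tb; apply: ccontD; [exact: D1|exact: ccont_cst].
  apply: ext_cint => t _; rewrite /r.
  have -> : b +i* t - w = (a +i* t - w) + (b - a)%:C by rewrite /w; simpc; congr (_ +i* _); ring.
  ring.
have rc : holo_rect a b c d -> forall x' y', a <= x' <= b -> c <= y' <= d -> cdf r (x' +i* y').
  move=> _ x' y' xb' yb'; apply: cdfB; first by apply: cdfB; [exact: H|exact: cdf_cst].
  apply: cdfM; first exact: cdf_cst.
  apply: cdfB; last exact: cdf_cst.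
  by apply: (@cdf_linear _ _ id 1 _ _ _).1 => // v; rewrite mul1r.
rewrite /rect E1 E2.
set I1 := cint a b _; set I2 := cint c d _.
(* The contributions of the affine part to the horizontal and to the vertical sides cancel. *)
have -> : B * 'i * (c - d)%:C * (b - a)%:C + I1 + 'i * (B * (b - a)%:C * (d - c)%:C + I2)
   = I1 + 'i * I2 by rewrite !rmorphB; ring.
have l0 : 0 <= l by rewrite /l; lra.
have el : 0 <= e * l by exact: mulr_ge0 (ltW e0) l0.
have N1 : nm I1 <= 2 * (2 * (e * l)) * (b - a).
  apply: cint_nm => // [t tb|t tb].
    apply: ccontD; last apply: ccontN.
      by apply: ccont_cdf (ccont_h _ _) _; apply: rc => //; lra.
    by apply: ccont_cdf (ccont_h _ _) _; apply: rc => //; lra.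
  apply: (le_trans (nmB _ _)); rewrite [2 * (e * l)]mulr_natl mulr2n.
  by apply: lerD; apply: Hr => //; lra.
have N2 : nm I2 <= 2 * (2 * (e * l)) * (d - c).
  apply: cint_nm => // [t tb|t tb].
    apply: ccontD; last apply: ccontN.
      by apply: ccont_cdf (ccont_v _ _) _; apply: rc => //; lra.
    by apply: ccont_cdf (ccont_v _ _) _; apply: rc => //; lra.
  apply: (le_trans (nmB _ _)); rewrite [2 * (e * l)]mulr_natl mulr2n.
  by apply: lerD; apply: Hr => //; lra.
apply: (le_trans (nmD _ _)); rewrite nmM.
have -> : nm ('i : C) = 1 by rewrite /nm normc_def /= expr0n add0r expr1n sqrtr1.
rewrite mul1r; apply: (le_trans (lerD N1 N2)).
have -> : 8 * e * l ^+ 2 = 2 * (4 * (e * l) * l) by ring.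
have -> : 2 * (2 * (e * l)) * (b - a) + 2 * (2 * (e * l)) * (d - c) = 4 * (e * l) * l.
  by rewrite /l; ring.
by rewrite [leRHS]mulr_natl mulr2n lerDl; apply: mulr_ge0 l0; apply: mulr_ge0.
Qed.

Lemma small_pow2 (l e : R) : 0 <= l -> 0 < e -> exists n, l / 2 ^+ n < e.
Proof.
move=> l0 e0; exists (Num.bound (l / e)).
have h := ltn_expl (Num.bound (l / e)) (isT : (1 < 2)%N).
rewrite ltr_pdivrMr ?exprn_gt0 // mulrC -ltr_pdivrMr //.
apply: (@lt_trans _ _ (Num.bound (l / e))%:R); first by apply: archi_boundP; rewrite divr_ge0 // ltW.
by rewrite -natrX ltr_nat.
Qed.
End Goursat.

Section Goursat2.
Variable R : realType.
Local Notation C := R[i].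
Variable g : C -> C.
Implicit Types (a b c d x y t : R).

Lemma quarter (M x y z w : R) : M <= x + y + (z + w) ->
  [\/ M <= 4 * x, M <= 4 * y, M <= 4 * z | M <= 4 * w].
Proof.
move=> N; have [h1|h1] := lerP M (4 * x); first by apply: Or41.
have [h2|h2] := lerP M (4 * y); first by apply: Or42.
have [h3|h3] := lerP M (4 * z); first by apply: Or43.
by apply: Or44; lra.
Qed.

(** Boundary integrals add up over the four quarters, so one of them carries at least a quarter of
    the modulus; [p] is its lower left corner. *)
Lemma rect_bisect a c L H : 0 <= L -> 0 <= H -> holo_rect g a (a + L) c (c + H) ->
  exists p : R * R, [/\ a <= p.1, p.1 + L / 2 <= a + L, c <= p.2, p.2 + H / 2 <= c + H &
    nm (rect g a (a + L) c (c + H)) <=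
    4 * nm (rect g p.1 (p.1 + L / 2) p.2 (p.2 + H / 2))].
Proof.
move=> L0 H0 Hg.
have L2 : 0 <= L / 2 by rewrite divr_ge0.
have H2 : 0 <= H / 2 by rewrite divr_ge0.
have e1 : a + L / 2 + L / 2 = a + L by rewrite -addrA -splitr.
have e2 : c + H / 2 + H / 2 = c + H by rewrite -addrA -splitr.
have S : rect g a (a + L) c (c + H) =
   (rect g a (a + L / 2) c (c + H / 2) + rect g a (a + L / 2) (c + H / 2) (c + H / 2 + H / 2)) +
   (rect g (a + L / 2) (a + L / 2 + L / 2) c (c + H / 2) +
    rect g (a + L / 2) (a + L / 2 + L / 2) (c + H / 2) (c + H / 2 + H / 2)).
  rewrite e1 e2 (@rect_splith _ _ _ _ _ _ (a + L / 2)) //; [|lra|lra].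
  by congr (_ + _); apply: rect_splitv; rewrite ?e1; try lra; apply: holo_sub Hg; lra.
set q1 := rect g a (a + L / 2) c (c + H / 2) in S *.
set q2 := rect g a (a + L / 2) (c + H / 2) _ in S *.
set q3 := rect g (a + L / 2) _ c _ in S *.
set q4 := rect g (a + L / 2) _ (c + H / 2) _ in S *.
have N : nm (rect g a (a + L) c (c + H)) <= nm q1 + nm q2 + (nm q3 + nm q4).
  by rewrite S; apply: (le_trans (nmD _ _)); apply: lerD; exact: nmD.
case: (quarter N) => h; [exists (a, c)|exists (a, c + H / 2)|exists (a + L / 2, c)|
  exists (a + L / 2, c + H / 2)]; split=> //; rewrite /= ?e1 ?e2; move: L2 H2 e1 e2; clear; lra.
Qed.

Theorem goursat a b c d : a <= b -> c <= d -> holo_rect g a b c d -> rect g a b c d = 0.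
Proof.
move=> ab cd0 Hg; set L := b - a; set H := d - c.
have L0 : 0 <= L by rewrite /L; lra.
have H0 : 0 <= H by rewrite /H; lra.
pose Ln n := L / 2 ^+ n; pose Hn n := H / 2 ^+ n.
have Ln0 n : 0 <= Ln n by rewrite divr_ge0 // exprn_ge0.
have Hn0 n : 0 <= Hn n by rewrite divr_ge0 // exprn_ge0.
have LnS n : Ln n.+1 = Ln n / 2 by rewrite /Ln exprSr invfM mulrA.
have HnS n : Hn n.+1 = Hn n / 2 by rewrite /Hn exprSr invfM mulrA.
pose ins n (p : R * R) := [/\ a <= p.1, p.1 + Ln n <= b, c <= p.2 & p.2 + Hn n <= d].
pose Q n (p : R * R) := nm (rect g p.1 (p.1 + Ln n) p.2 (p.2 + Hn n)).
(* A choice function must be defined at every corner; outside [ins] any value does, and [insu] shows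
   that the sequence stays inside. *)
have /choice[F HF] : forall np : nat * (R * R), exists p : R * R, ins np.1 np.2 ->
    [/\ ins np.1.+1 p, np.2.1 <= p.1, p.1 + Ln np.1.+1 <= np.2.1 + Ln np.1,
      np.2.2 <= p.2 /\ p.2 + Hn np.1.+1 <= np.2.2 + Hn np.1 &
      Q np.1 np.2 <= 4 * Q np.1.+1 p].
  move=> -[n p] /=.
  have [ip|] := pselect (ins n p); last by exists p.
  case: (ip) => i1 i2 i3 i4.
  have [|q [q1 q2 q3 q4 q5]] := @rect_bisect p.1 p.2 (Ln n) (Hn n) (Ln0 n) (Hn0 n).
    by apply: holo_sub Hg.
  exists q => _; rewrite /Q LnS HnS; split => //.
  by rewrite /ins LnS HnS; split; lra.
pose u := fix u n := if n is n'.+1 then F (n', u n') else (a, c).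
have uS n : u n.+1 = F (n, u n) by [].
have insu n : ins n (u n).
  elim: n => [|n IH]; last by rewrite uS; have [] := HF (n, u n) IH.
  by rewrite /ins /= /Ln /Hn expr0 !divr1 /L /H; split; lra.
have HFu n := HF (n, u n) (insu n).
have mono n k : [/\ (u n).1 <= (u (n + k)%N).1, (u (n + k)%N).1 + Ln (n + k)%N <= (u n).1 + Ln n,
   (u n).2 <= (u (n + k)%N).2 & (u (n + k)%N).2 + Hn (n + k)%N <= (u n).2 + Hn n].
  elim: k => [|k [h1 h2 h3 h4]]; first by rewrite addn0.
  have := HFu (n + k)%N; rewrite -uS -addnS /= => -[_ k1 k2 [k3 k4] _].
  by split; lra.
have cross n m : (u m).1 <= (u n).1 + Ln n /\ (u m).2 <= (u n).2 + Hn n.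
  have [nm|mn] := leqP n m.
    have [_ h1 _ h2] := mono n (m - n)%N; move: h1 h2; rewrite subnKC // => h1 h2.
    by have := Ln0 m; have := Hn0 m; split; lra.
  have [h1 _ h2 _] := mono m (n - m)%N; move: h1 h2; rewrite subnKC ?(ltnW mn) // => h1 h2.
  by have := Ln0 n; have := Hn0 n; split; lra.
(* The common point of the nested rectangles: by [cross], every left or lower end lies below every
   right or upper end. *)
pose xs := sup [set (u n).1 | n in setT]; pose ys := sup [set (u n).2 | n in setT].
have xsP n : (u n).1 <= xs <= (u n).1 + Ln n.
  apply/andP; split.
    apply: ub_le_sup; last by exists n.
    by exists ((u 0%N).1 + Ln 0%N) => _ [m _ <-]; have [] := cross 0%N m.
  apply: ge_sup; first by exists (u 0%N).1; exists 0%N.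
  by move=> _ [m _ <-]; have [] := cross n m.
have ysP n : (u n).2 <= ys <= (u n).2 + Hn n.
  apply/andP; split.
    apply: ub_le_sup; last by exists n.
    by exists ((u 0%N).2 + Hn 0%N) => _ [m _ <-]; have [] := cross 0%N m.
  apply: ge_sup; first by exists (u 0%N).2; exists 0%N.
  by move=> _ [m _ <-]; have [] := cross n m.
have Q4 n : Q 0%N (u 0%N) <= 4 ^+ n * Q n (u n).
  elim: n => [|n IH]; first by rewrite expr0 mul1r.
  apply: (le_trans IH); rewrite exprSr -mulrA ler_wpM2l ?exprn_ge0 //.
  by have [] := HFu n.
have cg : cdf g (xs +i* ys).
  have := xsP 0%N; have := ysP 0%N; rewrite /= /Ln /Hn expr0 !divr1 /L /H => h1 h2.
  by apply: Hg; lra.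
apply/eqP; rewrite -nm0_eq0; apply/eqP/le_anti; rewrite nm_ge0 andbT.
have -> : rect g a b c d = rect g (u 0%N).1 ((u 0%N).1 + Ln 0%N) (u 0%N).2 ((u 0%N).2 + Hn 0%N).
  rewrite /= /Ln /Hn expr0 !divr1 /L /H.
  by rewrite [a + _]addrC subrK [c + _]addrC subrK.
rewrite -[nm _]/(Q 0%N (u 0%N)); apply/ler_addgt0Pl => e e0; rewrite addr0.
pose l := L + H; have l0 : 0 <= l by rewrite addr_ge0.
(* The factor 4^n of [Q4] cancels the square of 2^n in the size, leaving [8 * e' * l ^+ 2] at every
   stage; the [+ 1] allows [l = 0]. *)
pose e' := e / (8 * (l ^+ 2 + 1)).
have l20 : 0 < l ^+ 2 + 1 by rewrite ltr_wpDl ?exprn_ge0.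
have e'0 : 0 < e' by rewrite divr_gt0 // mulr_gt0.
have [_ /(_ _ e'0)[dl dl0 Hdl]] := cdf_nm cg.
have [n Hn'] := @small_pow2 _ l dl l0 dl0.
apply: (le_trans (Q4 n)).
have [i1 i2 i3 i4] := insu n.
have lE : ((u n).1 + Ln n - (u n).1) + ((u n).2 + Hn n - (u n).2) = l / 2 ^+ n.
  by rewrite [(u n).1 + _]addrC addrK [(u n).2 + _]addrC addrK /Ln /Hn -mulrDl.
have := @rect_small _ g _ _ _ _ xs ys e' dl (xsP n) (ysP n) e'0 _ _ Hdl.
rewrite lE => /(_ (holo_sub i1 i2 i3 i4 Hg) Hn') h.
apply: (@le_trans _ _ (4 ^+ n * (8 * e' * (l / 2 ^+ n) ^+ 2))).
  by rewrite ler_wpM2l ?exprn_ge0.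
have -> : 4 ^+ n * (8 * e' * (l / 2 ^+ n) ^+ 2) = 8 * e' * l ^+ 2.
  rewrite expr_div_n -exprM mulnC exprM.
  have -> : (2 ^+ 2 : R) = 4 by rewrite expr2; lra.
  by rewrite mulrC mulrA divfK // expf_neq0.
have -> : 8 * e' * l ^+ 2 = e * (l ^+ 2 / (l ^+ 2 + 1)).
  by rewrite /e'; field; rewrite gt_eqF.
by rewrite ler_piMr ?(ltW e0) // ler_pdivrMr // mul1r lerDl.
Qed.

End Goursat2.

(** * The exponential map and mean values over circles *)

Section Circle.
Variable R : realType.
Local Notation C := R[i].
Local Notation Re := complex.Re.
Local Notation Im := complex.Im.
Implicit Types (r t x y : R) (f : C -> C).

Lemma is_derive_nm (f : R -> R) x (df : R) : is_derive x (1 : R) f df ->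
  forall e : R, 0 < e -> exists2 d : R, 0 < d & forall h, `|h| < d ->
    `|f (x + h) - f x - df * h| <= e * `|h|.
Proof.
move=> [Df dfE] e e0.
have Dd := (@derivable1_diffP R R^o f x).1 Df.
have [_ /eqaddoP /(_ e e0) /nbhs_ballP[d /= d0 Hd]] := (diff_locallyP x f).1 Dd.
exists d => // h hd; have := Hd h; rewrite /ball /= sub0r normrN => /(_ hd).
rewrite /= !fctE /= deriv1E // derive1E dfE opprD addrA [h + x]addrC.
by rewrite [h *: df]mulrC.
Qed.

Definition cis t : C := cos t +i* sin t.
Definition cexp (w : C) : C := (expR (Re w))%:C * cis (Im w).
Definition circ r t : C := r%:C * cis t.

Lemma cisD x y : cis (x + y) = cis x * cis y.
Proof. by rewrite /cis cosD sinD; simpc; congr (_ +i* _); ring. Qed.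
Lemma nm_cis t : nm (cis t) = 1.
Proof. by rewrite /nm normc_def /= cos2Dsin2 sqrtr1. Qed.
Lemma cis_periodic t : cis (t + 2 * pi) = cis t.
Proof. by rewrite /cis mulr_natl cosD2pi sinD2pi. Qed.
Lemma cis0 : cis 0 = 1.
Proof. by rewrite /cis cos0 sin0. Qed.
Lemma cis2pi : cis (2 * pi) = 1.
Proof. by rewrite -[2 * pi]add0r cis_periodic cis0. Qed.
Lemma cis_neq0 t : cis t != 0.
Proof. by rewrite -nm_gt0 nm_cis. Qed.
Lemma nm_circ r t : 0 <= r -> nm (circ r t) = r.
Proof. by move=> r0; rewrite nmM nm_cis mulr1 nmR ger0_norm. Qed.

Lemma cexpD v w : cexp (v + w) = cexp v * cexp w.
Proof. by rewrite /cexp !raddfD /= expRD cisD rmorphM; ring. Qed.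
Lemma ccont_cis t : ccont cis t.
Proof.
by apply/rcontP; split; apply/rcont_continuous => /=; [exact: continuous_cos|exact: continuous_sin].
Qed.

(** By the functional equation it is enough to treat the point 0, where the first-order expansions
    of the real exponential, cosine and sine combine. *)
Lemma cexp_cdf w : cdf cexp w.
Proof.
suff H e : 0 < e -> exists2 d : R, 0 < d & forall h : C, nm h < d ->
    nm (cexp h - 1 - h) <= e * nm h.
  apply: (@is_cd_nm _ _ cexp w (fun h => cexp w * h) (nm (cexp w)) _ _ _).1.
  - by move=> c u v; rewrite -[c *: u]/(c * u); ring.
  - by move=> v; rewrite nmM.
  move=> e e0; have [|d d0 Hd] := H (e / (nm (cexp w) + 1)).
    by rewrite divr_gt0 // ltr_wpDl ?nm_ge0.
  exists d => // h /Hd hh; rewrite cexpD.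
  have -> : cexp w * cexp h - cexp w - cexp w * h = cexp w * (cexp h - 1 - h) by ring.
  rewrite nmM; apply: (@le_trans _ _ ((nm (cexp w) + 1) * (e / (nm (cexp w) + 1) * nm h))).
    by apply: ler_pM; rewrite ?nm_ge0 // lerDl.
  by rewrite mulrA [_ * (e / _)]mulrC divfK // gt_eqF // ltr_wpDl ?nm_ge0.
(* 6 = 4 + 1 + 1, for the three terms into which [cexp h - 1 - h] is split below, [expR a] being at
   most 2. *)
move=> e0; pose e' := Num.min 1 (e / 6).
have e'0 : 0 < e' by rewrite lt_min ltr01 divr_gt0.
have e'1 : e' <= 1 by rewrite ge_min lexx.
have e'6 : e' <= e / 6 by rewrite ge_min lexx orbT.
have [dE dE0 HE] := @is_derive_nm expR 0 (expR 0) (is_derive_expR 0) e' e'0.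
have [dC dC0 HC] := @is_derive_nm cos 0 (- sin 0) (is_derive_cos 0) e' e'0.
have [dS dS0 HS] := @is_derive_nm sin 0 (cos 0) (is_derive_sin 0) e' e'0.
exists (Num.min (Num.min dE (e' / 2)) (Num.min dC dS)).
  by rewrite !lt_min dE0 dC0 dS0 divr_gt0.
move=> [a b]; rewrite !lt_min => /andP[/andP[h1 h2] /andP[h3 h4]].
set h := a +i* b in h1 h2 h3 h4 *.
have ah : `|a| <= nm h := nm_Re h.
have bh : `|b| <= nm h := nm_Im h.
have := HE a (le_lt_trans ah h1); have := HC b (le_lt_trans bh h3).
have := HS b (le_lt_trans bh h4).
rewrite !add0r expR0 cos0 sin0 oppr0 mul0r ?oppr0 !addr0 ?subr0 !mul1r.
set P := sin b - b; set Q := cos b - 1; set S := expR a - 1 - a => hP hQ hS.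
have e'n (u v : R) : `|u| <= e' * `|v| -> `|v| <= nm h -> `|u| <= e' * nm h.
  by move=> /le_trans hu hv; apply: hu; rewrite ler_wpM2l // ltW.
have {}hP := e'n _ _ hP bh; have {}hQ := e'n _ _ hQ bh; have {}hS := e'n _ _ hS ah.
have E1 : `|expR a - 1| <= e'.
  have -> : expR a - 1 = S + a by rewrite /S; ring.
  apply: (le_trans (ler_normD _ _)).
  have : e' * nm h <= nm h by rewrite ler_piMl ?nm_ge0.
  lra.
have E2 : `|expR a| <= 2.
  rewrite -[expR a](subrK 1); apply: (le_trans (ler_normD _ _)); rewrite normr1; lra.
have -> : cexp h - 1 - h = (expR a)%:C * (Q +i* P) + S%:C + (b * (expR a - 1))%:C * 'i.
  by rewrite /cexp /cis /P /Q /S /h; simpc; congr (_ +i* _); ring.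
apply: (le_trans (nmD _ _)); rewrite nmM.
have -> : nm ('i : C) = 1 by rewrite /nm normc_def /= expr0n add0r expr1n sqrtr1.
apply: (le_trans (lerD (nmD _ _) (lexx _))); rewrite nmM !nmR mulr1 normrM.
have hh : 0 <= nm h := nm_ge0 h.
have n1 : `|expR a| * nm (Q +i* P) <= 2 * (2 * (e' * nm h)).
  apply: ler_pM; rewrite ?nm_ge0 //.
  apply: (le_trans (nm_ReIm _)); rewrite [leRHS]mulr_natl mulr2n.
  exact: lerD hQ hP.
have n2 : `|b| * `|expR a - 1| <= e' * nm h by rewrite mulrC ler_pM.
have n3 : 6 * (e' * nm h) <= e * nm h by rewrite mulrA ler_wpM2r //; lra.
lra.
Qed.

Lemma ccont_circ r t : ccont (circ r) t.
Proof. by apply: ccontM; [exact: ccont_cst|exact: ccont_cis]. Qed.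

Lemma pi2_gt0 : 0 < 2 * pi :> R.
Proof. by rewrite mulr_gt0 // pi_gt0. Qed.
Lemma pi2_ge0 : 0 <= 2 * pi :> R.
Proof. exact: ltW pi2_gt0. Qed.

(** This is the integral of f(s) ds / (2 pi i s) over the circle, which is why the Cauchy kernel
    appears below as [s / (s - x)]. *)
Definition mean (r : R) f : C := cint 0 (2 * pi) (fun t => f (circ r t)) / (2 * pi)%:C.

Definition oncirc r f := forall t, ccont (fun t => f (circ r t)) t.

Lemma oncircP r f : 0 <= r -> (forall s, nm s = r -> cdf f s) -> oncirc r f.
Proof. by move=> r0 H t; apply: ccont_cdf (ccont_circ _ _) _; apply: H; exact: nm_circ. Qed.

Lemma pi2C_neq0 : (2 * pi)%:C != 0 :> C.
Proof. by rewrite -nm_gt0 nmR gtr0_norm pi2_gt0. Qed.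

(* Goursat on a rectangle, transported by the exponential map. *)
Theorem mean_annulus r1 r2 f : 0 < r1 -> r1 <= r2 ->
  (forall s, r1 <= nm s <= r2 -> cdf f s) -> mean r1 f = mean r2 f.
Proof.
move=> r10 r12 Hf; congr (_ / _).
have r20 := lt_le_trans r10 r12.
pose g w := f (cexp w).
have nmcexp x y : nm (cexp (x +i* y)) = expR x.
  by rewrite nmM nm_cis mulr1 nmR ger0_norm // expR_ge0.
have Hg : holo_rect g (ln r1) (ln r2) 0 (2 * pi).
  move=> x y /andP[x1 x2] _; apply: cdf_comp; first by rewrite -cdfE; exact: cexp_cdf.
  apply: Hf; rewrite nmcexp -[r1]lnK ?posrE // -[r2]lnK ?posrE //.
  by rewrite !ler_expR x1.
have l12 : ln r1 <= ln r2 by rewrite ler_ln ?posrE.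
have /eqP := goursat l12 pi2_ge0 Hg.
rewrite rectE ?pi2_ge0 //.
have -> : (fun t => g (t +i* 0)) = (fun t => g (t +i* (2 * pi))).
  by apply/funext => t; rewrite /g /cexp /= cis0 cis2pi.
rewrite subrr add0r mulf_eq0 => /orP[|].
  by rewrite eq_complex /= oner_eq0 andbF.
rewrite subr_eq0 => /eqP.
have E r : 0 < r -> (fun t => g (ln r +i* t)) = (fun t => f (circ r t)).
  by move=> r0; apply/funext => t; rewrite /g /cexp /circ /= lnK ?posrE.
by rewrite !E.
Qed.

Lemma mean_nm r f M : 0 <= r -> oncirc r f -> (forall s, nm s = r -> nm (f s) <= M) ->
  nm (mean r f) <= 2 * M.
Proof.
move=> r0 Hf HM; rewrite nmM nmV nmR (gtr0_norm pi2_gt0).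
rewrite ler_pdivrMr ?pi2_gt0 //.
have := @cint_nm R 0 (2 * pi) (fun t => f (circ r t)) M pi2_ge0.
rewrite subr0; apply; first by move=> t _; exact: Hf.
by move=> t _; apply: HM; exact: nm_circ.
Qed.

Lemma ext_mean r f h : 0 <= r -> (forall s, nm s = r -> f s = h s) -> mean r f = mean r h.
Proof. by move=> r0 H; congr (_ / _); apply: ext_cint => t _; apply: H; exact: nm_circ. Qed.
Lemma meanD r f h : 0 <= r -> oncirc r f -> oncirc r h ->
  mean r (fun s => f s + h s) = mean r f + mean r h.
Proof.
by move=> r0 Hf Hh; rewrite /mean cintD ?mulrDl // => t _; by [exact: Hf|exact: Hh].
Qed.
Lemma meanZ r f k : 0 <= r -> oncirc r f -> mean r (fun s => k * f s) = k * mean r f.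
Proof.
by move=> r0 Hf; rewrite /mean cintZ ?mulrA // => t _; by [exact: Hf|exact: Hh].
Qed.
Lemma meanB r f h : 0 <= r -> oncirc r f -> oncirc r h ->
  mean r (fun s => f s - h s) = mean r f - mean r h.
Proof.
by move=> r0 Hf Hh; rewrite /mean cintB ?mulrBl // => t _; by [exact: Hf|exact: Hh].
Qed.
Lemma mean_cst r k : mean r (fun=> k) = k.
Proof. by rewrite /mean cint_cst ?pi2_ge0 // subr0 mulfK // pi2C_neq0. Qed.

Lemma nm_le0 (z : C) : (forall e : R, 0 < e -> nm z <= e) -> z = 0.
Proof.
move=> H; apply/eqP; rewrite -nm0_eq0; apply/eqP/le_anti; rewrite nm_ge0 andbT.
by apply/ler_addgt0Pl => e e0; rewrite addr0; exact: H.
Qed.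

(** [mean_annulus] allows the radius to shrink, and continuity at 0 gives the limit. *)
Theorem mean_value r f : 0 <= r -> (forall s, nm s <= r -> cdf f s) -> mean r f = f 0.
Proof.
rewrite le_eqVlt => /orP[/eqP <- _|r0 Hf].
  rewrite /mean (@ext_cint _ _ _ _ (fun=> f 0)) ?cint_cst ?pi2_ge0 //.
    by rewrite subr0 mulfK // pi2C_neq0.
  by move=> t _; rewrite /circ mul0r.
apply/eqP; rewrite -subr_eq0; apply/eqP/nm_le0 => e e0.
have f0 : cdf f 0 by apply: Hf; rewrite nm0 ltW.
have [|d d0 Hd] := cdf_cont f0 (e := e / 2); first by rewrite divr_gt0.
pose r' := Num.min r (d / 2).
have r'0 : 0 < r' by rewrite lt_min r0 divr_gt0.
have r'r : r' <= r by rewrite ge_min lexx.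
have r'd : r' < d by rewrite gt_min [d / 2 < d]gtr_pMr // invf_lt1 // ltr1n orbT.
rewrite -(@mean_annulus r' r f) //; last by move=> s /andP[_ ?]; exact: Hf.
rewrite -[f 0 in X in X <= _](mean_cst r') -meanB ?(ltW r'0) //.
- have -> : e = 2 * (e / 2) by rewrite mulrC divfK.
  apply: mean_nm; rewrite ?(ltW r'0) //.
    by apply: oncircP (ltW r'0) _ => s sr; apply: cdfB; [apply: Hf; rewrite sr|exact: cdf_cst].
  by move=> s sr; apply/ltW/Hd; rewrite subr0 sr.
- by apply: oncircP (ltW r'0) _ => s sr; apply: Hf; rewrite sr.
- by apply: oncircP (ltW r'0) _ => s sr; exact: cdf_cst.
Qed.

End Circle.

(** * Cauchy's integral formula *)

Section Cauchy.
Variable R : realType.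
Local Notation C := R[i].
Local Notation Re := complex.Re.
Local Notation Im := complex.Im.
Let mu : measure _ _ := @lebesgue_measure R.
Implicit Types (r t : R) (f : C -> C).

Definition cont_at f (s : C) := forall e : R, 0 < e ->
  exists2 d : R, 0 < d & forall z, nm (z - s) < d -> nm (f z - f s) < e.

Lemma cont_atM f g s : cont_at f s -> cont_at g s -> cont_at (fun z => f z * g z) s.
Proof.
move=> /(continuous_nm (f : C -> C) s) hf /(continuous_nm (g : C -> C) s) hg.
apply/(continuous_nm (fun z => f z * g z : C) s); exact: (@continuousM C C f g s hf hg).
Qed.

Lemma ccont_cont_at f (g : R -> C) t : ccont g t -> cont_at f (g t) -> ccont (fun t => f (g t)) t.
Proof. by move=> hg hf e /hf[d /hg[d' d'0 H'] Hd]; exists d' => // s /H' /Hd. Qed.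

Lemma ccont_circr t r : ccont (fun r => circ r t) r.
Proof.
move=> e e0; exists e => // s se.
by rewrite /circ -mulrBl nmM nm_cis mulr1 -rmorphB nmR.
Qed.

Lemma Rint_circ_cont (h : R -> R -> R) u v K :
  (forall r t, u < r < v -> rcont (h r) t) ->
  (forall r t, u < r < v -> rcont (h^~ t) r) ->
  (forall r t, u < r < v -> `|h r t| <= K) ->
  forall r, u < r < v -> rcont (fun r => Rint 0 (2 * pi) (h r)) r.
Proof.
move=> H1 H2 HK r uv; apply/rcont_continuous.
have mB : measurable (`[0, 2 * pi]%classic : set R) by exact: measurable_itv.
apply: (@continuity_under_integral R _ _ mu h _ mB u v _ _ (cst K)).
- move=> x /=; rewrite in_itv /= => xI.
  by apply: rcont_integrable => t _; exact: H1.
- apply: aeW => y _ x; rewrite inE /= in_itv /= => xI.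
  by apply/rcont_continuous; exact: H2.
- by apply: rcont_integrable => t _ e e0; exists 1 => // s _; rewrite subrr normr0.
- move=> x /=; rewrite in_itv /= => xI.
  by apply: aeW => y _; exact: HK.
- by rewrite inE /= in_itv.
Qed.

(** Dominated convergence in the radius. It serves to cross the circle through a point where the
    integrand is only known to be continuous. *)
Lemma mean_cont f u v K : 0 <= u -> (forall s, u < nm s < v -> cont_at f s) ->
  (forall s, u < nm s < v -> nm (f s) <= K) ->
  forall r, u < r < v -> ccont (fun r => mean r f) r.
Proof.
move=> u0 Hf HK r uv; apply: ccontM; last exact: ccont_cst.
have P x t : u < x < v -> u < nm (circ x t) < v.
  by move=> xI; rewrite nm_circ //; lra.
have C1 x t : u < x < v -> ccont (fun t => f (circ x t)) t.
  by move=> xI; apply: ccont_cont_at; [exact: ccont_circ|apply: Hf; exact: P].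
have C2 x t : u < x < v -> ccont (fun x => f (circ x t)) x.
  by move=> xI; apply: (@ccont_cont_at f (fun x => circ x t)); [exact: ccont_circr|apply: Hf; exact: P].
apply/rcontP; split => /=.
  apply: (@Rint_circ_cont (fun r t => Re (f (circ r t))) u v K) => // x t xI.
  - by have /rcontP[] := C1 x t xI.
  - by have /rcontP[] := C2 x t xI.
  - by apply: (le_trans (nm_Re _)); apply: HK; exact: P.
apply: (@Rint_circ_cont (fun r t => Im (f (circ r t))) u v K) => // x t xI.
- by have /rcontP[] := C1 x t xI.
- by have /rcontP[] := C2 x t xI.
- by apply: (le_trans (nm_Im _)); apply: HK; exact: P.
Qed.

Lemma cdf_id (s : C) : cdf (fun z : C => z) s.
Proof. by apply: (@cdf_linear _ _ (fun z : C => z) 1 _ _ _).1 => // v; rewrite mul1r. Qed.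
Lemma cdf_sub (x s : C) : cdf (fun z : C => z - x) s.
Proof. by apply: cdfB; [exact: cdf_id|exact: cdf_cst]. Qed.

Lemma nm_lt_neq (x s : C) : nm x < nm s -> s - x != 0.
Proof. by rewrite subr_eq0; apply: contraTneq => ->; rewrite ltxx. Qed.
Lemma nm_gt_neq (x s : C) : nm s < nm x -> s - x != 0.
Proof. by rewrite subr_eq0; apply: contraTneq => ->; rewrite ltxx. Qed.

Lemma cdf_cont_at f s : cdf f s -> cont_at f s.
Proof. by move=> /cdf_cont. Qed.

(** The kernel is 1 + x / (s - x), and the mean of x / (s - x) is independent of the radius while it
    tends to 0 at infinity. *)
Lemma mean_kernel1 (x : C) r : nm x < r -> mean r (fun s => s / (s - x)) = 1.
Proof.
move=> xr; have r0 : 0 < r := le_lt_trans (nm_ge0 _) xr.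
have H s : r <= nm s -> cdf (fun s => x / (s - x)) s.
  move=> sr; apply: cdf_div; [exact: cdf_cst|exact: cdf_sub|].
  by apply: nm_lt_neq; lra.
have E : mean r (fun s => x / (s - x)) = 0.
  apply: nm_le0 => e e0.
  (* Chosen so that [2 * nm x / (r' - nm x)], the bound given by [mean_nm], is at most [e]. *)
  pose r' := r + nm x + 2 * nm x / e.
  have h : 0 <= 2 * nm x / e by rewrite divr_ge0 ?mulr_ge0 ?nm_ge0 // ltW.
  have r'r : r <= r' by rewrite /r'; have := nm_ge0 x; lra.
  rewrite (@mean_annulus _ r r') //; last by move=> s /andP[? _]; exact: H.
  have r'x : 0 < r' - nm x by rewrite /r'; lra.
  have -> : e = 2 * (e / 2) by rewrite mulrC divfK.
  apply: mean_nm; [lra| |].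
    by apply: oncircP; [lra|move=> s sr; apply: H; rewrite sr].
  move=> s sr; rewrite nmM nmV; have := nm_dist s x; rewrite sr => h2.
  have h3 : 0 < nm (s - x) by lra.
  rewrite ler_pdivrMr //; apply: (@le_trans _ _ (e / 2 * (r' - nm x))); last first.
    by rewrite ler_wpM2l // divr_ge0 // ltW.
  have -> : e / 2 * (r' - nm x) = e / 2 * r + nm x by rewrite /r'; field; rewrite gt_eqF.
  by rewrite lerDr mulr_ge0 ?divr_ge0 // ltW.
rewrite (@ext_mean _ _ _ (fun s => 1 + x / (s - x))) ?(ltW r0) //; last first.
  move=> s sr; rewrite -{1}[s](subrK x) mulrDl divff //.
  by apply: nm_lt_neq; rewrite sr.
rewrite meanD ?(ltW r0) //; first by rewrite E mean_cst addr0.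
  by apply: oncircP (ltW r0) _ => s _; exact: cdf_cst.
by apply: oncircP (ltW r0) _ => s sr; apply: H; rewrite sr.
Qed.

Lemma mean_kernel0 (x : C) r : 0 <= r -> r < nm x -> mean r (fun s => s / (s - x)) = 0.
Proof.
move=> r0 rx; rewrite mean_value ?mul0r // => s sr.
apply: cdf_div; [exact: cdf_id|exact: cdf_sub|].
by apply: nm_gt_neq; lra.
Qed.

Section Formula.
Variables (f : C -> C) (r0 M : R) (x : C).
Hypothesis Hf : forall s, nm s < r0 -> cdf f s.
Hypothesis HM : forall s, nm s < r0 -> nm (f s) <= M.

Let q (s : C) : C := if s == x then cd f x 1 else (f s - f x) / (s - x).

Lemma quot_cdf s : nm s < r0 -> s != x -> cdf q s.
Proof.
move=> sr sx; have sx0 : 0 < nm (s - x) by rewrite nm_gt0 subr_eq0.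
apply: (@cdf_near _ _ (fun s => (f s - f x) / (s - x))).
  apply/nearnP; exists (nm (s - x)) => // y ys; rewrite /q.
  by case: eqVneq ys => // ->; rewrite nm_distC ltxx.
apply: cdf_div; last by rewrite subr_eq0.
  by apply: cdfB; [exact: Hf|exact: cdf_cst].
exact: cdf_sub.
Qed.

Hypothesis xr0 : nm x < r0.

Lemma quot_cont s : nm s < r0 -> cont_at q s.
Proof.
move=> sr; have [->|sx] := eqVneq s x; last by apply: cdf_cont_at; exact: quot_cdf.
have [_ H] := cdf_nm (Hf xr0).
move=> e e0; have [|d d0 Hd] := H (e / 2); first by rewrite divr_gt0.
exists d => // z zd; rewrite /q eqxx; case: eqVneq => [_|zx].
  by rewrite subrr nm0.
have zx0 : z - x != 0 by rewrite subr_eq0.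
have := Hd (z - x) zd; have -> : x + (z - x) = z by rewrite addrC subrK.
rewrite cd_mul => h.
rewrite -(mulfK zx0 (cd f x 1)) -mulrBl nmM nmV ltr_pdivrMr ?nm_gt0 //.
rewrite [cd f x 1 * _]mulrC; apply: (le_lt_trans h).
by rewrite ltr_pM2r ?nm_gt0 // gtr_pMr // invf_lt1 // ltr1n.
Qed.

Lemma quot_bound : exists K, forall s, nm s < r0 -> nm (q s) <= K.
Proof.
have [K1 K10 [d d0 Hd]] := cdf_lip (Hf xr0).
have M0 : 0 <= M by apply: le_trans (HM xr0); exact: nm_ge0.
exists (nm (cd f x 1) + K1 + 2 * M / d) => s sr.
have c0 := nm_ge0 (cd f x 1).
have c1 : 0 <= 2 * M / d by rewrite divr_ge0 ?mulr_ge0 // ltW.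
rewrite /q; case: eqVneq => [_|sx]; first by lra.
have sx0 : 0 < nm (s - x) by rewrite nm_gt0 subr_eq0.
have [sd|sd] := ltrP (nm (s - x)) d.
  apply: (@le_trans _ _ K1); last by lra.
  rewrite nmM nmV ler_pdivrMr //.
  by have := Hd _ sd; have -> : x + (s - x) = s by rewrite addrC subrK.
apply: (@le_trans _ _ (2 * M / d)); last by lra.
rewrite nmM nmV ler_pdivrMr //; apply: (@le_trans _ _ (2 * M)).
  apply: (le_trans (nmB _ _)); rewrite mulr_natl mulr2n.
  by apply: lerD; exact: HM.
rewrite -[leLHS](@divfK _ d) ?gt_eqF // ler_wpM2l //.
Qed.

(** For radii below |x| the mean is the value of s q(s) at 0; above |x| it is constant by
    [mean_annulus]. At |x| the two ranges are joined by [mean_cont], since [q] is continuous and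
    bounded across [x]. *)
Lemma mean_quot r : nm x < r -> r < r0 -> mean r (fun s => s * q s) = 0.
Proof.
move=> xr rr0; pose G s := s * q s.
have r00 : 0 < r := le_lt_trans (nm_ge0 _) xr.
have GM s : nm s < r0 -> s != x -> cdf G s.
  by move=> sr sx; apply: cdfM; [exact: cdf_id|exact: quot_cdf].
have [x0|x0] := eqVneq x 0.
  rewrite (@ext_mean _ _ _ (fun s => f s - f 0)) ?ltW //; last first.
    move=> s sr; rewrite /q x0 subr0; case: eqVneq => [s0|s0].
      by move: r00; rewrite -sr s0 nm0 ltxx.
    by rewrite mulrC divfK.
  rewrite meanB ?ltW //.
  - by rewrite mean_cst mean_value ?subrr ?ltW // => s sr; apply: Hf; lra.
  - by apply: oncircP (ltW r00) _ => s sr; apply: Hf; lra.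
  - by apply: oncircP (ltW r00) _ => s _; exact: cdf_cst.
have xp : 0 < nm x by rewrite nm_gt0.
have [K HK] := quot_bound.
have Gc : ccont (fun r => mean r G) (nm x).
  apply: (@mean_cont G 0 r0 (r0 * K)) => //; last by rewrite xp.
    move=> s /andP[_ sr]; apply: cont_atM; last exact: quot_cont.
    by apply: cdf_cont_at; exact: cdf_id.
  move=> s /andP[_ sr]; rewrite nmM; apply: ler_pM; [exact: nm_ge0|exact: nm_ge0|exact: ltW|exact: HK].
have L r' : 0 < r' < nm x -> mean r' G = 0.
  move=> /andP[r'0 r'x]; rewrite mean_value ?ltW //; first by rewrite /G mul0r.
  move=> s sr; apply: GM; first by lra.
  by apply: contraTneq sr => ->; rewrite -ltNge.
have U r' : nm x < r' < r -> mean r' G = mean r G.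
  move=> /andP[r'x r'r]; apply: mean_annulus; rewrite ?ltW //; first by lra.
  move=> s /andP[s1 s2]; apply: GM; first by lra.
  by apply: contraTneq s1 => ->; rewrite -ltNge.
have Lx : mean (nm x) G = 0.
  apply: nm_le0 => e e0; have [d d0 Hd] := Gc e e0.
  pose r' := Num.max (nm x / 2) (nm x - d / 2).
  have r'1 : 0 < r' by rewrite lt_max divr_gt0.
  have r'2 : r' < nm x by rewrite gt_max; apply/andP; split; lra.
  have r'3 : nm x - d / 2 <= r' by rewrite le_max lexx orbT.
  have := Hd r'; rewrite L ?r'1 // sub0r nmN => h; apply/ltW/h.
  by rewrite ltr_norml; apply/andP; split; lra.
rewrite -[RHS]Lx; apply/eqP; rewrite -subr_eq0; apply/eqP/nm_le0 => e e0.
have [d d0 Hd] := Gc e e0.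
pose r' := Num.min ((nm x + r) / 2) (nm x + d / 2).
have r'1 : nm x < r' by rewrite lt_min; apply/andP; split; lra.
have r'2 : r' < r by rewrite gt_min; apply/orP; left; lra.
have r'3 : r' <= nm x + d / 2 by rewrite ge_min lexx orbT.
have := Hd r'; rewrite U ?r'1 // => h; apply/ltW/h.
by rewrite ltr_norml; apply/andP; split; lra.
Qed.

Theorem cauchy r : nm x < r -> r < r0 -> mean r (fun s => f s * (s / (s - x))) = f x.
Proof.
move=> xr rr0; have r00 : 0 <= r := le_trans (nm_ge0 _) (ltW xr).
have on1 (s : C) : nm s = r -> cdf (fun s : C => s / (s - x)) s.
  move=> sr; apply: cdf_div; [exact: cdf_id|exact: cdf_sub|].
  by apply: nm_lt_neq; lra.
have on2 (s : C) : nm s = r -> cdf f s by move=> sr; apply: Hf; lra.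
have := mean_quot xr rr0.
rewrite (@ext_mean _ _ _ (fun s => f s * (s / (s - x)) - f x * (s / (s - x)))) //; last first.
  move=> s sr; have sx : s - x != 0 by apply: nm_lt_neq; lra.
  rewrite /q -subr_eq0 (negPf sx); ring.
rewrite meanB //.
- rewrite meanZ ?mean_kernel1 // ?mulr1; last exact: oncircP.
  by move=> /eqP; rewrite subr_eq0 => /eqP.
- by apply: oncircP => // s sr; apply: cdfM; [exact: on2|exact: on1].
- by apply: oncircP => // s sr; apply: cdfM; [exact: cdf_cst|exact: on1].
Qed.

End Formula.
End Cauchy.

(** * Taylor and Cauchy estimates in one variable and along lines *)

Section Taylor.
Variable R : realType.
Local Notation C := R[i].
Implicit Types (r : R) (f : C -> C).

Lemma nm_circle_neq0 r (s : C) : 0 < r -> nm s = r -> s != 0.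
Proof. by move=> r0 sr; rewrite -nm_gt0 sr. Qed.

(** Expand s/(s - h) = 1 + h/s + h^2/(s (s - h)) in Cauchy's formula: on |s| = r0/2, with |h| <=
    r0/4, the last denominator is at least r0^2/8, and [mean_nm] doubles the bound, whence 16.
    Letting h tend to 0 then identifies the mean of f(s)/s with the derivative. *)
Lemma taylor1_coef f r0 M : 0 < r0 -> (forall s, nm s < r0 -> cdf f s) ->
  (forall s, nm s < r0 -> nm (f s) <= M) ->
  mean (r0 / 2) (fun s => f s / s) = cd f 0 1 /\
  forall h, nm h <= r0 / 4 ->
    nm (f h - f 0 - h * cd f 0 1) <= 16 * M * nm h ^+ 2 / r0 ^+ 2.
Proof.
move=> r00 Hf HM; set rho := r0 / 2; set A := mean rho (fun s => f s / s).
have rp : 0 < rho by rewrite divr_gt0.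
have rr0 : rho < r0 by rewrite /rho; lra.
have f0 : cdf f 0 by apply: Hf; rewrite nm0.
have M0 : 0 <= M by apply: le_trans (HM 0 _); rewrite ?nm_ge0 ?nm0.
have TA h : nm h <= r0 / 4 ->
    nm (f h - f 0 - h * A) <= 16 * M * nm h ^+ 2 / r0 ^+ 2.
  move=> hr; have hrho : nm h < rho by rewrite /rho; lra.
  have cfs (s : C) : nm s = rho -> cdf f s by move=> sr; apply: Hf; lra.
  have c1 (s : C) : nm s = rho -> cdf (fun s : C => s / (s - h)) s.
    move=> sr; apply: cdf_div; [exact: cdf_id|exact: cdf_sub|apply: nm_lt_neq; lra].
  have c2 (s : C) : nm s = rho -> cdf (fun s => f s / s) s.
    by move=> sr; apply: cdf_div; [exact: cfs|exact: cdf_id|exact: nm_circle_neq0 sr].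
  have E : f h - f 0 - h * A = mean rho (fun s => f s * (s / (s - h)) - f s - h * (f s / s)).
    rewrite meanB ?(ltW rp) //; last 2 first.
    - apply: oncircP (ltW rp) _ => s sr; apply: cdfB; last exact: cfs.
      by apply: cdfM; [exact: cfs|exact: c1].
    - by apply: oncircP (ltW rp) _ => s sr; apply: cdfM; [exact: cdf_cst|exact: c2].
    rewrite meanB ?(ltW rp) //; last 2 first.
    - by apply: oncircP (ltW rp) _ => s sr; apply: cdfM; [exact: cfs|exact: c1].
    - by apply: oncircP (ltW rp) _ => s sr; exact: cfs.
    rewrite meanZ ?(ltW rp) //; last by apply: oncircP (ltW rp) _.
    rewrite (cauchy Hf HM) //; last by lra.
    rewrite (@mean_value _ rho f) // ?(ltW rp) // => s sr; apply: Hf; lra.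
  rewrite E; have -> : 16 * M * nm h ^+ 2 / r0 ^+ 2 = 2 * (M * (nm h ^+ 2 / (rho * (r0 / 4)))).
    by rewrite /rho; field; rewrite gt_eqF.
  apply: mean_nm (ltW rp) _ _.
    apply: oncircP (ltW rp) _ => s sr; apply: cdfB.
      by apply: cdfB; [apply: cdfM; [exact: cfs|exact: c1]|exact: cfs].
    by apply: cdfM; [exact: cdf_cst|exact: c2].
  move=> s sr.
  have s0 : s != 0 by exact: nm_circle_neq0 sr.
  have sh : s - h != 0 by apply: nm_lt_neq; lra.
  have -> : f s * (s / (s - h)) - f s - h * (f s / s) = f s * (h ^+ 2 / (s * (s - h))).
    by field; rewrite sh s0.
  rewrite nmM; apply: ler_pM; rewrite ?nm_ge0 //; first by apply: HM; lra.
  rewrite nmM nmX nmV nmM sr ler_wpM2l ?exprn_ge0 ?nm_ge0 //.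
  have hp : 0 < rho * (r0 / 4) by rewrite !mulr_gt0.
  have sp : 0 < rho * nm (s - h) by rewrite mulr_gt0 // nm_gt0.
  rewrite lef_pV2 ?posrE //.
  rewrite ler_wpM2l ?(ltW rp) //; have := nm_dist s h; rewrite sr /rho; lra.
have EA : A = cd f 0 1.
  apply/eqP; rewrite -subr_eq0; apply/eqP/nm_le0 => e e0.
  have [_ /(_ (e / 2))[|d d0 Hd]] := cdf_nm f0; first by rewrite divr_gt0.
  pose B := 16 * M / r0 ^+ 2.
  have B0 : 0 <= B by rewrite divr_ge0 ?mulr_ge0 ?exprn_ge0 // ltW.
  pose t := Num.min (r0 / 4) (Num.min (d / 2) (e / 2 / (B + 1))).
  have t0 : 0 < t by rewrite !lt_min !divr_gt0 //; lra.
  have t1 : t <= r0 / 4 by rewrite ge_min lexx.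
  have t2 : t <= d / 2 by rewrite !ge_min lexx orbT.
  have t3 : t <= e / 2 / (B + 1) by rewrite !ge_min lexx !orbT.
  have nt : nm (t%:C : C) = t by rewrite nmR gtr0_norm.
  have h1 := TA t%:C; rewrite nt in h1; have {}h1 := h1 t1.
  have h2 := Hd t%:C; rewrite nt add0r cd_mul in h2; have {}h2 := h2 _.
  have td : t < d by lra.
  have {}h2 := h2 td.
  have h3 : t * nm (A - cd f 0 1) <= e / 2 * t + 16 * M * t ^+ 2 / r0 ^+ 2.
    rewrite -{1}nt -nmM.
    have -> : t%:C * (A - cd f 0 1) = (f t%:C - f 0 - t%:C * cd f 0 1) - (f t%:C - f 0 - t%:C * A) by ring.
    by apply: (le_trans (nmB _ _)); apply: lerD.
  have h4 : 16 * M * t ^+ 2 / r0 ^+ 2 <= e / 2 * t.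
    have -> : 16 * M * t ^+ 2 / r0 ^+ 2 = B * t * t by rewrite /B; field; rewrite gt_eqF.
    rewrite ler_wpM2r ?(ltW t0) //.
    apply: (@le_trans _ _ (B * (e / 2 / (B + 1)))); first by rewrite ler_wpM2l.
    rewrite mulrA ler_pdivrMr; last by lra.
    rewrite mulrDr mulr1 mulrC lerDl; lra.
  rewrite -(ler_pM2l t0); apply: (le_trans h3).
  apply: (le_trans (lerD (lexx _) h4)); rewrite -mulrDl -splitr mulrC //.
by split=> // h hr; rewrite -EA; exact: TA.
Qed.

End Taylor.

Section Several.
Variable R : realType.
Local Notation C := R[i].
Variable W : normedModType C.
Implicit Types (f : W -> C) (u v w : W) (r : R).

Lemma cd0 f u : cd f u 0 = 0.
Proof. by rewrite cdE linear0. Qed.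
Lemma cd_scale f u (c : C) v : cd f u (c *: v) = c * cd f u v.
Proof. by rewrite !cdE linearZ. Qed.

Lemma line_diff u v (t : C) : differentiable (fun t : C => u + t *: v) t /\
  forall h, 'd (fun t : C => u + t *: v) t h = h *: v.
Proof.
apply: (@is_diff_nm R _ _ (fun t : C => u + t *: v) t (fun h : C => h *: v) (nm v)).
- by move=> c a b; rewrite scalerDl scalerA.
- by move=> h; rewrite nmZ mulrC.
move=> e e0; exists 1 => // h _; rewrite scalerDl addrA [_ + h *: v]addrC addrK subrr nm0.
by rewrite mulr_ge0 ?nm_ge0 ?ltW.
Qed.

Lemma cdf_line f u v (t : C) : cdf f (u + t *: v) -> cdf (fun t : C => f (u + t *: v)) t.
Proof. by move=> H; apply: (@cdf_comp _ _ _ (fun t : C => u + t *: v) f t (line_diff u v t).1). Qed.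
Lemma cd_line f u v (t : C) : cdf f (u + t *: v) ->
  cd (fun t : C => f (u + t *: v)) t 1 = cd f (u + t *: v) v.
Proof.
move=> H; have [h1 h2] := line_diff u v t.
by have := @cd_comp _ _ _ (fun t : C => u + t *: v) f t 1 h1 H; rewrite h2 scale1r.
Qed.

Lemma in_ball_line u v (t : C) : u + t *: v - u = t *: v.
Proof. by rewrite addrC addKr. Qed.

(** Restrict [f] to the complex line through [u] in the direction [h], on the disc of radius r/|h|,
    and take the parameter 1. The constant is the same for all directions, which is what [mean_cdf]
    needs. *)
Lemma taylor f u r M : 0 < r -> (forall w, nm (w - u) < r -> cdf f w) ->
  (forall w, nm (w - u) < r -> nm (f w) <= M) ->
  forall h, nm h <= r / 4 ->
    nm (f (u + h) - f u - cd f u h) <= 16 * M * nm h ^+ 2 / r ^+ 2.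
Proof.
move=> r0 Hf HM h hr.
have fu : cdf f u by apply: Hf; rewrite subrr nm0.
have [->|h0] := eqVneq h 0.
  by rewrite addr0 subrr cd0 subr0 !nm0 expr0n /= mulr0 mul0r.
have hp : 0 < nm h by rewrite nm_gt0.
pose g (t : C) := f (u + t *: h).
have B (t : C) : nm t < r / nm h -> nm (u + t *: h - u) < r.
  by rewrite in_ball_line nmZ ltr_pdivlMr.
have [_ /(_ 1)] := @taylor1_coef _ g (r / nm h) M (divr_gt0 r0 hp)
  (fun t tr => cdf_line (Hf _ (B t tr))) (fun t tr => HM _ (B t tr)).
rewrite nm1 mul1r (@cd_line f u h 0) ?scale0r ?addr0 // /g scale1r scale0r addr0 expr1n mulr1.
have h4 : 1 <= r / nm h / 4.
  rewrite ler_pdivlMr // mul1r ler_pdivlMr //; lra.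
move=> /(_ h4)/le_trans; apply.
by rewrite expr_div_n invf_div mulrA.
Qed.

(** Writes a directional derivative as a mean of values of [f], over a circle of parameters that can
    be kept fixed when [u] moves; [hol_cd] differentiates this expression. *)
Lemma cd_coef f u r M v : 0 < r -> (forall w, nm (w - u) < r -> cdf f w) ->
  (forall w, nm (w - u) < r -> nm (f w) <= M) ->
  forall d, 0 < d -> d * nm v <= r ->
    cd f u v = mean (d / 2) (fun s => f (u + s *: v) / s).
Proof.
move=> r0 Hf HM d d0 dv.
have fu : cdf f u by apply: Hf; rewrite subrr nm0.
have B (t : C) : nm t < d -> nm (u + t *: v - u) < r.
  rewrite in_ball_line nmZ => td.
  have := nm_ge0 v; rewrite le_eqVlt => /orP[/eqP <-|v0]; first by rewrite mulr0.
  by apply: lt_le_trans dv; rewrite ltr_pM2r.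
have [-> _] := @taylor1_coef _ (fun t : C => f (u + t *: v)) d M d0
  (fun t tr => cdf_line (Hf _ (B t tr))) (fun t tr => HM _ (B t tr)).
by rewrite (@cd_line f u v 0) ?scale0r ?addr0.
Qed.

Lemma cauchy_est f u r M v : 0 < r -> (forall w, nm (w - u) < r -> cdf f w) ->
  (forall w, nm (w - u) < r -> nm (f w) <= M) -> nm (cd f u v) <= 4 * M / r * nm v.
Proof.
move=> r0 Hf HM; have [->|v0] := eqVneq v 0.
  by rewrite cd0 !nm0 mulr0.
have vp : 0 < nm v by rewrite nm_gt0.
have d0 : 0 < r / nm v by rewrite divr_gt0.
have dv : r / nm v * nm v <= r by rewrite divfK ?gt_eqF.
have d20 : 0 < r / nm v / 2 by rewrite divr_gt0.
have B (s : C) : nm s = r / nm v / 2 -> nm (u + s *: v - u) < r.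
  move=> sr; rewrite in_ball_line nmZ sr mulrAC divfK ?gt_eqF //.
  by rewrite gtr_pMr // invf_lt1 // ltr1n.
rewrite (cd_coef r0 Hf HM d0 dv).
have -> : 4 * M / r * nm v = 2 * (M / (r / nm v / 2)).
  by field; rewrite !gt_eqF.
apply: mean_nm (ltW d20) _ _.
  apply: oncircP (ltW d20) _ => s sr; apply: cdf_div; [|exact: cdf_id|exact: nm_circle_neq0 sr].
  by apply: cdf_line; apply: Hf; exact: B.
move=> s sr; rewrite nmM nmV sr ler_wpM2r ?invr_ge0 ?(ltW d20) //.
by apply: HM; exact: B.
Qed.

(* The Taylor remainders of the integrands are uniformly quadratic. *)
Lemma mean_cdf (K : C -> W -> C) rho u r M : 0 < rho -> 0 < r ->
  (forall s w, nm s = rho -> nm (w - u) < r -> cdf (K s) w) ->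
  (forall s w, nm s = rho -> nm (w - u) < r -> nm (K s w) <= M) ->
  (forall w, nm (w - u) < r -> oncirc rho (K^~ w)) ->
  cdf (fun w => mean rho (K^~ w)) u.
Proof.
move=> rho0 r0 HK HM HC.
have uu : nm (u - u) < r by rewrite subrr nm0.
have TK s : nm s = rho -> forall h, nm h <= r / 4 ->
    nm (K s (u + h) - K s u - cd (K s) u h) <= 16 * M * nm h ^+ 2 / r ^+ 2.
  by move=> sr; apply: taylor => // w wr; [exact: HK|exact: HM].
pose B := 16 * M / r ^+ 2.
have M0 : 0 <= M.
  apply: le_trans (HM (circ rho 0) u (nm_circ _ (ltW rho0)) uu).
  exact: nm_ge0.
have B0 : 0 <= B by rewrite divr_ge0 ?mulr_ge0 ?exprn_ge0 // ltW.
have {}TK s : nm s = rho -> forall h, nm h <= r / 4 ->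
    nm (K s (u + h) - K s u - cd (K s) u h) <= B * nm h ^+ 2.
  move=> sr h hr; apply: (le_trans (TK s sr h hr)); rewrite /B le_eqVlt; apply/orP; left.
  by apply/eqP; ring.
have small h : nm h < r -> nm (u + h - u) < r by rewrite addrC addKr.
(* continuity in s of the differentials, as uniform limits of difference quotients *)
have oc h : oncirc rho (fun s => cd (K s) u h).
  move=> t e e0.
  have [h00|h0] := eqVneq h 0.
    exists 1 => // s _; rewrite h00 !cd0 subrr nm0 //.
  have hp : 0 < nm h by rewrite nm_gt0.
  have e4 : 0 < e / 4 by rewrite divr_gt0.
  (* With this step the difference quotient [D] is within e/4 of the differential, uniformly on the
     circle; two such errors and the continuity of [D] stay below [e]. *)
  pose d := Num.min (r / 4 / nm h) (e / 4 / (B * nm h ^+ 2 + 1)).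
  have Bh : 0 < B * nm h ^+ 2 + 1 by rewrite ltr_wpDl // mulr_ge0 // exprn_ge0 // ltW.
  have d0 : 0 < d by rewrite lt_min !divr_gt0.
  have d1 : d * nm h <= r / 4 by rewrite -ler_pdivlMr // ge_min lexx.
  have d2 : d * (B * nm h ^+ 2) <= e / 4.
    apply: (@le_trans _ _ (d * (B * nm h ^+ 2 + 1))); first by rewrite ler_wpM2l ?(ltW d0) // lerDl.
    by rewrite -ler_pdivlMr // ge_min lexx orbT.
  pose D s := d%:C^-1 * (K s (u + d%:C *: h) - K s u).
  have dC : d%:C != 0 :> C by rewrite -nm_gt0 nmR gtr0_norm.
  have HD s : nm s = rho -> nm (D s - cd (K s) u h) <= e / 4.
    move=> sr; have := TK s sr (d%:C *: h); rewrite nmZ nmR gtr0_norm // => /(_ d1).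
    rewrite cd_scale.
    have -> : K s (u + d%:C *: h) - K s u - d%:C * cd (K s) u h = d%:C * (D s - cd (K s) u h).
      by rewrite /D mulrBr mulrA divff // mul1r.
    rewrite nmM nmR gtr0_norm // exprMn => hh.
    rewrite -(ler_pM2l d0); apply: (le_trans hh).
    have -> : B * (d ^+ 2 * nm h ^+ 2) = d * (d * (B * nm h ^+ 2)) by ring.
    by rewrite ler_wpM2l // ltW.
  have Dc : ccont (fun t => D (circ rho t)) t.
    apply: ccontM; first exact: ccont_cst.
    apply: ccontD; last by apply: ccontN; exact: HC.
    apply: HC; apply: small; rewrite nmZ nmR gtr0_norm //; lra.
  have [a a0 Ha] := Dc _ e4; exists a => // s /Ha hs.
  have n1 := HD _ (nm_circ s (ltW rho0)); have n2 := HD _ (nm_circ t (ltW rho0)).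
  set x := circ rho s in hs n1 *; set y := circ rho t in hs n2 *.
  have -> : cd (K x) u h - cd (K y) u h =
    (D x - D y) - (D x - cd (K x) u h) + (D y - cd (K y) u h) by ring.
  apply: (le_lt_trans (nmD _ _)); apply: (le_lt_trans (lerD (nmB _ _) (lexx _))).
  lra.
have oK w : nm (w - u) < r -> oncirc rho (K^~ w) by exact: HC.
have rle := ltW rho0.
have mean_err h : nm h <= r / 4 ->
    nm (mean rho (K^~ (u + h)) - mean rho (K^~ u) - mean rho (fun s => cd (K s) u h))
    <= 2 * (B * nm h ^+ 2).
  move=> hr; have uh : nm (u + h - u) < r by apply: small; lra.
  rewrite -meanB //; [|exact: oK|exact: oK].
  have o1 : oncirc rho (fun s => K s (u + h) - K s u).
    by move=> t; apply: ccontD; [exact: oK|apply: ccontN; exact: oK].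
  rewrite -meanB //; apply: mean_nm => //; last by move=> s sr; exact: TK.
  by move=> t; apply: ccontD; [exact: o1|apply: ccontN; exact: oc].
have Lb : exists k, forall h, nm (mean rho (fun s => cd (K s) u h)) <= k * nm h.
  exists (2 * (4 * M / r)) => h; rewrite -[leRHS]mulrA.
  apply: (@mean_nm _ rho (fun s => cd (K s) u h)) => // s sr.
  by apply: cauchy_est => // w wr; [exact: HK|exact: HM].
have [k Hk] := Lb.
apply: (@is_cd_nm _ _ _ u (fun h => mean rho (fun s => cd (K s) u h)) k _ _ _).1 => //.
  move=> c a b; rewrite -meanZ // -meanD //; last first.
    by move=> t; apply: ccontM; [exact: ccont_cst|exact: oc].
  by apply: ext_mean => // s _; exact: cd_lin.
move=> e e0; exists (Num.min (r / 4) (e / (2 * B + 1))).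
  have h : 0 < 2 * B + 1 by rewrite ltr_wpDl // mulr_ge0.
  by rewrite lt_min !divr_gt0.
move=> h; rewrite lt_min => /andP[/ltW h1 h2]; apply: (le_trans (mean_err h h1)).
have -> : 2 * (B * nm h ^+ 2) = (2 * B * nm h) * nm h by ring.
rewrite ler_wpM2r ?nm_ge0 //.
have hB : 0 < 2 * B + 1 by rewrite ltr_wpDl // mulr_ge0.
apply: (@le_trans _ _ ((2 * B + 1) * nm h)).
  by apply: ler_wpM2r; [exact: nm_ge0|lra].
by rewrite mulrC -ler_pdivlMr // ltW.
Qed.

End Several.

(** * Germs of holomorphic functions and their quotients *)

Section Hol.
Variable R : realType.
Local Notation C := R[i].
Variable W : normedModType C.
Implicit Types (f g h phi : W -> C) (u v w : W) (r : R).

Definition hol f u := \forall w \near u, cdf f w.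

Lemma hol_cdf f u : hol f u -> cdf f u.
Proof. by move=> /nbhs_singleton. Qed.

Lemma hol_near f u : hol f u -> \forall w \near u, hol f w.
Proof. by move=> H; apply: near_join. Qed.

Lemma hol_eq f g u : (\forall w \near u, f w = g w) -> hol f u -> hol g u.
Proof.
move=> /near_join H1 H2; rewrite /hol; near=> w.
apply: (@cdf_near _ _ f); first by near: w.
by near: w.
Unshelve. all: by end_near. Qed.

Lemma hol_ball f u : hol f u -> exists r M, 0 < r /\
  forall w, nm (w - u) < r -> cdf f w /\ nm (f w) <= M.
Proof.
move=> H; have fu := hol_cdf H; have /nearnP[r r0 Hr] := H.
have [d d0 Hd] := cdf_cont fu ltr01.
exists (Num.min r d), (nm (f u) + 1); split; first by rewrite lt_min r0.
move=> w; rewrite lt_min => /andP[/Hr ? /Hd h]; split => //.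
by have := nm_dist (f w) (f u); lra.
Qed.

Lemma cdf_shift f a w : cdf f (w + a) -> cdf (fun w => f (w + a)) w.
Proof.
move=> H; apply: (@cdf_comp _ _ _ (fun w => w + a) f w) => //.
Qed.

Lemma nm_add3 u w v r1 r2 : nm (w - u) <= r1 -> nm v <= r2 -> nm (w + v - u) <= r1 + r2.
Proof. by move=> h1 h2; rewrite addrAC; apply: (le_trans (nmD _ _)); apply: lerD. Qed.

(** By [cd_coef] the derivative at [w] is the mean of f(w + s v)/s over a circle independent of [w],
    and such a mean is holomorphic in [w] by [mean_cdf]. *)
Lemma hol_cd f u v : hol f u -> hol (fun w => cd f w v) u.
Proof.
move=> /hol_ball[r [M [r0 H]]].
apply/nearnP; exists (r / 4); first by rewrite divr_gt0.
move=> w wr.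
pose d := r / 4 / (nm v + 1).
have v1 : 0 < nm v + 1 by rewrite ltr_wpDl ?nm_ge0.
have d0 : 0 < d by rewrite !divr_gt0.
have d20 : 0 < d / 2 by rewrite divr_gt0.
have dv : d * nm v <= r / 4.
  apply: (@le_trans _ _ (d * (nm v + 1))); first by rewrite ler_wpM2l ?(ltW d0) // lerDl.
  by rewrite divfK // gt_eqF.
have r40 : 0 < r / 4 by rewrite divr_gt0.
have B (s : C) w' : nm s = d / 2 -> nm (w' - w) < r / 4 -> nm (w' + s *: v - u) < r.
  move=> sd w'r.
  have h1 : nm (w' - u) <= r / 2.
    rewrite -(subrK w w') -addrA; apply: (le_trans (nmD _ _)); lra.
  have h2 : nm (s *: v) <= r / 4.
    rewrite nmZ sd mulrAC; have : 0 <= d * nm v by rewrite mulr_ge0 ?nm_ge0 // ltW.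
    lra.
  by have := nm_add3 h1 h2; lra.
apply: (@cdf_near _ _ (fun w => mean (d / 2) (fun s => f (w + s *: v) / s))).
  apply/nearnP; exists (r / 4) => // w' w'r.
  have P x : nm (x - w') < r / 4 -> cdf f x /\ nm (f x) <= M.
    move=> xr; apply: H.
    have h1 : nm (w' - u) <= r / 2.
      rewrite -(subrK w w') -addrA; apply: (le_trans (nmD _ _)); lra.
    rewrite -(subrK w' x) -addrA; apply: (le_lt_trans (nmD _ _)); lra.
  by rewrite (@cd_coef _ _ f w' (r / 4) M v _ _ _ d) // => x /P[].
apply: (@mean_cdf _ _ (fun s w => f (w + s *: v) / s) (d / 2) w (r / 4) (M / (d / 2))) => //.
- move=> s w' sd w'r; apply: cdfM; last exact: cdf_cst.
  by apply: cdf_shift; apply: (H _ (B _ _ sd w'r)).1.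
- move=> s w' sd w'r; rewrite nmM nmV sd ler_wpM2r ?invr_ge0 ?(ltW d20) //.
  exact: (H _ (B _ _ sd w'r)).2.
- move=> w' w'r; apply: oncircP (ltW d20) _ => s sd; apply: cdf_div.
  + by apply: cdf_line; apply: (H _ (B _ _ sd w'r)).1.
  + exact: cdf_id.
  + exact: nm_circle_neq0 sd.
Qed.

Lemma hol_bounded f u : hol f u -> exists B : R, 0 <= B /\ \forall w \near u, nm (f w) <= B.
Proof.
move=> /hol_ball[r [M [r0 H]]]; exists M; split.
  by apply: le_trans (H u _).2; rewrite ?nm_ge0 // subrr nm0.
by apply/nearnP; exists r => // w /H[].
Qed.

Lemma near2 u (P Q S : W -> Prop) : (\forall x \near u, P x) -> (\forall x \near u, Q x) ->
  (forall x, P x -> Q x -> S x) -> \forall x \near u, S x.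
Proof. by move=> hP hQ H; near=> x; apply: H; near: x. Unshelve. all: by end_near. Qed.

Lemma near1 u (P S : W -> Prop) : (\forall x \near u, P x) -> (forall x, P x -> S x) ->
  \forall x \near u, S x.
Proof. by move=> h H; apply: (near2 h h) => x hx _; exact: H. Qed.

Lemma nearI u (P Q : W -> Prop) : (\forall x \near u, P x) -> (\forall x \near u, Q x) ->
  \forall x \near u, P x /\ Q x.
Proof. by move=> h1 h2; apply: (near2 h1 h2). Qed.

Lemma holM f g u : hol f u -> hol g u -> hol (fun w => f w * g w) u.
Proof. by move=> /[swap]; apply: filterS2 => w hg hf; exact: cdfM. Qed.
Lemma holD f g u : hol f u -> hol g u -> hol (fun w => f w + g w) u.
Proof. by move=> /[swap]; apply: filterS2 => w hg hf; exact: cdfD. Qed.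
Lemma holB f g u : hol f u -> hol g u -> hol (fun w => f w - g w) u.
Proof. by move=> /[swap]; apply: filterS2 => w hg hf; exact: cdfB. Qed.
Lemma holN f u : hol f u -> hol (fun w => - f w) u.
Proof. by apply: filterS => w; exact: cdfN. Qed.
Lemma holX f n u : hol f u -> hol (fun w => f w ^+ n) u.
Proof. by apply: filterS => w; exact: cdfX. Qed.
Lemma hol_cst (c : C) u : hol (fun=> c) u.
Proof. by apply: nearW => w; exact: cdf_cst. Qed.

Lemma cdf_neq0 f u : cdf f u -> f u != 0 -> \forall w \near u, f w != 0.
Proof.
move=> fu f0; have [|d d0 Hd] := cdf_cont fu (e := nm (f u)); first by rewrite nm_gt0.
apply/nearnP; exists d => // w /Hd; apply: contraTneq => ->.
by rewrite sub0r nmN ltxx.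
Qed.

Lemma hol_div f g u : hol f u -> hol g u -> g u != 0 -> hol (fun w => f w / g w) u.
Proof.
move=> hf hg g0; have := cdf_neq0 (hol_cdf hg) g0; move: hf hg => H1 H2 H3.
rewrite /hol; near=> w; apply: cdf_div; by near: w.
Unshelve. all: by end_near. Qed.

(** Under this condition a continuous quotient by [h] has a determined value at [w]. *)
Definition accum h w := forall e : R, 0 < e -> exists2 w', nm (w' - w) < e & h w' != 0.

Lemma quot_unique g h phi psi w : cdf phi w -> cdf psi w -> accum h w ->
  (\forall y \near w, g y = phi y * h y) -> (\forall y \near w, g y = psi y * h y) ->
  phi w = psi w.
Proof.
move=> c1 c2 hw /nearnP[d1 d10 H1] /nearnP[d2 d20 H2].
apply/eqP; rewrite -subr_eq0; apply/negPn/negP => ne.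
have /nearnP[d3 d30 H3] := cdf_neq0 (cdfB c1 c2) ne.
have [|w' w'd hw'] := hw (Num.min d1 (Num.min d2 d3)); first by rewrite !lt_min d10 d20.
move: w'd; rewrite !lt_min => /and3P[/H1 e1 /H2 e2 /H3]; apply/negP/negPn.
by rewrite -(mulIr_eq0 _ (mulIf hw')) mulrBl -e1 -e2 subrr.
Qed.

Definition quot_at g h u phi := hol phi u /\ \forall w \near u, g w = phi w * h w.

(** By [quot_unique] the value at a point does not depend on the local quotient; choosing these
    values pointwise gives one function that is a quotient wherever a local one exists. *)
Lemma quot_glue g h : exists Phi, forall u, (\forall w \near u, accum h w) ->
  (exists phi, quot_at g h u phi) -> quot_at g h u Phi.
Proof.
have /choice[F HF] : forall u, exists c : C, forall phi, accum h u -> quot_at g h u phi -> phi u = c.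
  move=> u; have [[phi Hphi]|no] := pselect (exists phi, quot_at g h u phi).
    exists (phi u) => psi hu Hpsi.
    by apply: (quot_unique (g := g) (h := h)) => //; [exact: hol_cdf Hpsi.1|exact: hol_cdf Hphi.1|exact: Hpsi.2|exact: Hphi.2].
  by exists 0 => phi _ Hphi; exfalso; apply: no; exists phi.
exists F => u hu [phi [h1 h2]].
have E : \forall w \near u, phi w = F w.
  have h1' := hol_near h1; have h2' : \forall w \near u, \forall y \near w, g y = phi y * h y by exact: near_join.
  near=> w; apply: HF; first by near: w.
  by split; near: w.
split; first exact: hol_eq h1.
by near=> w; rewrite -(near E w) //; near: w.
Unshelve. all: by end_near. Qed.

End Hol.

Lemma hol_comp (R : realType) (U W : normedModType R[i]) (F : U -> W) (f : W -> R[i]) u :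
  (\forall w \near u, differentiable F w) -> hol f (F u) -> hol (fun w => f (F w)) u.
Proof.
move=> dF hf; have cF := differentiable_continuous (nbhs_singleton dF).
have h2 : \forall w \near u, cdf f (F w) by exact: (cF _ hf).
by apply: filterS2 dF h2 => w; exact: cdf_comp.
Qed.

(** * Riemann extension of quotients *)

Section OneVar.
Variable R : realType.
Local Notation C := R[i].
Implicit Types (f g h : C -> C) (r : R).

Definition bhd r f := (forall s : C, nm s < r -> cdf f s) /\
  exists M, forall s : C, nm s < r -> nm (f s) <= M.

Definition quot0 f (s : C) : C := if s == 0 then cd f 0 1 else (f s - f 0) / s.

Lemma quot0E f s : f s = f 0 + s * quot0 f s.
Proof.
rewrite /quot0; case: eqVneq => [->|s0]; first by rewrite mul0r addr0.
by rewrite mulrC divfK // addrC subrK.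
Qed.

(** Only the point 0 is in question; near it [quot0 f x] is the mean of f(z)/(z - x) over a fixed
    circle, hence holomorphic in [x]. *)
Lemma quot0_bhd r f : 0 < r -> bhd r f -> bhd r (quot0 f).
Proof.
move=> r0 [Hf [M HM]].
have z0 : nm (0 : C) < r by rewrite nm0.
have E : quot0 f = (fun s => if s == 0 then cd f 0 1 else (f s - f 0) / (s - 0)).
  by apply/funext => s; rewrite /quot0 subr0.
split; last by rewrite E; exact: (quot_bound Hf HM z0).
move=> s sr; have [->|s0] := eqVneq s 0; last by rewrite E; exact: (quot_cdf Hf sr s0).
pose rho := r / 2; have rp : 0 < rho by rewrite divr_gt0.
have rr : rho < r by rewrite /rho; lra.
have cfs (z : C) : nm z = rho -> cdf f z by move=> zr; apply: Hf; lra.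
have c1 (z x : C) : nm z = rho -> nm x < rho -> cdf (fun z : C => z / (z - x)) z.
  move=> zr xr; apply: cdf_div; [exact: cdf_id|exact: cdf_sub|apply: nm_lt_neq; lra].
have c2 (z x : C) : nm z = rho -> nm x < rho -> cdf (fun z : C => f z / (z - x)) z.
  move=> zr xr; apply: cdf_div; [exact: cfs|exact: cdf_sub|apply: nm_lt_neq; lra].
apply: (@cdf_near _ _ (fun x => mean rho (fun z => f z / (z - x)))).
  apply/nearnP; exists rho => // x; rewrite subr0 => xr.
  rewrite /quot0; case: eqVneq => [->|x0].
    have [<- _] := taylor1_coef r0 Hf HM.
    by apply: ext_mean (ltW rp) _ => z _; rewrite subr0.
  have e1 := cauchy Hf HM (lt_trans xr rr) xr rr.
  have e2 := @mean_value _ rho f (ltW rp) (fun s sr => Hf s (le_lt_trans sr rr)).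
  have e3 : f x - f 0 = mean rho (fun z => x * (f z / (z - x))).
    rewrite -e1 -e2 -meanB ?(ltW rp) //; last 2 first.
    - by apply: oncircP (ltW rp) _ => z zr; apply: cdfM; [exact: cfs|exact: c1].
    - by apply: oncircP (ltW rp) _ => z zr; exact: cfs.
    apply: ext_mean (ltW rp) _ => z zr; field.
    by apply: nm_lt_neq; lra.
  rewrite e3 meanZ ?(ltW rp) //; first by rewrite [x * _]mulrC mulfK.
  by apply: oncircP (ltW rp) _ => z zr; exact: c2.
apply: (@mean_cdf _ _ (fun z x => f z / (z - x)) rho 0 (rho / 2) (M / (rho / 2))) => //.
- by rewrite divr_gt0.
- move=> z x zr; rewrite subr0 => xr; apply: cdf_div; [exact: cdf_cst| |].
    by apply: cdfB; [exact: cdf_cst|exact: cdf_id].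
  by apply: nm_lt_neq; lra.
- move=> z x zr; rewrite subr0 => xr; rewrite nmM nmV.
  have h : rho / 2 <= nm (z - x) by have := nm_dist z x; lra.
  apply: ler_pM; rewrite ?nm_ge0 ?invr_ge0 ?nm_ge0 //; first by apply: HM; lra.
  by rewrite lef_pV2 ?posrE //; lra.
- move=> x; rewrite subr0 => xr; apply: oncircP (ltW rp) _ => z zr; apply: c2 => //; lra.
Qed.

Lemma expn_small (q e : R) : 0 <= q -> q < 1 -> 0 < e -> exists n, q ^+ n < e.
Proof.
move=> q0 q1 e0; have : (q ^+ n @[n --> \oo] --> (0 : R)).
  by apply: cvg_expr; rewrite ger0_norm.
move=> /cvgrPdist_lt /(_ e e0) [N _ HN]; exists N.
by have := HN N (leqnn N); rewrite /= sub0r normrN ger0_norm // exprn_ge0.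
Qed.

(** Cauchy's formula for f/s^n on the circle of radius [rho] bounds |f(s)| by a constant times
    (|s|/rho)^n, for every n. *)
Lemma infinite_order f r : 0 < r -> bhd r f ->
  (forall n, exists2 g, bhd r g & forall s : C, nm s < r -> f s = s ^+ n * g s) ->
  forall s : C, nm s < r -> f s = 0.
Proof.
move=> r0 [Hf [M HM]] H s sr.
have s0 := nm_ge0 s.
have [rho r1 r2] : exists2 rho, nm s < rho & rho < r by exists ((nm s + r) / 2); lra.
have rp : 0 < rho by lra.
have M0 : 0 <= M by apply: le_trans (HM s sr); exact: nm_ge0.
pose q := nm s / rho; pose A := 2 * (M * (rho / (rho - nm s))).
have q0 : 0 <= q by rewrite divr_ge0 // ltW.
have q1 : q < 1 by rewrite ltr_pdivrMr // mul1r.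
have rs : 0 < rho - nm s by lra.
have A0 : 0 <= A by apply: mulr_ge0 => //; apply: mulr_ge0 => //; apply: divr_ge0; lra.
apply: nm_le0 => e e0.
have [|n Hn] := @expn_small q (e / (A + 1)) q0 q1; first by rewrite divr_gt0 //; lra.
have [g [Hg [Mg HMg]] fg] := H n.
rewrite fg // -(cauchy Hg HMg sr r1 r2) nmM.
have ck (z : C) : nm z = rho -> cdf (fun z : C => z / (z - s)) z.
  move=> zr; apply: cdf_div; [exact: cdf_id|exact: cdf_sub|apply: nm_lt_neq; lra].
apply: (@le_trans _ _ (nm s ^+ n * (2 * (M / rho ^+ n * (rho / (rho - nm s)))))).
  rewrite nmX ler_wpM2l ?exprn_ge0 //; apply: mean_nm (ltW rp) _ _.
    apply: oncircP (ltW rp) _ => z zr; apply: cdfM; [apply: Hg; lra|exact: ck].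
  move=> z zr; rewrite nmM; apply: ler_pM; rewrite ?nm_ge0 //.
    have := HM z; rewrite fg ?zr // nmM nmX zr => /(_ r2) h.
    by rewrite ler_pdivlMr ?exprn_gt0 // mulrC.
  rewrite nmM nmV zr ler_wpM2l ?(ltW rp) //.
  have h := nm_dist z s; rewrite zr in h.
  by rewrite lef_pV2 ?posrE //; lra.
have -> : nm s ^+ n * (2 * (M / rho ^+ n * (rho / (rho - nm s)))) = A * q ^+ n.
  rewrite /A /q expr_div_n; move: (rho ^+ n)^-1 (nm s ^+ n) (rho / _) => X Y Z.
  by ring.
apply: (@le_trans _ _ (A * (e / (A + 1)))); first by rewrite ler_wpM2l // ltW.
rewrite mulrA ler_pdivrMr; last by lra.
rewrite mulrDr mulr1 mulrC; lra.
Qed.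

(** Divide by [s] as long as the value at 0 vanishes; if this never stopped, [infinite_order] would
    make [f] zero. *)
Lemma bhd_order f r (s1 : C) : 0 < r -> bhd r f -> nm s1 < r -> f s1 != 0 ->
  exists n g, [/\ bhd r g, forall s : C, nm s < r -> f s = s ^+ n * g s & g 0 != 0].
Proof.
move=> r0 Hf s1r fs1; apply: contrapT => no; move/eqP: fs1; apply.
apply: (infinite_order r0 Hf) => //; elim=> [|n [g Hg fg]].
  by exists f => // s _; rewrite expr0 mul1r.
exists (quot0 g); first exact: quot0_bhd.
have g0 : g 0 = 0.
  by apply: contrapT => /eqP g0; apply: no; exists n, g.
by move=> s sr; rewrite fg // {1}(quot0E g s) g0 add0r exprSr mulrA.
Qed.

Lemma bhd_ident f r d (s1 : C) : 0 < r -> bhd r f -> 0 < d ->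
  (forall s : C, nm s < d -> f s = 0) -> nm s1 < r -> f s1 = 0.
Proof.
move=> r0 Hf d0 H s1r; apply: contrapT => /eqP fs1.
have [n [g [Hg fg g0]]] := bhd_order r0 Hf s1r fs1.
have cg : cdf g 0 by apply: Hg.1; rewrite nm0.
have /nearnP[e e0 He] := cdf_neq0 cg g0.
pose t := Num.min (r / 2) (Num.min (d / 2) (e / 2)).
have t0 : 0 < t by rewrite !lt_min !divr_gt0.
have tr : t <= r / 2 by rewrite ge_min lexx.
have td : t <= d / 2 by rewrite !ge_min lexx orbT.
have te : t <= e / 2 by rewrite !ge_min lexx !orbT.
have nt : nm (t%:C : C) = t by rewrite nmR gtr0_norm.
have tC : t%:C != 0 :> C by rewrite -nm_gt0 nt.
have := fg t%:C; rewrite nt H ?nt; [|lra].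
move=> /(_ _)/esym/eqP; rewrite mulf_eq0 expf_eq0 (negPf tC) andbF /=.
have /negPf -> : g t%:C != 0 by apply: He; rewrite subr0 nt; lra.
by move=> Hh; have : false by apply: Hh; lra.
Qed.

(** If [h] has order n at 0, the bound |g| <= K |h| forces [g] to vanish to order n: as long as j <
    n, the cofactor of s^j in [g] tends to 0 at 0. It is tested at small real points [t]. *)
Lemma bhd_div_local g h r (s1 : C) K : 0 < r -> bhd r g -> bhd r h -> nm s1 < r -> h s1 != 0 ->
  (forall s, nm s < r -> h s != 0 -> nm (g s) <= K * nm (h s)) ->
  exists phi, quot_at g h 0 phi.
Proof.
move=> r0 Hg Hh s1r hs1 HK.
have [n [h1 [Hh1 hE h10]]] := bhd_order r0 Hh s1r hs1.
have ch1 : cdf h1 0 by apply: Hh1.1; rewrite nm0.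
have /nearnP[d d0 Hd] := cdf_neq0 ch1 h10.
have [d' d'0 Hd'] := cdf_cont ch1 ltr01.
pose B := nm (h1 0) + 1.
have hne s : nm s < r -> nm s < d -> s != 0 -> h s != 0.
  move=> sr sd s0; rewrite hE // mulf_neq0 ?expf_neq0 //.
  by apply: Hd; rewrite subr0.
have key j : (j <= n)%N -> exists2 gj, bhd r gj & forall s : C, nm s < r -> g s = s ^+ j * gj s.
  elim: j => [|j IH] jn; first by exists g => // s _; rewrite expr0 mul1r.
  have [gj Hgj gE] := IH (ltnW jn).
  exists (quot0 gj); first exact: quot0_bhd.
  suff gj0 : gj 0 = 0.
    by move=> s sr; rewrite gE // {1}(quot0E gj s) gj0 add0r exprSr mulrA.
  apply: nm_le0 => e e0.
  have cgj : cdf gj 0 by apply: Hgj.1; rewrite nm0.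
  have e2 : 0 < e / 2 by rewrite divr_gt0.
  have [a a0 Ha] := cdf_cont cgj e2.
  have K0 : 0 <= `|K| * B by rewrite mulr_ge0 // /B addr_ge0 ?nm_ge0.
  (* The last entry makes [t * (|K| * B)] at most e/2; [t <= 1] discards the surplus powers of [t],
     and the other entries keep [t] where the earlier estimates hold. *)
  pose t := Num.min (Num.min (r / 2) (d / 2)) (Num.min (Num.min (d' / 2) (a / 2)) (Num.min 1 (e / 2 / (`|K| * B + 1)))).
  have KB : 0 < `|K| * B + 1 by lra.
  have t0 : 0 < t by rewrite !lt_min ltr01 !divr_gt0.
  have tr : t <= r / 2 by rewrite !ge_min lexx.
  have td : t <= d / 2 by rewrite !ge_min lexx !orbT.
  have td' : t <= d' / 2 by rewrite !ge_min lexx !orbT.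
  have ta : t <= a / 2 by rewrite !ge_min lexx !orbT.
  have t1 : t <= 1 by rewrite !ge_min lexx !orbT.
  have te : t <= e / 2 / (`|K| * B + 1) by rewrite !ge_min lexx !orbT.
  have nt : nm (t%:C : C) = t by rewrite nmR gtr0_norm.
  have tC : t%:C != 0 :> C by rewrite -nm_gt0 nt.
  have tr' : nm (t%:C : C) < r by rewrite nt; lra.
  have td0 : nm (t%:C : C) < d by rewrite nt; lra.
  have := HK _ tr' (hne _ tr' td0 tC).
  rewrite gE // hE // !nmM !nmX nt => hk.
  have hB : nm (h1 t%:C) <= B.
    have := Hd' t%:C; rewrite subr0 nt => /(_ _) hh.
    have := nm_dist (h1 t%:C) (h1 0); have : nm (h1 t%:C - h1 0) < 1 by apply: hh; lra.
    by rewrite /B; clear; lra.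
  have hg : nm (gj t%:C) <= e / 2.
    have tj : 0 < t ^+ j by rewrite exprn_gt0.
    rewrite -(ler_pM2l tj); apply: (le_trans hk).
    have -> : t ^+ n = t ^+ j * (t * t ^+ (n - j.+1)) by rewrite -exprS -exprD addnS -addSn subnKC.
    have tm : t ^+ (n - j.+1) <= 1 by rewrite exprn_ile1 // ltW.
    apply: (@le_trans _ _ (`|K| * (t ^+ j * t * B))).
      apply: (@le_trans _ _ (`|K| * (t ^+ j * (t * t ^+ (n - j.+1)) * nm (h1 t%:C)))).
        by rewrite ler_wpM2r ?ler_norm // !mulr_ge0 ?exprn_ge0 ?nm_ge0 // ltW.
      rewrite ler_wpM2l //; apply: ler_pM; rewrite ?nm_ge0 //.
        by rewrite !mulr_ge0 ?exprn_ge0 // ltW.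
      by rewrite mulrA ler_piMr // mulr_ge0 ?exprn_ge0 // ltW.
    have -> : `|K| * (t ^+ j * t * B) = t ^+ j * (t * (`|K| * B)) by ring.
    rewrite ler_wpM2l ?(ltW tj) //.
    apply: (@le_trans _ _ (t * (`|K| * B + 1))); first by rewrite ler_wpM2l ?(ltW t0) // lerDl.
    by rewrite -ler_pdivlMr.
  have := Ha t%:C; rewrite subr0 nt => /(_ _) hh.
  have h2 : nm (gj t%:C - gj 0) < e / 2 by apply: hh; lra.
  by have := nm_dist (gj 0) (gj t%:C); rewrite nm_distC; move: h2 hg; clear; lra.
have [gn Hgn gE] := key n (leqnn n).
exists (fun s => gn s / h1 s).
have d1 : 0 < Num.min r d by rewrite lt_min r0.
split; apply/nearnP; exists (Num.min r d) => // s; rewrite subr0 lt_min => /andP[sr sd].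
  apply: cdf_div; [exact: Hgn.1|exact: Hh1.1|by apply: Hd; rewrite subr0].
have hs : h1 s != 0 by apply: Hd; rewrite subr0.
by rewrite gE // hE //; field.
Qed.

Lemma bhd_shift f r (s0 : C) : bhd r f -> bhd (r - nm s0) (fun s => f (s + s0)).
Proof.
move=> [Hf [M HM]]; have B (s : C) : nm s < r - nm s0 -> nm (s + s0) < r.
  by move=> h; apply: (le_lt_trans (nmD _ _)); lra.
split; first by move=> s /B sr; apply: cdf_shift; exact: Hf.
by exists M => s /B; exact: HM.
Qed.

(** The quotient extends holomorphically over the closed disc of radius [r], so its value at 0 is
    its mean over the circle, where g/h makes sense because [h] has no zero there. *)
Lemma mean_value_quot g h r r' K : 0 < r -> r < r' -> bhd r' g -> bhd r' h ->
  (forall s : C, nm s = r -> h s != 0) ->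
  (forall s, nm s < r' -> h s != 0 -> nm (g s) <= K * nm (h s)) ->
  g 0 = mean r (fun s => g s / h s) * h 0.
Proof.
move=> r0 rr' Hg Hh hr HK.
(* Moving radially from [s0] reaches the circle of radius [r] within the disc of radius
   [r' - nm s0]; hence [h] is not identically zero on that disc, and the identity theorem yields
   [acc]. *)
have circ_pt (s0 : C) : nm s0 < (r + r') / 2 ->
    exists2 s1 : C, nm s1 < r' - nm s0 & h (s1 + s0) != 0.
  move=> s0r; have [->|s00] := eqVneq s0 0.
    exists r%:C; first by rewrite nm0 subr0 nmR gtr0_norm.
    by rewrite addr0; apply: hr; rewrite nmR gtr0_norm.
  have np : 0 < nm s0 by rewrite nm_gt0.
  exists (((r - nm s0) / nm s0)%:C * s0).
    rewrite nmM nmR normrM normfV (gtr0_norm np) divfK ?gt_eqF //.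
    by rewrite ltr_norml; apply/andP; split; lra.
  apply: hr; rewrite (_ : _ + s0 = ((r - nm s0) / nm s0 + 1)%:C * s0); last first.
    by rewrite rmorphD rmorph1 [RHS]mulrDl mul1r.
  rewrite nmM nmR.
  have -> : (r - nm s0) / nm s0 + 1 = r / nm s0 by field; rewrite gt_eqF.
  by rewrite ger0_norm ?divr_ge0 ?(ltW r0) ?(ltW np) // divfK // gt_eqF.
have acc (s0 : C) : nm s0 < (r + r') / 2 -> accum h s0.
  move=> s0r e e0; apply: contrapT => no.
  have [s1 s1r] := circ_pt s0 s0r; move/eqP; apply.
  apply: (@bhd_ident (fun s => h (s + s0)) (r' - nm s0) e) => //; first by lra.
    exact: bhd_shift.
  move=> s se; apply: contrapT => /eqP hs; apply: no; exists (s + s0) => //.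
  by rewrite addrK.
have nacc (s0 : C) : nm s0 <= r -> \forall w \near s0, accum h w.
  move=> s0r; apply/nearnP; exists ((r' - r) / 2); first by lra.
  move=> w wr; apply: acc; have := nm_dist w s0; lra.
have [Phi HPhi] := quot_glue g h.
have {}HPhi s0 : nm s0 <= r -> quot_at g h s0 Phi.
  move=> s0r; apply: HPhi; first exact: nacc.
  have [|s1 s1r hs1] := circ_pt s0; first by lra.
  have rs0 : 0 < r' - nm s0 by lra.
  have [|phi [p1 p2]] := @bhd_div_local (fun s => g (s + s0)) (fun s => h (s + s0)) (r' - nm s0)
    s1 K rs0 (bhd_shift s0 Hg) (bhd_shift s0 Hh) s1r hs1.
    move=> s sr; apply: HK; apply: (le_lt_trans (nmD _ _)); lra.
  exists (fun s => phi (s - s0)); split.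
    move: p1 => /nearnP[d d0 Hd]; apply/nearnP; exists d => // s sd.
    by apply: (@cdf_shift _ _ phi (- s0)); apply: Hd; rewrite subr0.
  move: p2 => /nearnP[d d0 Hd]; apply/nearnP; exists d => // s sd.
  by have := Hd (s - s0); rewrite subr0 subrK => ->.
have [_ /nbhs_singleton ->] : quot_at g h 0 Phi by apply: HPhi; rewrite nm0 ltW.
congr (_ * _); rewrite -(@mean_value _ r Phi) ?(ltW r0) //; last first.
  by move=> s sr; exact: hol_cdf (HPhi s sr).1.
apply: ext_mean (ltW r0) _ => s sr.
have [_ /nbhs_singleton ->] : quot_at g h s Phi by apply: HPhi; rewrite sr.
by rewrite mulfK // hr.
Qed.

End OneVar.

Section Riemann.
Variable R : realType.
Local Notation C := R[i].
Variable W : normedModType C.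
Implicit Types (f g h : W -> C) (u v w : W) (r : R).

Lemma bhd_line f u r M v : 0 < r -> (forall w, nm (w - u) < r -> cdf f w /\ nm (f w) <= M) ->
  forall w d, 0 < d -> nm (w - u) + d * nm v <= r -> nm (w - u) < r ->
  bhd d (fun t : C => f (w + t *: v)).
Proof.
move=> r0 H w d d0 wd wr.
have B (t : C) : nm t < d -> nm (w + t *: v - u) < r.
  move=> td; rewrite addrAC; apply: (le_lt_trans (nmD _ _)); rewrite nmZ.
  have := nm_ge0 v; rewrite le_eqVlt => /orP[/eqP <-|v0]; first by rewrite mulr0 addr0.
  by apply: lt_le_trans wd; rewrite ltrD2l ltr_pM2r.
split; first by move=> t /B /H[h _]; exact: cdf_line.
by exists M => t /B /H[].
Qed.

(** The Cauchy estimate and the Taylor remainder each contribute 4 M / r. *)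
Lemma lip_ball f u r M : 0 < r -> (forall w, nm (w - u) < r -> cdf f w /\ nm (f w) <= M) ->
  forall v, nm v <= r / 4 -> nm (f (u + v) - f u) <= 8 * M / r * nm v.
Proof.
move=> r0 H v vr.
have H1 w : nm (w - u) < r -> cdf f w by move=> /H[].
have H2 w : nm (w - u) < r -> nm (f w) <= M by move=> /H[].
have M0 : 0 <= M by apply: le_trans (H2 u _); rewrite ?nm_ge0 // subrr nm0.
have T := taylor r0 H1 H2 vr; have E := cauchy_est v r0 H1 H2.
rewrite -(subrK (cd f u v) (f (u + v) - f u)); apply: (le_trans (nmD _ _)).
apply: (le_trans (lerD T E)).
have -> : 16 * M * nm v ^+ 2 / r ^+ 2 = 16 * M / r ^+ 2 * nm v * nm v by ring.
rewrite -mulrDl ler_wpM2r ?nm_ge0 //.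
have h : 16 * M / r ^+ 2 * nm v <= 16 * M / r ^+ 2 * (r / 4).
  apply: ler_wpM2l => //; apply: divr_ge0; first by apply: mulr_ge0.
  by apply: exprn_ge0; exact: ltW.
have E2 : 16 * M / r ^+ 2 * (r / 4) = 4 * M / r by field; rewrite gt_eqF.
have E3 : 8 * M / r = 4 * M / r + 4 * M / r by field; rewrite gt_eqF.
by rewrite E3 lerD2r -E2.
Qed.

(* On a complex line through [u] where [h] is not identically zero, the quotient
   extends and is a Cauchy integral over a circle free of zeros of [h]; the same
   integral over the parallel lines defines the extension near [u]. *)
Theorem riemann_div g h u K : hol g u -> hol h u -> accum h u ->
  (\forall w \near u, h w != 0 -> nm (g w) <= K * nm (h w)) ->
  exists phi, quot_at g h u phi.
Proof.
move=> /hol_ball[r1 [M1 [r10 H1]]] /hol_ball[r2 [M2 [r20 H2]]] hu /nearnP[r3 r30 HK].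
pose r := Num.min r1 (Num.min r2 r3).
have r0 : 0 < r by rewrite !lt_min r10 r20.
have Hg w : nm (w - u) < r -> cdf g w /\ nm (g w) <= M1.
  by rewrite !lt_min => /and3P[? _ _]; exact: H1.
have Hh w : nm (w - u) < r -> cdf h w /\ nm (h w) <= M2.
  by rewrite !lt_min => /and3P[_ ? _]; exact: H2.
have {}HK w : nm (w - u) < r -> h w != 0 -> nm (g w) <= K * nm (h w).
  by rewrite !lt_min => /and3P[_ _ ?]; exact: HK.
have M20 : 0 <= M2 by apply: le_trans (Hh u _).2; rewrite ?nm_ge0 // subrr nm0.
(* Provides a direction [v] along which [h] is not identically zero; the 1/8 leaves room for
   parameters of modulus up to 4. *)
have [|u1 u1r hu1] := hu (r / 8); first by rewrite divr_gt0.
pose v := u1 - u.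
have [n [k [[Hk _] kE k0]]] : exists n (k : C -> C), [/\ bhd 4 k,
    forall s : C, nm s < 4 -> h (u + s *: v) = s ^+ n * k s & k 0 != 0].
  apply: (@bhd_order _ (fun s : C => h (u + s *: v)) 4 1) => //.
  - by apply: (bhd_line r0 Hh) => //; rewrite subrr nm0 //; lra.
  - by rewrite nm1; lra.
  - by rewrite scale1r /v addrC subrK.
have ck : cdf k 0 by apply: Hk; rewrite nm0.
have [|d d0 Hd] := cdf_cont ck (e := nm (k 0) / 2); first by rewrite divr_gt0 // nm_gt0.
(* On this circle [k] stays within half of [nm (k 0)] from [k 0], so |h| is at least [mu] there. *)
pose rho := Num.min 1 (d / 2).
have rp : 0 < rho by rewrite lt_min ltr01 divr_gt0.
have rle1 : rho <= 1 by rewrite ge_min lexx.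
have rled : rho < d by rewrite gt_min [d / 2 < d]gtr_pMr // invf_lt1 // ltr1n orbT.
pose mu := rho ^+ n * (nm (k 0) / 2).
have mu0 : 0 < mu by rewrite mulr_gt0 ?exprn_gt0 // divr_gt0 // nm_gt0.
have hmu (s : C) : nm s = rho -> mu <= nm (h (u + s *: v)).
  move=> sr; rewrite kE ?sr; last by lra.
  rewrite nmM nmX sr ler_wpM2l ?exprn_ge0 ?(ltW rp) //.
  have := Hd s; rewrite subr0 sr => /(_ rled) h1.
  by have := nm_dist (k 0) (k s); rewrite nm_distC; lra.
pose L := 8 * M2 / (r / 2).
have L0 : 0 <= L by rewrite divr_ge0 ?mulr_ge0 // ltW // divr_gt0.
(* [L] is a Lipschitz constant for [h] near the circle, so moving the line by less than
   [mu / (L + 1)] creates no zero of [h] on it. *)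
pose dl := Num.min (r / 8) (mu / (L + 1)).
have dl0 : 0 < dl by rewrite lt_min !divr_gt0 //; lra.
have dlr : dl <= r / 8 by rewrite ge_min lexx.
have svr (s : C) : nm s = rho -> nm (s *: v) <= r / 8.
  move=> sr; rewrite nmZ sr; apply: (@le_trans _ _ (1 * nm v)).
    by rewrite ler_wpM2r ?nm_ge0.
  by rewrite mul1r ltW.
have hnz (s : C) w : nm s = rho -> nm (w - u) < dl -> h (w + s *: v) != 0.
  move=> sr wd; set a := u + s *: v.
  have au : nm (a - u) <= r / 8 by rewrite /a addrC addKr; exact: svr.
  have Ha x : nm (x - a) < r / 2 -> cdf h x /\ nm (h x) <= M2.
    move=> xa; apply: Hh; rewrite -(subrK a x) -addrA.
    apply: (le_lt_trans (nmD _ _)); lra.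
  have wa : a + (w - u) = w + s *: v by rewrite /a addrC addrA subrK.
  have rh : 0 < r / 2 by rewrite divr_gt0.
  have := @lip_ball h a (r / 2) M2 rh Ha (w - u).
  rewrite wa -/L => /(_ _) hh.
  have {}hh : nm (h (w + s *: v) - h a) <= L * nm (w - u) by apply: hh; move: wd dlr r0; clear; lra.
  rewrite -nm_gt0; have := nm_dist (h a) (h (w + s *: v)); rewrite nm_distC => h2.
  have h3 := hmu s sr.
  have h4 : L * nm (w - u) < mu.
    apply: (@le_lt_trans _ _ ((L + 1) * nm (w - u))); first by rewrite ler_wpM2r ?nm_ge0 // lerDl.
    have Lp : 0 < L + 1 by rewrite ltr_wpDl.
    rewrite mulrC -ltr_pdivlMr //; apply: (lt_le_trans wd).
    by rewrite ge_min lexx orbT.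
  by rewrite -/a in h3; move: h2 h3 h4 hh; clear; lra.
have wsv (s : C) w : nm s = rho -> nm (w - u) < dl -> nm (w + s *: v - u) < r.
  move=> sr wd; have := nm_add3 (ltW wd) (svr s sr); move: dlr r0; clear; lra.
exists (fun w => mean rho (fun s => g (w + s *: v) / h (w + s *: v))).
have cq (s : C) w : nm s = rho -> nm (w - u) < dl -> cdf (fun w => g (w + s *: v) / h (w + s *: v)) w.
  move=> sr wd; apply: cdf_div; last exact: hnz.
    by apply: cdf_shift; apply: (Hg _ (wsv _ _ sr wd)).1.
  by apply: cdf_shift; apply: (Hh _ (wsv _ _ sr wd)).1.
split.
  apply/nearnP; exists dl => // w wd.
  have tri x : nm (x - w) < dl - nm (w - u) -> nm (x - u) < dl.
    exact: nm_near.
  apply: (@mean_cdf _ _ (fun s w => g (w + s *: v) / h (w + s *: v)) rho w (dl - nm (w - u)) K) => //.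
  - by lra.
  - by move=> s x sr /tri xd; exact: cq.
  - move=> s x sr /tri xd; rewrite nmM nmV ler_pdivrMr ?nm_gt0 ?hnz //.
    by apply: HK; [exact: wsv|exact: hnz].
  - move=> x /tri xd; apply: oncircP (ltW rp) _ => s sr; apply: cdf_div; last exact: hnz.
      by apply: cdf_line; apply: (Hg _ (wsv _ _ sr xd)).1.
    by apply: cdf_line; apply: (Hh _ (wsv _ _ sr xd)).1.
apply/nearnP; exists dl => // w wd.
have w2 : nm (w - u) + 2 * nm v <= r.
  have : nm v < r / 8 by [].
  by move: wd dlr r0; clear; lra.
have := @mean_value_quot _ (fun t : C => g (w + t *: v)) (fun t : C => h (w + t *: v)) rho 2 K rp.
rewrite !scale0r !addr0; apply.
- by lra.
- by apply: (bhd_line r0 Hg) => //; lra.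
- by apply: (bhd_line r0 Hh) => //; lra.
- by move=> s sr; exact: hnz.
- move=> s s2; apply: HK; rewrite addrAC; apply: (le_lt_trans (nmD _ _)); rewrite nmZ.
  have : nm s * nm v <= 2 * nm v by rewrite ler_wpM2r ?nm_ge0 // ltW.
  have : nm v < r / 8 by [].
  by move: wd dlr r0; clear; lra.
Qed.

End Riemann.

(** * Laurent expansions on the surface *)

Section Reflect.
Variable R : realType.
Local Notation C := R[i].
Local Notation Re := complex.Re.
Local Notation Im := complex.Im.
Let mu : measure _ _ := @lebesgue_measure R.

Lemma Rint_refl (g : R -> R) a b c : a <= b -> (forall t, rcont g t) ->
  Rint a b (fun t => g (c - t)) = Rint (c - b) (c - a) g.
Proof.
move=> ab Hg; rewrite /Rint /Rintegral; congr fine.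
have dF : ((fun t : R => c - t)^`())%classic = cst (-1).
  apply/funext => t; rewrite derive1E deriveB // derive_cst derive_id sub0r //.
rewrite (@integration_by_substitution_decreasing R (fun t => c - t) g a b) //.
- by apply: eq_integral => t _; rewrite /= dF /= opprK mulr1.
- by move=> x y _ _ xy; rewrite ltrD2l ltrN2.
- by rewrite dF => x _; exact: cvg_cst.
- by rewrite dF; exact: is_cvg_cst.
- by rewrite dF; exact: is_cvg_cst.
- split.
  + by move=> x _; apply: derivableB => //.
  + by apply: cvg_at_right_filter; apply: cvgB; [exact: cvg_cst|exact: cvg_id].
  + by apply: cvg_at_left_filter; apply: cvgB; [exact: cvg_cst|exact: cvg_id].
- by apply: continuous_subspaceT => t; exact/rcont_continuous.
Qed.

Lemma cint_refl (g : R -> C) a b c : a <= b -> (forall t, ccont g t) ->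
  cint a b (fun t => g (c - t)) = cint (c - b) (c - a) g.
Proof.
move=> ab Hg; rewrite /cint (@Rint_refl (fun t => Re (g t))) //; last by move=> t; have /rcontP[] := Hg t.
by rewrite (@Rint_refl (fun t => Im (g t))) //; move=> t; have /rcontP[] := Hg t.
Qed.

Lemma cint_shift (g : R -> C) a b c : a <= b -> (forall t, ccont g t) ->
  cint a b (fun t => g (c + t)) = cint (c + a) (c + b) g.
Proof.
move=> ab Hg.
have E : (fun t => g (c + t)) = (fun t => g (c - (0 - t))).
  by apply/funext => t; rewrite sub0r opprK.
rewrite E (@cint_refl (fun t => g (c - t)) a b 0) //.
  rewrite !sub0r cint_refl //; last by rewrite lerN2.
  by rewrite !opprK.
move=> t e e0; have [d d0 Hd] := Hg (c - t) e e0.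
exists d => // s sd; apply: Hd.
by rewrite (_ : c - s - (c - t) = - (s - t)) ?normrN //; ring.
Qed.

Lemma cint_period (g : R -> C) a : (forall t, ccont g t) -> (forall t, g (t + 2 * pi) = g t) ->
  0 <= a <= 2 * pi -> cint 0 (2 * pi) (fun t => g (a - t)) = cint 0 (2 * pi) g.
Proof.
move=> Hg Pg /andP[a0 a2].
rewrite cint_refl ?pi2_ge0 // subr0.
rewrite (@cint_split _ _ _ 0) //; last by rewrite subr_le0 a2.
rewrite [RHS](@cint_split _ _ _ a) ?a0 // addrC; congr (_ + _).
have -> : cint a (2 * pi) g = cint (2 * pi + (a - 2 * pi)) (2 * pi + 0) g.
  by rewrite addr0 addrC subrK.
rewrite -cint_shift ?subr_le0 //.
by apply: ext_cint => t _; rewrite addrC Pg.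
Qed.

Lemma polar (w : C) : nm w = 1 -> exists2 a, 0 <= a <= 2 * pi & w = cis a.
Proof.
move=> w1; case: w w1 => x y w1.
have xy : x ^+ 2 + y ^+ 2 = 1.
  have := add_Re2_Im2 (x +i* y); rewrite nmE w1 /= expr1n => /eqP.
  by rewrite eq_complex /= => /andP[/eqP ->].
have x1 : -1 <= x <= 1.
  rewrite -ler_norml -(@ler_pXn2r _ 2) ?nnegrE // expr1n real_normK ?num_real //.
  by rewrite -xy lerDl sqr_ge0.
have cx : cos (acos x) = x by rewrite acosK // in_itv.
have sx : sin (acos x) = `|y|.
  by rewrite sin_acos // -xy addrC addKr sqrtr_sqr.
have p0 := acos_ge0 x1; have pp := acos_lepi x1; have pi0 := pi_gt0 R.
have [y0|y0] := lerP 0 y.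
  exists (acos x); first by apply/andP; split; lra.
  by rewrite /cis cx sx ger0_norm.
exists (2 * pi - acos x); first by apply/andP; split; lra.
by rewrite addrC -[RHS]/(cis _) cis_periodic /cis cosN sinN cx sx ltr0_norm // opprK.
Qed.

Lemma cisN (t : R) : cis (- t) = (cis t)^-1 :> C.
Proof.
apply: (mulIf (cis_neq0 t)); rewrite mulVf ?cis_neq0 // -cisD.
by rewrite addNr cis0.
Qed.

(** The substitution s -> w/s reverses both ds/s and the orientation. With w = z^k it exchanges the
    coordinates x and y on the curves z = const of X. *)
Lemma mean_inv (f : C -> C) (w : C) r rho : 0 < rho -> 0 < r -> nm w = r * rho ->
  (forall s, nm s = r -> cdf f s) -> mean r f = mean rho (fun s => f (w / s)).
Proof.
move=> rho0 r0 wr Hf; have w0 : 0 < nm w by rewrite wr mulr_gt0.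
have [|a ab wa] := polar (w := (nm w)^-1%:C * w).
  by rewrite nmM nmR ger0_norm ?invr_ge0 ?(ltW w0) // mulVf // gt_eqF.
have wE : w = (r * rho)%:C * cis a.
  rewrite -wa -wr mulrA -rmorphM divff ?rmorph1 ?mul1r // gt_eqF //.
congr (_ / _); rewrite -(@cint_period (fun t => f (circ r t)) a) //.
- apply: ext_cint => t _; congr (f _); rewrite /circ wE cisD cisN.
  have h1 : rho%:C != 0 :> C by rewrite -nm_gt0 nmR gtr0_norm.
  by rewrite rmorphM; field; rewrite h1 cis_neq0.
- exact: oncircP (ltW r0) Hf.
- by move=> t; rewrite /circ cis_periodic.
Qed.

(** The difference quotient [q] at [x] is holomorphic on the whole annulus, so s q(s) has the same
    mean on both circles; the kernel has mean 1 on the outer one and 0 on the inner one. *)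
Lemma laurent (f : C -> C) r1 r2 (x : C) : 0 < r1 -> r1 < nm x -> nm x < r2 ->
  (forall s, r1 <= nm s <= r2 -> cdf f s) ->
  f x = mean r2 (fun s => f s * (s / (s - x))) - mean r1 (fun s => f s * (s / (s - x))).
Proof.
move=> r10 r1x xr2 Hf; have r20 : 0 < r2 by lra.
have [d d0 Hd] : exists2 d, 0 < d & forall s, nm (s - x) < d -> r1 <= nm s <= r2.
  exists (Num.min (nm x - r1) (r2 - nm x)); first by rewrite lt_min; apply/andP; split; lra.
  move=> s; rewrite lt_min => /andP[h1 h2].
  have := nm_dist s x; have := nm_dist x s; rewrite [nm (x - s)]nm_distC => h3 h4.
  by apply/andP; split; lra.
have fx : cdf f x by apply: Hf; lra.
have [d' d'0 Hd'] := cdf_cont fx ltr01.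
pose q s := quot0 (fun s => f (s + x)) (s - x).
have qE s : s != x -> q s = (f s - f x) / (s - x).
  by move=> sx; rewrite /q /quot0 subr_eq0 (negPf sx) subrK add0r.
have qc s : r1 <= nm s <= r2 -> cdf q s.
  move=> sr; have [->|sx] := eqVneq s x.
    apply: (@cdf_shift _ _ (quot0 (fun s => f (s + x))) (- x)); rewrite subrr.
    have m0 : 0 < Num.min d d' by rewrite lt_min d0.
    have [//||H _] := @quot0_bhd _ (Num.min d d') (fun s => f (s + x)).
      split=> [s0|].
        rewrite lt_min => /andP[h _]; apply: cdf_shift; apply: Hf; apply: Hd.
        by rewrite addrK.
      exists (nm (f x) + 1) => s0; rewrite lt_min => /andP[_ h].
      have := Hd' (s0 + x); rewrite addrK => /(_ h).
      have := nm_dist (f (s0 + x)) (f x); lra.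
    by apply: H; rewrite nm0.
  have sx0 : 0 < nm (s - x) by rewrite nm_gt0 subr_eq0.
  apply: (@cdf_near _ _ (fun s => (f s - f x) / (s - x))).
    apply/nearnP; exists (nm (s - x)) => // y ys; rewrite qE //.
    by apply: contraTneq ys => ->; rewrite nm_distC ltxx.
  apply: cdf_div; [|exact: cdf_sub|by rewrite subr_eq0].
  by apply: cdfB; [exact: Hf|exact: cdf_cst].
have M : mean r1 (fun s => s * q s) = mean r2 (fun s => s * q s).
  apply: mean_annulus => //; first by lra.
  by move=> s sr; apply: cdfM; [exact: cdf_id|exact: qc].
have E r : r1 <= r <= r2 -> r != nm x -> mean r (fun s => s * q s) =
    mean r (fun s => f s * (s / (s - x))) - f x * mean r (fun s => s / (s - x)).
  move=> rr rx; have r0 : 0 <= r by lra.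
  have sx0 (s : C) : nm s = r -> s - x != 0.
    by move=> sr; rewrite subr_eq0; apply: contra_neq rx => <-.
  have c1 (s : C) : nm s = r -> cdf (fun s : C => s / (s - x)) s.
    by move=> sr; apply: cdf_div; [exact: cdf_id|exact: cdf_sub|exact: sx0].
  have c2 (s : C) : nm s = r -> cdf f s by move=> sr; apply: Hf; rewrite sr.
  have o1 : oncirc r (fun s => f s * (s / (s - x))).
    by apply: oncircP r0 _ => s sr; apply: cdfM; [exact: c2|exact: c1].
  have o2 : oncirc r (fun s => f x * (s / (s - x))).
    by apply: oncircP r0 _ => s sr; apply: cdfM; [exact: cdf_cst|exact: c1].
  rewrite -(@meanZ _ r (fun s => s / (s - x)) (f x) r0 (oncircP r0 c1)).
  rewrite -(@meanB _ r _ _ r0 o1 o2).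
  apply: (ext_mean r0) => s sr; have sx : s != x by rewrite -subr_eq0 sx0.
  by rewrite (qE s sx); ring.
have E1 := E r1; have E2 := E r2.
have i1 : r1 <= r1 <= r2 by lra.
have i2 : r1 <= r2 <= r2 by lra.
have n1 : r1 != nm x by rewrite lt_eqF.
have n2 : r2 != nm x by rewrite gt_eqF.
rewrite (mean_kernel0 (ltW r10) r1x) in E1.
rewrite (mean_kernel1 xr2) in E2.
have := etrans (esym (E1 i1 n1)) (etrans M (E2 i2 n2)).
by rewrite mulr0 subr0 mulr1 => ->; ring.
Qed.

End Reflect.

(** * Coordinates, and holomorphic functions on the surface *)

Section Rows.
Variable R : realType.
Local Notation C := R[i].

Lemma nm_row_lt n (p : 'rV[C]_n) (e : R) : 0 < e ->
  (nm p < e) <-> forall j, nm (p 0 j) < e.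
Proof.
move=> e0.
have B : ball (0 : 'rV[C]_n) e%:C p <-> nm p < e.
  by rewrite -ball_normE /ball_ /= sub0r normrN nmE ltcR.
rewrite -B; split.
  move=> [_ h] j; have := h 0 j; rewrite /ball /= mxE sub0r normrN nmE ltcR //.
move=> h; split; first by rewrite ltcR.
by move=> i j; rewrite ord1 /ball /= mxE sub0r normrN nmE ltcR.
Qed.

Lemma nm_row_le n (p : 'rV[C]_n) (e : R) : 0 <= e ->
  (nm p <= e) <-> forall j, nm (p 0 j) <= e.
Proof.
move=> e0; split=> [h j|h].
  apply/ler_addgt0Pl => d d0; apply/ltW.
  have e1 : 0 < d + e by lra.
  by apply: (nm_row_lt p e1).1; lra.
rewrite leNgt; apply/negP => h2.
have e1 : 0 < (e + nm p) / 2 by lra.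
have : nm p < (e + nm p) / 2 by apply/(nm_row_lt p e1) => j; have := h j; lra.
lra.
Qed.

Lemma nm_coord n (p : 'rV[C]_n) j : nm (p 0 j) <= nm p.
Proof. exact: ((nm_row_le p (nm_ge0 p)).1 (lexx _) j). Qed.

Lemma cdf_coord n (p : 'rV[C]_n) j : cdf (fun p : 'rV[C]_n => p 0 j) p /\
  forall v, cd (fun p : 'rV[C]_n => p 0 j) p v = v 0 j.
Proof.
apply: (@cdf_linear _ _ (fun p : 'rV[C]_n => p 0 j) 1).
  by move=> c u v; rewrite !mxE.
by move=> v; rewrite mul1r nm_coord.
Qed.

Lemma diff_row (W : normedModType C) n (F : W -> 'rV[C]_n) w :
  (forall j, cdf (fun w => F w 0 j) w) ->
  differentiable F w /\ forall v j, 'd F w v 0 j = cd (fun w => F w 0 j) w v.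
Proof.
move=> HF; pose L v := \row_j cd (fun w => F w 0 j) w v.
have /choice[K HK] : forall j, exists K : R, 0 < K /\ forall v, nm (cd (fun w => F w 0 j) w v) <= K * nm v.
  by move=> j; have [[K K0 H] _] := cdf_nm (HF j); exists K.
pose KK := \sum_j K j.
have Kle j : K j <= KK.
  by rewrite /KK (bigD1 j) //= lerDl sumr_ge0 // => i _; have [/ltW] := HK i.
have KK0 : 0 <= KK by rewrite sumr_ge0 // => i _; have [/ltW] := HK i.
have [|||dF dE] := @is_diff_nm R _ _ F w L KK.
- by move=> c u v; apply/rowP => j; rewrite !mxE cd_lin.
- move=> v; apply/nm_row_le; first by rewrite mulr_ge0 ?nm_ge0.
  move=> j; rewrite mxE; apply: (le_trans ((HK j).2 v)).
  by apply: ler_wpM2r; [exact: nm_ge0|exact: Kle].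
- move=> e e0.
  have /choice[d Hd] : forall j, exists d : R, 0 < d /\ forall h, nm h < d ->
      nm (F (w + h) 0 j - F w 0 j - cd (fun w => F w 0 j) w h) <= e * nm h.
    by move=> j; have [_ /(_ e e0)[d d0 H]] := cdf_nm (HF j); exists d.
  exists (\big[Num.min/1]_j d j).
    by elim/big_ind: _ => // [x y x0 y0|j _]; [rewrite lt_min x0|exact: (Hd j).1].
  move=> h hd; apply/nm_row_le; first by rewrite mulr_ge0 ?nm_ge0 // ltW.
  move=> j; rewrite !mxE; apply: ((Hd j).2 h); apply: (lt_le_trans hd).
  by rewrite (bigD1 j) //= ge_min lexx.
by split=> // v j; rewrite dE mxE.
Qed.

End Rows.

(* [nearW] at a generic normed module: on matrices the filter instance of
   [nbhs] is not found. *)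
Lemma near_all (R : realType) (W : normedModType R[i]) (P : W -> Prop) (u : W) :
  (forall w, P w) -> \forall w \near u, P w.
Proof. exact: nearW. Qed.

Section Space3.
Variable R : realType.
Local Notation C := R[i].
Local Notation V := 'rV[C]_3.
Implicit Types p q : V.

Definition pt (x y z : C) : V := \row_j nth 0 [:: x; y; z] j.

Lemma xc_pt x y z : xc (pt x y z) = x. Proof. by rewrite /xc mxE. Qed.
Lemma yc_pt x y z : yc (pt x y z) = y. Proof. by rewrite /yc mxE. Qed.
Lemma zc_pt x y z : zc (pt x y z) = z. Proof. by rewrite /zc mxE. Qed.
Definition cpt := (xc_pt, yc_pt, zc_pt).

Lemma ord3P (P : 'I_3 -> Prop) : P 0 -> P 1 -> P 2 -> forall j, P j.
Proof.
move=> h0 h1 h2 [[|[|[|//]]] hj].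
- by have -> : Ordinal hj = 0 by apply: val_inj.
- by have -> : Ordinal hj = 1 by apply: val_inj.
- by have -> : Ordinal hj = 2 by apply: val_inj.
Qed.

Lemma ptE p : p = pt (xc p) (yc p) (zc p).
Proof. by apply/rowP; apply: ord3P; rewrite mxE. Qed.

Lemma pt_eq (p q : V) : xc p = xc q -> yc p = yc q -> zc p = zc q -> p = q.
Proof. by move=> h1 h2 h3; rewrite [p]ptE [q]ptE h1 h2 h3. Qed.

Lemma nm_xc p : nm (xc p) <= nm p. Proof. exact: nm_coord. Qed.
Lemma nm_yc p : nm (yc p) <= nm p. Proof. exact: nm_coord. Qed.
Lemma nm_zc p : nm (zc p) <= nm p. Proof. exact: nm_coord. Qed.
Lemma nm3_lt (p : V) e : 0 < e -> nm (xc p) < e -> nm (yc p) < e -> nm (zc p) < e -> nm p < e.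
Proof. by move=> e0 h1 h2 h3; apply/nm_row_lt => //; apply: ord3P. Qed.

Lemma xcB p q : xc (p - q) = xc p - xc q. Proof. by rewrite /xc !mxE. Qed.
Lemma ycB p q : yc (p - q) = yc p - yc q. Proof. by rewrite /yc !mxE. Qed.
Lemma zcB p q : zc (p - q) = zc p - zc q. Proof. by rewrite /zc !mxE. Qed.

Lemma cdf_xc p : cdf (@xc R) p. Proof. exact: (cdf_coord p 0).1. Qed.
Lemma cdf_yc p : cdf (@yc R) p. Proof. exact: (cdf_coord p 1).1. Qed.
Lemma cdf_zc p : cdf (@zc R) p. Proof. exact: (cdf_coord p 2).1. Qed.
Lemma cd_xc p (v : V) : cd (@xc R) p v = xc v. Proof. exact: (cdf_coord p 0).2. Qed.
Lemma cd_yc p (v : V) : cd (@yc R) p v = yc v. Proof. exact: (cdf_coord p 1).2. Qed.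
Lemma cd_zc p (v : V) : cd (@zc R) p v = zc v. Proof. exact: (cdf_coord p 2).2. Qed.
Lemma hol_xc p : hol (@xc R) p. Proof. by apply: near_all => q; exact: cdf_xc. Qed.
Lemma hol_yc p : hol (@yc R) p. Proof. by apply: near_all => q; exact: cdf_yc. Qed.
Lemma hol_zc p : hol (@zc R) p. Proof. by apply: near_all => q; exact: cdf_zc. Qed.

Lemma diff_pt (W : normedModType C) (f g h : W -> C) w : cdf f w -> cdf g w -> cdf h w ->
  differentiable (fun w => pt (f w) (g w) (h w)) w /\
  forall v : W, 'd (fun w => pt (f w) (g w) (h w)) w v = pt (cd f w v) (cd g w v) (cd h w v).
Proof.
move=> hf hg hh; have [|dF dE] := @diff_row R W 3 (fun w => pt (f w) (g w) (h w)) w.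
  apply: ord3P.
  - by rewrite (_ : (fun w => _) = f) //; apply/funext => x; rewrite mxE.
  - by rewrite (_ : (fun w => _) = g) //; apply/funext => x; rewrite mxE.
  - by rewrite (_ : (fun w => _) = h) //; apply/funext => x; rewrite mxE.
split=> // v; apply/rowP; apply: ord3P; rewrite dE mxE /=; congr (cd _ w v);
  by apply/funext => x; rewrite mxE.
Qed.

Section X.
Variable k : nat.
Local Notation X := (Sk R k).

(** Holomorphy on the reduced space X, expressed by restriction from the ambient space; [phi] is
    arbitrary off X. *)
Definition Xhol (p : V) (phi : V -> C) := exists2 f, hol f p &
  \forall y \near p, X y -> phi y = f y.

Lemma Xhol_comp (U : normedModType C) (F : U -> V) phi u : differentiable F u ->
  (\forall w \near u, X (F w)) -> Xhol (F u) phi -> cdf (fun w => phi (F w)) u.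
Proof.
move=> dF XF [f hf ff].
apply: (@cdf_near _ _ (fun w => f (F w))); last first.
  by apply: cdf_comp dF _; exact: hol_cdf.
have cF := differentiable_continuous dF.
have ff' : \forall w \near u, X (F w) -> phi (F w) = f (F w) by exact: (cF _ ff).
by apply: filterS2 XF ff' => w Xw h; rewrite h.
Qed.

Definition G1 (s z : C) : V := pt s (z ^+ k / s) z.
Definition swap (p : V) : V := pt (yc p) (xc p) (zc p).

Lemma X_G1 s z : s != 0 -> X (G1 s z).
Proof. by move=> s0; rewrite /Sk /= !cpt mulrC divfK. Qed.
Lemma swapK p : swap (swap p) = p.
Proof. by rewrite /swap !cpt -ptE. Qed.
Lemma X_swap p : X p -> X (swap p).
Proof. by rewrite /Sk /= !cpt mulrC. Qed.
Lemma nm_swap p e : 0 < e -> nm p < e -> nm (swap p) < e.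
Proof.
by move=> e0 h; apply: nm3_lt; rewrite ?cpt //; apply: le_lt_trans h;
  [exact: nm_yc|exact: nm_xc|exact: nm_zc].
Qed.

Lemma diff_swap p : differentiable swap p.
Proof. exact: (diff_pt (cdf_yc p) (cdf_xc p) (cdf_zc p)).1. Qed.

Lemma Xhol_swap p phi : Xhol p phi -> Xhol (swap p) (fun q => phi (swap q)).
Proof.
move=> [f hf ff]; exists (fun q => f (swap q)).
  by apply: (hol_comp (F := swap)); [apply: near_all => w; exact: diff_swap|rewrite swapK].
have cF : swap @ (swap p) --> p.
  by rewrite -[X in _ --> X]swapK; exact: differentiable_continuous (diff_swap _).
have /nearnP[d d0 Hd] : \forall w \near swap p, X (swap w) -> phi (swap w) = f (swap w).
  exact: (cF _ ff).
by apply/nearnP; exists d => // w /Hd h /X_swap.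
Qed.

Hypothesis k0 : (0 < k)%N.

Lemma Xhol_G1_s phi s z : s != 0 -> Xhol (G1 s z) phi -> cdf (fun s => phi (G1 s z)) s.
Proof.
move=> s0 H; apply: (@Xhol_comp _ (fun s => G1 s z)) => //.
  apply: (diff_pt (f := fun s => s) (g := fun s => z ^+ k / s) (h := fun=> z) _ _ _).1.
  - exact: cdf_id.
  - by apply: cdf_div; [exact: cdf_cst|exact: cdf_id|].
  - exact: cdf_cst.
apply: filterS (cdf_neq0 (cdf_id s) s0) => w; exact: X_G1.
Qed.

Lemma Xhol_G1_w phi s (W : normedModType C) (h : W -> C) (w : W) : s != 0 -> cdf h w ->
  Xhol (G1 s (h w)) phi -> cdf (fun w => phi (G1 s (h w))) w.
Proof.
move=> s0 hw H; apply: (@Xhol_comp _ (fun w => G1 s (h w))) => //.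
  apply: (diff_pt (f := fun=> s) (g := fun w => h w ^+ k / s) (h := h) _ _ _).1 => //.
  - exact: cdf_cst.
  - by apply: cdfM; [exact: cdfX|exact: cdf_cst].
by apply: nearW => x; exact: X_G1.
Qed.

Section Half.
Variables (phi : V -> C) (eps C0 : R).
Hypothesis eps0 : 0 < eps.
Hypothesis Hphi : forall p, X p -> p != 0 -> nm p < eps -> Xhol p phi /\ nm (phi p) <= C0.

Let rho := eps / 2.
(** For |s| = rho, |z^k| <= |z| < rho^2 keeps the coordinate z^k/s of [G1 s z] below [rho];
    [rho / 2] keeps the coordinates of the point away from the circle. *)
Definition smallr : R := Num.min 1 (Num.min (rho ^+ 2) (rho / 2)).

Lemma rho0 : 0 < rho. Proof. by rewrite /rho divr_gt0. Qed.
Lemma smallr0 : 0 < smallr. Proof. by rewrite !lt_min ltr01 exprn_gt0 ?divr_gt0 ?rho0. Qed.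

Lemma small_bounds (z : C) : nm z < smallr -> nm (z ^+ k) < rho ^+ 2 /\ nm z < rho / 2.
Proof.
rewrite !lt_min => /and3P[h1 h2 h3]; split => //; rewrite nmX; apply: le_lt_trans h2.
by rewrite -[leRHS]expr1 ler_wiXn2l ?nm_ge0 // ltW.
Qed.

Lemma G1_in (s z : C) : 0 < nm s -> nm s <= rho -> nm (z ^+ k) <= rho * nm s -> nm z < smallr ->
  Xhol (G1 s z) phi /\ nm (phi (G1 s z)) <= C0.
Proof.
move=> s0 sr zs zr; have [_ zr2] := small_bounds zr; have r0 := rho0.
have s1 : s != 0 by rewrite -nm_gt0.
apply: Hphi; first exact: X_G1.
  by apply: contra_neq s1 => /(congr1 (@xc R)); rewrite cpt /xc mxE.
have re : rho < eps by have := eps0; rewrite /rho; lra.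
apply: nm3_lt => //; rewrite cpt; [exact: le_lt_trans sr re| |by apply: lt_trans zr2 _; lra].
by rewrite nmM nmV; apply: le_lt_trans re; rewrite ler_pdivrMr.
Qed.

Lemma G1_circ (s z : C) : nm s = rho -> nm z < smallr ->
  Xhol (G1 s z) phi /\ nm (phi (G1 s z)) <= C0.
Proof.
move=> sr zr; have r0 := rho0; have [h _] := small_bounds zr.
by apply: G1_in; rewrite ?sr // -expr2 ltW.
Qed.

(** The part of positive degree in x of the Laurent expansion at height z, divided by x; [cf] is the
    term of degree 0. *)
Definition Pf (x z : C) := mean rho (fun s => phi (G1 s z) / (s - x)).
Definition cf (z : C) := mean rho (fun s => phi (G1 s z)).

Lemma hol_Pf : hol (fun p : V => Pf (xc p) (zc p)) 0.
Proof.
have r0 := rho0; have s0 := smallr0.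
apply/nearnP; exists smallr => // u; rewrite subr0 => us.
have tri w : nm (w - u) < smallr - nm u -> nm w < smallr.
  by have := nm_dist w u; lra.
have sx (s : C) w : nm s = rho -> nm w < smallr -> rho / 2 <= nm (s - xc w).
  move=> sr ws; have := nm_dist s (xc w); have := nm_xc w.
  have : smallr <= rho / 2 by rewrite !ge_min lexx !orbT.
  by rewrite sr; lra.
have sx0 (s : C) w : nm s = rho -> nm w < smallr -> s - xc w != 0.
  by move=> sr ws; rewrite -nm_gt0; have := sx s w sr ws; lra.
have zw w : nm w < smallr -> nm (zc w) < smallr by apply: le_lt_trans; exact: nm_zc.
have xh (s : C) w : nm s = rho -> nm w < smallr -> s != 0.
  by move=> sr _; rewrite -nm_gt0 sr.
apply: (@mean_cdf _ _ (fun s p => phi (G1 s (zc p)) / (s - xc p)) rho u (smallr - nm u)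
  (C0 / (rho / 2))) => //; first by lra.
- move=> s w sr /tri ws; apply: cdf_div.
  + apply: Xhol_G1_w; [exact: xh ws|exact: cdf_zc|].
    by apply: (G1_circ sr _).1; exact: zw.
  + by apply: cdfB; [exact: cdf_cst|exact: cdf_xc].
  + exact: sx0.
- move=> s w sr /tri ws; rewrite nmM nmV; apply: ler_pM; rewrite ?nm_ge0 ?invr_ge0 ?nm_ge0 //.
    by apply: (G1_circ sr _).2; exact: zw.
  have h := sx s w sr ws.
  by rewrite lef_pV2 ?posrE //; lra.
- move=> w /tri ws; apply: oncircP (ltW r0) _ => s sr; apply: cdf_div.
  + by apply: Xhol_G1_s; [exact: xh ws|apply: (G1_circ sr _).1; exact: zw].
  + exact: cdf_sub.
  + exact: sx0.
Qed.

Lemma hol_cf : hol (fun p : V => cf (zc p)) 0.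
Proof.
have r0 := rho0; have s0 := smallr0.
apply/nearnP; exists smallr => // u; rewrite subr0 => us.
have tri w : nm (w - u) < smallr - nm u -> nm w < smallr.
  by have := nm_dist w u; lra.
have zw w : nm w < smallr -> nm (zc w) < smallr by apply: le_lt_trans; exact: nm_zc.
have xh (s : C) : nm s = rho -> s != 0 by move=> sr; rewrite -nm_gt0 sr.
apply: (@mean_cdf _ _ (fun s p => phi (G1 s (zc p))) rho u (smallr - nm u) C0) => //; first by lra.
- move=> s w sr /tri ws; apply: Xhol_G1_w; [exact: xh|exact: cdf_zc|].
  by apply: (G1_circ sr _).1; exact: zw.
- move=> s w sr /tri ws; by apply: (G1_circ sr _).2; exact: zw.
- move=> w /tri ws; apply: oncircP (ltW r0) _ => s sr.
  by apply: Xhol_G1_s; [exact: xh|apply: (G1_circ sr _).1; exact: zw].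
Qed.

Lemma outer_part (x z : C) : nm x < rho -> nm z < smallr ->
  mean rho (fun s => phi (G1 s z) * (s / (s - x))) = cf z + x * Pf x z.
Proof.
move=> xr zr; have r0 := rho0; have rle := ltW r0.
have sx (s : C) : nm s = rho -> s - x != 0 by move=> sr; apply: nm_lt_neq; rewrite sr.
have xh (s : C) : nm s = rho -> s != 0 by move=> sr; rewrite -nm_gt0 sr.
have c1 (s : C) : nm s = rho -> cdf (fun s => phi (G1 s z)) s.
  by move=> sr; apply: Xhol_G1_s; [exact: xh|apply: (G1_circ sr _).1].
have c2 (s : C) : nm s = rho -> cdf (fun s => phi (G1 s z) / (s - x)) s.
  by move=> sr; apply: cdf_div; [exact: c1|exact: cdf_sub|exact: sx].
have o3 : oncirc rho (fun s => x * (phi (G1 s z) / (s - x))).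
  by apply: oncircP rle _ => s sr; apply: cdfM; [exact: cdf_cst|exact: c2].
rewrite /cf /Pf -(@meanZ _ rho _ x rle (oncircP rle c2)) -(@meanD _ rho _ _ rle (oncircP rle c1) o3).
apply: ext_mean => // s sr; field; exact: sx.
Qed.

End Half.

(* Laurent expansion in x along the curves z = const of X. *)
Theorem decomp (phi : V -> C) (eps C0 : R) : 0 < eps ->
  (forall p, X p -> p != 0 -> nm p < eps -> Xhol p phi /\ nm (phi p) <= C0) ->
  exists P Q : C -> C -> C, exists c : C -> C,
  [/\ hol (fun p : V => P (xc p) (zc p)) 0, hol (fun p : V => Q (yc p) (zc p)) 0,
      hol (fun p : V => c (zc p)) 0 &
      \forall p \near (0 : V), X p -> zc p != 0 ->
        phi p = c (zc p) + xc p * P (xc p) (zc p) + yc p * Q (yc p) (zc p)].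
Proof.
move=> eps0 Hphi.
(* The terms of negative degree in x are terms of positive degree in y = z^k/x, so they come from
   the same construction applied after exchanging x and y. *)
pose phi' p := phi (swap p).
have Hphi' p : X p -> p != 0 -> nm p < eps -> Xhol p phi' /\ nm (phi' p) <= C0.
  move=> Xp p0 pe; have [|||h1 h2] := Hphi (swap p).
  - exact: X_swap.
  - apply: contra_neq p0 => /(congr1 swap); rewrite swapK => ->.
    by apply: pt_eq; rewrite cpt /xc /yc /zc !mxE.
  - exact: nm_swap.
  by split => //; rewrite -[p]swapK; apply: Xhol_swap.
exists (Pf phi eps), (Pf phi' eps), (cf phi eps); split.
- exact: hol_Pf Hphi.
- have sw0 : swap 0 = 0 by apply: pt_eq; rewrite cpt /xc /yc /zc !mxE.
  have h : hol (fun p : V => Pf phi' eps (xc p) (zc p)) (swap 0).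
    by rewrite sw0; exact: hol_Pf Hphi'.
  have := hol_comp (near_all 0 diff_swap) h.
  by congr hol; apply/funext => p; rewrite !cpt.
- exact: hol_cf Hphi.
have r0 := rho0 eps0; have s0 := smallr0 eps0; set rho := eps / 2 in r0.
apply/nearnP; exists (smallr eps) => // p; rewrite subr0 => ps Xp z0.
have zr : nm (zc p) < smallr eps by apply: le_lt_trans ps; exact: nm_zc.
have [zk zr2] := small_bounds zr.
have sr : smallr eps <= rho / 2 by rewrite !ge_min lexx !orbT.
have xr : nm (xc p) < rho by have := nm_xc p; lra.
have yr : nm (yc p) < rho by have := nm_yc p; lra.
have xy : xc p * yc p = zc p ^+ k by [].
have zk0 : zc p ^+ k != 0 by rewrite expf_neq0.
have /norP[x0 y0] : ~~ ((xc p == 0) || (yc p == 0)) by rewrite -mulf_eq0 xy.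
have yE : yc p = zc p ^+ k / xc p by rewrite -xy mulrC mulKf.
set z := zc p in zr zk zr2 xy zk0 yE *; set x := xc p in xr xy x0 yE *.
set y := yc p in yr xy y0 yE *; set w := z ^+ k.
have w0 : 0 < nm w by rewrite nm_gt0.
(* The circle |x| = r1 is the circle |y| = rho, so the inner integral in x turns into an outer
   integral in y. *)
pose r1 := nm w / rho.
have r10 : 0 < r1 by rewrite divr_gt0.
have pE : phi p = phi (G1 x z) by rewrite /G1 -yE -ptE.
have wr : nm w = r1 * rho by rewrite /r1 divfK // gt_eqF.
have nxy : nm x * nm y = nm w by rewrite -nmM xy.
have xp : 0 < nm x by rewrite nm_gt0.
have r1x : r1 < nm x by rewrite /r1 ltr_pdivrMr // -nxy ltr_pM2l.
have c1 (s : C) : r1 <= nm s <= rho -> cdf (fun s => phi (G1 s z)) s.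
  move=> /andP[h1 h2]; have sp : 0 < nm s by lra.
  apply: Xhol_G1_s; first by rewrite -nm_gt0.
  apply: (G1_in eps0 Hphi sp h2 _ zr).1.
  by rewrite -/w wr mulrC ler_pM2l.
rewrite pE (@laurent _ (fun s => phi (G1 s z)) r1 rho x r10 r1x xr c1).
rewrite (outer_part eps0 Hphi xr zr) -/x; congr (_ + _).
rewrite (@mean_inv _ _ w r1 rho) //; last first.
  move=> s sr1; apply: cdfM; first by apply: c1; lra.
  apply: cdf_div; [exact: cdf_id|exact: cdf_sub|by apply: nm_gt_neq; lra].
have yn (s : C) : nm s = rho -> s - y != 0 by move=> s1; apply: nm_lt_neq; rewrite s1.
have sn (s : C) : nm s = rho -> s != 0 by move=> s1; rewrite -nm_gt0 s1.
(* With z^k = x y the transformed kernel is - y/(s - y); there is no constant term, as [cf] already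
   accounts for it. *)
rewrite (@ext_mean _ rho _ (fun s => (- y) * (phi' (G1 s z) / (s - y)))) ?(ltW r0) //; last first.
  move=> s s1; have sy := yn s s1; have s00 := sn s s1.
  have -> : phi (G1 (w / s) z) = phi' (G1 s z).
    rewrite /phi' /G1 /swap !cpt -/w; congr (phi (pt _ _ _)).
    by rewrite invf_div mulrC divfK.
  have -> : w / s / (w / s - x) = - y / (s - y).
    have wE : w = x * y by rewrite xy.
    have -> : w / s - x = - x * (s - y) / s by rewrite wE; field.
    by rewrite wE; field; rewrite s00 sy x0.
  by rewrite mulrC mulrAC mulrA.
rewrite meanZ ?(ltW r0) //; first by rewrite mulNr opprK.
apply: oncircP (ltW r0) _ => s s1; apply: cdf_div; [|exact: cdf_sub|exact: yn].
by apply: Xhol_G1_s; [exact: sn|exact: (G1_circ eps0 Hphi' s1 zr).1].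
Qed.

End X.
End Space3.

Lemma cd_id (R : realType) (s v : R[i]) : cd (fun z : R[i] => z) s v = v.
Proof. by apply: (@cdf_linear _ _ (fun z : R[i] => z) 1 _ _ _).2 => // u; rewrite mul1r. Qed.

(** * The regular part and its tangent vectors *)

Section Geometry.
Variable R : realType.
Local Notation C := R[i].
Local Notation V := 'rV[C]_3.
Implicit Types p q : V.
Variable k : nat.
Hypothesis k2 : (2 <= k)%N.
Local Notation X := (Sk R k).

Lemma holo_atE (W : normedModType C) (f : W -> C) (u : W) : hol f u = (\forall x \near u, differentiable f x).
Proof. by rewrite /hol; congr (nbhs u); apply/funext => x; rewrite cdfE. Qed.

Lemma holo_hol (f : V -> C) p : holo_at p (f : V -> C) <-> hol f p.
Proof. by rewrite holo_atE. Qed.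

Lemma k0 : (0 < k)%N. Proof. exact: ltnW. Qed.
Lemma kC : k%:R != 0 :> C. Proof. by rewrite pnatr_eq0 -lt0n k0. Qed.

Definition defX (p : V) : C := xc p * yc p - zc p ^+ k.

Lemma defX0 p : X p <-> defX p = 0.
Proof.
rewrite /Sk /defX /=; split=> [->|/eqP]; first by rewrite subrr.
by rewrite subr_eq0 => /eqP.
Qed.

Lemma cdf_defX p : cdf defX p.
Proof.
apply: cdfB; last by apply: cdfX; exact: cdf_zc.
by apply: cdfM; [exact: cdf_xc|exact: cdf_yc].
Qed.

Lemma cd_defX p (v : V) :
  cd defX p v = xc p * yc v + yc p * xc v - k%:R * zc p ^+ k.-1 * zc v.
Proof.
rewrite /defX cdB; [|by apply: cdfM; [exact: cdf_xc|exact: cdf_yc]|by apply: cdfX; exact: cdf_zc].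
rewrite cdM; [|exact: cdf_xc|exact: cdf_yc].
by rewrite cdX ?cd_xc ?cd_yc ?cd_zc //; exact: cdf_zc.
Qed.

Lemma X_axes p : X p -> p != 0 -> xc p != 0 \/ yc p != 0.
Proof.
move=> Xp p0; have [x0|x0] := eqVneq (xc p) 0; last by left.
have [y0|y0] := eqVneq (yc p) 0; last by right.
case/eqP: p0; apply: pt_eq; rewrite ?x0 ?y0 /xc /yc /zc ?mxE //.
have : zc p ^+ k = 0 by rewrite -[LHS](_ : xc p * yc p = _) // x0 mul0r.
by move=> /eqP; rewrite expf_eq0 k0 /= => /eqP.
Qed.

Lemma reg_neq0 p : X p -> p != 0 -> reg 2 X p.
Proof.
move=> Xp p0; split => //.
have D (q : V) : differentiable (fun q => \row_(j < 3 - 2) defX q : 'rV[C]_(3 - 2)) q /\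
    forall v j, 'd (fun q => \row_(j < 3 - 2) defX q : 'rV[C]_(3 - 2)) q v 0 j = cd defX q v.
  have E j : (fun w => (\row_(j < 3 - 2) defX w : 'rV[C]_(3 - 2)) 0 j) = defX.
    by apply/funext => x; rewrite mxE.
  have [|h1 h2] := @diff_row _ _ _ (fun q => \row_(j < 3 - 2) defX q : 'rV[C]_(3 - 2)) q.
    by move=> j; rewrite E; exact: cdf_defX.
  by split=> // v j; rewrite h2 E.
exists (fun q => \row_(j < 3 - 2) defX q); split.
- by apply: near_all => q; exact: (D q).1.
- move=> u; have h (v : V) : cd defX p v = u 0 0 -> 'd (fun q => \row_(j < 3 - 2) defX q : 'rV[C]_(3 - 2)) p v = u.
    by move=> hv; apply/rowP => j; rewrite (D p).2 hv ord1.
  case: (X_axes Xp p0) => c0; [exists (pt 0 (u 0 0 / xc p) 0)|exists (pt (u 0 0 / yc p) 0 0)];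
    by apply: h; rewrite cd_defX !cpt ?mulr0 ?subr0 ?addr0 ?add0r mulrC divfK.
- apply: near_all => q; rewrite defX0; split=> [h|/rowP /(_ 0)]; last by rewrite !mxE.
  by apply/rowP => j; rewrite !mxE.
Qed.

(** The source of all tangent vectors below: velocities of curves lying in X. *)
Lemma curve_zero (F : C -> V) (f : V -> C) : differentiable F 0 ->
  (\forall t \near (0 : C), X (F t)) -> cdf f (F 0) ->
  (\forall y \near F 0, X y -> f y = 0) -> cd f (F 0) ('d F 0 1) = 0.
Proof.
move=> dF XF cf f0; rewrite -(@cd_comp _ _ _ F f 0 (1 : C) dF cf).
have cF := differentiable_continuous dF.
have ff' : \forall w \near (0 : C), X (F w) -> f (F w) = 0 by exact: (cF _ f0).
have E : \forall w \near (0 : C), (fun=> 0) w = f (F w).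
  by apply: filterS2 XF ff' => w Xw h; rewrite h.
by rewrite (cd_near _ E (cdf_cst 0 _)) cd_cst.
Qed.

Lemma X0 : X 0.
Proof. by rewrite /Sk /= /xc /yc /zc !mxE mul0r expr0n gtn_eqF // k0. Qed.

Lemma Xeq p : X p -> xc p * yc p = zc p ^+ k. Proof. by []. Qed.

(** The curves (t, 0, 0), (0, t, 0) and (t, t^(k-1), t) lie in X and their velocities at 0 span the
    whole space, so the differential at 0 of a local equation would be zero instead of onto. *)
Lemma nreg0 : ~ reg 2 X 0.
Proof.
move=> [_ [g [hg gs gX]]].
pose G (q : V) : C := g q 0 0.
have dg : differentiable g 0 by apply: nbhs_singleton hg.
have gE (v : V) : differentiable G 0 /\ cd G 0 v = 'd g 0 v 0 0.
  have [h1 h2] := cdf_coord (g 0) 0.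
  have := @cd_comp _ _ _ g (fun w : 'rV[C]_(3 - 2) => w 0 0) 0 v dg h1; rewrite h2 => h3.
  split; last by rewrite -h3.
  by rewrite -cdfE; apply: (@cdf_comp _ _ _ g (fun w : 'rV[C]_(3 - 2) => w 0 0) 0 dg h1).
have cG : cdf G 0 by rewrite cdfE; exact: (gE 0).1.
have G0 : \forall y \near (0 : V), X y -> G y = 0.
  by apply: filterS gX => y h /h; rewrite /G => ->; rewrite mxE.
have curve (a b c : C -> C) : cdf a 0 -> cdf b 0 -> cdf c 0 -> a 0 = 0 -> b 0 = 0 -> c 0 = 0 ->
    (forall t, X (pt (a t) (b t) (c t))) -> cd G 0 (pt (cd a 0 1) (cd b 0 1) (cd c 0 1)) = 0.
  move=> ca cb cc a0 b0 c0 HX.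
  have [dF dE] := diff_pt ca cb cc.
  have F0 : pt (a 0) (b 0) (c 0) = 0 by apply: pt_eq; rewrite cpt ?a0 ?b0 ?c0 /xc /yc /zc mxE.
  have := @curve_zero (fun t => pt (a t) (b t) (c t)) G dF; rewrite F0 dE => H.
  by apply: H => //; apply: near_all => t; exact: HX.
have ids (t : C) : cdf (fun t : C => t) t by exact: cdf_id.
have zs (t : C) : cdf (fun t : C => 0 : C) t by exact: cdf_cst.
have e0 : cd G 0 (pt 1 0 0) = 0.
  have := curve _ _ _ (ids 0) (zs 0) (zs 0) erefl erefl erefl.
  rewrite cd_id cd_cst; apply => t.
  by rewrite /Sk /= !cpt mulr0 expr0n gtn_eqF // k0.
have e1 : cd G 0 (pt 0 1 0) = 0.
  have := curve _ _ _ (zs 0) (ids 0) (zs 0) erefl erefl erefl.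
  rewrite cd_id cd_cst; apply => t.
  by rewrite /Sk /= !cpt mul0r expr0n gtn_eqF // k0.
(* This is 1 for k = 2 and 0 for larger k; in either case [e1] removes the second component. *)
pose b := cd (fun t : C => t ^+ k.-1) 0 1.
have e2 : cd G 0 (pt 1 b 1) = 0.
  have cb : cdf (fun t : C => t ^+ k.-1) 0 by apply: cdfX; exact: ids.
  have b00 : (0 : C) ^+ k.-1 = 0 by rewrite expr0n; case: k k2 => [|[|n]].
  have := curve _ _ _ (ids 0) cb (ids 0) erefl b00 erefl.
  rewrite cd_id -/b; apply => t.
  by rewrite /Sk /= !cpt -exprS prednK // k0.
have e3 : cd G 0 (pt 0 0 1) = 0.
  have -> : pt 0 0 1 = (- 1) *: pt 1 0 0 + ((- b) *: pt 0 1 0 + pt 1 b 1) :> V.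
    by apply: pt_eq; rewrite /xc /yc /zc !mxE /=; ring.
  by rewrite !cd_lin e0 e1 e2 !mulr0 !addr0.
have Gv (v : V) : cd G 0 v = 0.
  have -> : v = xc v *: pt 1 0 0 + (yc v *: pt 0 1 0 + (zc v *: pt 0 0 1 + 0)) :> V.
    by apply: pt_eq; rewrite /xc /yc /zc !mxE /=; ring.
  by rewrite !cd_lin e0 e1 e3 cd0 !mulr0 !addr0.
have [v hv] := gs (const_mx 1).
by have := (gE v).2; rewrite Gv hv mxE => /esym/eqP; rewrite oner_eq0.
Qed.

Lemma regP p : reg 2 X p <-> X p /\ p != 0.
Proof.
split=> [h|[]]; last exact: reg_neq0.
by split; [exact: h.1|apply/eqP => p0; apply: nreg0; rewrite -p0].
Qed.

Lemma singP p : sing 2 X p <-> p = 0.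
Proof.
split=> [[Xp nr]|->]; last by split; [exact: X0|exact: nreg0].
by apply: contrapT => /eqP p0; apply: nr; exact: reg_neq0.
Qed.

Lemma zc_neq0 p : zc p != 0 -> p != 0.
Proof. by apply: contra_neq => ->; rewrite /zc mxE. Qed.

Lemma X_z p : X p -> zc p != 0 -> xc p != 0 /\ yc p != 0.
Proof.
move=> Xp z0; have /norP[] // : ~~ ((xc p == 0) || (yc p == 0)).
by rewrite -mulf_eq0 (Xeq Xp) expf_neq0.
Qed.

(* The values at [p] of [k x d/dx + z d/dz] and [k y d/dy + z d/dz], which are
   tangent to X. *)
Definition ea (p : V) : V := pt (k%:R * xc p) 0 (zc p).
Definition eb (p : V) : V := pt 0 (k%:R * yc p) (zc p).

Lemma tangent_ea p : X p -> tangent X p (ea p).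
Proof.
move=> Xp f hf f0.
(* An orbit of the torus action on X that scales x with weight k and z with weight 1; its velocity
   at 0 is [ea p]. *)
pose F (t : C) : V := pt (xc p * (1 + t) ^+ k) (yc p) (zc p * (1 + t)).
have c1 (t : C) : cdf (fun t : C => 1 + t) t by apply: cdfD; [exact: cdf_cst|exact: cdf_id].
have d1 : cd (fun t : C => 1 + t) 0 1 = 1.
  by rewrite cdD ?cd_cst ?cd_id ?add0r //; [exact: cdf_cst|exact: cdf_id].
have [dF dE] := @diff_pt R C (fun t => xc p * (1 + t) ^+ k) (fun=> yc p) (fun t => zc p * (1 + t)) 0
  (cdfM (cdf_cst _ _) (cdfX k (c1 0))) (cdf_cst _ _) (cdfM (cdf_cst _ _) (c1 0)).
have F0 : F 0 = p by apply: pt_eq; rewrite /F cpt ?addr0 ?expr1n ?mulr1.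
have := @curve_zero F f dF; rewrite F0 -cdE => <- //.
- congr (cd f p _); rewrite dE cd_cst cdZ; last exact: cdfX.
  rewrite cdX // d1 cdZ // d1 addr0 expr1n !mulr1.
  by rewrite /ea [xc p * _]mulrC.
- apply: near_all => t; rewrite /F /Sk /= !cpt exprMn -(Xeq Xp).
  by rewrite mulrAC.
- by rewrite cdfE; exact: nbhs_singleton hf.
Qed.

Lemma tangent_eb p : X p -> tangent X p (eb p).
Proof.
move=> Xp f hf f0.
pose F (t : C) : V := pt (xc p) (yc p * (1 + t) ^+ k) (zc p * (1 + t)).
have c1 (t : C) : cdf (fun t : C => 1 + t) t by apply: cdfD; [exact: cdf_cst|exact: cdf_id].
have d1 : cd (fun t : C => 1 + t) 0 1 = 1.
  by rewrite cdD ?cd_cst ?cd_id ?add0r //; [exact: cdf_cst|exact: cdf_id].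
have [dF dE] := @diff_pt R C (fun=> xc p) (fun t => yc p * (1 + t) ^+ k) (fun t => zc p * (1 + t)) 0
  (cdf_cst _ _) (cdfM (cdf_cst _ _) (cdfX k (c1 0))) (cdfM (cdf_cst _ _) (c1 0)).
have F0 : F 0 = p by apply: pt_eq; rewrite /F cpt ?addr0 ?expr1n ?mulr1.
have := @curve_zero F f dF; rewrite F0 -cdE => <- //.
- congr (cd f p _); rewrite dE cd_cst cdZ; last exact: cdfX.
  rewrite cdX // d1 cdZ // d1 addr0 expr1n !mulr1.
  by rewrite /eb [yc p * _]mulrC.
- apply: near_all => t; rewrite /F /Sk /= !cpt exprMn -(Xeq Xp).
  by rewrite mulrA.
- by rewrite cdfE; exact: nbhs_singleton hf.
Qed.

Lemma tangent_eq p (v : V) : X p -> tangent X p v ->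
  xc p * yc v + yc p * xc v = k%:R * zc p ^+ k.-1 * zc v.
Proof.
move=> Xp tv; have := tv defX; rewrite -cdE cd_defX => h.
apply/eqP; rewrite -subr_eq0; apply/eqP/h.
  by apply/holo_hol; apply: near_all => q; exact: cdf_defX.
by apply: near_all => q /defX0.
Qed.

(** The components along x and y give the coefficients; the z-component then agrees by the
    differentiated equation, after multiplication by k z^k. *)
Lemma tangent_frame p (v : V) : X p -> zc p != 0 -> tangent X p v ->
  v = (xc v / (k%:R * xc p)) *: ea p + (yc v / (k%:R * yc p)) *: eb p.
Proof.
move=> Xp z0 tv; have [x0 y0] := X_z Xp z0; have h := tangent_eq Xp tv.
have kk := kC.
apply: pt_eq; rewrite /xc /yc /zc !mxE /= -?/(xc _) -?/(yc _) -?/(zc _).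
- by field; rewrite kk x0 y0.
- by field; rewrite kk x0 y0.
have E : zc p ^+ k = zc p * zc p ^+ k.-1 by rewrite -exprS prednK // k0.
have kz : k%:R * zc p ^+ k != 0 by rewrite mulf_neq0 // expf_neq0.
apply: (mulfI kz); rewrite E.
have -> : k%:R * (zc p * zc p ^+ k.-1) * zc v = zc p * (xc p * yc v + yc p * xc v).
  by rewrite h; ring.
rewrite -E -(Xeq Xp).
by field; rewrite kk x0 y0.
Qed.

Lemma nbhs_nm (W : normedModType C) (x : W) (e : R) : 0 < e -> nbhs x [set y | nm (y - x) < e].
Proof. by move=> e0; apply: ((nearnP x (fun y => nm (y - x) < e)).2); exists e. Qed.

(** Approach [x] by a point of X where [h1] is nonzero, then that point by one where [h2] is nonzero
    too, staying where [h1] has no zero. *)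
Lemma nonzerodivM p (h1 h2 : V -> C) : nonzerodiv X p h1 -> nonzerodiv X p h2 ->
  nonzerodiv X p (fun x => h1 x * h2 x).
Proof.
move=> [a1 b1] [a2 b2]; have c1 := (holo_hol _ _).1 a1; have c2 := (holo_hol _ _).1 a2.
split; first by apply/holo_hol; exact: holM.
have /nearnP[d1 d10 H1] := b1; have /nearnP[d2 d20 H2] := b2; have /nearnP[d3 d30 H3] := c1.
apply/nearnP; exists (Num.min d1 (Num.min d2 d3)); first by rewrite !lt_min d10 d20.
move=> x; rewrite !lt_min => /and3P[x1 x2 x3] Xx O /nearnP[e e0 He].
have [|y [[Xy hy] ye]] := H1 x x1 Xx [set y | nm (y - x) < Num.min e (Num.min (d2 - nm (x - p)) (d3 - nm (x - p)))].
  by apply: nbhs_nm; rewrite !lt_min e0 !subr_gt0 x2.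
move: ye; rewrite /= !lt_min => /and3P[y1 y2 y3].
have yp d : nm (y - x) < d - nm (x - p) -> nm (y - p) < d.
  exact: nm_near.
have /nearnP[d4 d40 H4] := cdf_neq0 (H3 _ (yp _ y3)) hy.
have [|w [[Xw hw] we]] := H2 y (yp _ y2) Xy [set w | nm (w - y) < Num.min d4 (e - nm (y - x))].
  by apply: nbhs_nm; rewrite !lt_min d40 subr_gt0.
move: we; rewrite /= lt_min => /andP[w1 w2].
exists w; split; first by split => //=; rewrite mulf_neq0 // H4.
by apply: He; exact: nm_near w2.
Qed.

(** Through every point with z = 0 passes a curve of X parametrized by z: (t, t^(k-1), t) at the
    origin, a curve with x or y fixed elsewhere. Hence z is a denominator, and meromorphic
    identities may be checked where z is nonzero. *)
Lemma zc_dense p (e : R) : X p -> 0 < e -> exists q, [/\ X q, nm (q - p) < e & zc q != 0].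
Proof.
move=> Xp e0; have [z0|z0] := eqVneq (zc p) 0; last first.
  by exists p; split => //; rewrite subrr nm0.
have [F [dF XF F0 zF]] : exists F : C -> V, [/\ differentiable F 0, forall t, X (F t), F 0 = p &
    forall t, zc (F t) = t].
  have k10 : (0 : C) ^+ k = 0 by rewrite expr0n gtn_eqF // k0.
  have ck (t : C) : cdf (fun t : C => t ^+ k) t by apply: cdfX; exact: cdf_id.
  have [p0|p0] := eqVneq p 0.
    exists (fun t => pt t (t ^+ k.-1) t); split.
    - by apply: (diff_pt _ _ _).1; [exact: cdf_id|apply: cdfX; exact: cdf_id|exact: cdf_id].
    - by move=> t; rewrite /Sk /= !cpt -exprS prednK // k0.
    - rewrite p0; apply: pt_eq; rewrite cpt /xc /yc /zc mxE //.
      by rewrite expr0n; case: k k2 => [|[|n]].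
    - by move=> t; rewrite cpt.
  have [x0|y0] := X_axes Xp p0.
    exists (fun t => pt (xc p) (t ^+ k / xc p) t); split.
    - apply: (diff_pt _ _ _).1; [exact: cdf_cst| |exact: cdf_id].
      by apply: cdfM; [exact: ck|exact: cdf_cst].
    - by move=> t; rewrite /Sk /= !cpt mulrC divfK.
    - apply: pt_eq; rewrite cpt // k10 mul0r.
      have : xc p * yc p = 0 by rewrite (Xeq Xp) // z0 k10.
      by move=> /eqP; rewrite mulf_eq0 (negPf x0) => /eqP.
    - by move=> t; rewrite cpt.
  exists (fun t => pt (t ^+ k / yc p) (yc p) t); split.
  - apply: (diff_pt _ _ _).1; [|exact: cdf_cst|exact: cdf_id].
    by apply: cdfM; [exact: ck|exact: cdf_cst].
  - by move=> t; rewrite /Sk /= !cpt divfK.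
  - apply: pt_eq; rewrite cpt // k10 mul0r.
    have : xc p * yc p = 0 by rewrite (Xeq Xp) // z0 k10.
    by move=> /eqP; rewrite mulf_eq0 (negPf y0) orbF => /eqP.
  - by move=> t; rewrite cpt.
have [d d0 Hd] := (continuous_nm F 0).1 (differentiable_continuous dF) e e0.
exists (F (d / 2)%:C); split => //.
  rewrite -F0; apply: Hd; rewrite subr0 nmR gtr0_norm; last by rewrite divr_gt0.
  by rewrite gtr_pMr // invf_lt1 // ltr1n.
by rewrite zF -nm_gt0 nmR gtr0_norm divr_gt0.
Qed.

Lemma nonzerodiv_zc p : nonzerodiv X p (@zc R).
Proof.
split; first by apply/holo_hol; exact: hol_zc.
apply: near_all => x Xx O /nearnP[e e0 He].
have [q [Xq qe zq]] := zc_dense Xx e0.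
by exists q; split => //; exact: He.
Qed.

End Geometry.

(** * Holomorphy off the origin of continuous meromorphic functions *)

Section StepH.
Variable R : realType.
Local Notation C := R[i].
Local Notation V := 'rV[C]_3.
Local Notation U := 'rV[C]_2.
Implicit Types p q : V.
Variable k : nat.
Hypothesis k2 : (2 <= k)%N.
Local Notation X := (Sk R k).

Definition Xcont (phi : V -> C) (y : V) := forall e : R, 0 < e -> exists2 d : R, 0 < d &
  forall q, X q -> nm (q - y) < d -> nm (phi q - phi y) < e.

Definition Xaccum (h : V -> C) (y : V) := forall e : R, 0 < e -> exists q,
  [/\ X q, nm (q - y) < e & h q != 0].

Definition gchart (u : U) : V := G1 k (u 0 0) (u 0 1).
Definition proj (p : V) : U := \row_j nth 0 [:: xc p; zc p] j.

Lemma projK p : X p -> xc p != 0 -> gchart (proj p) = p.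
Proof.
move=> Xp x0; rewrite /gchart /proj !mxE /G1 /=.
by rewrite -(Xeq Xp) mulrC mulKf // -ptE.
Qed.

Lemma ord2P (P : 'I_2 -> Prop) : P 0 -> P 1 -> forall j, P j.
Proof.
move=> h0 h1 [[|[|//]] hj].
- by have -> : Ordinal hj = 0 by apply: val_inj.
- by have -> : Ordinal hj = 1 by apply: val_inj.
Qed.

Lemma diff_proj p : differentiable proj p.
Proof.
apply: (diff_row _).1; apply: ord2P.
- by rewrite (_ : (fun w => _) = @xc R); [exact: cdf_xc|apply/funext => w; rewrite mxE].
- by rewrite (_ : (fun w => _) = @zc R); [exact: cdf_zc|apply/funext => w; rewrite mxE].
Qed.

Lemma nm_proj p q : nm (proj p - proj q) <= nm (p - q).
Proof.
apply/nm_row_le; first exact: nm_ge0.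
apply: ord2P; rewrite !mxE /=; first by rewrite -xcB nm_xc.
by rewrite -zcB nm_zc.
Qed.

Lemma diff_chart (u : U) : u 0 0 != 0 -> differentiable gchart u.
Proof.
move=> u0; apply: (diff_pt _ _ _).1; [exact: (cdf_coord u 0).1| |exact: (cdf_coord u 1).1].
apply: cdf_div => //; last exact: (cdf_coord u 0).1.
by apply: cdfX; exact: (cdf_coord u 1).1.
Qed.

Lemma Xhol_chart x0 (phi g h : V -> C) : X x0 -> xc x0 != 0 -> hol g x0 -> hol h x0 ->
  (\forall x \near x0, X x -> Xaccum h x) ->
  (\forall x \near x0, X x -> h x != 0 -> g x = h x * phi x) ->
  (\forall x \near x0, X x -> Xcont phi x) -> Xhol k x0 phi.
Proof.
move=> Xx0 xx0 hg hh acc gh pc.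
pose u0 := proj x0.
have u00 : u0 0 0 != 0 by rewrite mxE.
have F0 : gchart u0 = x0 by exact: projK.
have unz : \forall u \near u0, (u : U) 0 0 != 0 by exact: (cdf_neq0 (cdf_coord u0 0).1).
have dF : \forall u \near u0, differentiable gchart u.
  by have /nearnP[d d0 Hd] := unz; apply/nearnP; exists d => // u /Hd; exact: diff_chart.
have cF := (continuous_nm gchart u0).1 (differentiable_continuous (nbhs_singleton dF)).
have pull (P : V -> Prop) : (\forall x \near x0, P x) -> \forall u \near u0, P (gchart u).
  move=> /nearnP[e e0 He]; have [d d0 Hd] := cF e e0.
  by apply/nearnP; exists d => // u /Hd; rewrite F0; exact: He.
have XF (u : U) : u 0 0 != 0 -> X (gchart u) by exact: X_G1.
have xnz : \forall x \near x0, xc x != 0 by exact: (cdf_neq0 (cdf_xc x0)).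
have hgF : hol (fun u => g (gchart u)) u0 by apply: (hol_comp (F := gchart)); rewrite ?F0.
have hhF : hol (fun u => h (gchart u)) u0 by apply: (hol_comp (F := gchart)); rewrite ?F0.
have accF : accum (fun u => h (gchart u)) u0.
  move=> e e0; have /nearnP[d d0 Hd] := xnz.
  have [|q [Xq qe hq]] := nbhs_singleton acc Xx0 (Num.min e d); first by rewrite lt_min e0.
  move: qe; rewrite lt_min => /andP[qe qd].
  exists (proj q); first exact: le_lt_trans (nm_proj _ _) qe.
  by rewrite projK //; exact: Hd.
have [|psi [hpsi gpsi]] := @riemann_div R _ (fun u => g (gchart u)) (fun u => h (gchart u)) u0
    (nm (phi x0) + 1) hgF hhF accF.
  have [d d0 Hd] := nbhs_singleton pc Xx0 1 ltr01.
  have b : \forall x \near x0, X x -> nm (phi x) <= nm (phi x0) + 1.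
    apply/nearnP; exists d => // x xd Xx; have := Hd x Xx xd.
    by have := nm_dist (phi x) (phi x0); lra.
  have /nearnP[d1 d10 H1] := pull _ b; have /nearnP[d2 d20 H2] := pull _ gh.
  have /nearnP[d3 d30 H3] := unz.
  apply/nearnP; exists (Num.min d1 (Num.min d2 d3)); first by rewrite !lt_min d10 d20.
  move=> u; rewrite !lt_min => /and3P[/H1 h1 /H2 h2 /H3 /XF h3] hu.
  by rewrite h2 // nmM mulrC ler_wpM2r ?nm_ge0 // h1.
exists (fun p => psi (proj p)).
  by apply: (hol_comp (F := proj)) => //; apply: near_all => p; exact: diff_proj.
have push (P : U -> Prop) : (\forall u \near u0, P u) -> \forall x \near x0, P (proj x).
  move=> /nearnP[e e0 He]; apply/nearnP; exists e => // x xe; apply: He.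
  exact: le_lt_trans (nm_proj _ _) xe.
have /nearnP[d1 d10 H1] := push _ gpsi; have /nearnP[d2 d20 H2] := gh.
have /nearnP[d3 d30 H3] := xnz; have /nearnP[d4 d40 H4] := pc.
have /nearnP[d5 d50 H5] := push _ hpsi; have /nearnP[d6 d60 H6] := acc.
pose d := Num.min (Num.min d1 (Num.min d2 d3)) (Num.min d4 (Num.min d5 d6)).
have d0 : 0 < d by rewrite !lt_min d10 d20 d30 d40 d50.
apply/nearnP; exists d => // x xd Xx.
have dP (y : V) : nm (y - x0) < d -> [/\ [/\ nm (y - x0) < d1, nm (y - x0) < d2 & nm (y - x0) < d3],
   nm (y - x0) < d4, nm (y - x0) < d5 & nm (y - x0) < d6].
  by rewrite !lt_min => /andP[/and3P[? ? ?] /and3P[? ? ?]].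
have [[x1 x2 x3] x4 x5 x6] := dP x xd.
apply/eqP; rewrite -subr_eq0; apply/eqP/nm_le0 => e e0.
have e2 : 0 < e / 2 by rewrite divr_gt0.
have [a a0 Ha] := H4 x x4 Xx _ e2.
have [b b0 Hb] := cdf_cont (H5 x x5) e2.
have [|q [Xq qe hq]] := H6 x x6 Xx (Num.min a (Num.min b (d - nm (x - x0)))).
  by rewrite !lt_min a0 b0 subr_gt0.
move: qe; rewrite !lt_min => /and3P[qa qb qd].
have qx0 : nm (q - x0) < d by exact: nm_near qd.
have [[q1 q2 q3] q4 q5 q6] := dP q qx0.
have E : phi q = psi (proj q).
  apply: (mulfI hq); rewrite -(H2 q q2 Xq hq); have := H1 q q1.
  by rewrite projK ?H3 // mulrC.
have h1 := Ha q Xq qa.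
have h2 : nm (psi (proj q) - psi (proj x)) < e / 2 by apply: Hb; exact: le_lt_trans (nm_proj _ _) qb.
have -> : phi x - psi (proj x) = (psi (proj q) - psi (proj x)) - (phi q - phi x) by rewrite E; ring.
by apply: (le_trans (nmB _ _)); rewrite [leRHS]splitr ltW // ltrD.
Qed.

Lemma swap0E p q : nm (swap p - swap q) <= nm (p - q).
Proof.
apply/nm_row_le; first exact: nm_ge0.
apply: ord3P; rewrite !mxE /=; first by rewrite -ycB nm_yc.
  by rewrite -xcB nm_xc.
by rewrite -zcB nm_zc.
Qed.

Lemma near_swap (P : V -> Prop) p : (\forall x \near p, P x) -> \forall x \near swap p, P (swap x).
Proof.
move=> /nearnP[e e0 He]; apply/nearnP; exists e => // x xe; apply: He.
by have := swap0E x (swap p); rewrite swapK => h; exact: le_lt_trans h xe.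
Qed.

Lemma hol_swap (g : V -> C) p : hol g p -> hol (fun q => g (swap q)) (swap p).
Proof.
by move=> hg; apply: hol_comp; [apply: near_all => w; exact: diff_swap|rewrite swapK].
Qed.

Lemma Xhol_local x0 (phi g h : V -> C) : X x0 -> x0 != 0 -> hol g x0 -> hol h x0 ->
  (\forall x \near x0, X x -> Xaccum h x) ->
  (\forall x \near x0, X x -> h x != 0 -> g x = h x * phi x) ->
  (\forall x \near x0, X x -> Xcont phi x) -> Xhol k x0 phi.
Proof.
move=> Xx0 x00 hg hh acc gh pc.
have [xx0|yx0] := X_axes k2 Xx0 x00; first exact: Xhol_chart hg hh acc gh pc.
have H : Xhol k (swap x0) (fun q => phi (swap q)).
  apply: (@Xhol_chart (swap x0) _ (fun q => g (swap q)) (fun q => h (swap q))).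
  - exact: X_swap.
  - by rewrite /swap cpt.
  - exact: hol_swap.
  - exact: hol_swap.
  - have /nearnP[d d0 Hd] := near_swap acc; apply/nearnP; exists d => // x /Hd H /X_swap /H {}H.
    move=> e /H[q [Xq qe hq]]; exists (swap q); split; [exact: X_swap| |by rewrite swapK].
    by have := swap0E q (swap x); rewrite swapK => h2; exact: le_lt_trans h2 qe.
  - have /nearnP[d d0 Hd] := near_swap gh; apply/nearnP; exists d => // x /Hd H /X_swap /H {}H.
    exact: H.
  - have /nearnP[d d0 Hd] := near_swap pc; apply/nearnP; exists d => // x /Hd H /X_swap /H {}H.
    move=> e /H[a a0 Ha]; exists a => // q /X_swap Xq qa; apply: Ha => //.
    exact: le_lt_trans (swap0E _ _) qa.
have := Xhol_swap H; rewrite swapK; congr Xhol.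
by apply/funext => q; rewrite swapK.
Qed.

(** Multiplying [g] and [h] by z leaves the relation to be checked only where z is nonzero; the
    hypotheses of [Xhol_local] then pass from [p] to all nearby points off the origin. *)
Lemma Xhol_quot p (phi g h : V -> C) : hol g p -> nonzerodiv X p h ->
  (\forall x \near p, X x -> zc x != 0 -> h x != 0 -> g x = h x * phi x) ->
  (\forall x \near p, X x -> x != 0 -> Xcont phi x) ->
  \forall x \near p, X x -> x != 0 -> Xhol k x phi.
Proof.
move=> hg nh gh pc; pose H x := h x * zc x.
have [hH' H1'] : nonzerodiv X p H := nonzerodivM nh (nonzerodiv_zc k2 p).
have hH : hol H p by apply/holo_hol; exact: hH'.
have /nearnP[d1 d10 H1] := H1'.
have /nearnP[d2 d20 H2] := hol_near hg; have /nearnP[d3 d30 H3] := hol_near hH.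
have /nearnP[d4 d40 H4] := gh; have /nearnP[d5 d50 H5] := pc.
pose d := Num.min (Num.min d1 (Num.min d2 d3)) (Num.min d4 d5).
have d0 : 0 < d by rewrite !lt_min d10 d20 d30 d40.
have dP (y : V) : nm (y - p) < d -> [/\ nm (y - p) < d1, nm (y - p) < d2, nm (y - p) < d3,
   nm (y - p) < d4 & nm (y - p) < d5].
  by rewrite !lt_min => /andP[/and3P[? ? ?] /andP[? ?]].
apply/nearnP; exists d => // x0 xd Xx0 x00.
have [x1 x2 x3 x4 x5] := dP x0 xd.
have nd : \forall x \near x0, nm (x - p) < d.
  apply/nearnP; exists (d - nm (x0 - p)); first by rewrite subr_gt0.
  by move=> x; exact: nm_near.
have /nearnP[a a0 Ha] := nd.
have n0 : \forall x \near x0, x != 0.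
  apply/nearnP; exists (nm x0); first by rewrite nm_gt0.
  by move=> x; apply: contraTneq => ->; rewrite sub0r nmN ltxx.
have /nearnP[b b0 Hb] := n0.
apply: (@Xhol_local x0 phi (fun x => g x * zc x) H Xx0 x00).
- by apply: holM; [exact: H2|exact: hol_zc].
- exact: H3.
- apply/nearnP; exists a => // x /Ha /dP[y1 _ _ _ _] Xx e e0.
  have [y [[Xy hy] ye]] := H1 x y1 Xx _ (nbhs_nm x e0).
  by exists y.
- apply/nearnP; exists a => // x /Ha /dP[_ _ _ y4 _] Xx.
  by rewrite /H mulf_eq0 => /norP[hx zx]; rewrite (H4 x) //; ring.
- apply/nearnP; exists (Num.min a b); first by rewrite lt_min a0.
  move=> x; rewrite lt_min => /andP[/Ha /dP[_ _ _ _ y5] /Hb xn] Xx.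
  exact: H5.
Qed.

Definition rvec (x : V) : 'rV[R]_(3 + 3) :=
  \row_(j < 3 + 3) match fintype.split j with inl i => complex.Re (x 0 i) | inr i => complex.Im (x 0 i) end.

Lemma rvecK x : cvec (rvec x) = x.
Proof.
apply/rowP => j; rewrite !mxE.
have -> : fintype.split (lshift 3 j) = inl j by exact: (unsplitK (inl j)).
have -> : fintype.split (rshift 3 j) = inr j by exact: (unsplitK (inr j)).
by case: (x 0 j).
Qed.

Lemma cvecK w : rvec (cvec w) = w.
Proof.
apply/rowP => j; rewrite !mxE; by case: (split_ordP j) => i ->; rewrite mxE.
Qed.

Lemma smooth_cont x (f : V -> C) : smooth_at x f -> forall e : R, 0 < e ->
  exists2 d : R, 0 < d & forall y, nm (y - x) < d -> nm (f y - f x) < e.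
Proof.
move=> [D [oD [w Dw wx]] /(_ 0%N)[/= cr ci]] e e0.
have e2 : 0 < e / 2 by rewrite divr_gt0.
have /(@cvgrPdist_lt _ R^o) /(_ _ e2) /nbhs_ballP[d1 /= d10 H1] := cr w Dw.
have /(@cvgrPdist_lt _ R^o) /(_ _ e2) /nbhs_ballP[d2 /= d20 H2] := ci w Dw.
exists (Num.min d1 d2); first by rewrite lt_min d10.
move=> y yx.
have wE : w = rvec x by rewrite -wx cvecK.
have B d : nm (y - x) < d -> ball w d (rvec y).
  move=> h; have d0 : 0 < d by apply: le_lt_trans h; exact: nm_ge0.
  split => // i j; rewrite wE /ball /= !mxE distrC; case: (fintype.split j) => l; rewrite -raddfB.
    by apply: le_lt_trans (nm_Re _) _; apply: le_lt_trans h; have := nm_coord (y - x) l; rewrite !mxE.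
  by apply: le_lt_trans (nm_Im _) _; apply: le_lt_trans h; have := nm_coord (y - x) l; rewrite !mxE.
move: yx; rewrite lt_min => /andP[/B/H1 h1 /B/H2 h2].
move: h1 h2; rewrite /= rvecK wx => h1 h2.
apply: (le_lt_trans (nm_ReIm _)); rewrite [e]splitr !raddfB /= distrC [X in _ + X]distrC.
exact: ltrD.
Qed.

Lemma smooth_bounded_cont p rho : smooth_bounded 2 X p rho ->
  \forall x \near p, X x -> x != 0 -> Xcont rho x.
Proof.
move=> [/nearnP[d d0 Hd] _]; apply/nearnP; exists d => // x xd Xx x0.
have [|f sf /nearnP[a a0 Ha]] := Hd x xd; first exact/regP.
move=> e e0; have [b b0 Hb] := smooth_cont sf e0.
exists (Num.min a b); first by rewrite lt_min a0.
move=> q Xq; rewrite lt_min => /andP[qa qb].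
by rewrite !Ha // ?subrr ?nm0 //; exact: Hb.
Qed.

Lemma smooth_bounded_bound0 rho : smooth_bounded 2 X 0 rho ->
  exists B : R, \forall y \near (0 : V), X y -> y != 0 -> nm (rho y) <= B.
Proof.
move=> [_ /nbhs_singleton H]; have [|B /nearnP[d d0 Hd]] := H; first exact/singP.
exists B; apply/nearnP; exists d => // y yd Xy y0.
have := Hd y yd; rewrite nmE lecR; apply; exact/regP.
Qed.

Lemma XcontM (phi psi : V -> C) x : Xcont phi x -> Xcont psi x -> Xcont (fun q => phi q * psi q) x.
Proof.
move=> hf hg e e0.
pose A := nm (phi x) + 1; pose B := nm (psi x) + 1.
have A0 : 0 < A by rewrite ltr_wpDl ?nm_ge0.
have B0 : 0 < B by rewrite ltr_wpDl ?nm_ge0.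
have [|d1 d10 H1] := hf (Num.min 1 (e / 2 / B)); first by rewrite lt_min ltr01 !divr_gt0.
have [|d2 d20 H2] := hg (e / 2 / A); first by rewrite !divr_gt0.
exists (Num.min d1 d2); first by rewrite lt_min d10.
move=> s Xs; rewrite lt_min => /andP[/(H1 s Xs) h1 /(H2 s Xs) h2].
have -> : phi s * psi s - phi x * psi x = phi s * (psi s - psi x) + (phi s - phi x) * psi x by ring.
apply: (le_lt_trans (nmD _ _)); rewrite !nmM.
move: h1; rewrite lt_min => /andP[h11 h12].
have fs : nm (phi s) < A.
  by have := nm_dist (phi s) (phi x); rewrite /A; lra.
rewrite [e]splitr; apply: ler_ltD.
  rewrite -[e / 2](@divfK _ A) ?gt_eqF // mulrC; apply: ler_pM; rewrite ?nm_ge0 // ltW //.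
rewrite -[e / 2](@divfK _ B) ?gt_eqF //.
apply: (@le_lt_trans _ _ (nm (phi s - phi x) * B)).
  by rewrite ler_wpM2l ?nm_ge0 // /B lerDl.
by rewrite ltr_pM2r.
Qed.

Lemma Xcont_sum n (f : 'I_n -> V -> C) x : (forall j, Xcont (f j) x) ->
  Xcont (fun q => \sum_j f j q) x.
Proof.
move=> H e e0.
have n0 : 0 < (n.+1)%:R :> R by rewrite ltr0n.
have /choice[d Hd] : forall j, exists d : R, 0 < d /\ forall q, X q -> nm (q - x) < d ->
    nm (f j q - f j x) < e / n.+1%:R.
  by move=> j; have [|d d0 H1] := H j (e / n.+1%:R); [rewrite divr_gt0|exists d].
exists (\big[Num.min/1]_j d j).
  by elim/big_ind: _ => // [y z y0 z0|j _]; [rewrite lt_min y0|exact: (Hd j).1].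
move=> q Xq qd; rewrite -sumrB.
apply: (@le_lt_trans _ _ (\sum_(j < n) e / n.+1%:R)).
  elim/big_ind2: _ => [|a b a' b' h1 h2|j _]; first by rewrite nm0.
    by apply: (le_trans (nmD _ _)); exact: lerD.
  apply/ltW/(Hd j).2 => //; apply: (lt_le_trans qd).
  by rewrite (bigD1 j) //= ge_min lexx.
rewrite sumr_const card_ord -[X in X < _]mulr_natr mulrAC ltr_pdivrMr // ltr_pM2l // ltr_nat //.
Qed.

Lemma hol_Xcont (f : V -> C) p : hol f p -> \forall x \near p, Xcont f x.
Proof.
move=> /nearnP[d d0 Hd]; apply/nearnP; exists d => // x /Hd fx e e0.
by have [a a0 Ha] := cdf_cont fx e0; exists a => // q _; exact: Ha.
Qed.

End StepH.

Lemma sum_tuple0 (V : nmodType) (P : pred (0.-tuple bool)) (F : 0.-tuple bool -> V) :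
  \sum_(m : 0.-tuple bool | P m) F m = if P [tuple] then F [tuple] else 0.
Proof.
rewrite big_mkcond /= (eq_bigr (fun=> if P [tuple] then F [tuple] else 0)).
  by rewrite sumr_const card_tuple expn0 mulr1n.
by move=> m _; rewrite (tuple0 m).
Qed.

(** Splitting off the first bit of the mask expands the shuffle sums of [wedge] in degrees at most
    2. *)
Lemma sum_tupleS n (V : nmodType) (P : pred (n.+1.-tuple bool)) (F : n.+1.-tuple bool -> V) :
  \sum_(m : n.+1.-tuple bool | P m) F m =
  \sum_(t : n.-tuple bool | P [tuple of true :: t]) F [tuple of true :: t] +
  \sum_(t : n.-tuple bool | P [tuple of false :: t]) F [tuple of false :: t].
Proof.
rewrite big_mkcond /=.
rewrite (reindex (fun bt : bool * n.-tuple bool => [tuple of bt.1 :: bt.2])) /=; last first.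
  exists (fun m : n.+1.-tuple bool => (thead m, [tuple of behead m])).
    by move=> [b t] _; congr (_, _); apply: val_inj.
  by move=> m _; apply: val_inj; rewrite [in RHS](tuple_eta m).
rewrite -(pair_bigA _ (fun (b : bool) (t : n.-tuple bool) =>
  if P [tuple of b :: t] then F [tuple of b :: t] else 0)) /=.
by rewrite big_bool /= -!big_mkcond.
Qed.

(** * Forms in coordinates *)

Section Alternating.
Variables (R : realType) (N : nat).
Local Notation C := R[i].
Local Notation V := 'rV[C]_N.
Implicit Types (u v : V).

Lemma alternating0 (f : seq V -> C) : alternating 0 f.
Proof.
split; first by move=> s1 s2 c u v; rewrite addnS.
by move=> s /size0nil ->.
Qed.

Lemma alternating1P (f : seq V -> C) : alternating 1 f <->
  forall (c : C) u v, f [:: c *: u + v] = c * f [:: u] + f [:: v].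
Proof.
split=> [[h _] c u v|h]; first exact: (h [::] [::]).
split; last by move=> [|? []].
by move=> [|y s1] [|z s2] c u v //= hs; move: hs; rewrite ?addSn ?addnS.
Qed.

Lemma alternating2P (f : seq V -> C) : alternating 2 f <->
  [/\ forall (c : C) u v x, f [:: c *: u + v; x] = c * f [:: u; x] + f [:: v; x],
      forall (c : C) u v x, f [:: x; c *: u + v] = c * f [:: x; u] + f [:: x; v] &
      forall v, f [:: v; v] = 0].
Proof.
split=> [[h0 h1]|[h1 h2 h3]]; split.
- by move=> c u v x; exact: (h0 [::] [:: x]).
- by move=> c u v x; exact: (h0 [:: x] [::]).
- by move=> v; apply: h1; rewrite //= inE eqxx.
- move=> s1 s2 c u v hs.
  case: s1 hs => [|x [|y s1]]; case: s2 => [|x' [|y' s2]] //=; rewrite ?addSn ?addnS //.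
- case=> [|u [|v [|y s]]] // _ us; suff -> : u = v by exact: h3.
  by apply/eqP; move: us; rewrite /= inE andbT negbK.
Qed.

Lemma alternating_ext q (f g : seq V -> C) : (forall s, size s = q -> f s = g s) ->
  alternating q f -> alternating q g.
Proof.
move=> E [h1 h2]; split.
  move=> s1 s2 c u v hs; rewrite -!E ?size_cat //=; exact: h1.
by move=> s hs us; rewrite -E // h2.
Qed.

Lemma alternatingD q (f g : seq V -> C) : alternating q f -> alternating q g ->
  alternating q (fun s => f s + g s).
Proof.
move=> [h1 h2] [h3 h4]; split.
  by move=> s1 s2 c u v hs; rewrite h1 // h3 //; ring.
by move=> s hs us; rewrite h2 // h4 // addr0.
Qed.

Lemma alternatingZ q (f : seq V -> C) (c : C) : alternating q f -> alternating q (fun s => c * f s).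
Proof.
move=> [h1 h2]; split.
  by move=> s1 s2 d u v hs; rewrite h1 //; ring.
by move=> s hs us; rewrite h2 // mulr0.
Qed.

Lemma alternating_sum q n (f : 'I_n -> seq V -> C) : (forall j, alternating q (f j)) ->
  alternating q (fun s => \sum_j f j s).
Proof.
move=> H; split.
  move=> s1 s2 c u v hs; rewrite mulr_sumr -big_split /=; apply: eq_bigr => j _.
  exact: (H j).1.
by move=> s hs us; rewrite big1 // => j _; exact: (H j).2.
Qed.

Lemma alt_swap (f : seq V -> C) : alternating 2 f -> forall u v, f [:: u; v] = - f [:: v; u].
Proof.
move=> /alternating2P[h1 h2 h3] u v; apply/eqP; rewrite -subr_eq0 opprK; apply/eqP.
have := h3 (1 *: u + v); rewrite h1 !h2 !h3 !mul1r add0r addr0 //.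
Qed.

Lemma alternating_map N' (L : {linear V -> 'rV[C]_N'}) q (f : seq 'rV[C]_N' -> C) :
  alternating q f -> alternating q (fun s => f (map L s)).
Proof.
move=> [h1 h2]; split.
  by move=> s1 s2 c u v hs; rewrite !map_cat /= linearP h1 // !size_map.
move=> s hs us; apply: h2; first by rewrite size_map.
by apply: contra us; exact: map_uniq.
Qed.

End Alternating.

Section Forms.
Variable R : realType.
Local Notation C := R[i].
Local Notation V := 'rV[C]_3.
Local Notation form := (form R 3).
Implicit Types (x p u v : V) (a b c w : form).

Lemma mask_inv0 : mask_inversions [::] = 0%N.
Proof. by rewrite /mask_inversions big_mkcond big_ord0. Qed.
Lemma mask_inv1 (b : bool) : mask_inversions [:: b] = 0%N.
Proof. by case: b; rewrite /mask_inversions big_mkcond /= !big_ord_recl big_ord0. Qed.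
Lemma mask_inv2 (b1 b2 : bool) : mask_inversions [:: b1; b2] = (b2 && ~~ b1) :> nat.
Proof.
by case: b1; case: b2; rewrite /mask_inversions big_mkcond /= !big_ord_recl big_ord0.
Qed.

Lemma wedge00 a b x : wedge 0 a b x [::] = a x [::] * b x [::].
Proof. by rewrite /wedge sum_tuple0 /= mask_inv0 expr0 mul1r. Qed.
Lemma wedge01 a b x v : wedge 0 a b x [:: v] = a x [::] * b x [:: v].
Proof. by rewrite /wedge sum_tupleS !sum_tuple0 /= mask_inv1 expr0 mul1r add0r. Qed.
Lemma wedge11 a b x v : wedge 1 a b x [:: v] = a x [:: v] * b x [::].
Proof. by rewrite /wedge sum_tupleS !sum_tuple0 /= mask_inv1 expr0 mul1r addr0. Qed.
Lemma wedge02 a b x u v : wedge 0 a b x [:: u; v] = a x [::] * b x [:: u; v].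
Proof. by rewrite /wedge !sum_tupleS !sum_tuple0 /= mask_inv2 /= expr0 mul1r !add0r. Qed.
Lemma wedge12 a b x u v :
  wedge 1 a b x [:: u; v] = a x [:: u] * b x [:: v] - a x [:: v] * b x [:: u].
Proof.
rewrite /wedge !sum_tupleS !sum_tuple0 /= !mask_inv2 /= expr0 expr1 mul1r add0r addr0.
by rewrite mulN1r mulNr.
Qed.
Lemma wedge22 a b x u v : wedge 2 a b x [:: u; v] = a x [:: u; v] * b x [::].
Proof. by rewrite /wedge !sum_tupleS !sum_tuple0 /= mask_inv2 /= expr0 mul1r !addr0. Qed.

Lemma extd0 w x v : extd w x [:: v] = cd (w^~ [::]) x v.
Proof. by rewrite /extd /= big_ord_recl big_ord0 /= addr0 expr0 mul1r cdE. Qed.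
Lemma extd1 w x u v : extd w x [:: u; v] = cd (w^~ [:: v]) x u - cd (w^~ [:: u]) x v.
Proof.
rewrite /extd /= !big_ord_recl big_ord0 /= addr0 expr0 mul1r /bump /= addn0 expr1.
by rewrite mulN1r !cdE.
Qed.

Definition dz : form := @dcoord R 3 2.
Definition b0 : V := pt 1 0 0.
Definition b1 : V := pt 0 1 0.
Definition b2 : V := pt 0 0 1.

Lemma basisE v : v = xc v *: b0 + (yc v *: b1 + (zc v *: b2 + 0)).
Proof. by apply: pt_eq; rewrite /b0 /b1 /b2 /xc /yc /zc !mxE /=; ring. Qed.

Lemma alt1_0 (f : seq V -> C) : alternating 1 f -> f [:: 0] = 0.
Proof. by move=> /alternating1P h; have := h (-1) 0 0; rewrite scaler0 addr0 => ->; ring. Qed.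

Lemma alt1E (f : seq V -> C) : alternating 1 f -> forall v,
  f [:: v] = xc v * f [:: b0] + yc v * f [:: b1] + zc v * f [:: b2].
Proof.
move=> hf v; have f0 := alt1_0 hf; move/alternating1P: hf => h.
by rewrite {1}[v]basisE !h f0; ring.
Qed.

Lemma alt2_l (f : seq V -> C) v : alternating 2 f -> alternating 1 (fun s => f (head 0 s :: [:: v])).
Proof. by move=> /alternating2P[h1 _ _]; apply/alternating1P => c u w /=; exact: h1. Qed.
Lemma alt2_r (f : seq V -> C) v : alternating 2 f -> alternating 1 (fun s => f [:: v; head 0 s]).
Proof. by move=> /alternating2P[_ h2 _]; apply/alternating1P => c u w /=; exact: h2. Qed.

Lemma alt2E (f : seq V -> C) : alternating 2 f -> forall u v,
  f [:: u; v] = (xc u * yc v - yc u * xc v) * f [:: b0; b1] +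
    (xc u * zc v - zc u * xc v) * f [:: b0; b2] + (yc u * zc v - zc u * yc v) * f [:: b1; b2].
Proof.
move=> hf u v; have := alt1E (alt2_l v hf) u => /= ->.
have E x : f [:: x; v] = xc v * f [:: x; b0] + yc v * f [:: x; b1] + zc v * f [:: x; b2].
  exact: (alt1E (alt2_r x hf) v).
have [_ _ h3] := (alternating2P _).1 hf.
rewrite !E !h3 (alt_swap hf b1 b0) (alt_swap hf b2 b0) (alt_swap hf b2 b1); ring.
Qed.

Lemma alternating_d i x : alternating 1 (@dcoord R 3 i x).
Proof. by apply/alternating1P => c u v; rewrite /dcoord /= !mxE. Qed.

Lemma alternating_w12 a b x : alternating 1 (a x) -> alternating 1 (b x) ->
  alternating 2 (wedge 1 a b x).
Proof.
move=> /alternating1P ha /alternating1P hb; apply/alternating2P; split.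
- by move=> c u v w; rewrite !wedge12 !ha !hb; ring.
- by move=> c u v w; rewrite !wedge12 !ha !hb; ring.
- by move=> v; rewrite wedge12 subrr.
Qed.

Definition form1 (f1 f2 f3 : V -> C) : form := fun x s =>
  f1 x * @dx R x s + f2 x * @dy R x s + f3 x * dz x s.
Definition form2 (f12 f13 f23 : V -> C) : form := fun x s =>
  f12 x * wedge 1 (@dx R) (@dy R) x s + f13 x * wedge 1 (@dx R) dz x s +
  f23 x * wedge 1 (@dy R) dz x s.

Lemma form1E f1 f2 f3 x v : form1 f1 f2 f3 x [:: v] = f1 x * xc v + f2 x * yc v + f3 x * zc v.
Proof. by []. Qed.
Lemma form2E f12 f13 f23 x u v : form2 f12 f13 f23 x [:: u; v] =
  f12 x * (xc u * yc v - yc u * xc v) + f13 x * (xc u * zc v - zc u * xc v) +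
  f23 x * (yc u * zc v - zc u * yc v).
Proof.
rewrite /form2 !wedge12 /dx /dy /dz /dcoord /= -!/(xc _) -!/(yc _) -!/(zc _).
by rewrite ![xc v * _]mulrC ![yc v * _]mulrC.
Qed.

Lemma alternating_form1 f1 f2 f3 x : alternating 1 (form1 f1 f2 f3 x).
Proof.
by rewrite /form1; apply: alternatingD; [apply: alternatingD|]; apply: alternatingZ; exact: alternating_d.
Qed.
Lemma alternating_form2 f12 f13 f23 x : alternating 2 (form2 f12 f13 f23 x).
Proof.
rewrite /form2; apply: alternatingD; [apply: alternatingD|]; apply: alternatingZ;
  apply: alternating_w12; exact: alternating_d.
Qed.

Lemma size1 (s : seq V) : size s = 1%N -> exists v, s = [:: v].
Proof. by case: s => [|v []] // _; exists v. Qed.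
Lemma size2 (s : seq V) : size s = 2%N -> exists u v, s = [:: u; v].
Proof. by case: s => [|u [|v []]] // _; exists u, v. Qed.

Lemma holo_form0 p w : holo_form 0 p w <-> hol (w^~ [::]) p.
Proof.
split=> [[_ h]|h]; first by apply/holo_hol; exact: h.
split; first by apply: near_all => x; exact: alternating0.
by move=> s /size0nil ->; apply/holo_hol.
Qed.

Lemma holo_form1 p f1 f2 f3 : hol f1 p -> hol f2 p -> hol f3 p -> holo_form 1 p (form1 f1 f2 f3).
Proof.
move=> h1 h2 h3; split; first by apply: near_all => x; exact: alternating_form1.
move=> s /size1[v ->]; apply/holo_hol.
by apply: holD; [apply: holD|]; apply: holM => //; exact: hol_cst.
Qed.

Lemma holo_form2 p f12 f13 f23 : hol f12 p -> hol f13 p -> hol f23 p ->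
  holo_form 2 p (form2 f12 f13 f23).
Proof.
move=> h1 h2 h3; split; first by apply: near_all => x; exact: alternating_form2.
move=> s /size2[u [v ->]]; apply/holo_hol.
rewrite (_ : (fun _ => _) = fun x => f12 x * (xc u * yc v - yc u * xc v) +
  f13 x * (xc u * zc v - zc u * xc v) + f23 x * (yc u * zc v - zc u * yc v)); last first.
  by apply/funext => x; rewrite form2E.
by apply: holD; [apply: holD|]; apply: holM => //; exact: hol_cst.
Qed.

Lemma holo_form_coef q p w s : holo_form q p w -> size s = q -> hol (w^~ s) p.
Proof. by move=> [_ h] hs; apply/holo_hol; exact: h. Qed.

Lemma holo_form1E p w : holo_form 1 p w -> \forall x \near p,
  forall v, w x [:: v] = form1 (w^~ [:: b0]) (w^~ [:: b1]) (w^~ [:: b2]) x [:: v].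
Proof.
move=> [/nearnP[d d0 Hd] _]; apply/nearnP; exists d => // x /Hd hx v.
by rewrite form1E (alt1E hx v); ring.
Qed.

Lemma holo_alternating q p w : holo_form q p w -> \forall x \near p, alternating q (w x).
Proof. by case. Qed.

(** Linearity of [w] on a neighbourhood of [p], and not just at [p], makes the differential of the
    coefficient linear in the vector. *)
Lemma alternating_extd1 p w : holo_form 1 p w -> alternating 2 (extd w p).
Proof.
move=> [/nearnP[d d0 Hd] hw].
have cw v : cdf (w^~ [:: v]) p by apply: hol_cdf; apply/holo_hol; exact: hw.
have L (c : C) u v y : cd (w^~ [:: c *: u + v]) p y = c * cd (w^~ [:: u]) p y + cd (w^~ [:: v]) p y.
  have E : \forall x \near p, (fun x => c * w x [:: u] + w x [:: v]) x = w x [:: c *: u + v].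
    by apply/nearnP; exists d => // x /Hd/alternating1P ->.
  have cu : cdf (fun x => c * w x [:: u]) p by apply: cdfM; [exact: cdf_cst|exact: cw].
  by rewrite (cd_near y E) ?cdD ?cdZ //; exact: cdfD.
apply/alternating2P; split.
- by move=> c u v y; rewrite !extd1 L !cd_lin; ring.
- by move=> c u v y; rewrite !extd1 L !cd_lin; ring.
- by move=> v; rewrite extd1 subrr.
Qed.

End Forms.

Section Frames.
Variable R : realType.
Local Notation C := R[i].
Local Notation V := 'rV[C]_3.
Local Notation form := (form R 3).
Variable k : nat.
Hypothesis k2 : (2 <= k)%N.
Local Notation X := (Sk R k).
Local Notation ea := (@ea R k).
Local Notation eb := (@eb R k).
Implicit Types (x p u v : V) (a b c w : form).

Definition coef_eq q a b x : Prop := match q with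
  | 0 => a x [::] = b x [::]
  | 1 => a x [:: ea x] = b x [:: ea x] /\ a x [:: eb x] = b x [:: eb x]
  | _ => a x [:: ea x; eb x] = b x [:: ea x; eb x]
  end.

Lemma same_at_coef q a b x : X x -> zc x != 0 -> (q <= 2)%N -> alternating q (a x) -> alternating q (b x) ->
  coef_eq q a b x -> same_at X q x a b.
Proof.
move=> Xx z0; case: q => [|[|[|//]]] _ ha hb /=.
- by move=> E s /size0nil ->.
- move=> [E1 E2] s /size1[v ->] tv.
  have -> := tangent_frame k2 Xx z0 (tv v (mem_head _ _)).
  have [h1 h2] := ((alternating1P _).1 ha, (alternating1P _).1 hb).
  set c := _ / _; set d := _ / _.
  rewrite -[d *: _]addr0 !h1 !h2 E1 E2 (alt1_0 ha) (alt1_0 hb) //.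
- move=> E s /size2[u [v ->]] tv.
  have tu : tangent X x u by apply: tv; rewrite inE eqxx.
  have tv' : tangent X x v by apply: tv; rewrite !inE eqxx orbT.
  rewrite (tangent_frame k2 Xx z0 tu) (tangent_frame k2 Xx z0 tv').
  set c := _ / _; set d := _ / _; set c' := _ / _; set d' := _ / _.
  have F f : alternating 2 f -> f [:: c *: ea x + d *: eb x; c' *: ea x + d' *: eb x] =
      (c * d' - d * c') * f [:: ea x; eb x].
    move=> hf; have [h1 h2 h3] := (alternating2P _).1 hf.
    have z1 y : f [:: 0; y] = 0 by exact: (alt1_0 (alt2_l y hf)).
    have z2 y : f [:: y; 0] = 0 by exact: (alt1_0 (alt2_r y hf)).
    rewrite -[d *: _]addr0 -[d' *: _]addr0 !h1 !h2 !z1 !z2 !h3 (alt_swap hf (eb x)); ring.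
  by rewrite !F // E.
Qed.

(** A variant of the quantification in [meq]: asking z to be nonzero excludes the origin and
    provides the frame, and costs nothing since z is a denominator. *)
Definition generically p (P : V -> Prop) := exists2 h, nonzerodiv X p h &
  \forall x \near p, X x -> zc x != 0 -> h x != 0 -> P x.

Lemma generically_near p P : (\forall x \near p, X x -> zc x != 0 -> P x) -> generically p P.
Proof.
move=> H; exists (@zc R); first exact: nonzerodiv_zc.
by move: H => /nearnP[d d0 Hd]; apply/nearnP; exists d => // x /Hd h Xx z0 _; exact: h.
Qed.

Lemma generically_and p P Q : generically p P -> generically p Q ->
  generically p (fun x => P x /\ Q x).
Proof.
move=> [h1 n1 /nearnP[d1 d10 H1]] [h2 n2 /nearnP[d2 d20 H2]].
exists (fun x => h1 x * h2 x); first exact: nonzerodivM.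
apply/nearnP; exists (Num.min d1 d2); first by rewrite lt_min d10.
move=> x; rewrite lt_min => /andP[/H1 e1 /H2 e2] Xx z0; rewrite mulf_eq0 => /norP[x1 x2].
by split; [exact: e1|exact: e2].
Qed.

Lemma generically_mono p (P Q : V -> Prop) : (forall x, X x -> zc x != 0 -> P x -> Q x) ->
  generically p P -> generically p Q.
Proof.
move=> H [h n /nearnP[d d0 Hd]]; exists h => //; apply/nearnP; exists d => // x /Hd e Xx z0 hx.
by apply: H => //; exact: e.
Qed.

Lemma meq_gen q p a b : meq 2 X q p a b <-> generically p (fun x => same_at X q x a b).
Proof.
split=> [[h n /nearnP[d d0 Hd]]|[h n /nearnP[d d0 Hd]]].
  exists h => //; apply/nearnP; exists d => // x xd Xx z0; apply: (Hd x xd).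
  by apply/(regP k2); split => //; exact: zc_neq0.
exists (fun x => h x * zc x); first by apply: nonzerodivM => //; exact: nonzerodiv_zc.
apply/nearnP; exists d => // x xd /(regP k2)[Xx _]; rewrite mulf_eq0 => /norP[hx z0].
exact: Hd.
Qed.

Lemma coef_meq q p a b : (q <= 2)%N -> generically p (fun x => alternating q (a x)) ->
  generically p (fun x => alternating q (b x)) -> generically p (coef_eq q a b) ->
  meq 2 X q p a b.
Proof.
move=> q2 ha hb hc; apply/meq_gen.
have := generically_and (generically_and ha hb) hc.
by apply: generically_mono => x Xx z0 [[h1 h2] h3]; exact: same_at_coef.
Qed.

Lemma meq_trans q p a b c : meq 2 X q p a b -> meq 2 X q p b c -> meq 2 X q p a c.
Proof.
move=> /meq_gen h1 /meq_gen h2; apply/meq_gen.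
have := generically_and h1 h2; apply: generically_mono => x _ _ [e1 e2] s hs ts.
by rewrite e1 // e2.
Qed.
Lemma meq_eq q p a b : (forall x s, size s = q -> a x s = b x s) -> meq 2 X q p a b.
Proof.
move=> E; apply/meq_gen; apply: generically_near; apply: near_all => x _ _ s hs _.
exact: E.
Qed.

End Frames.

(** * Divisibility by powers of z *)

Section Division.
Variable R : realType.
Local Notation C := R[i].
Local Notation V := 'rV[C]_3.
Lemma near0P (W : normedModType C) (P : W -> Prop) : (\forall w \near (0 : W), P w) <->
  exists2 e : R, 0 < e & forall w, nm w < e -> P w.
Proof.
rewrite nearnP; split=> -[e e0 He]; exists e => // w; first by move=> we; apply: He; rewrite subr0.
by rewrite subr0 => /He.
Qed.

Lemma hol_lip (W : normedModType C) (f : W -> C) u : hol f u -> exists K d : R,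
  [/\ 0 <= K, 0 < d & forall w w', nm (w - u) < d -> nm (w' - u) < d -> nm (f w - f w') <= K * nm (w - w')].
Proof.
move=> /hol_ball[r [M [r0 H]]].
have M0 : 0 <= M by apply: le_trans (H u _).2; rewrite ?nm_ge0 // subrr nm0.
have r2 : 0 < r / 2 by rewrite divr_gt0.
exists (8 * M / (r / 2)), (r / 16); split.
- by rewrite divr_ge0 ?mulr_ge0 // ltW.
- by rewrite divr_gt0.
move=> w w' wr w'r.
have := @lip_ball R W f w' (r / 2) M r2 _ (w - w').
have -> : w' + (w - w') = w by rewrite addrC subrK.
apply.
  move=> y yr; apply: H; rewrite -(subrK w' y) -addrA; apply: (le_lt_trans (nmD _ _)); lra.
rewrite -(subrK u w) -addrA; apply: (le_trans (nmD _ _)).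
by rewrite [nm (u - w')]nm_distC; lra.
Qed.

Lemma accum_zc p : accum (@zc R) p.
Proof.
move=> e e0; have [z0|z0] := eqVneq (zc p) 0; last by exists p => //; rewrite subrr nm0.
exists (p + pt 0 0 (e / 2)%:C).
  rewrite addrC addKr; apply: nm3_lt => //; rewrite cpt ?nm0 //.
  by rewrite nmR gtr0_norm; lra.
have -> : zc (p + pt 0 0 (e / 2)%:C) = (e / 2)%:C by rewrite /zc !mxE /= -/(zc p) z0 add0r.
by rewrite -nm_gt0 nmR gtr0_norm; lra.
Qed.

Implicit Types (x p w : V) (f g : V -> C).

Definition flat w : V := pt (xc w) (yc w) 0.

(** Comparing [w] with its projection [flat w], where [f] vanishes, the Lipschitz estimate gives |f|
    <= K |z|, and Riemann extension divides. *)
Lemma div_zc f : hol f 0 -> (\forall w \near (0 : V), zc w = 0 -> f w = 0) ->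
  exists2 g, hol g 0 & \forall w \near (0 : V), f w = zc w * g w.
Proof.
move=> hf /nearnP[d d0 Hd]; have [K [d' [K0 d'0 HK]]] := hol_lip hf.
have [|g [hg fg]] := @riemann_div R _ f (@zc R) 0 K hf (hol_zc 0) (accum_zc (0 : V)).
  apply/nearnP; exists (Num.min d d'); first by rewrite lt_min d0.
  move=> w; rewrite subr0 lt_min => /andP[wd wd'] _.
  have fl e : 0 < e -> nm w < e -> nm (flat w) < e.
    by move=> e0 we; apply: nm3_lt; rewrite ?cpt ?nm0 //; apply: le_lt_trans we; [exact: nm_xc|exact: nm_yc].
  have fw0 : f (flat w) = 0 by apply: Hd; rewrite ?subr0 ?cpt //; exact: fl.
  have := HK w (flat w); rewrite !subr0 fw0 subr0 => /(_ wd' (fl _ d'0 wd')) h.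
  apply: (le_trans h); rewrite ler_wpM2l //.
  apply/nm_row_le; first exact: nm_ge0.
  apply: ord3P.
  - by rewrite -[X in nm X]/(xc (w - flat w)) xcB cpt subrr nm0 nm_ge0.
  - by rewrite -[X in nm X]/(yc (w - flat w)) ycB cpt subrr nm0 nm_ge0.
  - by rewrite -[X in nm X]/(zc (w - flat w)) zcB cpt subr0.
exists g => //; move: fg => /nearnP[e e0 He]; apply/nearnP; exists e => // w /He ->.
by rewrite mulrC.
Qed.

(** The bound is squared because k/2 need not be an integer. If f = z^j g with 2 j < n, then |g|^2
    is O(|z|), so [g] vanishes on z = 0 and one more factor z comes out; this goes on up to n/2
    rounded up, whence [n.+1]. *)
Lemma pow_div f (K : R) n j : hol f 0 -> (2 * j <= n.+1)%N -> 0 <= K ->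
  (\forall w \near (0 : V), zc w != 0 -> nm (f w) ^+ 2 <= K * nm (zc w) ^+ n) ->
  exists2 g, hol g 0 & \forall w \near (0 : V), f w = zc w ^+ j * g w.
Proof.
move=> hf + K0 /nearnP[d d0 Hd]; elim: j => [|j IH] jn.
  by exists f => //; apply: near_all => w; rewrite expr0 mul1r.
have [|g hg /nearnP[d1 d10 H1]] := IH; first lia.
have [d2 d20 H2] : exists2 d2, 0 < d2 & forall w, nm (w - 0) < d2 -> cdf g w.
  exact: ((nearnP _ _).1 hg).
suff gz : \forall w \near (0 : V), zc w = 0 -> g w = 0.
  have [g' hg' /nearnP[d3 d30 H3]] := div_zc hg gz; exists g' => //.
  apply/nearnP; exists (Num.min d1 d3); first by rewrite lt_min d10.
  by move=> w; rewrite lt_min => /andP[/H1 -> /H3 ->]; rewrite exprSr mulrA.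
pose d3 := Num.min d (Num.min d1 d2).
have d30 : 0 < d3 by rewrite !lt_min d0 d10.
apply/nearnP; exists d3 => // w; rewrite subr0 => wd z0.
apply: nm_le0 => e e0.
have cgw : cdf g w.
  by apply: H2; rewrite subr0; apply: lt_le_trans wd _; rewrite !ge_min lexx !orbT.
have [|a a0 Ha] := cdf_cont cgw (e := e / 2); first by rewrite divr_gt0.
pose b := Num.min (Num.min a (d3 - nm w)) (Num.min 1 ((e / 2) ^+ 2 / (K + 1))).
have K1 : 0 < K + 1 by lra.
have b0' : 0 < b by rewrite !lt_min a0 subr_gt0 wd ltr01 divr_gt0 // exprn_gt0 // divr_gt0.
have [w' w'b z'] := accum_zc w b0'.
move: w'b; rewrite !lt_min => /andP[/andP[wa wb] /andP[w1 wk]].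
have w'd : nm w' < d3 by have := nm_dist w' w; lra.
have zw' : nm (zc w') <= nm (w' - w) by have := nm_zc (w' - w); rewrite zcB z0 subr0.
move: w'd; rewrite !lt_min => /and3P[e1 e2 e3].
have := Hd w'; rewrite subr0 => /(_ e1 z'); rewrite (H1 w') ?subr0 // nmM nmX exprMn -exprM => hh.
have zp : 0 < nm (zc w') by rewrite nm_gt0.
have gw' : nm (g w') ^+ 2 <= (e / 2) ^+ 2.
  have zj : 0 < nm (zc w') ^+ (j * 2) by rewrite exprn_gt0.
  rewrite -(ler_pM2l zj); apply: (le_trans hh).
  have [l nE] : exists l, n = (j * 2 + l.+1)%N by clear -jn; exists (n - (j * 2).+1)%N; lia.
  rewrite nE exprD exprS mulrCA ler_wpM2l ?(ltW zj) //.
  apply: (@le_trans _ _ (K * nm (zc w'))).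
    by rewrite ler_wpM2l // ler_piMr ?nm_ge0 // exprn_ile1 ?nm_ge0 //; move: zw' w1; clear; lra.
  apply: (@le_trans _ _ ((K + 1) * nm (zc w'))); first by rewrite ler_wpM2r ?nm_ge0 // lerDl.
  by rewrite mulrC -ler_pdivlMr //; move: zw' wk; clear; lra.
have gw : nm (g w') <= e / 2 by rewrite -(@ler_pXn2r _ 2) ?nnegrE ?nm_ge0 // divr_ge0 // ltW.
by have := Ha w' wa; have := nm_dist (g w) (g w'); rewrite nm_distC; move: gw; clear; lra.
Qed.

End Division.

(** * Estimates on the axes and on the diagonal of X *)

Section AtZero.
Variable R : realType.
Local Notation C := R[i].
Local Notation V := 'rV[C]_3.
Variable k : nat.
Hypothesis k2 : (2 <= k)%N.
Local Notation X := (Sk R k).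
Let k0 := k0 k2.
Implicit Types (x p w : V) (f g phi : V -> C).

(** Density of z <> 0 in X carries the bound over to the axes, where z = 0. *)
Lemma bound_closed f g1 g2 K : 0 <= K -> hol f 0 -> hol g1 0 -> hol g2 0 ->
  (\forall x \near (0 : V), X x -> zc x != 0 -> nm (f x) <= K * (nm (g1 x) + nm (g2 x))) ->
  \forall x \near (0 : V), X x -> nm (f x) <= K * (nm (g1 x) + nm (g2 x)).
Proof.
move=> K0 /near0P[d1 d10 H1] /near0P[d2 d20 H2] /near0P[d3 d30 H3] /near0P[d d0 Hd].
pose a := Num.min (Num.min d d1) (Num.min d2 d3).
have a0 : 0 < a by rewrite !lt_min d0 d10 d20.
apply/near0P; exists a => // x xa Xx; move: (xa).
rewrite !lt_min => /andP[/andP[xd x1] /andP[x2 x3]].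
apply/ler_addgt0Pl => e e0.
pose e' := e / (2 * (K + 1)).
have K1 : 0 < 2 * (K + 1) by lra.
have e2 : 0 < e / 2 by lra.
have e'0 : 0 < e' / 2 by rewrite !divr_gt0.
have [b1 b10 B1] := cdf_cont (H1 x x1) e2.
have [b2 b20 B2] := cdf_cont (H2 x x2) e'0.
have [b3 b30 B3] := cdf_cont (H3 x x3) e'0.
have [|q [Xq qx zq]] := @zc_dense R k k2 x (Num.min (Num.min b1 b2) (Num.min b3 (a - nm x))) Xx.
  by rewrite !lt_min b10 b20 b30 subr_gt0.
move: qx; rewrite !lt_min => /andP[/andP[q1 q2] /andP[q3 qa]].
have qd : nm q < d.
  have : nm q < a by have := nm_dist q x; move: qa; clear; lra.
  by rewrite !lt_min => /andP[/andP[]].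
have h := Hd q qd Xq zq.
have h1 := B1 q q1; have h2 := B2 q q2; have h3 := B3 q q3.
have n1 := nm_dist (f x) (f q); rewrite nm_distC in n1.
have n2 := nm_dist (g1 q) (g1 x); have n3 := nm_dist (g2 q) (g2 x).
have h4 : K * (nm (g1 q) + nm (g2 q)) <= K * (nm (g1 x) + nm (g2 x)) + K * e'.
  by rewrite -mulrDr ler_wpM2l //; move: n2 n3 h2 h3; clear; lra.
have h5 : K * e' <= e / 2.
  rewrite /e' mulrA ler_pdivrMr // ; have -> : e / 2 * (2 * (K + 1)) = K * e + e by field.
  by move: e0; clear; lra.
by move: h h1 n1 h4 h5; clear; lra.
Qed.

Lemma punctured_zero (q : C -> C) : cdf q 0 -> (\forall t \near (0 : C), t != 0 -> q t = 0) -> q 0 = 0.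
Proof.
move=> cq /near0P[d d0 Hd]; apply: nm_le0 => e e0.
have [a a0 Ha] := cdf_cont cq e0.
pose t := Num.min (d / 2) (a / 2).
have t0 : 0 < t by rewrite lt_min !divr_gt0.
have t1 : t <= d / 2 by rewrite ge_min lexx.
have t2 : t <= a / 2 by rewrite ge_min lexx orbT.
have nt : nm (t%:C : C) = t by rewrite nmR gtr0_norm.
have := Ha t%:C; rewrite subr0 nt Hd ?nt ?sub0r ?nmN; [|lra|by rewrite -nm_gt0 nt].
by move=> h; apply/ltW/h; lra.
Qed.

Lemma X_yaxis (y : C) : X (pt 0 y 0).
Proof. by rewrite /Sk /= !cpt mul0r expr0n gtn_eqF. Qed.
Lemma nm_pty (y : C) (e : R) : 0 < e -> nm y < e -> nm (pt 0 y 0) < e.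
Proof. by move=> e0 ye; apply: nm3_lt; rewrite ?cpt ?nm0. Qed.
(* Read off on the axes of X, where z = 0. *)
Lemma laurent_div_y (P Q : C -> C -> C) (c : C -> C) K : 0 <= K ->
  hol (fun p : V => P (xc p) (zc p)) 0 -> hol (fun p : V => Q (yc p) (zc p)) 0 ->
  hol (fun p : V => c (zc p)) 0 ->
  (\forall p \near (0 : V), X p -> zc p != 0 ->
    nm (c (zc p) + xc p * P (xc p) (zc p) + yc p * Q (yc p) (zc p)) <= K * (nm (xc p) + nm (zc p))) ->
  exists c' Q' : V -> C, [/\ hol c' 0, hol Q' 0 &
    \forall p \near (0 : V), c (zc p) = zc p * c' p /\ Q (yc p) (zc p) = zc p * Q' p].
Proof.
move=> K0 hP hQ hc HK.
have hs : hol (fun p : V => c (zc p) + xc p * P (xc p) (zc p) + yc p * Q (yc p) (zc p)) 0.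
  by apply: holD; [apply: holD => //|]; apply: holM => //; [exact: hol_xc|exact: hol_yc].
have /near0P[d d0 Hd] := bound_closed K0 hs (hol_xc 0) (hol_zc 0) HK.
have A (y : C) : nm y < d -> c 0 + y * Q y 0 = 0.
  move=> yd; have := Hd _ (nm_pty d0 yd) (X_yaxis y).
  rewrite !cpt nm0 addr0 mulr0 mul0r addr0 => h.
  by apply/eqP; rewrite -nm0_eq0; apply/eqP/le_anti; rewrite h nm_ge0.
have c0 : c 0 = 0 by have := A 0; rewrite nm0 mul0r addr0 => ->.
have Q1 (y : C) : nm y < d -> y != 0 -> Q y 0 = 0.
  by move=> yd y0; have /eqP := A y yd; rewrite c0 add0r mulf_eq0 (negPf y0) => /eqP.
have Q0 : Q 0 0 = 0.
  have cl (t : C) : differentiable (fun t : C => pt 0 t 0) t.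
    by apply: (diff_pt (cdf_cst _ _) (cdf_id _) (cdf_cst _ _)).1.
  have := @punctured_zero (fun t => Q t 0); apply; last by apply/near0P; exists d.
  have E : (fun t : C => Q t 0) = (fun t => (fun p : V => Q (yc p) (zc p)) (pt 0 t 0)).
    by apply/funext => t; rewrite !cpt.
  rewrite E; apply: (@cdf_comp _ _ _ (fun t : C => pt 0 t 0) (fun p : V => Q (yc p) (zc p)) 0 (cl 0)).
  have -> : pt 0 0 0 = 0 :> V by apply: pt_eq; rewrite cpt /xc /yc /zc mxE.
  exact: hol_cdf.
have [|c' hc' /near0P[d1 d10 H1]] := div_zc hc.
  by apply: near_all => w ->.
have [|Q' hQ' /near0P[d2 d20 H2]] := div_zc hQ.
  apply/near0P; exists d => // w wd ->; have [->//|y0] := eqVneq (yc w) 0.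
  by apply: Q1 => //; apply: le_lt_trans wd; exact: nm_yc.
exists c', Q'; split => //; apply/near0P; exists (Num.min d1 d2); first by rewrite lt_min d10.
by move=> w; rewrite lt_min => /andP[/H1 -> /H2 ->].
Qed.

Lemma laurent_div_x (P Q : C -> C -> C) (c : C -> C) K : 0 <= K ->
  hol (fun p : V => P (xc p) (zc p)) 0 -> hol (fun p : V => Q (yc p) (zc p)) 0 ->
  hol (fun p : V => c (zc p)) 0 ->
  (\forall p \near (0 : V), X p -> zc p != 0 ->
    nm (c (zc p) + xc p * P (xc p) (zc p) + yc p * Q (yc p) (zc p)) <= K * (nm (yc p) + nm (zc p))) ->
  exists c' P' : V -> C, [/\ hol c' 0, hol P' 0 &
    \forall p \near (0 : V), c (zc p) = zc p * c' p /\ P (xc p) (zc p) = zc p * P' p].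
Proof.
move=> K0 hP hQ hc HK.
have sw0 : swap (0 : V) = 0 by apply: pt_eq; rewrite cpt /xc /yc /zc !mxE.
have hs (f : V -> C) : hol f 0 -> hol (fun q => f (swap q)) 0.
  by move=> hf; have := @hol_swap R f 0 hf; rewrite sw0.
have tr (f : C -> C -> C) : (fun q : V => (fun p : V => f (xc p) (zc p)) (swap q)) =
    (fun q : V => f (yc q) (zc q)) by apply/funext => q; rewrite !cpt.
have tr' (f : C -> C -> C) : (fun q : V => (fun p : V => f (yc p) (zc p)) (swap q)) =
    (fun q : V => f (xc q) (zc q)) by apply/funext => q; rewrite !cpt.
have hP' := hs _ hP; rewrite tr in hP'; have hQ' := hs _ hQ; rewrite tr' in hQ'.
have [|c' [P1 [h1 h2 h3]]] := @laurent_div_y Q P c K K0 hQ' hP' hc.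
  have := near_swap HK; rewrite sw0 => /near0P[d d0 Hd]; apply/near0P; exists d => // p pd Xp z0.
  have := Hd p pd (X_swap Xp); rewrite !cpt => /(_ z0); congr (nm _ <= _); ring.
exists (fun q => c' (swap q)), (fun q => P1 (swap q)); split; [exact: hs|exact: hs|].
have := near_swap h3; rewrite sw0 => /near0P[d d0 Hd]; apply/near0P; exists d => // p /Hd.
by rewrite !cpt.
Qed.

(** Taking the k-th power of a square root of z gives a point with x = y for odd k as well. *)
Lemma diag_point (z : C) : exists x : C, nm x ^+ 2 = nm z ^+ k /\ X (pt x x z).
Proof.
exists (sqrtc z ^+ k); rewrite /Sk /= !cpt -expr2 -nmX -exprM mulnC exprM sqr_sqrtc.
by rewrite nmX.
Qed.

(** [h] is a weight depending on z alone: 1 in degree 1, |z| in degree 2. *)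
Lemma diag_bound (g : C -> C) (h : V -> R) K : 0 <= K ->
  (forall w w', zc w = zc w' -> h w = h w') -> (forall w, 0 <= h w) ->
  (\forall p \near (0 : V), X p -> zc p != 0 -> xc p = yc p ->
     nm (g (zc p)) <= h p * K * (nm (xc p) + nm (yc p))) ->
  \forall w \near (0 : V), zc w != 0 -> nm (g (zc w)) ^+ 2 <= 4 * K ^+ 2 * h w ^+ 2 * nm (zc w) ^+ k.
Proof.
move=> K0 hh h0 /near0P[d d0 Hd].
pose d' := Num.min 1 (Num.min d (d ^+ 2)).
have d'0 : 0 < d' by rewrite !lt_min ltr01 d0 exprn_gt0.
apply/near0P; exists d' => // w wd z0.
have [x [nx Xx]] := diag_point (zc w).
have zd : nm (zc w) < d' by apply: le_lt_trans wd; exact: nm_zc.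
move: zd; rewrite !lt_min => /and3P[z1 zd zd2].
have xd : nm x < d.
  rewrite -(@ltr_pXn2r _ 2) ?nnegrE ?nm_ge0 ?(ltW d0) // nx; apply: le_lt_trans zd2.
  by rewrite -[leRHS]expr1 ler_wiXn2l ?nm_ge0 // ltW.
have pd : nm (pt x x (zc w)) < d by apply: nm3_lt; rewrite ?cpt.
have := Hd _ pd Xx; rewrite !cpt => /(_ z0 erefl).
rewrite (hh _ w) ?cpt // => hb.
have -> : 4 * K ^+ 2 * h w ^+ 2 * nm (zc w) ^+ k = (h w * K * (nm x + nm x)) ^+ 2.
  by rewrite -nx; ring.
by rewrite ler_pXn2r // nnegrE ?nm_ge0 // !mulr_ge0 // addr_ge0 ?nm_ge0.
Qed.

End AtZero.

(** * Upper bounds for alpha *)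

Section Origin.
Variable R : realType.
Local Notation C := R[i].
Local Notation V := 'rV[C]_3.
Variable k : nat.
Hypothesis k2 : (2 <= k)%N.
Local Notation X := (Sk R k).
Local Notation m := k./2.
Implicit Types (x p w : V) (f g phi u v t : V -> C).

Definition Xbhol phi := exists2 e : R, 0 < e & exists K : R, forall p, X p -> p != 0 -> nm p < e ->
  Xhol k p phi /\ nm (phi p) <= K.

Lemma nmnat (n : nat) : nm (n%:R : C) = n%:R.
Proof. by rewrite -(rmorph_nat (real_complex R)) nmR ger0_norm. Qed.

Lemma decomp0 phi : Xbhol phi -> exists P Q : C -> C -> C, exists c : C -> C,
  [/\ hol (fun p : V => P (xc p) (zc p)) 0, hol (fun p : V => Q (yc p) (zc p)) 0,
      hol (fun p : V => c (zc p)) 0 &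
      \forall p \near (0 : V), X p -> zc p != 0 ->
        phi p = c (zc p) + xc p * P (xc p) (zc p) + yc p * Q (yc p) (zc p)].
Proof. by move=> [e e0 [K HK]]; exact: (decomp (k0 k2) e0 HK). Qed.

Lemma half_le : (m + m <= k)%N. Proof. by rewrite addnn -[leqRHS]odd_double_half leq_addl. Qed.
Lemma half_ge : (k <= (m + m).+1)%N.
Proof. by rewrite addnn -[leqLHS]odd_double_half -add1n leq_add2r leq_b1. Qed.
Lemma half_gt0 : (0 < m)%N. Proof. by rewrite half_gt0. Qed.

Theorem origin0 phi : Xbhol phi -> exists2 f, hol f 0 &
  \forall p \near (0 : V), X p -> zc p != 0 -> phi p = f p.
Proof.
move=> /decomp0[P [Q [c [hP hQ hc E]]]].
exists (fun p => c (zc p) + xc p * P (xc p) (zc p) + yc p * Q (yc p) (zc p)) => //.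
by apply: holD; [apply: holD => //|]; apply: holM => //; [exact: hol_xc|exact: hol_yc].
Qed.

(** Here [u] and [v] are the values of a 1-form on [ea] and [eb]. On the y-axis the bound on [u]
    makes c and Q divisible by z, and on the x-axis the bound on [v] does so for d and S; the bound
    on u - v, read on the diagonal, controls c - d. *)
Theorem origin1 u v K : 0 <= K -> Xbhol u -> Xbhol v ->
  (\forall p \near (0 : V), X p -> p != 0 -> [/\ nm (u p) <= K * (nm (xc p) + nm (zc p)),
     nm (v p) <= K * (nm (yc p) + nm (zc p)) & nm (u p - v p) <= K * (nm (xc p) + nm (yc p))]) ->
  exists f1 f2 f3 f : V -> C, [/\ hol f1 0, hol f2 0, hol f3 0 & hol f 0] /\
   \forall p \near (0 : V), X p -> zc p != 0 ->
     u p = k%:R * xc p * f1 p + zc p * f3 p /\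
     v p = k%:R * yc p * f2 p + zc p * f3 p + k%:R * zc p ^+ (k - m) * f p.
Proof.
move=> K0 /decomp0[P [Q [c [hP hQ hc Eu]]]] /decomp0[S [T [d [hS hT hd Ev]]]] HB.
have [|c' [Q' [hc' hQ' Ec]]] := laurent_div_y k2 K0 hP hQ hc.
  apply: (near2 Eu HB) => p e1 e2 Xp z0; rewrite -e1 //.
  by have [] := e2 Xp (zc_neq0 z0).
have [|d' [S' [hd' hS' Ed]]] := laurent_div_x k2 K0 hS hT hd.
  apply: (near2 Ev HB) => p e1 e2 Xp z0; rewrite -e1 //.
  by have [] := e2 Xp (zc_neq0 z0).
have hPS : hol (fun p : V => P (xc p) (zc p) - S (xc p) (zc p)) 0 by exact: holB.
have hQT : hol (fun p : V => Q (yc p) (zc p) - T (yc p) (zc p)) 0 by exact: holB.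
have [B1 [B10 hB1]] := hol_bounded hPS; have [B2 [B20 hB2]] := hol_bounded hQT.
have hcd : hol (fun p : V => c (zc p) - d (zc p)) 0 by exact: holB.
(* On the diagonal c - d is O(|x| + |y|), whose square is O(|z|^k), and k - m is k/2 rounded up. *)
have [e he Ee] : exists2 e, hol e 0 & \forall w \near (0 : V), c (zc w) - d (zc w) = zc w ^+ (k - m) * e w.
  pose L := K + B1 + B2.
  have L0 : 0 <= L by rewrite /L !addr_ge0.
  apply: (@pow_div _ _ (4 * L ^+ 2) k) => //.
  - by have := half_ge; have := half_le; clear; lia.
  - by rewrite mulr_ge0 // exprn_ge0.
  have := @diag_bound R k k2 (fun z => c z - d z) (fun=> 1) L L0 (fun _ _ _ => erefl) (fun _ => ler01).
  move=> H; apply: near1 (H _) _ => {H}; last first.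
    by move=> w h z0; have := h z0; rewrite expr1n mulr1.
  apply: (near2 (nearI Eu Ev) (nearI HB (nearI hB1 hB2))) => p [e1 e2] [e3 [e4 e5]] Xp z0 _.
  have [_ _ b] := e3 Xp (zc_neq0 z0); rewrite e1 // e2 // in b.
  have -> : c (zc p) - d (zc p) = (c (zc p) + xc p * P (xc p) (zc p) + yc p * Q (yc p) (zc p) -
      (d (zc p) + xc p * S (xc p) (zc p) + yc p * T (yc p) (zc p))) -
      (xc p * (P (xc p) (zc p) - S (xc p) (zc p)) + yc p * (Q (yc p) (zc p) - T (yc p) (zc p))) by ring.
  rewrite mul1r; apply: (le_trans (nmB _ _)).
  have n1 : nm (xc p * (P (xc p) (zc p) - S (xc p) (zc p))) <= B1 * nm (xc p).
    by rewrite nmM mulrC ler_wpM2r ?nm_ge0.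
  have n2 : nm (yc p * (Q (yc p) (zc p) - T (yc p) (zc p))) <= B2 * nm (yc p).
    by rewrite nmM mulrC ler_wpM2r ?nm_ge0.
  have x0 := nm_ge0 (xc p); have y0 := nm_ge0 (yc p).
  have -> : L * (nm (xc p) + nm (yc p)) = K * (nm (xc p) + nm (yc p)) +
     (B1 * nm (xc p) + B2 * nm (yc p) + (B1 * nm (yc p) + B2 * nm (xc p))) by rewrite /L; ring.
  apply: lerD => //; apply: (le_trans (nmD _ _)).
  apply: (le_trans (lerD n1 n2)); rewrite lerDl.
  by rewrite addr_ge0 // mulr_ge0.
(* The common part z (c' + y Q' + x S') goes into [f3]. There remains x (P - z S') in u, and y (T -
   z Q') + z (d' - c') in v, where z (d' - c') = - z^(k-m) e. *)
pose ki := (k%:R : C)^-1.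
exists (fun p => ki * (P (xc p) (zc p) - zc p * S' p)), (fun p => ki * (T (yc p) (zc p) - zc p * Q' p)),
  (fun p => c' p + yc p * Q' p + xc p * S' p), (fun p => - ki * e p).
split.
  split.
  - by apply: holM; [exact: hol_cst|apply: holB => //; apply: holM => //; exact: hol_zc].
  - by apply: holM; [exact: hol_cst|apply: holB => //; apply: holM => //; exact: hol_zc].
  - by apply: holD; [apply: holD => //|]; apply: holM => //; [exact: hol_yc|exact: hol_xc].
  - by apply: holM => //; exact: hol_cst.
apply: (near2 (nearI Eu Ev) (nearI Ec (nearI Ed Ee))) => p [e1 e2] [[e3 e4] [[e5 e6] e7]] Xp z0.
rewrite e1 // e2 // e3 e4 e5 e6.
have kk := kC R k2.
have K1 : k%:R * ki = 1 by rewrite /ki divff.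
split.
  have -> : k%:R * xc p * (ki * (P (xc p) (zc p) - zc p * S' p)) =
    (k%:R * ki) * (xc p * (P (xc p) (zc p) - zc p * S' p)) by ring.
  by rewrite K1; ring.
have -> : k%:R * yc p * (ki * (T (yc p) (zc p) - zc p * Q' p)) =
    (k%:R * ki) * (yc p * (T (yc p) (zc p) - zc p * Q' p)) by ring.
have -> : k%:R * zc p ^+ (k - m) * (- ki * e p) = - (k%:R * ki) * (zc p ^+ (k - m) * e p) by ring.
by rewrite K1 -e7 e3 e5; ring.
Qed.

(** Here [t] is the value of a 2-form on ([ea], [eb]). Near the origin the bound is at most 3 K |z|,
    so c, P and Q are divisible by z. On the diagonal |x| = |y| <= |z|, and the bound becomes O(|z|
    (|x| + |y|)), one power of z better than in degree 1. *)
Theorem origin2 t K : 0 <= K -> Xbhol t ->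
  (\forall p \near (0 : V), X p -> p != 0 ->
     nm (t p) <= K * (nm (xc p * yc p) + nm (xc p * zc p) + nm (yc p * zc p))) ->
  exists f1 f2 f : V -> C, [/\ hol f1 0, hol f2 0 & hol f 0] /\
   \forall p \near (0 : V), X p -> zc p != 0 ->
     t p = k%:R * xc p * zc p * f1 p - k%:R * yc p * zc p * f2 p + k%:R ^+ 2 * zc p ^+ (k - (m - 1)) * f p.
Proof.
move=> K0 /decomp0[P [Q [c [hP hQ hc E]]]] HB.
have one : \forall p \near (0 : V), nm p < 1 by apply/near0P; exists 1.
have small p : nm p < 1 -> [/\ nm (xc p) <= 1, nm (yc p) <= 1 & nm (zc p) <= 1].
  by move=> p1; split; apply/ltW; apply: le_lt_trans p1; [exact: nm_xc|exact: nm_yc|exact: nm_zc].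
have zk p : X p -> nm p < 1 -> nm (xc p * yc p) <= nm (zc p).
  move=> Xp /small[_ _ z1]; rewrite (Xeq Xp) nmX -[leRHS]expr1 ler_wiXn2l ?nm_ge0 //.
  by move: k2; clear; lia.
have bz p : X p -> nm p < 1 -> nm (xc p * yc p) + nm (xc p * zc p) + nm (yc p * zc p) <= 3 * nm (zc p).
  move=> Xp p1; have := zk p Xp p1; have [x1 y1 z1] := small p p1.
  have : nm (xc p * zc p) <= nm (zc p) by rewrite nmM ler_piMl ?nm_ge0.
  have : nm (yc p * zc p) <= nm (zc p) by rewrite nmM ler_piMl ?nm_ge0.
  lra.
have K3 : 0 <= 3 * K by rewrite mulr_ge0.
have B p : X p -> nm p < 1 -> K * (nm (xc p * yc p) + nm (xc p * zc p) + nm (yc p * zc p)) <= 3 * K * nm (zc p).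
  by move=> Xp p1; rewrite [3 * K]mulrC -mulrA ler_wpM2l // bz.
have [|c' [Q' [hc' hQ' Ec]]] := laurent_div_y k2 K3 hP hQ hc.
  apply: (near2 E (nearI HB one)) => p e1 [e2 e3] Xp z0; rewrite -e1 //.
  apply: (le_trans (e2 Xp (zc_neq0 z0))); apply: (le_trans (B p Xp e3)).
  by rewrite ler_wpM2l // lerDr nm_ge0.
have [|c'' [P' [_ hP' Ec']]] := laurent_div_x k2 K3 hP hQ hc.
  apply: (near2 E (nearI HB one)) => p e1 [e2 e3] Xp z0; rewrite -e1 //.
  apply: (le_trans (e2 Xp (zc_neq0 z0))); apply: (le_trans (B p Xp e3)).
  by rewrite ler_wpM2l // lerDr nm_ge0.
have [B1 [B10 hB1]] := hol_bounded hP'; have [B2 [B20 hB2]] := hol_bounded hQ'.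
have [e he Ee] : exists2 e, hol e 0 & \forall w \near (0 : V), c (zc w) = zc w ^+ (k - (m - 1)) * e w.
  pose L := 2 * K + B1 + B2.
  have L0 : 0 <= L by rewrite /L !addr_ge0 // mulr_ge0.
  (* The weight |z| adds two to the exponent of the squared bound, hence one to the order in z. *)
  apply: (@pow_div _ _ (4 * L ^+ 2) k.+2) => //.
  - by have := half_ge; have := half_le; have := half_gt0; clear; lia.
  - by rewrite mulr_ge0 // exprn_ge0.
  have := @diag_bound R k k2 c (fun w => nm (zc w)) L L0 _ (fun w => nm_ge0 _).
  move=> H; apply: near1 (H _ _) _ => {H}; first by move=> w w' ->.
    apply: (near2 E (nearI (nearI HB one) (nearI Ec' (nearI Ec (nearI hB1 hB2))))).
    move=> p e1 [[e2 e3] [[_ e4] [[_ e5] [e6 e7]]]] Xp z0 xy.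
    have b := e2 Xp (zc_neq0 z0); rewrite e1 // e4 e5 in b.
    have xz : nm (xc p) <= nm (zc p).
      rewrite -(@ler_pXn2r _ 2) ?nnegrE ?nm_ge0 // expr2 -nmM {2}xy (Xeq Xp) nmX.
      by rewrite ler_wiXn2l ?nm_ge0 //; have [_ _] := small p e3.
    have n1 : K * (nm (xc p * yc p) + nm (xc p * zc p) + nm (yc p * zc p)) <=
        2 * K * nm (zc p) * (nm (xc p) + nm (yc p)).
      have -> : 2 * K * nm (zc p) * (nm (xc p) + nm (yc p)) =
         K * (2 * nm (zc p) * (nm (xc p) + nm (yc p))) by ring.
      rewrite ler_wpM2l // !nmM -!xy.
      have : nm (xc p) * nm (xc p) <= nm (xc p) * nm (zc p) by rewrite ler_wpM2l ?nm_ge0.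
      have : 0 <= nm (xc p) * nm (zc p) by rewrite mulr_ge0 ?nm_ge0.
      have -> : 2 * nm (zc p) * (nm (xc p) + nm (xc p)) = 4 * (nm (xc p) * nm (zc p)) by ring.
      lra.
    have -> : c (zc p) = (c (zc p) + xc p * (zc p * P' p) + yc p * (zc p * Q' p)) -
        (zc p * xc p * P' p + zc p * yc p * Q' p) by ring.
    apply: (le_trans (nmB _ _)); apply: (le_trans (lerD (le_trans b n1) (nmD _ _))).
    have m1 : nm (zc p * xc p * P' p) <= B1 * (nm (zc p) * nm (xc p)).
      by rewrite nmM mulrC nmM ler_wpM2r // mulr_ge0 ?nm_ge0.
    have m2 : nm (zc p * yc p * Q' p) <= B2 * (nm (zc p) * nm (yc p)).
      by rewrite nmM mulrC nmM ler_wpM2r // mulr_ge0 ?nm_ge0.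
    apply: (le_trans (lerD (lexx _) (lerD m1 m2))).
    have -> : nm (zc p) * L * (nm (xc p) + nm (yc p)) = 2 * K * nm (zc p) * (nm (xc p) + nm (yc p)) +
      (B1 * (nm (zc p) * nm (xc p)) + B2 * (nm (zc p) * nm (yc p))) +
      (B1 * (nm (zc p) * nm (yc p)) + B2 * (nm (zc p) * nm (xc p))) by rewrite /L; ring.
    by rewrite lerDl addr_ge0 // !mulr_ge0 ?nm_ge0.
  move=> w h z0; have := h z0.
  by rewrite -mulrA -exprD.
pose ki := (k%:R : C)^-1.
exists (fun p => ki * P' p), (fun p => - ki * Q' p), (fun p => ki ^+ 2 * e p).
split.
  by split; apply: holM => //; exact: hol_cst.
apply: (near2 E (nearI Ec (nearI Ec' Ee))) => p e1 [[_ e2] [[_ e3] e4]] Xp z0.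
rewrite e1 // e2 e3 e4.
have kk := kC R k2.
have K1 : k%:R * ki = 1 by rewrite /ki divff.
have -> : k%:R * xc p * zc p * (ki * P' p) - k%:R * yc p * zc p * (- ki * Q' p) +
   k%:R ^+ 2 * zc p ^+ (k - (m - 1)) * (ki ^+ 2 * e p) =
   (k%:R * ki) * (xc p * zc p * P' p) + (k%:R * ki) * (yc p * zc p * Q' p) +
   (k%:R * ki) ^+ 2 * (zc p ^+ (k - (m - 1)) * e p) by ring.
by rewrite K1; ring.
Qed.

End Origin.

(** * From sections of alpha to the listed generators *)

Section AlphaSub.
Variable R : realType.
Local Notation C := R[i].
Local Notation V := 'rV[C]_3.
Local Notation form := (form R 3).
Variable k : nat.
Hypothesis k2 : (2 <= k)%N.
Local Notation X := (Sk R k).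
Local Notation m := k./2.
Local Notation ea := (@ea R k).
Local Notation eb := (@eb R k).
Implicit Types (x p u v : V) (a b c w : form).

Definition hol_field (e : V -> V) p :=
  [/\ hol (fun x => xc (e x)) p, hol (fun x => yc (e x)) p & hol (fun x => zc (e x)) p].

Lemma hol_pt (f g h : V -> C) p : hol f p -> hol g p -> hol h p ->
  hol_field (fun x => pt (f x) (g x) (h x)) p.
Proof.
move=> hf hg hh; split.
- by rewrite (_ : (fun _ => _) = f) //; apply/funext => x; rewrite cpt.
- by rewrite (_ : (fun _ => _) = g) //; apply/funext => x; rewrite cpt.
- by rewrite (_ : (fun _ => _) = h) //; apply/funext => x; rewrite cpt.
Qed.

Lemma hol_ea p : hol_field ea p.
Proof.
by apply: hol_pt; [apply: holM; [exact: hol_cst|exact: hol_xc]|exact: hol_cst|exact: hol_zc].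
Qed.
Lemma hol_eb p : hol_field eb p.
Proof.
by apply: hol_pt; [exact: hol_cst|apply: holM; [exact: hol_cst|exact: hol_yc]|exact: hol_zc].
Qed.

Lemma hol_eval1 p w e : holo_form 1 p w -> hol_field e p -> hol (fun x => w x [:: e x]) p.
Proof.
move=> hw [h1 h2 h3]; have [/nearnP[d d0 Hd] _] := hw.
apply: (@hol_eq _ _ (fun x => xc (e x) * w x [:: b0 R] + yc (e x) * w x [:: b1 R] + zc (e x) * w x [:: b2 R])).
  by apply/nearnP; exists d => // x /Hd hx; rewrite (alt1E hx (e x)).
by apply: holD; [apply: holD|]; apply: holM => //; exact: holo_form_coef hw _.
Qed.

Lemma hol_eval2 p w e e' : holo_form 2 p w -> hol_field e p -> hol_field e' p ->
  hol (fun x => w x [:: e x; e' x]) p.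
Proof.
move=> hw [h1 h2 h3] [h4 h5 h6]; have [/nearnP[d d0 Hd] _] := hw.
apply: (@hol_eq _ _ (fun x =>
  (xc (e x) * yc (e' x) - yc (e x) * xc (e' x)) * w x [:: b0 R; b1 R] +
  (xc (e x) * zc (e' x) - zc (e x) * xc (e' x)) * w x [:: b0 R; b2 R] +
  (yc (e x) * zc (e' x) - zc (e x) * yc (e' x)) * w x [:: b1 R; b2 R])).
  by apply/nearnP; exists d => // x /Hd hx; rewrite (alt2E hx (e x) (e' x)).
apply: holD; [apply: holD|]; (apply: holM; last exact: holo_form_coef hw _);
  by apply: holB; exact: holM.
Qed.

Lemma tangentZ x v (c : C) : tangent X x v -> tangent X x (c *: v).
Proof. by move=> tv f hf f0; rewrite linearZ /= (tv f hf f0) scaler0. Qed.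

Section Sums.
Variables (q J : nat) (p : V) (rho : 'I_J -> V -> C) (w : 'I_J -> form) (a : form).
Hypothesis ma : mero 2 X q p a.
Hypothesis sr : forall j, smooth_bounded 2 X p (rho j).
Hypothesis hw : forall j, holo_form q p (w j).

Definition rsum : form := fun x s => \sum_(j < J) rho j x * w j x s.
Hypothesis mE : meq 2 X q p a rsum.

Lemma rsum_alt : \forall x \near p, alternating q (rsum x).
Proof.
have : \forall x \near p, forall j, alternating q (w j x).
  have /choice[d Hd] : forall j, exists d : R, 0 < d /\ forall x, nm (x - p) < d -> alternating q (w j x).
    by move=> j; have /nearnP[d d0 Hd] := holo_alternating (hw j); exists d.
  apply/nearnP; exists (\big[Num.min/1]_j d j).
    by elim/big_ind: _ => // [y z y0 z0|j _]; [rewrite lt_min y0|exact: (Hd j).1].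
  move=> x xd j; apply: (Hd j).2; apply: (lt_le_trans xd).
  by rewrite (bigD1 j) //= ge_min lexx.
move=> /nearnP[d d0 Hd]; apply/nearnP; exists d => // x /Hd hx.
by apply: alternating_sum => j; exact: alternatingZ.
Qed.

Lemma near_forall n (P : 'I_n -> V -> Prop) : (forall j, \forall x \near p, P j x) ->
  \forall x \near p, forall j, P j x.
Proof.
move=> H; have /choice[d Hd] : forall j, exists d : R, 0 < d /\ forall x, nm (x - p) < d -> P j x.
  by move=> j; have /nearnP[d d0 Hd] := H j; exists d.
apply/nearnP; exists (\big[Num.min/1]_j d j).
  by elim/big_ind: _ => // [y z y0 z0|j _]; [rewrite lt_min y0|exact: (Hd j).1].
move=> x xd j; apply: (Hd j).2; apply: (lt_le_trans xd).
by rewrite (bigD1 j) //= ge_min lexx.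
Qed.

(** The section is both a meromorphic quotient and a sum with coefficients continuous off the
    origin; on a holomorphic tangent field it is thus a continuous quotient, and [Xhol_quot]
    applies. *)
Lemma rsum_Xhol (E : V -> seq V) : (forall x, size (E x) = q) ->
  (\forall x \near p, X x -> zc x != 0 -> forall v, v \in E x -> tangent X x v) ->
  (forall w', holo_form q p w' -> hol (fun x => w' x (E x)) p) ->
  \forall x \near p, X x -> x != 0 -> Xhol k x (fun x => rsum x (E x)).
Proof.
move=> sE /nearnP[d1 d10 tE] hE.
have [h1 [w1 [n1 hw1 m1]]] := ma.
have [h2 n2 /nearnP[d2 d20 H2]] := (meq_gen k2 _ _ _ _).1 m1.
have [h3 n3 /nearnP[d3 d30 H3]] := (meq_gen k2 _ _ _ _).1 mE.
have hh2 := (holo_hol _ _).1 n2.1; have hh3 := (holo_hol _ _).1 n3.1.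
(* The extra factor makes a nonzero denominator guarantee that both representations of the section
   are valid at the point. *)
apply: (@Xhol_quot R k k2 p _ (fun x => w1 x (E x) * (h2 x * h3 x)) (fun x => h1 x * (h2 x * h3 x))).
- by apply: holM; [exact: hE|exact: holM].
- by do 2 (apply: nonzerodivM => //).
- apply/nearnP; exists (Num.min d1 (Num.min d2 d3)); first by rewrite !lt_min d10 d20.
  move=> x; rewrite !lt_min => /and3P[x1 x2 x3] Xx z0; rewrite !mulf_eq0 !negb_or => /and3P[e1 e2 e3].
  have t := tE x x1 Xx z0.
  rewrite -(H3 x x3 Xx z0 e3 (E x) (sE x) t) (H2 x x2 Xx z0 e2 (E x) (sE x) t).
  by field.
- have c1 := near_forall (fun j => smooth_bounded_cont k2 (sr j)).
  have c2 := near_forall (fun j => hol_Xcont k (hE _ (hw j))).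
  have /nearnP[a1 a10 A1] := c1; have /nearnP[a2 a20 A2] := c2.
  apply/nearnP; exists (Num.min a1 a2); first by rewrite lt_min a10.
  move=> x; rewrite lt_min => /andP[/A1 x1 /A2 x2] Xx x0.
  by apply: Xcont_sum => j; apply: XcontM; [exact: x1|exact: x2].
Qed.

Lemma rsum_bound0 s : p = 0 -> size s = q -> exists B : R, 0 <= B /\
  \forall x \near (0 : V), X x -> x != 0 -> nm (rsum x s) <= B.
Proof.
move=> p0 ss.
have /choice[B HB] : forall j, exists B : R, 0 <= B /\
    \forall x \near (0 : V), X x -> x != 0 -> nm (rho j x * w j x s) <= B.
  move=> j; have := sr j; rewrite p0 => /(smooth_bounded_bound0 k2)[B1 H1].
  have hj := holo_form_coef (hw j) ss; rewrite p0 in hj.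
  have [B2 [B20 H2]] := hol_bounded hj.
  exists (`|B1| * B2); split; first by rewrite mulr_ge0.
  apply: (near2 H1 H2) => x e1 e2 Xx x0; rewrite nmM; apply: ler_pM; rewrite ?nm_ge0 //.
  by apply: le_trans (e1 Xx x0) _; exact: ler_norm.
exists (\sum_j B j); split; first by rewrite sumr_ge0 // => j _; exact: (HB j).1.
(* [near_forall] lives at [p], so the bounds at 0 are transported along [p = 0] and back. *)
have c := near_forall (fun j => eq_rect _ (fun y => \forall x \near y, X x -> x != 0 -> nm (rho j x * w j x s) <= B j) (HB j).2 _ (esym p0)).
rewrite p0 in c; apply: (near1 c) => x cx Xx x0; rewrite /rsum.
elim/big_ind2: _ => [|y b y' b' h1 h2|j _]; first by rewrite nm0.
  by apply: (le_trans (nmD _ _)); exact: lerD.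
exact: cx.
Qed.

Lemma rsum_Xbhol (E : V -> seq V) : p = 0 -> (forall x, size (E x) = q) ->
  (\forall x \near p, X x -> zc x != 0 -> forall v, v \in E x -> tangent X x v) ->
  (forall w', holo_form q p w' -> hol (fun x => w' x (E x)) p) ->
  Xbhol k (fun x => rsum x (E x)).
Proof.
move=> p0 sE tE hE; have H := rsum_Xhol sE tE hE; rewrite p0 in H.
have /choice[B HB] : forall j, exists B : R,
    \forall x \near (0 : V), X x -> x != 0 -> nm (rho j x * w j x (E x)) <= B.
  move=> j; have := sr j; rewrite p0 => /(smooth_bounded_bound0 k2)[B1 H1].
  have hj := hE _ (hw j); rewrite p0 in hj.
  have [B2 [B20 H2]] := hol_bounded hj.
  exists (`|B1| * B2).
  apply: (near2 H1 H2) => x e1 e2 Xx x0; rewrite nmM; apply: ler_pM; rewrite ?nm_ge0 //.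
  by apply: le_trans (e1 Xx x0) _; exact: ler_norm.
have c := near_forall (fun j => eq_rect _ (fun y => \forall x \near y, X x -> x != 0 -> nm (rho j x * w j x (E x)) <= B j) (HB j) _ (esym p0)).
rewrite p0 in c; have /near0P[d d0 Hd] := nearI H c.
exists d => //; exists (\sum_j B j) => x Xx x0 xd; have [h1 h2] := Hd x xd.
split; first exact: h1.
rewrite /rsum; elim/big_ind2: _ => [|y b y' b' e1 e2|j _]; first by rewrite nm0.
  by apply: (le_trans (nmD _ _)); exact: lerD.
exact: h2.
Qed.

End Sums.

Lemma alternating_xdy n x : alternating 1 (xdy_over_z n x : seq V -> C).
Proof.
apply: alternating_ext (alternatingZ (xc x / zc x ^+ n) (alternating_d 1 x)) => s _.
by rewrite /xdy_over_z /dy mulrAC.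
Qed.
Lemma alternating_dxdy n x : alternating 2 (dxdy_over_z n x : seq V -> C).
Proof.
have h := alternating_w12 (alternating_d 0 x) (alternating_d 1 x).
by apply: alternating_ext (alternatingZ (zc x ^+ n)^-1 h) => s _; rewrite mulrC.
Qed.

Lemma xdy_ea n x : xdy_over_z n x [:: ea x] = 0.
Proof. by rewrite /xdy_over_z /dy /dcoord /= -/(yc _) cpt mulr0 mul0r. Qed.
Lemma zk_split n x : (n <= k)%N -> zc x ^+ k = zc x ^+ (k - n) * zc x ^+ n.
Proof. by move=> nk; rewrite -exprD subnK. Qed.
Lemma xdy_eb n x : X x -> zc x != 0 -> (n <= k)%N -> xdy_over_z n x [:: eb x] = k%:R * zc x ^+ (k - n).
Proof.
move=> Xx z0 nk; rewrite /xdy_over_z /dy /dcoord /= -/(yc _) cpt mulrCA (Xeq Xx).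
by rewrite (zk_split x nk) mulrA mulfK ?expf_neq0.
Qed.
Lemma dxdy_e n x : X x -> zc x != 0 -> (n <= k)%N ->
  dxdy_over_z n x [:: ea x; eb x] = k%:R ^+ 2 * zc x ^+ (k - n).
Proof.
move=> Xx z0 nk; rewrite /dxdy_over_z wedge12 /dx /dy /dcoord /= -!/(xc _) -!/(yc _) !cpt.
rewrite mul0r subr0.
have -> : k%:R * xc x * (k%:R * yc x) = k%:R ^+ 2 * (xc x * yc x) by ring.
by rewrite (Xeq Xx) (zk_split x nk) mulrA mulfK ?expf_neq0.
Qed.

Lemma omega_plus_intro q p a F w (f : V -> C) theta : (q <= 2)%N ->
  meq 2 X q p a F -> (\forall x \near p, alternating q (F x)) ->
  (forall x, alternating q (theta x)) -> holo_form q p w -> hol f p ->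
  (\forall x \near p, X x -> zc x != 0 -> coef_eq k q F (fun x s => w x s + f x * theta x s) x) ->
  Omega_tf_plus 2 X q theta p a.
Proof.
move=> q2 aF altF altT hw hf E; exists w, f; split => //; first exact/holo_hol.
apply: (meq_trans k2 aF); apply: (coef_meq k2 q2).
- by apply: generically_near => //; move: altF => /nearnP[d d0 Hd]; apply/nearnP; exists d => // x /Hd.
- apply: generically_near => //; have /nearnP[d d0 Hd] := holo_alternating hw.
  apply/nearnP; exists d => // x /Hd hx _ _.
  by apply: alternatingD => //; exact: alternatingZ.
- exact: generically_near.
Qed.

Lemma tangent_ea_near p : \forall x \near p, X x -> zc x != 0 -> forall v, v \in [:: ea x] -> tangent X x v.
Proof. by apply: near_all => x Xx _ v; rewrite inE => /eqP ->; exact: tangent_ea. Qed.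
Lemma tangent_eb_near p : \forall x \near p, X x -> zc x != 0 -> forall v, v \in [:: eb x] -> tangent X x v.
Proof. by apply: near_all => x Xx _ v; rewrite inE => /eqP ->; exact: tangent_eb. Qed.
Lemma tangent_eab_near p : \forall x \near p, X x -> zc x != 0 -> forall v, v \in [:: ea x; eb x] -> tangent X x v.
Proof.
by apply: near_all => x Xx _ v; rewrite !inE => /orP[] /eqP ->; [exact: tangent_ea|exact: tangent_eb].
Qed.

Lemma alpha0_sub p a : X p -> alpha 2 X 0 p a -> Omega_tf 2 X 0 p a.
Proof.
move=> Xp [[ma _] [J [rho [w [sr hw mE]]]]].
have tE : \forall x \near p, X x -> zc x != 0 -> forall v, v \in [::] -> tangent X x v.
  by apply: near_all.
have hE w' : holo_form 0 p w' -> hol (fun x => w' x [::]) p by move=> /holo_form0.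
have [f hf E] : exists2 f : V -> C, hol f p &
    \forall x \near p, X x -> zc x != 0 -> rsum rho w x [::] = f x.
  have [p0|p0] := eqVneq p 0.
    have := rsum_Xbhol ma sr hw mE p0 (E := fun=> [::]) (fun=> erefl) tE hE.
    by move=> /(origin0 k2); rewrite p0.
  have [f hf E] := nbhs_singleton (rsum_Xhol ma sr hw mE (E := fun=> [::]) (fun=> erefl) tE hE) Xp p0.
  by exists f => //; move: E => /nearnP[d d0 Hd]; apply/nearnP; exists d => // x /Hd h Xx _; exact: h.
exists (fun x _ => f x); first exact/holo_form0.
apply: (meq_trans k2 mE); apply: (coef_meq k2) => //.
- by apply: generically_near => //; apply: near_all => x _ _; exact: alternating0.
- by apply: generically_near => //; apply: near_all => x _ _; exact: alternating0.
- exact: generically_near.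
Qed.

Lemma holo_field_ez p : xc p != 0 -> hol_field (fun x => pt 0 (k%:R * zc x ^+ k.-1 / xc x) 1) p.
Proof.
move=> x0; apply: hol_pt; [exact: hol_cst| |exact: hol_cst].
apply: hol_div => //; last exact: hol_xc.
by apply: holM; [exact: hol_cst|apply: holX; exact: hol_zc].
Qed.
Lemma holo_field_ez' p : yc p != 0 -> hol_field (fun x => pt (k%:R * zc x ^+ k.-1 / yc x) 0 1) p.
Proof.
move=> x0; apply: hol_pt; [|exact: hol_cst|exact: hol_cst].
apply: hol_div => //; last exact: hol_yc.
by apply: holM; [exact: hol_cst|apply: holX; exact: hol_zc].
Qed.

(** The field [eb] divided by z. [ea] and [eb] no longer span the tangent plane where z = 0, but
    [ea] and [ez] do wherever x is nonzero; [ez'] is the symmetric choice for y. *)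
Definition ez x : V := pt 0 (k%:R * zc x ^+ k.-1 / xc x) 1.
Definition ez' x : V := pt (k%:R * zc x ^+ k.-1 / yc x) 0 1.

Lemma eb_ez x : X x -> zc x != 0 -> eb x = zc x *: ez x.
Proof.
move=> Xx z0; have [x0 y0] := X_z Xx z0.
have E : zc x * zc x ^+ k.-1 = xc x * yc x by rewrite -exprS prednK ?(k0 k2) // (Xeq Xx).
apply: pt_eq; rewrite /xc /yc /zc !mxE /= -?/(xc _) -?/(yc _) -?/(zc _); [by rewrite mulr0| |by rewrite mulr1].
have -> : zc x * (k%:R * zc x ^+ k.-1 / xc x) = k%:R * (zc x * zc x ^+ k.-1) / xc x by ring.
by rewrite E; field.
Qed.
Lemma ea_ez x : X x -> zc x != 0 -> ea x = zc x *: ez' x.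
Proof.
move=> Xx z0; have [x0 y0] := X_z Xx z0.
have E : zc x * zc x ^+ k.-1 = xc x * yc x by rewrite -exprS prednK ?(k0 k2) // (Xeq Xx).
apply: pt_eq; rewrite /xc /yc /zc !mxE /= -?/(xc _) -?/(yc _) -?/(zc _); [|by rewrite mulr0|by rewrite mulr1].
have -> : zc x * (k%:R * zc x ^+ k.-1 / yc x) = k%:R * (zc x * zc x ^+ k.-1) / yc x by ring.
by rewrite E; field.
Qed.

Lemma tangent_ez x : X x -> zc x != 0 -> tangent X x (ez x).
Proof.
move=> Xx z0; rewrite -[ez x]scale1r -(mulVf z0) -scalerA -eb_ez //.
by apply: tangentZ; exact: tangent_eb.
Qed.
Lemma tangent_ez' x : X x -> zc x != 0 -> tangent X x (ez' x).
Proof.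
move=> Xx z0; rewrite -[ez' x]scale1r -(mulVf z0) -scalerA -ea_ez //.
by apply: tangentZ; exact: tangent_ea.
Qed.

Lemma alt1Z (f : seq V -> C) (c : C) v : alternating 1 f -> f [:: c *: v] = c * f [:: v].
Proof. by move=> hf; have := (alternating1P _).1 hf c v 0; rewrite addr0 (alt1_0 hf) addr0. Qed.

Lemma alpha1_sub p a : X p -> alpha 2 X 1 p a -> Omega_tf_plus 2 X 1 (xdy_over_z m) p a.
Proof.
move=> Xp [[ma _] [J [rho [w [sr hw mE]]]]].
have hEa w' : holo_form 1 p w' -> hol (fun x => w' x [:: ea x]) p by move=> h; exact: hol_eval1 h (hol_ea p).
have hEb w' : holo_form 1 p w' -> hol (fun x => w' x [:: eb x]) p by move=> h; exact: hol_eval1 h (hol_eb p).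
have altF := rsum_alt rho hw.
have mk : (m <= k)%N by have := half_le k; clear; lia.
have kk := kC R k2.
have intro1 (f1 f2 f3 f : V -> C) : hol f1 p -> hol f2 p -> hol f3 p -> hol f p ->
    (\forall x \near p, X x -> zc x != 0 ->
      rsum rho w x [:: ea x] = k%:R * xc x * f1 x + zc x * f3 x /\
      rsum rho w x [:: eb x] = k%:R * yc x * f2 x + zc x * f3 x + k%:R * zc x ^+ (k - m) * f x) ->
    Omega_tf_plus 2 X 1 (xdy_over_z m) p a.
  move=> h1 h2 h3 hf E.
  apply: (omega_plus_intro (isT : (1 <= 2)%N) mE altF (alternating_xdy m) (holo_form1 h1 h2 h3) hf).
  move: E => /nearnP[d d0 Hd]; apply/nearnP; exists d => // x /Hd e Xx z0; have [e1 e2] := e Xx z0.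
  split; [apply: (etrans e1)|apply: (etrans e2)]; rewrite form1E !cpt ?xdy_ea ?xdy_eb //; ring.
have [p0|p0] := eqVneq p 0.
  have ub := rsum_Xbhol ma sr hw mE p0 (E := fun x => [:: ea x]) (fun=> erefl) (tangent_ea_near p) hEa.
  have vb := rsum_Xbhol ma sr hw mE p0 (E := fun x => [:: eb x]) (fun=> erefl) (tangent_eb_near p) hEb.
  have [B0 [B00 H0]] := rsum_bound0 sr hw p0 (erefl (size [:: b0 R])).
  have [B1 [B10 H1]] := rsum_bound0 sr hw p0 (erefl (size [:: b1 R])).
  have [B2 [B20 H2]] := rsum_bound0 sr hw p0 (erefl (size [:: b2 R])).
  (* [B0], [B1], [B2] bound the coefficients of the section on the basis, and the components of [ea]
     and [eb] are k x, k y and z. *)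
  pose K := k%:R * (B0 + B1 + B2).
  have kR : 1 <= k%:R :> R by rewrite ler1n (k0 k2).
  have K0 : 0 <= K by rewrite /K mulr_ge0 ?addr_ge0.
  have altF0 := altF; rewrite p0 in altF0.
  have [|f1 [f2 [f3 [f [[h1 h2 h3 hf] E]]]]] := origin1 k2 K0 ub vb; last first.
    by apply: (intro1 f1 f2 f3 f); rewrite p0.
  apply: (near2 (nearI H0 H1) (nearI H2 altF0)) => x [e0 e1] [e2 ax] Xx x0.
  have {}e0 := e0 Xx x0; have {}e1 := e1 Xx x0; have {}e2 := e2 Xx x0.
  rewrite !(alt1E ax (ea x)) !(alt1E ax (eb x)) !cpt.
  set A0 := rsum _ _ _ [:: b0 R] in e0 *; set A1 := rsum _ _ _ [:: b1 R] in e1 *.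
  set A2 := rsum _ _ _ [:: b2 R] in e2 *.
  have X0 := nm_ge0 (xc x); have Y0 := nm_ge0 (yc x); have Z0 := nm_ge0 (zc x).
  have nk : nm (k%:R : C) = k%:R by exact: nmnat.
  have Bk (B : R) : 0 <= B -> B <= B0 + B1 + B2 -> k%:R * B <= K.
    by move=> b b'; rewrite /K ler_wpM2l.
  have B0k := Bk B0 B00; have B1k := Bk B1 B10; have B2k := Bk B2 B20.
  have P (t1 s1 : C) (B : R) : 0 <= B -> B <= B0 + B1 + B2 -> nm s1 <= B -> nm (k%:R * t1 * s1) <= K * nm t1.
    move=> b b' h; rewrite !nmM nk mulrAC ler_wpM2r ?nm_ge0 //.
    by apply: le_trans (Bk B b b'); rewrite ler_wpM2l.
  have P' (t1 s1 : C) (B : R) : 0 <= B -> B <= B0 + B1 + B2 -> nm s1 <= B -> nm (t1 * s1) <= K * nm t1.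
    move=> b b' h; rewrite nmM mulrC ler_wpM2r ?nm_ge0 //.
    apply: le_trans (Bk B b b'); apply: (le_trans h); by rewrite ler_peMl.
  have s0 : B0 <= B0 + B1 + B2 by rewrite -addrA lerDl addr_ge0.
  have s1 : B1 <= B0 + B1 + B2 by rewrite addrAC lerDr addr_ge0.
  have s2 : B2 <= B0 + B1 + B2 by rewrite lerDr addr_ge0.
  have p0' := P (xc x) A0 B0 B00 s0 e0.
  have p1 := P (yc x) A1 B1 B10 s1 e1.
  have p2 := P' (zc x) A2 B2 B20 s2 e2.
  rewrite !mul0r !addr0 !add0r; split.
  - by apply: (le_trans (nmD _ _)); rewrite mulrDr lerD.
  - by apply: (le_trans (nmD _ _)); rewrite mulrDr lerD.
  (* [ea] and [eb] have the same z-component, so the dz-coefficient drops out of the difference and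
     a bound in |x| + |y| remains. *)
  - rewrite opprD addrACA subrr addr0.
    by apply: (le_trans (nmB _ _)); rewrite mulrDr lerD.
(* At a regular point no pole occurs: where x is a unit take f = 0 and f2 = 0, let f3 be the value
   on [ez], and solve for f1; similarly with y. *)
have [x0|y0] := X_axes k2 Xp p0.
  have ubs := nbhs_singleton (rsum_Xhol ma sr hw mE (E := fun x => [:: ea x]) (fun=> erefl) (tangent_ea_near p) hEa) Xp p0.
  have tz : \forall x \near p, X x -> zc x != 0 -> forall v, v \in [:: ez x] -> tangent X x v.
    by apply: near_all => x Xx z0 v; rewrite inE => /eqP ->; exact: tangent_ez.
  have hz w' : holo_form 1 p w' -> hol (fun x => w' x [:: ez x]) p.
    by move=> h; exact: hol_eval1 h (holo_field_ez x0).
  have bs := nbhs_singleton (rsum_Xhol ma sr hw mE (E := fun x => [:: ez x]) (fun=> erefl) tz hz) Xp p0.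
  have [fu hu Eu] := ubs; have [fB hB EB] := bs.
  apply: (intro1 (fun x => (fu x - zc x * fB x) / (k%:R * xc x)) (fun=> 0) fB (fun=> 0)) => //.
  - apply: hol_div; first by apply: holB => //; apply: holM => //; exact: hol_zc.
      by apply: holM; [exact: hol_cst|exact: hol_xc].
    by rewrite mulf_neq0.
  - exact: hol_cst.
  - exact: hol_cst.
  have xn := cdf_neq0 (cdf_xc p) x0.
  apply: (near2 (nearI Eu EB) (nearI altF xn)) => x [e1 e2] [ax xx] Xx z0.
  rewrite e1 // (eb_ez Xx z0) (alt1Z _ _ ax) e2 //; split; last by ring.
  by field; rewrite kk xx.
have vbs := nbhs_singleton (rsum_Xhol ma sr hw mE (E := fun x => [:: eb x]) (fun=> erefl) (tangent_eb_near p) hEb) Xp p0.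
have tz : \forall x \near p, X x -> zc x != 0 -> forall v, v \in [:: ez' x] -> tangent X x v.
  by apply: near_all => x Xx z0 v; rewrite inE => /eqP ->; exact: tangent_ez'.
have hz w' : holo_form 1 p w' -> hol (fun x => w' x [:: ez' x]) p.
  by move=> h; exact: hol_eval1 h (holo_field_ez' y0).
have bs := nbhs_singleton (rsum_Xhol ma sr hw mE (E := fun x => [:: ez' x]) (fun=> erefl) tz hz) Xp p0.
have [fu hu Eu] := vbs; have [fB hB EB] := bs.
apply: (intro1 (fun=> 0) (fun x => (fu x - zc x * fB x) / (k%:R * yc x)) fB (fun=> 0)) => //.
- exact: hol_cst.
- apply: hol_div; first by apply: holB => //; apply: holM => //; exact: hol_zc.
    by apply: holM; [exact: hol_cst|exact: hol_yc].
  by rewrite mulf_neq0.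
- exact: hol_cst.
have yn := cdf_neq0 (cdf_yc p) y0.
apply: (near2 (nearI Eu EB) (nearI altF yn)) => x [e1 e2] [ax yy] Xx z0.
rewrite e1 // (ea_ez Xx z0) (alt1Z _ _ ax) e2 //; split; first by ring.
by field; rewrite kk yy.
Qed.

End AlphaSub.

Section AlphaSub2.
Variable R : realType.
Local Notation C := R[i].
Local Notation V := 'rV[C]_3.
Local Notation form := (form R 3).
Variable k : nat.
Hypothesis k2 : (2 <= k)%N.
Local Notation X := (Sk R k).
Local Notation m := k./2.
Local Notation ea := (@ea R k).
Local Notation eb := (@eb R k).
Implicit Types (x p u v : V) (a b w : form).

Lemma alpha2_sub p a : X p -> alpha 2 X 2 p a -> Omega_tf_plus 2 X 2 (dxdy_over_z (m - 1)) p a.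
Proof.
move=> Xp [[ma _] [J [rho [w [sr hw mE]]]]].
have hE w' : holo_form 2 p w' -> hol (fun x => w' x [:: ea x; eb x]) p.
  by move=> h; exact: hol_eval2 h (hol_ea _ p) (hol_eb _ p).
have altF := rsum_alt rho hw.
have mk : (m - 1 <= k)%N by have := half_le k; clear; lia.
have kk := kC R k2.
have intro2 (f12 f13 f23 f : V -> C) : hol f12 p -> hol f13 p -> hol f23 p -> hol f p ->
    (\forall x \near p, X x -> zc x != 0 ->
      rsum rho w x [:: ea x; eb x] = k%:R ^+ 2 * xc x * yc x * f12 x + k%:R * xc x * zc x * f13 x -
        k%:R * yc x * zc x * f23 x + k%:R ^+ 2 * zc x ^+ (k - (m - 1)) * f x) ->
    Omega_tf_plus 2 X 2 (dxdy_over_z (m - 1)) p a.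
  move=> h1 h2 h3 hf E.
  apply: (omega_plus_intro k2 (isT : (2 <= 2)%N) mE altF (alternating_dxdy (m - 1)) (holo_form2 h1 h2 h3) hf).
  move: E => /nearnP[d d0 Hd]; apply/nearnP; exists d => // x /Hd e Xx z0; have e1 := e Xx z0.
  apply: (etrans e1); rewrite form2E !cpt dxdy_e //; ring.
have [p0|p0] := eqVneq p 0.
  have tb := rsum_Xbhol k2 ma sr hw mE p0 (E := fun x => [:: ea x; eb x]) (fun=> erefl) (tangent_eab_near k p) hE.
  have [B0 [B00 H0]] := rsum_bound0 k2 sr hw p0 (erefl (size [:: b0 R; b1 R])).
  have [B1 [B10 H1]] := rsum_bound0 k2 sr hw p0 (erefl (size [:: b0 R; b2 R])).
  have [B2 [B20 H2]] := rsum_bound0 k2 sr hw p0 (erefl (size [:: b1 R; b2 R])).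
  pose K : R := k%:R ^+ 2 * (B0 + B1 + B2).
  have kR : 1 <= k%:R :> R by rewrite ler1n (k0 k2).
  have kR2 : k%:R <= k%:R ^+ 2 :> R by rewrite expr2 ler_peMl // (le_trans _ kR).
  have K0 : 0 <= K by rewrite /K mulr_ge0 ?addr_ge0 ?exprn_ge0.
  have altF0 := altF; rewrite p0 in altF0.
  have [|f1 [f2 [f [[h1 h2 hf] E]]]] := origin2 k2 K0 tb; last first.
    apply: (intro2 (fun=> 0) f1 f2 f); rewrite p0 => //; first exact: hol_cst.
    by apply: (near1 E) => x e Xx z0; rewrite (e Xx z0); ring.
  apply: (near2 (nearI H0 H1) (nearI H2 altF0)) => x [e0 e1] [e2 ax] Xx x0.
  have {}e0 := e0 Xx x0; have {}e1 := e1 Xx x0; have {}e2 := e2 Xx x0.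
  rewrite !(alt2E ax (ea x) (eb x)) !cpt.
  set A0 := rsum _ _ _ [:: b0 R; b1 R] in e0 *; set A1 := rsum _ _ _ [:: b0 R; _] in e1 *.
  set A2 := rsum _ _ _ [:: b1 R; _] in e2 *.
  have nk : nm (k%:R : C) = k%:R by exact: nmnat.
  rewrite !mul0r !subr0 !mulr0 subr0 sub0r.
  have P (t1 s1 c : C) (B : R) : 0 <= B -> B <= B0 + B1 + B2 -> nm s1 <= B -> nm c <= k%:R ^+ 2 ->
      nm (c * t1 * s1) <= K * nm t1.
    move=> b b' h h'; rewrite !nmM mulrAC ler_wpM2r ?nm_ge0 //.
    by apply: ler_pM; rewrite ?nm_ge0 //; exact: le_trans h b'.
  have s0 : B0 <= B0 + B1 + B2 by rewrite -addrA lerDl addr_ge0.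
  have s1 : B1 <= B0 + B1 + B2 by rewrite addrAC lerDr addr_ge0.
  have s2 : B2 <= B0 + B1 + B2 by rewrite lerDr addr_ge0.
  have q0 := P (xc x * yc x) A0 (k%:R ^+ 2) B0 B00 s0 e0 ltac:(by rewrite nmX nk).
  have q1 := P (xc x * zc x) A1 k%:R B1 B10 s1 e1 ltac:(by rewrite nk).
  have q2 := P (yc x * zc x) A2 (- k%:R) B2 B20 s2 e2 ltac:(by rewrite nmN nk).
  rewrite (_ : _ + _ = k%:R ^+ 2 * (xc x * yc x) * A0 + k%:R * (xc x * zc x) * A1 + - k%:R * (yc x * zc x) * A2); last by ring.
  apply: (le_trans (nmD _ _)); rewrite mulrDr; apply: lerD => //.
  by apply: (le_trans (nmD _ _)); rewrite mulrDr lerD.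
(* Where x is a unit, the value on ([ea], [eb]) is z times the value on ([ea], [ez]), and a multiple
   of dx dz accounts for it; dy dz does so where y is a unit. *)
have [x0|y0] := X_axes k2 Xp p0.
  have tz : \forall x \near p, X x -> zc x != 0 -> forall v, v \in [:: ea x; ez k x] -> tangent X x v.
    apply: near_all => x Xx z0 v; rewrite !inE => /orP[] /eqP ->; [exact: tangent_ea|exact: tangent_ez].
  have hz w' : holo_form 2 p w' -> hol (fun x => w' x [:: ea x; ez k x]) p.
    by move=> h; exact: hol_eval2 h (hol_ea _ p) (holo_field_ez k x0).
  have [fB hB EB] := nbhs_singleton (rsum_Xhol k2 ma sr hw mE (E := fun x => [:: ea x; ez k x]) (fun=> erefl) tz hz) Xp p0.
  apply: (intro2 (fun=> 0) (fun x => fB x / (k%:R * xc x)) (fun=> 0) (fun=> 0)); try exact: hol_cst.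
    apply: hol_div => //; first by apply: holM; [exact: hol_cst|exact: hol_xc].
    by rewrite mulf_neq0.
  have xn := cdf_neq0 (cdf_xc p) x0.
  apply: (near2 EB (nearI altF xn)) => x e [ax xx] Xx z0.
  rewrite (eb_ez k2 Xx z0) (alt1Z (zc x) (ez k x) (alt2_r (ea x) ax)) /= e //.
  by field; rewrite kk xx.
have tz : \forall x \near p, X x -> zc x != 0 -> forall v, v \in [:: ez' k x; eb x] -> tangent X x v.
  apply: near_all => x Xx z0 v; rewrite !inE => /orP[] /eqP ->; [exact: tangent_ez'|exact: tangent_eb].
have hz w' : holo_form 2 p w' -> hol (fun x => w' x [:: ez' k x; eb x]) p.
  by move=> h; exact: hol_eval2 h (holo_field_ez' k y0) (hol_eb _ p).
have [fB hB EB] := nbhs_singleton (rsum_Xhol k2 ma sr hw mE (E := fun x => [:: ez' k x; eb x]) (fun=> erefl) tz hz) Xp p0.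
apply: (intro2 (fun=> 0) (fun=> 0) (fun x => - (fB x / (k%:R * yc x))) (fun=> 0)); try exact: hol_cst.
  apply: holN; apply: hol_div => //; first by apply: holM; [exact: hol_cst|exact: hol_yc].
  by rewrite mulf_neq0.
have yn := cdf_neq0 (cdf_yc p) y0.
apply: (near2 EB (nearI altF yn)) => x e [ax yy] Xx z0.
rewrite (ea_ez k2 Xx z0) (alt1Z (zc x) (ez' k x) (alt2_l (eb x) ax)) /= e //.
by field; rewrite kk yy.
Qed.

End AlphaSub2.

(** * Bounded smooth coefficients *)

Section CkTheory.
Variables (R : realType) (M : nat).
Local Notation U := 'rV[R]_M.
Implicit Types (D : set U) (f g : U -> R) (x v : U).

Lemma near_eq_diffR f g x : (\forall y \near x, f y = g y) -> differentiable f x ->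
  differentiable g x /\ 'd g x = 'd f x :> (U -> R).
Proof.
move=> E df; have [_ /eqaddoP H] := (diff_locallyP x f).1 df.
have Ho : g \o shift x = cst (g x) + 'd f x +o_ (0 : U) id.
  apply/eqaddoP => e e0; have /nbhs_normP[b /= b0 Hb] := H e e0.
  move: E => /nbhs_normP[d /= d0 Hd].
  have fx : f x = g x by apply: Hd; rewrite /ball_ /= subrr normr0.
  suff HH : \forall h \near (0 : U), `|(g \o shift x - (cst (g x) + 'd f x)) h| <= e * `|h| by exact: HH.
  apply/nbhs_normP; exists (Num.min b d) => /=; first by rewrite lt_min b0.
  move=> h; rewrite /= lt_min => /andP[/Hb + hd]; rewrite !fctE /= fx.
  suff -> : f (h + x) = g (h + x) by [].
  by apply: Hd; rewrite /ball_ /= opprD addrCA subrr addr0 -[- h]sub0r.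
have dE := diff_unique (diff_continuous df) Ho.
by split; [apply/diff_locallyP; rewrite dE; split => //; exact: diff_continuous|].
Qed.

(** [Ck] speaks of differentials at points of [D], which depend on values nearby; openness of [D] is
    what makes the values on [D] sufficient. *)
Lemma Ck_ext D k f g : open D -> (forall x, D x -> f x = g x) -> Ck k D f -> Ck k D g.
Proof.
move=> oD; have nD x : D x -> \forall y \near x, D y by move=> Dx; exact: open_nbhs_nbhs.
elim: k f g => [|k IH] f g E /= H.
  move=> x Dx; rewrite /prop_for /continuous_at -(E x Dx).
  have N : {near x, f =1 g} by have := nD x Dx; apply: filterS => y /E.
  exact: cvg_trans (near_eq_cvg N) (H x Dx).
have N x : D x -> differentiable g x /\ 'd g x = 'd f x :> (U -> R).
  move=> Dx; apply: near_eq_diffR; last exact: H.1.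
  by have := nD x Dx; apply: filterS => y /E.
split=> [x Dx|v]; first exact: (N x Dx).1.
apply: IH (H.2 v) => x Dx; exact: (congr1 (fun F : U -> R => F v) (esym (N x Dx).2)).
Qed.

Lemma CkW D k f : Ck k.+1 D f -> Ck k D f.
Proof.
elim: k f => [|k IH] f [d H]; first by move=> x Dx; exact: differentiable_continuous (d x Dx).
by split => // v; apply: IH; exact: H.
Qed.

Lemma Ck_cst D k (c : R) : open D -> Ck k D (fun=> c).
Proof.
move=> oD; elim: k c => [|k IH] c /=; first by move=> x _; exact: cst_continuous.
split=> [x _|v]; first exact: differentiable_cst.
by apply: (Ck_ext oD _ (IH 0)) => x _; rewrite diff_cst.
Qed.

Lemma Ck_coord D k j : open D -> Ck k D (fun x => x 0 j).
Proof.
move=> oD; case: k => [|k] /=.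
  by move=> x _; exact: (differentiable_continuous (differentiable_coord x 0 j)).
split=> [x _|v]; first exact: differentiable_coord.
apply: (Ck_ext oD _ (Ck_cst k (v 0 j) oD)) => x _.
have c : continuous (fun x : U => x 0 j).
  by move=> y; exact: (differentiable_continuous (differentiable_coord y 0 j)).
have Ll : scalar (fun x : U => x 0 j) by move=> a u w; rewrite !mxE.
pose Lm := GRing.isLinear.Build _ _ _ _ (fun x : U => x 0 j) Ll.
pose L : {linear U -> R} := HB.pack (fun x : U => x 0 j) Lm.
by rewrite (@diff_lin _ _ _ L).
Qed.

Lemma CkD D k f g : open D -> Ck k D f -> Ck k D g -> Ck k D (fun x => f x + g x).
Proof.
move=> oD; elim: k f g => [|k IH] f g /= H1 H2.
  by move=> x Dx; apply: continuousD; [exact: H1|exact: H2].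
split=> [x Dx|v]; first by apply: differentiableD; [exact: H1.1|exact: H2.1].
apply: (Ck_ext oD _ (IH _ _ (H1.2 v) (H2.2 v))) => x Dx.
have e := diffD (H1.1 x Dx) (H2.1 x Dx).
exact: (esym (congr1 (fun F : U -> R => F v) e)).
Qed.

Lemma CkM D k f g : open D -> Ck k D f -> Ck k D g -> Ck k D (fun x => f x * g x).
Proof.
move=> oD; elim: k f g => [|k IH] f g H1 H2.
  by move=> x Dx; apply: continuousM; [exact: H1|exact: H2].
have W1 := CkW H1; have W2 := CkW H2; move: H1 H2 => /= H1 H2.
split=> [x Dx|v]; first by apply: differentiableM; [exact: H1.1|exact: H2.1].
apply: (Ck_ext oD _ (CkD oD (IH _ _ W1 (H2.2 v)) (IH _ _ W2 (H1.2 v)))) => x Dx.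
have e := diffM (H1.1 x Dx) (H2.1 x Dx).
exact: (esym (congr1 (fun F : U -> R => F v) e)).
Qed.

Lemma CkN D k f : open D -> Ck k D f -> Ck k D (fun x => - f x).
Proof.
move=> oD H; apply: (Ck_ext oD _ (CkM oD (Ck_cst k (-1) oD) H)) => x _; exact: mulN1r.
Qed.

Lemma CkV D k f : open D -> (forall x, D x -> f x != 0) -> Ck k D f -> Ck k D (fun x => (f x)^-1).
Proof.
move=> oD f0; elim: k => [|k IH] H.
  by move=> x Dx; apply: continuousV; [exact: f0|exact: H].
have W := IH (CkW H); move: H => /= H.
split=> [x Dx|v]; first by apply: differentiableV; [exact: H.1|exact: f0].
apply: (Ck_ext oD _ (CkN oD (CkM oD (CkM oD W W) (H.2 v)))) => x Dx.
have e := diffV (H.1 x Dx) (f0 x Dx).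
rewrite -mulNr -expr2 exprVn; exact: (esym (congr1 (fun F : U -> R => F v) e)).
Qed.

End CkTheory.

Section SmoothCoefficients.
Variable R : realType.
Local Notation C := R[i].
Local Notation V := 'rV[C]_3.
Local Notation form := (form R 3).
Variable k : nat.
Hypothesis k2 : (2 <= k)%N.
Local Notation X := (Sk R k).
Local Notation m := k./2.
Local Notation ea := (@ea R k).
Local Notation eb := (@eb R k).
Implicit Types (x p u v : V) (a b : form).

Section Dom.
Variable D : set 'rV[R]_(3 + 3).
Hypothesis oD : open D.

Definition CS (f : V -> C) := forall n, Ck n D (fun w => complex.Re (f (cvec w))) /\
  Ck n D (fun w => complex.Im (f (cvec w))).

Lemma CS_ext f g : f =1 g -> CS f -> CS g.
Proof. by move=> /funext ->. Qed.
Lemma CS_cst (c : C) : CS (fun=> c).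
Proof. by move=> n; split; exact: Ck_cst. Qed.
Lemma CS_coord (j : 'I_3) : CS (fun x => x 0 j).
Proof.
move=> n; split.
  by apply: (Ck_ext oD _ (Ck_coord n (lshift 3 j) oD)) => w _; rewrite mxE.
by apply: (Ck_ext oD _ (Ck_coord n (rshift 3 j) oD)) => w _; rewrite mxE.
Qed.
Lemma CSM f g : CS f -> CS g -> CS (fun x => f x * g x).
Proof.
move=> hf hg n; have [f1 f2] := hf n; have [g1 g2] := hg n; split.
  apply: (Ck_ext oD _ (CkD oD (CkM oD f1 g1) (CkN oD (CkM oD f2 g2)))) => w _.
  by case: (f _) => ? ?; case: (g _) => ? ?.
apply: (Ck_ext oD _ (CkD oD (CkM oD f1 g2) (CkM oD f2 g1))) => w _.
by case: (f _) => ? ?; case: (g _) => ? ?.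
Qed.
Lemma CSX f j : CS f -> CS (fun x => f x ^+ j).
Proof.
move=> hf; elim: j => [|j IH]; first exact: CS_cst.
by apply: (CS_ext (fun x => esym (exprS (f x) j))); exact: CSM.
Qed.
Lemma CS_conj f : CS f -> CS (fun x => (f x)^*%C).
Proof.
move=> hf n; have [f1 f2] := hf n; split.
  by apply: (Ck_ext oD _ f1) => w _; case: (f _).
by apply: (Ck_ext oD _ (CkN oD f2)) => w _; case: (f _).
Qed.
Lemma CS_inv (N : V -> R) : (forall n, Ck n D (fun w => N (cvec w))) ->
  (forall w, D w -> N (cvec w) != 0) -> CS (fun x => ((N x)^-1)%:C).
Proof.
move=> hN N0 n; split; last exact: (Ck_cst n 0 oD).
exact: CkV.
Qed.

Definition N2 x : R := nm (xc x) ^+ 2 + nm (yc x) ^+ 2.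

Lemma nm_sqr (c : C) : nm c ^+ 2 = complex.Re c ^+ 2 + complex.Im c ^+ 2.
Proof.
by case: c => s t; rewrite /nm normc_def /= sqr_sqrtr // addr_ge0 ?sqr_ge0.
Qed.
Lemma mul_conj (c : C) : c * c^*%C = (nm c ^+ 2)%:C.
Proof.
by rewrite nm_sqr; case: c => s t; apply/eqP; rewrite eq_complex /=; apply/andP; split; apply/eqP; ring.
Qed.
Lemma nm_conj (c : C) : nm c^*%C = nm c.
Proof. by case: c => s t; rewrite /nm !normc_def /= sqrrN. Qed.

Lemma Ck_N2 n : Ck n D (fun w => N2 (cvec w)).
Proof.
have [a1 a2] := CS_coord 0 n; have [b1 b2] := CS_coord 1 n.
apply: (Ck_ext oD _ (CkD oD (CkD oD (CkM oD a1 a1) (CkM oD a2 a2)) (CkD oD (CkM oD b1 b1) (CkM oD b2 b2)))) => w _.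
by rewrite /N2 !nm_sqr !expr2.
Qed.

End Dom.

(** [N2] vanishes exactly on the z-axis, which meets X only at the origin; so this single open set
    contains the regular part and 1/N2 is smooth on it. *)
Definition DN : set 'rV[R]_(3 + 3) := [set w | N2 (cvec w) != 0].

Lemma open_DN : open DN.
Proof.
have c : continuous (fun w : 'rV[R]_(3 + 3) => N2 (cvec w)).
  by move=> w; exact: (Ck_N2 openT 0).
rewrite (_ : DN = (fun w => N2 (cvec w)) @^-1` [set r | r != 0]) //.
apply: open_comp; first by move=> w _; exact: c.
exact: open_neq.
Qed.

Lemma N2_neq0 p : X p -> p != 0 -> N2 p != 0.
Proof.
move=> Xp p0; rewrite lt0r_neq0 //.
by have [x0|y0] := X_axes k2 Xp p0;
  [rewrite ltr_wpDr ?sqr_ge0 // exprn_gt0 // nm_gt0|rewrite ltr_wpDl ?sqr_ge0 // exprn_gt0 // nm_gt0].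
Qed.

Lemma CS_smooth_bounded p (f : V -> C) : CS DN f ->
  (\forall x \near (0 : V), X x -> x != 0 -> nm (f x) <= 1) -> smooth_bounded 2 X p f.
Proof.
move=> hf hb; split.
  apply: near_all => x /(regP k2)[Xx x0]; exists f; last exact: near_all.
  exists DN => //; split; first exact: open_DN.
  by exists (rvec x); rewrite /DN /= ?rvecK //; exact: N2_neq0.
apply: near_all => x /(singP k2) ->; exists 1.
move: hb => /nearnP[d d0 Hd]; apply/nearnP; exists d => // y /Hd h /(regP k2)[Xy y0].
by rewrite nmE lecR; exact: h.
Qed.

(* On X, [x dy / z^m = rho1 dy - rho2 dx + k z^(k-1-m) rho3 dz] and
   [dx dy / z^(m-1) = k rho2 dx dz - k rho1 dy dz]. *)
Definition rho1 x : C := zc x ^+ (k - m) * (yc x)^*%C * ((N2 x)^-1)%:C.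
Definition rho2 x : C := zc x ^+ (k - m) * (xc x)^*%C * ((N2 x)^-1)%:C.
Definition rho3 x : C := xc x * (xc x)^*%C * ((N2 x)^-1)%:C.

Lemma N2_split x : xc x * (xc x)^*%C + yc x * (yc x)^*%C = (N2 x)%:C.
Proof. by rewrite !mul_conj -rmorphD. Qed.

Let CN : CS DN (fun x => ((N2 x)^-1)%:C).
Proof. by apply: (CS_inv open_DN) => [n|//]; exact: (Ck_N2 open_DN n). Qed.

Lemma nm_zpow x : X x -> nm (zc x) <= 1 -> nm (zc x ^+ (k - m)) ^+ 2 <= nm (xc x) * nm (yc x).
Proof.
move=> Xx z1; rewrite -nmM (Xeq Xx) !nmX -exprM ler_wiXn2l ?nm_ge0 //.
by have := half_le k; clear; lia.
Qed.

(** [s] and [t] are |x| and |y| in either order and [z] is |z|^(k-m); square, and use z^2 <= s t <=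
    s^2 + t^2. *)
Lemma rho12_bound (s t z : R) : 0 <= s -> 0 <= t -> 0 <= z -> z ^+ 2 <= s * t -> 0 < s ^+ 2 + t ^+ 2 ->
  z * s * (s ^+ 2 + t ^+ 2)^-1 <= 1.
Proof.
move=> s0 t0 z0 h n0; rewrite ler_pdivrMr // mul1r.
rewrite -(@ler_pXn2r _ 2) ?nnegrE ?mulr_ge0 ?(ltW n0) //.
rewrite exprMn expr2 [leRHS]expr2; apply: ler_pM; rewrite ?mulr_ge0 ?sqr_ge0 //.
  rewrite -expr2; apply: (le_trans h); nra.
by rewrite lerDl sqr_ge0.
Qed.

Let N2gt0 x : X x -> x != 0 -> 0 < N2 x.
Proof. by move=> Xx x0; rewrite lt_def N2_neq0 //= addr_ge0 ?sqr_ge0. Qed.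

Lemma nm_invN2 x : nm (((N2 x)^-1)%:C : C) = (N2 x)^-1.
Proof. by rewrite nmR ger0_norm // invr_ge0 addr_ge0 ?sqr_ge0. Qed.

Let near_z1 : \forall x \near (0 : V), nm (zc x) <= 1.
Proof.
by apply/near0P; exists 1 => // x x1; apply/ltW; apply: le_lt_trans x1; exact: nm_zc.
Qed.

Lemma sb_rho1 p : smooth_bounded 2 X p rho1.
Proof.
apply: CS_smooth_bounded; last first.
  apply: (near1 near_z1) => x z1 Xx x0; rewrite !nmM nm_invN2 nm_conj /N2 addrC.
  apply: rho12_bound; rewrite ?nm_ge0 // 1?mulrC ?nm_zpow // addrC; exact: N2gt0.
by do 2 (apply: (CSM open_DN); last by [exact: CN|apply: (CS_conj open_DN); exact: (CS_coord open_DN)]);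
   apply: (CSX open_DN); exact: (CS_coord open_DN).
Qed.
Lemma sb_rho2 p : smooth_bounded 2 X p rho2.
Proof.
apply: CS_smooth_bounded; last first.
  apply: (near1 near_z1) => x z1 Xx x0; rewrite !nmM nm_invN2 nm_conj /N2.
  by apply: rho12_bound; rewrite ?nm_ge0 // ?nm_zpow //; exact: N2gt0.
by do 2 (apply: (CSM open_DN); last by [exact: CN|apply: (CS_conj open_DN); exact: (CS_coord open_DN)]);
   apply: (CSX open_DN); exact: (CS_coord open_DN).
Qed.
Lemma sb_rho3 p : smooth_bounded 2 X p rho3.
Proof.
apply: CS_smooth_bounded; last first.
  apply: near_all => x Xx x0; rewrite !nmM nm_invN2 nm_conj -expr2.
  by rewrite ler_pdivrMr ?N2gt0 // mul1r lerDl sqr_ge0.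
apply: (CSM open_DN); last exact: CN.
by apply: (CSM open_DN); [|apply: (CS_conj open_DN)]; exact: (CS_coord open_DN).
Qed.

Lemma sb_one p : smooth_bounded 2 X p (fun=> 1).
Proof.
apply: CS_smooth_bounded; first exact: (CS_cst open_DN 1).
by apply: near_all => x _ _; rewrite nmR normr1.
Qed.

End SmoothCoefficients.

Section SmoothSums.
Variable R : realType.
Local Notation C := R[i].
Local Notation V := 'rV[C]_3.
Local Notation form := (form R 3).
Variable k : nat.
Hypothesis k2 : (2 <= k)%N.
Local Notation X := (Sk R k).
Local Notation m := k./2.
Local Notation ea := (@ea R k).
Local Notation eb := (@eb R k).
Implicit Types (x p u v : V) (a b w : form).

Definition smooth_sum q p a := exists (J : nat) (rho : 'I_J -> V -> C) (w : 'I_J -> form),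
  [/\ forall j, smooth_bounded 2 X p (rho j), forall j, holo_form q p (w j) &
      meq 2 X q p a (fun x s => \sum_(j < J) rho j x * w j x s)].

Lemma smooth_sum0 p a : Omega_tf 2 X 0 p a -> smooth_sum 0 p a.
Proof.
move=> [w hw aw]; exists 1, (fun=> fun=> 1), (fun=> w); split; [by move=> _; exact: sb_one|by []|].
by apply: (meq_trans k2 aw); apply: (meq_eq k2) => x s _; rewrite big_ord1 mul1r.
Qed.

Lemma smooth_sum_intro q p a n (rho : nat -> V -> C) (w : nat -> form) F : (q <= 2)%N ->
  meq 2 X q p a F -> (\forall x \near p, alternating q (F x)) ->
  (forall j, (j < n)%N -> smooth_bounded 2 X p (rho j)) ->
  (forall j, (j < n)%N -> holo_form q p (w j)) ->
  (forall x, X x -> zc x != 0 -> coef_eq k q F (fun x s => \sum_(j < n) rho j x * w j x s) x) ->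
  smooth_sum q p a.
Proof.
move=> q2 aF altF sr hw E; exists n, (fun j => rho j), (fun j => w j); split.
- by move=> j; exact: sr.
- by move=> j; exact: hw.
apply: (meq_trans k2 aF); apply: (coef_meq k2 q2).
- by apply: generically_near => //; move: altF => /nearnP[d d0 Hd]; apply/nearnP; exists d => // x /Hd.
- apply: generically_near => //.
  have /nearnP[d d0 Hd] := @rsum_alt R q n p (fun j => rho j) (fun j => w j) (fun j => hw j (ltn_ord j)).
  by apply/nearnP; exists d => // x /Hd.
- by apply: generically_near => //; apply: near_all.
Qed.

Lemma plus_alt q p w (f : V -> C) theta : holo_form q p w -> (forall x, alternating q (theta x)) ->
  \forall x \near p, alternating q (fun s => w x s + f x * theta x s).
Proof.
move=> /holo_alternating/nearnP[d d0 Hd] ht; apply/nearnP; exists d => // x /Hd hx.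
by apply: alternatingD => //; exact: alternatingZ.
Qed.

Let mk : (m < k)%N. Proof. by have := half_le k; have := half_gt0 k2; clear; lia. Qed.

Lemma smooth_sum1 p a : Omega_tf_plus 2 X 1 (xdy_over_z m) p a -> smooth_sum 1 p a.
Proof.
move=> [w [f [hw /holo_hol hf aF]]].
pose F1 := form1 (fun=> 0) f (fun=> 0).
pose F2 := form1 (fun x => - f x) (fun=> 0) (fun=> 0).
(* The exponent is one less than k - m because dz contributes a factor z on [ea] and on [eb]. *)
pose F3 := form1 (fun=> 0) (fun=> 0) (fun x => f x * (k%:R * zc x ^+ (k.-1 - m))).
have cz : hol (fun=> 0 : C) p by exact: hol_cst.
apply: (@smooth_sum_intro 1 p a 4 (nth (fun=> 0) [:: fun=> 1; rho1 k; rho2 k; @rho3 R])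
  (nth w [:: w; F1; F2; F3]) _ isT aF).
- exact: plus_alt (alternating_xdy m).
- move=> [|[|[|[|//]]]] _ /=; [exact: sb_one|exact: sb_rho1|exact: sb_rho2|exact: sb_rho3].
- move=> [|[|[|[|//]]]] _ //=; apply: holo_form1 => //; first exact: holN.
  by apply: holM => //; apply: holM; [exact: hol_cst|apply: holX; exact: hol_zc].
move=> x Xx z0.
have E : zc x ^+ (k - m) = zc x ^+ (k.-1 - m) * zc x.
  by rewrite -exprSr; congr (_ ^+ _); move: mk; clear; lia.
have N0 : N2 x != 0 by apply: (N2_neq0 k2 Xx); exact: zc_neq0.
have S := N2_split x.
have Ni : ((N2 x)^-1)%:C * (N2 x)%:C = 1 :> C by rewrite -rmorphM mulVf.
split; rewrite !big_ord_recr big_ord0 /= /F1 /F2 /F3 !form1E ?xdy_ea ?(xdy_eb Xx z0 (ltnW mk)) !cpt /rho1 /rho2 /rho3 E; first by ring.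
rewrite -S in Ni; apply/subr0_eq.
rewrite (_ : _ - _ = f x * (k%:R * (zc x ^+ (k.-1 - m) * zc x)) *
  (1 - ((N2 x)^-1)%:C * (xc x * (xc x)^*%C + yc x * (yc x)^*%C))); last by ring.
by rewrite Ni subrr mulr0.
Qed.

Lemma smooth_sum2 p a : Omega_tf_plus 2 X 2 (dxdy_over_z (m - 1)) p a -> smooth_sum 2 p a.
Proof.
move=> [w [f [hw /holo_hol hf aF]]].
pose F1 := form2 (fun=> 0) (fun=> 0) (fun x => - (k%:R * f x)).
pose F2 := form2 (fun=> 0) (fun x => k%:R * f x) (fun=> 0).
have cz : hol (fun=> 0 : C) p by exact: hol_cst.
apply: (@smooth_sum_intro 2 p a 3 (nth (fun=> 0) [:: fun=> 1; rho1 k; rho2 k])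
  (nth w [:: w; F1; F2]) _ isT aF).
- exact: plus_alt (alternating_dxdy (m - 1)).
- move=> [|[|[|//]]] _ /=; [exact: sb_one|exact: sb_rho1|exact: sb_rho2].
- move=> [|[|[|//]]] _ //=; apply: holo_form2 => //; first apply: holN;
  by apply: holM => //; exact: hol_cst.
move=> x Xx z0.
have E : zc x ^+ (k - (m - 1)) = zc x ^+ (k - m) * zc x.
  by rewrite -exprSr; congr (_ ^+ _); move: mk (half_gt0 k2); clear; lia.
have S := N2_split x.
have N0 : N2 x != 0 by apply: (N2_neq0 k2 Xx); exact: zc_neq0.
have Ni : ((N2 x)^-1)%:C * (N2 x)%:C = 1 :> C by rewrite -rmorphM mulVf.
have mk' : (m - 1 <= k)%N by move: mk; clear; lia.
rewrite /coef_eq !big_ord_recr big_ord0 /= /F1 /F2 !form2E (dxdy_e Xx z0 mk') !cpt /rho1 /rho2 E.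
rewrite -S in Ni; apply/subr0_eq.
rewrite (_ : _ - _ = (f x * (k%:R ^+ 2 * (zc x ^+ (k - m) * zc x))) *
  (1 - ((N2 x)^-1)%:C * (xc x * (xc x)^*%C + yc x * (yc x)^*%C))); last by ring.
by rewrite Ni subrr mulr0.
Qed.

End SmoothSums.

(** * Pullback to a desingularization *)

Section Bounds.
Variable R : realType.
Local Notation C := R[i].
Variable W : normedModType C.
Variable k : nat.
Hypothesis k2 : (2 <= k)%N.
Local Notation m := k./2.
Variables (F1 F2 F3 : W -> C).
Implicit Types (u e : W).

(** If p > 2 A t, then p s <= p^2/2 and q <= p^2/4, against p^2 <= p s + q. *)
Lemma quad_bound (p s q t A : R) : 0 <= p -> 0 <= t -> 0 <= A -> s <= A * t -> q <= A ^+ 2 * t ^+ 2 ->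
  p ^+ 2 <= p * s + q -> p <= 2 * A * t.
Proof.
move=> p0 t0 A0 hs hq hp; rewrite leNgt; apply/negP => lt.
have At0 : 0 <= A * t by rewrite mulr_ge0.
have : p * s <= p * (A * t) by rewrite ler_wpM2l.
nra.
Qed.

Lemma pow_bound (b t : R) n j : 0 <= t -> t <= b -> 1 <= b -> (j <= n)%N -> t ^+ n <= b ^+ n * t ^+ j.
Proof.
move=> t0 tb b1 jn; have b0 : 0 <= b by exact: le_trans b1.
rewrite -{1}(subnK jn) exprD ler_wpM2r ?exprn_ge0 //.
apply: (@le_trans _ _ (b ^+ (n - j))); first by rewrite lerXn2r ?nnegrE.
by rewrite ler_weXn2l // leq_subr.
Qed.

Lemma curve_deriv u : hol F1 u -> hol F2 u -> hol F3 u ->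
  (\forall w \near u, F1 w * F2 w = F3 w ^+ k) ->
  \forall w \near u, forall e,
    F1 w * cd F2 w e + F2 w * cd F1 w e = k%:R * F3 w ^+ k.-1 * cd F3 w e.
Proof.
move=> h1 h2 h3 E.
have /nearnP[d d0 Hd] := nearI (nearI h1 h2) (nearI h3 E).
have En : \forall w \near u, \forall v \near w, F1 v * F2 v = F3 v ^+ k.
  by exact: near_join E.
have /nearnP[d' d'0 Hd'] := En.
apply/nearnP; exists (Num.min d d'); first by rewrite lt_min d0.
move=> w; rewrite lt_min => /andP[/Hd[[c1 c2] [c3 _]] /Hd' ew] e.
by rewrite -cdM // -cdX //; apply: esym; apply: (cd_near _ ew); exact: cdfM.
Qed.

(* [P = F1 dF2] and [Q = F2 dF1] satisfy [P + Q = k F3^(k-1) dF3] and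
   [P Q = F3^k dF1 dF2]; now use [|P|^2 <= |P| |P + Q| + |P Q|]. *)
Lemma product_bound1 u e : hol F1 u -> hol F2 u -> hol F3 u ->
  (\forall w \near u, F1 w * F2 w = F3 w ^+ k) ->
  exists K : R, \forall w \near u, nm (F1 w * cd F2 w e) <= K * nm (F3 w ^+ m).
Proof.
move=> h1 h2 h3 E; have D := curve_deriv h1 h2 h3 E.
have [B1 [B10 H1]] := hol_bounded (hol_cd e h1); have [B2 [B20 H2]] := hol_bounded (hol_cd e h2).
have [B3 [B30 H3]] := hol_bounded (hol_cd e h3); have [B [B0 H]] := hol_bounded h3.
pose b := 1 + B; have b1 : 1 <= b by rewrite lerDl.
pose A := (k%:R * B3 + B1 * B2 + 1) * b ^+ k.
have bk : 1 <= b ^+ k by exact: exprn_ege1.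
have A0 : 0 <= A by rewrite mulr_ge0 ?addr_ge0 ?mulr_ge0 // (le_trans _ bk).
exists (2 * A); apply: (near2 (nearI (nearI D E) H) (nearI H1 (nearI H2 H3))).
move=> w [[De Ew] bw] [b1w [b2w b3w]]; have {}De := De e.
set P := F1 w * cd F2 w e in De *; set Q := F2 w * cd F1 w e in De.
have PQ : P * P = P * (k%:R * F3 w ^+ k.-1 * cd F3 w e) - F3 w ^+ k * (cd F1 w e * cd F2 w e).
  by rewrite -De -Ew /P /Q; ring.
have kpos := k0 k2; have hm := half_le k; have hm0 := half_gt0 k2.
have tb : nm (F3 w) <= b by apply: (le_trans bw); rewrite lerDr.
apply: (@quad_bound _ (nm (k%:R * F3 w ^+ k.-1 * cd F3 w e)) (nm (F3 w ^+ k * (cd F1 w e * cd F2 w e)))) => //; rewrite ?nm_ge0 //.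
- rewrite !nmM !nmX nmnat.
  have e1 : nm (F3 w) ^+ k.-1 <= b ^+ k.-1 * nm (F3 w) ^+ m.
    by apply: pow_bound; rewrite ?nm_ge0 //; move: hm hm0 kpos; clear; lia.
  have e2 : b ^+ k.-1 <= b ^+ k by rewrite ler_weXn2l // leq_pred.
  have e3 : nm (F3 w) ^+ k.-1 <= b ^+ k * nm (F3 w) ^+ m.
    by apply: (le_trans e1); rewrite ler_wpM2r ?exprn_ge0 ?nm_ge0.
  apply: (@le_trans _ _ (k%:R * (b ^+ k * nm (F3 w) ^+ m) * B3)).
    by apply: ler_pM; rewrite ?mulr_ge0 ?exprn_ge0 ?nm_ge0 // ler_wpM2l.
  rewrite /A (_ : _ * B3 = (k%:R * B3) * b ^+ k * nm (F3 w) ^+ m); last by ring.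
  rewrite ler_wpM2r ?exprn_ge0 ?nm_ge0 // ler_wpM2r ?(le_trans _ bk) //.
  by rewrite -addrA lerDl addr_ge0 ?mulr_ge0.
- rewrite !nmM !nmX -exprM.
  have e1 : nm (F3 w) ^+ k <= b ^+ k * nm (F3 w) ^+ (m * 2).
    by apply: pow_bound; rewrite ?nm_ge0 //; move: hm; clear; lia.
  apply: (@le_trans _ _ (b ^+ k * nm (F3 w) ^+ (m * 2) * (B1 * B2))).
    apply: ler_pM; rewrite ?mulr_ge0 ?exprn_ge0 ?nm_ge0 //.
    by apply: ler_pM; rewrite ?nm_ge0.
  rewrite mulrAC ler_wpM2r ?exprn_ge0 ?nm_ge0 //.
  have e2 : b ^+ k * (B1 * B2) <= A.
    rewrite /A mulrC ler_wpM2r ?(le_trans _ bk) //.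
    by rewrite addrAC lerDr addr_ge0 ?mulr_ge0.
  have A1 : 1 <= A.
    rewrite /A -[leLHS]mulr1; apply: ler_pM => //.
    by rewrite lerDr addr_ge0 ?mulr_ge0.
  by apply: (le_trans e2); rewrite expr2 ler_peMl.
rewrite -nmM -nmX expr2 PQ; exact: nmB.
Qed.

(* [J12^2 = - k^2 F3^(k-2) J13 J23] for the minors of the differential of
   [(F1, F2, F3)]. *)
Lemma product_bound2 u e e' : hol F1 u -> hol F2 u -> hol F3 u ->
  (\forall w \near u, F1 w * F2 w = F3 w ^+ k) ->
  exists K : R, \forall w \near u, F3 w ^+ (m - 1) != 0 ->
    nm (cd F1 w e * cd F2 w e' - cd F1 w e' * cd F2 w e) <= K * nm (F3 w ^+ (m - 1)).
Proof.
move=> h1 h2 h3 E; have D := curve_deriv h1 h2 h3 E.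
have hJ (f g : W -> C) : hol f u -> hol g u -> hol (fun w => cd f w e * cd g w e' - cd f w e' * cd g w e) u.
  by move=> hf hg; apply: holB; apply: holM; exact: hol_cd.
have [Bj [Bj0 Hj]] := hol_bounded (hJ _ _ h1 h2).
(* For m = 1 the denominator is 1 and boundedness suffices; otherwise its nonvanishing gives that of
   [F3], needed to cancel F3^k. *)
have [m1|m1] := eqVneq (m - 1)%N 0%N.
  exists Bj; apply: (near2 Hj Hj) => w bw _ _.
  by rewrite m1 expr0 nmR normr1 mulr1.
have [B1 [B10 H1]] := hol_bounded (hJ _ _ h1 h3); have [B2 [B20 H2]] := hol_bounded (hJ _ _ h2 h3).
have [B [B0 H]] := hol_bounded h3.
pose b := 1 + B; have b1 : 1 <= b by rewrite lerDl.
pose A := (k%:R ^+ 2 * (B1 * B2) + 1) * b ^+ (k - 2).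
have bk : 1 <= b ^+ (k - 2) by exact: exprn_ege1.
have A1 : 1 <= A.
  by rewrite /A -[leLHS]mulr1; apply: ler_pM => //; rewrite lerDr mulr_ge0 ?exprn_ge0 ?mulr_ge0.
have A0 : 0 <= A by exact: le_trans A1.
exists (2 * A); apply: (near2 (nearI (nearI D E) H) (nearI Hj (nearI H1 H2))).
move=> w [[De Ew] bw] [bjw [b1w b2w]] z0.
have {}z0 : F3 w != 0 by apply: contraNneq z0 => ->; rewrite expr0n (negPf m1).
have d1 := De e; have d2 := De e'.
set J := cd F1 w e * _ - _; set J13 := (cd F1 w e * cd F3 w e' - _) in b1w.
set J23 := (cd F2 w e * cd F3 w e' - _) in b2w.
have kpos := k0 k2; have hm := half_le k; have hm0 := half_gt0 k2.
have e1 : F1 w * J = k%:R * F3 w ^+ k.-1 * J13.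
  rewrite /J /J13 (_ : _ * J13 = cd F1 w e * (k%:R * F3 w ^+ k.-1 * cd F3 w e') -
    cd F1 w e' * (k%:R * F3 w ^+ k.-1 * cd F3 w e)); last by rewrite /J13; ring.
  by rewrite -d1 -d2; ring.
have e2 : F2 w * J = - (k%:R * F3 w ^+ k.-1 * J23).
  rewrite (_ : _ * J23 = cd F2 w e * (k%:R * F3 w ^+ k.-1 * cd F3 w e') -
    cd F2 w e' * (k%:R * F3 w ^+ k.-1 * cd F3 w e)); last by rewrite /J23; ring.
  by rewrite -d1 -d2 /J; ring.
have kk : F3 w ^+ k.-1 * F3 w ^+ k.-1 = F3 w ^+ k * F3 w ^+ (k - 2).
  by rewrite -!exprD; congr (_ ^+ _); move: k2; clear; lia.
have JJ : J * J = - (k%:R ^+ 2 * F3 w ^+ (k - 2) * (J13 * J23)).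
  have zk : F3 w ^+ k != 0 by rewrite expf_neq0.
  apply: (mulfI zk); rewrite -{1}Ew (_ : F1 w * F2 w * (J * J) = (F1 w * J) * (F2 w * J)); last by ring.
  rewrite e1 e2 (_ : _ * _ = - (k%:R ^+ 2 * (F3 w ^+ k.-1 * F3 w ^+ k.-1) * (J13 * J23))); last by ring.
  by rewrite kk; ring.
have tb : nm (F3 w) <= b by apply: (le_trans bw); rewrite lerDr.
apply: (@quad_bound _ 0 (nm (J * J))) => //; rewrite ?nm_ge0 //; first exact: mulr_ge0 (nm_ge0 _).
  rewrite JJ nmN !nmM !nmX nmnat -exprM.
  have p1 : nm (F3 w) ^+ (k - 2) <= b ^+ (k - 2) * nm (F3 w) ^+ ((m - 1) * 2).
    by apply: pow_bound; rewrite ?nm_ge0 //; move: hm hm0; clear; lia.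
  apply: (@le_trans _ _ (k%:R ^+ 2 * (b ^+ (k - 2) * nm (F3 w) ^+ ((m - 1) * 2)) * (B1 * B2))).
    apply: ler_pM; rewrite ?mulr_ge0 ?exprn_ge0 ?nm_ge0 //.
      by rewrite ler_wpM2l ?exprn_ge0.
    by apply: ler_pM; rewrite ?nm_ge0.
  rewrite (_ : _ * (B1 * B2) = (k%:R ^+ 2 * (B1 * B2)) * b ^+ (k - 2) * nm (F3 w) ^+ ((m - 1) * 2)); last by ring.
  rewrite ler_wpM2r ?exprn_ge0 ?nm_ge0 //.
  apply: (@le_trans _ _ A); last by rewrite expr2 ler_peMl.
  by rewrite /A ler_wpM2r ?(le_trans _ bk) // lerDl.
by rewrite mulr0 add0r nmM -expr2.
Qed.

End Bounds.

(** * Holomorphic forms and their pullbacks *)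

Section Charts.
Variable R : realType.
Local Notation C := R[i].
Local Notation V := 'rV[C]_3.
Local Notation U := 'rV[C]_2.
Variable k : nat.
Hypothesis k2 : (2 <= k)%N.
Local Notation X := (Sk R k).
Local Notation m := k./2.

(** One neighbourhood must serve all lists of vectors at once: it is that of the finitely many
    coefficients on the basis. *)
Lemma holo_form_near q p (w : form R 3) : (q <= 2)%N -> holo_form q p w ->
  \forall x \near p, holo_form q x w.
Proof.
move=> q2 hw; have [ha _] := hw.
have {}ha : \forall x \near p, \forall y \near x, alternating q (w y) by exact: near_join.
have hn s : size s = q -> \forall x \near p, hol (w^~ s) x.
  by move=> hs; apply: hol_near; exact: holo_form_coef hw hs.
case: q q2 hw ha hn => [|[|[|//]]] _ hw ha hn.
- by apply: (near1 (hn [::] erefl)) => x h; apply/holo_form0.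
- have h0 := hn [:: b0 R] erefl; have h1 := hn [:: b1 R] erefl; have h2 := hn [:: b2 R] erefl.
  have /nearnP[d d0 Hd] := nearI (nearI h0 h1) (nearI h2 ha).
  apply/nearnP; exists d; first exact: d0.
  move=> x /Hd[[{}h0 {}h1] [{}h2 {}ha]]; split; first exact: ha.
  move=> s /size1[v ->]; apply/holo_hol.
  move: ha => /nearnP[e e0 He].
  apply: (@hol_eq _ _ (fun x => xc v * w x [:: b0 R] + yc v * w x [:: b1 R] + zc v * w x [:: b2 R])).
    by apply/nearnP; exists e => // y /He hy; rewrite (alt1E hy v).
  by apply: holD; [apply: holD|]; apply: holM => //; exact: hol_cst.
have h0 := hn [:: b0 R; b1 R] erefl; have h1 := hn [:: b0 R; b2 R] erefl; have h2 := hn [:: b1 R; b2 R] erefl.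
have /nearnP[d d0 Hd] := nearI (nearI h0 h1) (nearI h2 ha).
apply/nearnP; exists d; first exact: d0.
move=> x /Hd[[{}h0 {}h1] [{}h2 {}ha]]; split; first exact: ha.
move=> s /size2[v [v' ->]]; apply/holo_hol.
move: ha => /nearnP[e e0 He].
apply: (@hol_eq _ _ (fun x =>
  (xc v * yc v' - yc v * xc v') * w x [:: b0 R; b1 R] +
  (xc v * zc v' - zc v * xc v') * w x [:: b0 R; b2 R] +
  (yc v * zc v' - zc v * yc v') * w x [:: b1 R; b2 R])).
  by apply/nearnP; exists e => // y /He hy; rewrite (alt2E hy v v').
by apply: holD; [apply: holD|]; apply: holM => //; exact: hol_cst.
Qed.

Section Pullback.
Variables (F : U -> V) (v : U).
Hypothesis dF : \forall u \near v, differentiable F u.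

Lemma hol_coordF j : hol (fun u => F u 0 j) v.
Proof.
apply: (@hol_comp _ _ _ F (fun x : V => x 0 j)) => //.
by apply: near_all => x; exact: (cdf_coord x j).1.
Qed.

Lemma dF_coord j s : \forall u \near v, ('d F u s) 0 j = cd (fun u => F u 0 j) u s.
Proof.
move: dF => /nearnP[d d0 Hd]; apply/nearnP; exists d => // u /Hd du.
by rewrite (cd_comp _ du (cdf_coord (F u) j).1) (cdf_coord (F u) j).2.
Qed.

Lemma hol_dF j s : hol (fun u => ('d F u s) 0 j) v.
Proof.
apply: (hol_eq _ (hol_cd s (hol_coordF j))).
by have /nearnP[d d0 Hd] := dF_coord j s; apply/nearnP; exists d => // u /Hd ->.
Qed.

Lemma holo_pullback q (w : form R 3) : (q <= 2)%N -> holo_form q (F v) w ->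
  holo_form q v (fun u s => w (F u) (map ('d F u) s)).
Proof.
move=> q2 hw; have cF := differentiable_continuous (nbhs_singleton dF).
have ha : \forall u \near v, alternating q (w (F u)) by exact: (cF _ hw.1).
have hc s : size s = q -> hol (fun u => w (F u) s) v.
  by move=> hs; apply: (@hol_comp _ _ _ F (w^~ s)) => //; exact: holo_form_coef hw hs.
have hd j s := hol_dF j s.
split.
  by move: ha => /nearnP[d d0 Hd]; apply/nearnP; exists d => // u /Hd; exact: alternating_map.
move=> s hs; rewrite /holo_at -holo_atE.
case: q q2 hw ha hc hs => [|[|[|//]]] _ hw /nearnP[d d0 Hd] hc.
- by move=> /size0nil -> /=; exact: hc.
- case: s => [//|t [|//]] _ /=.
  apply: (@hol_eq _ _ (fun u => xc ('d F u t) * w (F u) [:: b0 R] + yc ('d F u t) * w (F u) [:: b1 R]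
    + zc ('d F u t) * w (F u) [:: b2 R])).
    by apply/nearnP; exists d => // u /Hd hu; rewrite (alt1E hu ('d F u t)).
  by apply: holD; [apply: holD|]; apply: holM; [exact: hd|exact: hc|exact: hd|exact: hc|exact: hd|exact: hc].
case: s => [//|t [//|t' [|//]]] _ /=.
apply: (@hol_eq _ _ (fun u =>
  (xc ('d F u t) * yc ('d F u t') - yc ('d F u t) * xc ('d F u t')) * w (F u) [:: b0 R; b1 R] +
  (xc ('d F u t) * zc ('d F u t') - zc ('d F u t) * xc ('d F u t')) * w (F u) [:: b0 R; b2 R] +
  (yc ('d F u t) * zc ('d F u t') - zc ('d F u t) * yc ('d F u t')) * w (F u) [:: b1 R; b2 R])).
  by apply/nearnP; exists d => // u /Hd hu; rewrite (alt2E hu ('d F u t) ('d F u t')).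
by apply: holD; [apply: holD|]; (apply: holM; last exact: hc); apply: holB; apply: holM; exact: hd.
Qed.

End Pullback.

End Charts.

(** * Charts of a desingularization *)

Section Desing.
Variable R : realType.
Local Notation C := R[i].
Local Notation V := 'rV[C]_3.
Local Notation U := 'rV[C]_2.
Variable k : nat.
Hypothesis k2 : (2 <= k)%N.
Local Notation X := (Sk R k).
Local Notation m := k./2.
Variables (M : cmanifold R 2) (tau : carrier M -> V) (i : chart M).
Hypothesis ds : desingularization X tau.

Let F : U -> V := tau \o cinv i.
Let W : set U := cmap i @` cdom i.

Lemma chart_dom v : W v -> cdom i (cinv i v) /\ cmap i (cinv i v) = v.
Proof. by move=> [u du <-]; rewrite cmapK. Qed.

Lemma chart_near v : W v -> \forall w \near v, W w.
Proof. by move=> Wv; apply: open_nbhs_nbhs; split => //; exact: cimg_open. Qed.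

Lemma chart_diff v : W v -> \forall w \near v, differentiable F w.
Proof. by move=> /chart_dom[du uv]; have [[_ h] _ _ _] := ds; have := h i _ du; rewrite uv. Qed.

Lemma chart_X v : X (F v).
Proof. by have [[h _] _ _ _] := ds; exact: h. Qed.

(** Density of the preimage of the regular part gives a nearby point over a regular point of X;
    there the inverse [g] of [tau] is continuous and lifts nearby points of X with z nonzero. *)
Lemma chart_accum v : W v -> accum (fun w => zc (F w)) v.
Proof.
move=> Wv e e0; have [du uv] := chart_dom Wv; set u := cinv i v in du uv.
have [[_ _] _ dn [g [gK tauK loc]]] := ds.
pose B : set U := [set w | nm (w - v) < e].
have openN (P : set (carrier M)) u' : nbhs u' P -> exists2 G : set (carrier M), open G /\ G u' & G `<=` P.
  by rewrite nbhsE; case=> G [oG Gu] GP; exists G.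
have nB w : nm (w - v) < e -> nbhs w B.
  move=> we; suff H : \forall w' \near w, nm (w' - v) < e by [].
  apply/nearnP; exists (e - nm (w - v)); first by rewrite subr_gt0.
  by move=> w'; exact: nm_near.
have nO u' : cdom i u' -> nm (cmap i u' - v) < e -> nbhs u' (cdom i `&` cmap i @^-1` B).
  move=> du' he; apply: filterI.
    by apply: open_nbhs_nbhs; split => //; exact: cdom_open.
  by apply: (cmap_continuous du'); exact: nB.
have [G [oG Gu] GP] := openN _ _ (nO u du (ltac:(by rewrite uv subrr nm0))).
have [u' [Gu' ru']] := dn G (ex_intro _ u Gu) oG.
have [du' hu'] := GP u' Gu'.
have [z0|z0] := eqVneq (zc (tau u')) 0; last first.
  by exists (cmap i u') => //; rewrite /F /= cmapK.
(* Continuity of [g] is read in the chart [j]: on X near [tau u'], [g] is [cinv j] composed with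
   [f]. *)
have [j [f [hf /nearnP[d d0 Hd]]]] := loc _ ru'.
have Xt := ru'.1.
have [|dj fj] := Hd (tau u') _ Xt; first by rewrite subrr nm0.
rewrite (tauK _ ru') in dj fj.
have cf : {for tau u', continuous f} by exact: differentiable_continuous (nbhs_singleton hf).
have N1 := cinv_continuous dj (ltac:(rewrite cmapK //; exact: nO _ du' hu') : nbhs (cinv j (cmap j u')) _).
have : \forall y \near tau u', (cdom i `&` cmap i @^-1` B) (cinv j (f y)).
  by apply: (cf (fun y => (cdom i `&` cmap i @^-1` B) (cinv j y))); rewrite -fj.
move=> /nearnP[d' d'0 Hd'].
have [|y [Xy yd zy]] := zc_dense k2 Xt (e := Num.min d d'); first by rewrite lt_min d0.
move: yd; rewrite lt_min => /andP[/Hd/(_ Xy)[djy fjy] /Hd'[dy' hy']].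
have E : cinv j (f y) = g y by rewrite -fjy cmapK.
have ry : reg 2 X y by apply/(regP k2); split; [exact: Xy|exact: zc_neq0].
rewrite E in dy' hy'; exists (cmap i (g y)); first exact: hy'.
by rewrite /F /= (cmapK dy') (gK _ ry).
Qed.

Lemma chart_accum_pow j v : W v -> \forall w \near v, accum (fun w => zc (F w) ^+ j) w.
Proof.
move=> Wv; apply: (near1 (chart_near Wv)) => w Ww e e0.
by have [w' h z0] := chart_accum Ww e0; exists w' => //; rewrite expf_neq0.
Qed.

(** [F] takes its values in X, so a function vanishing on X near [F v] vanishes identically after
    composition with [F]. *)
Lemma chart_tangent v s : W v -> tangent X (F v) ('d F v s).
Proof.
move=> Wv f hf f0; have dF := nbhs_singleton (chart_diff Wv).
have cF := differentiable_continuous dF.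
have df : differentiable f (F v) by exact: nbhs_singleton hf.
have -> : 'd f (F v) ('d F v s) = 'd (f \o F) v s by rewrite (diff_comp dF df).
have E : \forall w \near v, (fun=> 0 : C) w = (f \o F) w.
  by apply: (near1 (cF _ f0)) => w /(_ (chart_X w)).
by rewrite (near_eq_diff E (differentiable_cst _ _)).2 diff_cst.
Qed.

Let d0 : U := delta_mx 0 0.
Let d1 : U := delta_mx 0 1.

Lemma cd_row2 (f : U -> C) v s : cd f v s = s 0 0 * cd f v d0 + s 0 1 * cd f v d1.
Proof.
have {1}-> : s = s 0 0 *: d0 + (s 0 1 *: d1 + 0).
  by apply/rowP => j; rewrite !mxE addr0; move: j; apply: ord2P; rewrite /= ?eqxx /=; ring.
rewrite !cd_lin; have -> : cd f v 0 = 0.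
  by have := cd_lin f v (-1) 0 0; rewrite scaler0 addr0 mulN1r addNr.
by rewrite addr0.
Qed.

Let F1 v := xc (F v).
Let F2 v := yc (F v).
Let F3 v := zc (F v).
Let hF1 v : W v -> hol F1 v. Proof. by move=> Wv; exact: (hol_coordF (chart_diff Wv) 0). Qed.
Let hF2 v : W v -> hol F2 v. Proof. by move=> Wv; exact: (hol_coordF (chart_diff Wv) 1). Qed.
Let hF3 v : W v -> hol F3 v. Proof. by move=> Wv; exact: (hol_coordF (chart_diff Wv) 2). Qed.
Let FE (v : U) : \forall w \near v, F1 w * F2 w = F3 w ^+ k.
Proof. by apply: near_all => w; exact: chart_X. Qed.

Lemma chart_dF v j s : W v -> ('d F v s) 0 j = cd (fun u => F u 0 j) v s.
Proof. by move=> Wv; exact: (nbhs_singleton (dF_coord (chart_diff Wv) j s)). Qed.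

(** [T] is required to be holomorphic over the whole chart, including the points over z = 0, where
    [theta] carries no information. *)
Definition pulls q (theta : form R 3) (T : form R 2) := forall v, W v ->
  [/\ alternating q (T v), forall s, size s = q -> hol (T^~ s) v &
      zc (F v) != 0 -> forall s, size s = q -> T v s = theta (F v) (map ('d F v) s)].

(** Riemann division gives the coefficient on each of the two coordinate vectors, [quot_glue] makes
    it one function over the chart, and linearity does the rest. *)
Lemma pull_xdy : exists T, pulls 1 (xdy_over_z m) T.
Proof.
have H e : exists Phi : U -> C, forall v, W v -> quot_at (fun w => F1 w * cd F2 w e) (fun w => F3 w ^+ m) v Phi.
  have [Phi HPhi] := quot_glue (fun w => F1 w * cd F2 w e) (fun w => F3 w ^+ m).
  exists Phi => v Wv; apply: HPhi; first exact: chart_accum_pow.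
  have [K HK] := product_bound1 k2 e (hF1 Wv) (hF2 Wv) (hF3 Wv) (FE v).
  apply: (@riemann_div _ _ _ _ v K).
  - by apply: holM; [exact: hF1|apply: hol_cd; exact: hF2].
  - by apply: holX; exact: hF3.
  - exact: nbhs_singleton (chart_accum_pow m Wv).
  - by apply: (near1 HK).
have [P0 H0] := H d0; have [P1 H1] := H d1.
exists (fun (v : U) (s : seq U) => (head 0 s) 0 0 * P0 v + (head 0 s) 0 1 * P1 v) => v Wv.
have [h0 /nbhs_singleton E0] := H0 v Wv; have [h1 /nbhs_singleton E1] := H1 v Wv.
split.
- by apply/alternating1P => c u w /=; rewrite !mxE; ring.
- by move=> s _; apply: holD; apply: holM => //; exact: hol_cst.
move=> z0 [//|s [|//]] _ /=; rewrite /xdy_over_z /dy /dcoord /= chart_dF //.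
rewrite -/F2 (cd_row2 F2) -/(F1 v) -/(F3 v).
have -> : F1 v * (s 0 0 * cd F2 v d0 + s 0 1 * cd F2 v d1) =
  s 0 0 * (F1 v * cd F2 v d0) + s 0 1 * (F1 v * cd F2 v d1) by ring.
by rewrite E0 E1 !mulrA -mulrDl mulfK ?expf_neq0.
Qed.

Lemma pull_dxdy : exists T, pulls 2 (dxdy_over_z (m - 1)) T.
Proof.
have [P HP] := quot_glue (fun w => cd F1 w d0 * cd F2 w d1 - cd F1 w d1 * cd F2 w d0)
  (fun w => F3 w ^+ (m - 1)).
have {}HP v : W v -> quot_at (fun w => cd F1 w d0 * cd F2 w d1 - cd F1 w d1 * cd F2 w d0)
  (fun w => F3 w ^+ (m - 1)) v P.
  move=> Wv; apply: HP; first exact: chart_accum_pow.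
  have [K HK] := product_bound2 k2 d0 d1 (hF1 Wv) (hF2 Wv) (hF3 Wv) (FE v).
  apply: (@riemann_div _ _ _ _ v K) => //.
  - by apply: holB; apply: holM; apply: hol_cd; [exact: hF1|exact: hF2|exact: hF1|exact: hF2].
  - by apply: holX; exact: hF3.
  - exact: nbhs_singleton (chart_accum_pow (m - 1) Wv).
exists (fun (v : U) (s : seq U) => (s`_0 0 0 * s`_1 0 1 - s`_0 0 1 * s`_1 0 0) * P v) => v Wv.
have [h /nbhs_singleton E] := HP v Wv.
split.
- by apply/alternating2P; split => [c u w x|c u w x|u] /=; [rewrite !mxE| rewrite !mxE|]; ring.
- by move=> s _; apply: holM => //; exact: hol_cst.
move=> z0 [//|s [//|t [|//]]] _ /=.
rewrite /dxdy_over_z wedge12 /dx /dy /dcoord /= !chart_dF // -/F1 -/F2 -/(F3 v).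
rewrite !(cd_row2 F1 v s) !(cd_row2 F1 v t) !(cd_row2 F2 v s) !(cd_row2 F2 v t).
rewrite [X in _ = X / _](_ : _ = (s 0 0 * t 0 1 - s 0 1 * t 0 0) *
  (cd F1 v d0 * cd F2 v d1 - cd F1 v d1 * cd F2 v d0)); last by ring.
by rewrite E mulrA mulfK ?expf_neq0.
Qed.

Lemma pull_zero : exists T, pulls 0 (fun _ _ => 0) T.
Proof.
exists (fun _ _ => 0) => v Wv; split => //; first exact: alternating0.
by move=> s _; exact: hol_cst.
Qed.

End Desing.

Section HoloForms.
Variables (R : realType) (N : nat).
Local Notation C := R[i].
Local Notation U := 'rV[C]_N.

Lemma holo_formD q (p : U) (a b : form R N) : holo_form q p a -> holo_form q p b ->
  holo_form q p (fun x s => a x s + b x s).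
Proof.
move=> [a1 a2] [b1 b2]; split.
  by apply: (near2 a1 b1) => x h1 h2; exact: alternatingD.
by move=> s hs; rewrite /holo_at -holo_atE; apply: holD; rewrite holo_atE; [exact: a2|exact: b2].
Qed.

Lemma holo_formZ q (p : U) (f : U -> C) (a : form R N) : hol f p ->
  holo_form q p a -> holo_form q p (fun x s => f x * a x s).
Proof.
move=> hf [a1 a2]; split.
  by apply: (near1 a1) => x h1; exact: alternatingZ.
by move=> s hs; rewrite /holo_at -holo_atE; apply: holM => //; rewrite holo_atE; exact: a2.
Qed.

End HoloForms.

(** * The stalks of alpha in degrees 0, 1 and 2 *)

Section Alpha.
Variable R : realType.
Local Notation C := R[i].
Local Notation V := 'rV[C]_3.
Local Notation U := 'rV[C]_2.
Local Notation form := (form R 3).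
Variable k : nat.
Hypothesis k2 : (2 <= k)%N.
Local Notation X := (Sk R k).
Local Notation m := k./2.
Implicit Types (x p : V) (a b w : form).

Lemma pullback_intro q p a w f theta (M : cmanifold R 2) (tau : carrier M -> V) :
  (q <= 2)%N -> holo_form q p w -> hol f p ->
  meq 2 X q p a (fun x s => w x s + f x * theta x s) -> desingularization X tau ->
  (forall i, exists T, pulls tau i q theta T) -> pullback_holo X q p a tau.
Proof.
move=> q2 hw hf [h nh E] ds HT.
(* The set collects the points where the data are still holomorphic and represent [a], to be used at
   [tau u]; the factor z restricts the comparison to points where [theta] is meaningful. *)
exists (fun x => zc x * h x), [set x | [/\ holo_form q x w, hol f x &
  reg 2 X x -> h x != 0 -> same_at X q x a (fun x s => w x s + f x * theta x s)]]; split.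
- by apply: nonzerodivM => //; exact: nonzerodiv_zc.
- have := near2 (nearI (holo_form_near q2 hw) (hol_near hf)) E; apply.
  by move=> x [h1 h2] h3; split.
move=> i; have [T hT] := HT i; set F : U -> V := tau \o cinv i.
exists (fun v s => w (F v) (map ('d F v) s) + f (F v) * T v s) => u du [hwu hfu Eu].
have Wv : (cmap i @` cdom i) (cmap i u) by exists u.
have Fu : F (cmap i u) = tau u by rewrite /F /= cmapK.
have hwF : holo_form q (F (cmap i u)) w by rewrite Fu.
have hfF : hol f (F (cmap i u)) by rewrite Fu.
have dF := chart_diff ds Wv.
split.
  apply: holo_formD; first exact: (holo_pullback dF q2 hwF).
  apply: holo_formZ; first exact: (hol_comp dF hfF).
  split; first by apply: (near1 (chart_near Wv)) => v Wv'; have [h1 _ _] := hT v Wv'; exact: h1.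
  by move=> s hs; rewrite /holo_at -holo_atE; have [_ h2 _] := hT _ Wv; exact: h2.
move=> ru; rewrite mulf_eq0 negb_or => /andP[z0 h0] s hs.
rewrite (Eu ru h0 (map ('d F (cmap i u)) s)) ?size_map //; last first.
  by move=> v /mapP[t _ ->]; rewrite -Fu; exact: chart_tangent.
by have [_ _ h3] := hT _ Wv; rewrite -/F h3 // -/F Fu.
Qed.

Lemma mero_intro q p a w w' f theta n : holo_form q p w -> hol f p -> holo_form q p w' ->
  meq 2 X q p a (fun x s => w x s + f x * theta x s) ->
  (forall x s, zc x != 0 -> theta x s = w' x s / zc x ^+ n) -> mero 2 X q p a.
Proof.
move=> hw hf hw' aF E; exists (fun x => zc x ^+ n), (fun x s => zc x ^+ n * w x s + f x * w' x s).
have nz : nonzerodiv X p (fun x => zc x ^+ n).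
  elim: (n) => [|j IH].
    by split; [apply/holo_hol; exact: hol_cst|apply: near_all => x Xx; apply: subset_closure; split; rewrite ?oner_neq0].
  rewrite (_ : (fun _ => _) = (fun x => zc x * zc x ^+ j)); last by apply/funext => x; rewrite exprS.
  by apply: nonzerodivM => //; exact: nonzerodiv_zc.
split => //.
  by apply: holo_formD; apply: holo_formZ => //; apply: holX; exact: hol_zc.
apply: (meq_trans k2 aF); apply/(meq_gen k2); apply: (generically_near k2).
apply: near_all => x Xx z0 s hs _; rewrite E //.
by rewrite mulrDl mulrAC mulfV ?expf_neq0 // mul1r mulrA.
Qed.

Lemma alpha0E p a : X p -> alpha 2 X 0 p a <-> Omega_tf 2 X 0 p a.
Proof.
move=> Xp; split; first exact: alpha0_sub.
move=> H; split; last exact: smooth_sum0.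
have [w hw aw] := H.
have aF : meq 2 X 0 p a (fun x s => w x s + (fun=> 0) x * (fun=> fun=> 0) x s).
  by apply: (meq_trans k2 aw); apply: (meq_eq k2) => x s _; rewrite mul0r addr0.
have h0 : hol (fun=> 0 : C) p by exact: hol_cst.
split.
  have hw0 : holo_form 0 p (fun _ _ => 0) by apply/holo_form0.
  by apply: (@mero_intro 0 p a w _ (fun=> 0) (fun=> fun=> 0) 0 hw h0 hw0 aF) => x s _; rewrite mul0r.
move=> M tau ds; apply: (pullback_intro (isT : (0 <= 2)%N) hw h0 aF ds) => i; exact: pull_zero.
Qed.

Lemma alpha1E p a : X p -> alpha 2 X 1 p a <-> Omega_tf_plus 2 X 1 (xdy_over_z m) p a.
Proof.
move=> Xp; split; first exact: alpha1_sub.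
move=> H; split; last exact: smooth_sum1.
have [w [f [hw /holo_hol hf aF]]] := H.
split.
  have hd : holo_form 1 p (fun x s => xc x * @dy R x s).
    apply: holo_formZ; first exact: hol_xc.
    split; first by apply: near_all => x; exact: alternating_d.
    by move=> s _; apply/holo_hol; exact: hol_cst.
  exact: (mero_intro hw hf hd aF).
move=> M tau ds; apply: (pullback_intro (isT : (1 <= 2)%N) hw hf aF ds) => i; exact: pull_xdy.
Qed.

Lemma alpha2E p a : X p -> alpha 2 X 2 p a <-> Omega_tf_plus 2 X 2 (dxdy_over_z (m - 1)) p a.
Proof.
move=> Xp; split; first exact: alpha2_sub.
move=> H; split; last exact: smooth_sum2.
have [w [f [hw /holo_hol hf aF]]] := H.
split.
  have hd : holo_form 2 p (wedge 1 (@dx R) (@dy R)).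
    split; first by apply: near_all => x; apply: alternating_w12; exact: alternating_d.
    move=> s /size2[u [v ->]]; apply/holo_hol.
    by rewrite (_ : _^~ _ = fun=> dx 0 [:: u] * dy 0 [:: v] - dx 0 [:: v] * dy 0 [:: u]);
      [exact: hol_cst|apply/funext => x; rewrite wedge12].
  exact: (mero_intro hw hf hd aF).
move=> M tau ds; apply: (pullback_intro (isT : (2 <= 2)%N) hw hf aF ds) => i; exact: pull_dxdy.
Qed.

End Alpha.

(** * Exterior products and derivatives *)

Section Products.
Variable R : realType.
Local Notation C := R[i].
Local Notation V := 'rV[C]_3.
Local Notation form := (form R 3).
Variable k : nat.
Hypothesis k2 : (2 <= k)%N.
Local Notation X := (Sk R k).
Local Notation m := k./2.
Local Notation ea := (@ea R k).
Local Notation eb := (@eb R k).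
Implicit Types (x p : V) (a b c w : form).

Lemma wedge_same_at r q x b b' c c' : (r <= q)%N -> same_at X r x b b' -> same_at X (q - r) x c c' ->
  same_at X q x (wedge r b c) (wedge r b' c').
Proof.
move=> rq E1 E2 s hs ts; apply: eq_bigr => t /eqP ct.
have c1 : size (mask t s) = r by rewrite size_mask ?size_tuple.
have c2 : size (mask (map negb t) s) = (q - r)%N.
  rewrite size_mask ?size_map ?size_tuple // count_map.
  have e : (r + count (predC id) t)%N = q by rewrite -ct count_predC size_tuple hs.
  by rewrite -e addKn; apply: eq_count.
by rewrite E1 ?E2 // => v /mem_mask; exact: ts.
Qed.

Lemma wedge_meq r q p b b' c c' : (r <= q)%N -> meq 2 X r p b b' -> meq 2 X (q - r) p c c' ->
  meq 2 X q p (wedge r b c) (wedge r b' c').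
Proof.
move=> rq /(meq_gen k2) h1 /(meq_gen k2) h2; apply/(meq_gen k2).
have := generically_and h1 h2; apply: generically_mono => x _ _ [e1 e2].
exact: wedge_same_at.
Qed.

Lemma wedge0E q b c x s : (q <= 2)%N -> size s = q -> wedge 0 b c x s = b x [::] * c x s.
Proof.
by case: q => [|[|[|//]]] _; [move=> /size0nil ->; exact: wedge00|case: s => [|u []]// _; exact: wedge01
  |case: s => [|u [|v []]]// _; exact: wedge02].
Qed.
Lemma wedgeqE q b c x s : (q <= 2)%N -> size s = q -> wedge q b c x s = b x s * c x [::].
Proof.
by case: q => [|[|[|//]]] _; [move=> /size0nil ->; exact: wedge00|case: s => [|u []]// _; exact: wedge11
  |case: s => [|u [|v []]]// _; exact: wedge22].
Qed.

Lemma omega_plus_eq q theta p a b : meq 2 X q p a b -> Omega_tf_plus 2 X q theta p b ->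
  Omega_tf_plus 2 X q theta p a.
Proof. by move=> E [w [f [hw hf H]]]; exists w, f; split => //; exact: (meq_trans k2 E). Qed.

Lemma omega_plus_sum q theta p a (n : nat) (t : 'I_n -> form) :
  (forall j, Omega_tf_plus 2 X q theta p (t j)) ->
  meq 2 X q p a (fun x s => \sum_(j < n) t j x s) -> Omega_tf_plus 2 X q theta p a.
Proof.
move=> H E; apply: (omega_plus_eq E); clear E.
elim: n t H => [|n IH] t H.
  exists (fun _ _ => 0), (fun=> 0); split.
  - split; first by apply: near_all => x; split => // *; rewrite mulr0 addr0.
    by move=> s _; apply/holo_hol; exact: hol_cst.
  - by apply/holo_hol; exact: hol_cst.
  - by apply: (meq_eq k2) => x s _; rewrite big_ord0 mul0r addr0.
have [w1 [f1 [hw1 /holo_hol hf1 E1]]] := IH (fun j => t (widen_ord (leqnSn n) j)) (fun j => H _).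
have [w2 [f2 [hw2 /holo_hol hf2 E2]]] := H ord_max.
exists (fun x s => w1 x s + w2 x s), (fun x => f1 x + f2 x); split.
- exact: holo_formD.
- by apply/holo_hol; exact: holD.
apply/(meq_gen k2).
have := generically_and ((meq_gen k2 _ _ _ _).1 E1) ((meq_gen k2 _ _ _ _).1 E2).
apply: generically_mono => x _ _ [e1 e2] s hs ts.
by rewrite big_ord_recr /= e1 // e2 //; ring.
Qed.

Lemma omega_tf0 p a : Omega_tf 2 X 0 p a <-> exists2 f : V -> C, hol f p & meq 2 X 0 p a (fun x _ => f x).
Proof.
split=> [[w /holo_form0 hw E]|[f hf E]].
  exists (w^~ [::]) => //; apply: (meq_trans k2 E); apply: (meq_eq k2) => x s /size0nil -> //.
by exists (fun x _ => f x) => //; exact/holo_form0.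
Qed.

Lemma omega_plus_mul0 q theta p b c : (q <= 2)%N -> Omega_tf 2 X 0 p b -> Omega_tf_plus 2 X q theta p c ->
  Omega_tf_plus 2 X q theta p (wedge 0 b c).
Proof.
move=> q2 /omega_tf0[f hf E1] [w [g [hw /holo_hol hg E2]]].
have E2' : meq 2 X (q - 0) p c (fun x s => w x s + g x * theta x s) by rewrite subn0.
exists (fun x s => f x * w x s), (fun x => f x * g x); split.
- exact: holo_formZ.
- by apply/holo_hol; exact: holM.
apply: (meq_trans k2 (wedge_meq (leq0n q) E1 E2')); apply: (meq_eq k2) => x s hs.
by rewrite (wedge0E _ _ _ q2 hs); ring.
Qed.

Lemma omega_plus_mulq q theta p b c : (q <= 2)%N -> Omega_tf_plus 2 X q theta p b -> Omega_tf 2 X 0 p c ->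
  Omega_tf_plus 2 X q theta p (wedge q b c).
Proof.
move=> q2 [w [g [hw /holo_hol hg E2]]] /omega_tf0[f hf E1].
have E1' : meq 2 X (q - q) p c (fun x _ => f x) by rewrite subnn.
exists (fun x s => f x * w x s), (fun x => f x * g x); split.
- exact: holo_formZ.
- by apply/holo_hol; exact: holM.
apply: (meq_trans k2 (wedge_meq (leqnn q) E2 E1')); apply: (meq_eq k2) => x s hs.
by rewrite (wedgeqE _ _ _ q2 hs); ring.
Qed.

Lemma omega1_form theta p a : Omega_tf_plus 2 X 1 theta p a -> exists f1 f2 f3 f : V -> C,
  [/\ hol f1 p, hol f2 p, hol f3 p, hol f p &
      meq 2 X 1 p a (fun x s => form1 f1 f2 f3 x s + f x * theta x s)].
Proof.
move=> [w [f [hw /holo_hol hf E]]].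
exists (w^~ [:: b0 R]), (w^~ [:: b1 R]), (w^~ [:: b2 R]), f.
split => //; try exact: holo_form_coef hw _.
apply: (meq_trans k2 E); apply/(meq_gen k2); apply: (generically_near k2).
have H := holo_form1E hw; apply: (near1 H) => x hx _ _ s /size1[v ->] _.
by rewrite hx.
Qed.

Lemma omega_plus2_intro p (f12 f13 f23 f : V -> C) n F : (n <= k)%N ->
  hol f12 p -> hol f13 p -> hol f23 p -> hol f p -> (\forall x \near p, alternating 2 (F x)) ->
  (\forall x \near p, X x -> zc x != 0 -> F x [:: ea x; eb x] =
     k%:R ^+ 2 * xc x * yc x * f12 x + k%:R * xc x * zc x * f13 x -
     k%:R * yc x * zc x * f23 x + k%:R ^+ 2 * zc x ^+ (k - n) * f x) ->
  Omega_tf_plus 2 X 2 (dxdy_over_z n) p F.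
Proof.
move=> nk h1 h2 h3 hf aF E.
apply: (omega_plus_intro k2 (isT : (2 <= 2)%N) (F := F) _ aF (alternating_dxdy n) (holo_form2 h1 h2 h3) hf).
  exact: meq_eq.
apply: (near1 E) => x e Xx z0; rewrite /coef_eq (e Xx z0) form2E !cpt dxdy_e //; ring.
Qed.

Let mk : (m < k)%N. Proof. by have := half_le k; have := half_gt0 k2; clear; lia. Qed.

(** The square of x dy/z^m is zero, and its product with a holomorphic 1-form takes on ([ea], [eb])
    a value divisible by z^(k-m), that is, a multiple of dx dy/z^m. *)
Lemma wedge_xdy p b c : Omega_tf_plus 2 X 1 (xdy_over_z m) p b -> Omega_tf_plus 2 X 1 (xdy_over_z m) p c ->
  Omega_tf_plus 2 X 2 (dxdy_over_z m) p (wedge 1 b c).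
Proof.
move=> /omega1_form[f1 [f2 [f3 [f [h1 h2 h3 hf E1]]]]] /omega1_form[g1 [g2 [g3 [g [i1 i2 i3 ig E2]]]]].
apply: (omega_plus_eq (wedge_meq (isT : (1 <= 2)%N) E1 E2)).
have kk := kC R k2.
have al (e1 e2 e3 e : V -> C) x : alternating 1 (fun s => form1 e1 e2 e3 x s + e x * xdy_over_z m x s).
  by apply: alternatingD; [exact: alternating_form1|apply: alternatingZ; exact: alternating_xdy].
have hX := hol_xc p; have hZ := hol_zc p; have hk (c0 : C) : hol (fun=> c0 : C) p by exact: hol_cst.
apply: (@omega_plus2_intro p (fun x => f1 x * g2 x - g1 x * f2 x) (fun x => f1 x * g3 x - g1 x * f3 x)
  (fun x => g3 x * f2 x - f3 x * g2 x)
  (fun x => (k%:R * xc x * (f1 x * g x - g1 x * f x) + zc x * (f3 x * g x - g3 x * f x)) * k%:R^-1)).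
- exact: ltnW.
- by apply: holB; exact: holM.
- by apply: holB; exact: holM.
- by apply: holB; exact: holM.
- apply: holM; last exact: hk.
  by apply: holD; apply: holM; [exact: holM|apply: holB; exact: holM|exact: hZ|apply: holB; exact: holM].
- by apply: near_all => x; apply: alternating_w12; exact: al.
apply: near_all => x Xx z0; rewrite wedge12 !form1E !cpt !xdy_ea !(xdy_eb Xx z0 (ltnW mk)).
by field; rewrite kk.
Qed.

Lemma tangent_cd x v (f g : V -> C) : tangent X x v -> hol f x -> hol g x ->
  (\forall y \near x, X y -> f y = g y) -> cd f x v = cd g x v.
Proof.
move=> tv hf hg E; apply/eqP; rewrite -subr_eq0 -cdB; [|exact: hol_cdf|exact: hol_cdf].
rewrite cdE tv //; first by apply/holo_hol; exact: holB.
by apply: (near1 E) => y e Xy; rewrite e // subrr.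
Qed.

(* The vector fields [ea] and [eb] commute, so only the derivatives of the
   coefficients remain. *)
Lemma extd_coef x w (u v : V -> C) : X x -> holo_form 1 x w -> hol u x -> hol v x ->
  (\forall y \near x, X y -> w y [:: ea y] = u y) ->
  (\forall y \near x, X y -> w y [:: eb y] = v y) ->
  extd w x [:: ea x; eb x] = cd v x (ea x) - cd u x (eb x).
Proof.
move=> Xx hw hu hv Eu Ev.
have ta := tangent_ea Xx; have tb := tangent_eb Xx.
have hc s : size s = 1%N -> cdf (w^~ s) x by move=> hs; apply: hol_cdf; exact: holo_form_coef hw hs.
have hA := hol_eval1 hw (hol_ea k x); have hB := hol_eval1 hw (hol_eb k x).
rewrite extd1 -(tangent_cd ta hB hv Ev) -(tangent_cd tb hA hu Eu).
have [ha _] := hw.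
(* Product rule: deriving the value of [w] on a variable field adds the value of [w] on the
   derivative of the field. *)
have D e (s t r : V -> C) : cdf s x -> cdf t x -> cdf r x ->
    cd (fun y => w y [:: pt (s y) (t y) (r y)]) x e =
    cd (w^~ [:: pt (s x) (t x) (r x)]) x e + w x [:: pt (cd s x e) (cd t x e) (cd r x e)].
  move=> hs ht hr.
  have E : \forall y \near x, s y * w y [:: b0 R] + t y * w y [:: b1 R] + r y * w y [:: b2 R] =
      w y [:: pt (s y) (t y) (r y)].
    by apply: (near1 ha) => y hy; rewrite (alt1E hy (pt _ _ _)) !cpt.
  have E' : \forall y \near x, s x * w y [:: b0 R] + t x * w y [:: b1 R] + r x * w y [:: b2 R] =
      w y [:: pt (s x) (t x) (r x)].
    by apply: (near1 ha) => y hy; rewrite (alt1E hy (pt _ _ _)) !cpt.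
  have c0 := hc [:: b0 R] erefl; have c1 := hc [:: b1 R] erefl; have c2 := hc [:: b2 R] erefl.
  have cc (a0 : C) : cdf (fun=> a0) x by exact: cdf_cst.
  rewrite (cd_near _ E); last by apply: cdfD; [apply: cdfD|]; exact: cdfM.
  rewrite (cd_near _ E'); last by apply: cdfD; [apply: cdfD|]; exact: cdfM.
  rewrite (alt1E (nbhs_singleton ha) (pt (cd s x e) _ _)) !cpt.
  rewrite !cdD ?cdM ?cd_cst //; try (by apply: cdfM); try (by apply: cdfD; exact: cdfM).
  ring.
have cX := cdf_xc x; have cY := cdf_yc x; have cZ := cdf_zc x.
have cc (a0 : C) : cdf (fun=> a0) x by exact: cdf_cst.
have cM (f : V -> C) : cdf f x -> cdf (fun y => k%:R * f y) x by move=> h; exact: cdfM.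
(* The derivative of [eb] along [ea] and that of [ea] along [eb] are both (0, 0, z), so these terms
   cancel in the difference. *)
have -> : cd (fun y => w y [:: eb y]) x (ea x) = cd (w^~ [:: eb x]) x (ea x) + w x [:: pt 0 0 (zc x)].
  rewrite (D (ea x) _ _ _ (cc 0) (cM _ cY) cZ); congr (_ + w x [:: pt _ _ _]).
  - by rewrite cd_cst.
  - by rewrite cdM // cd_cst cd_yc cpt; ring.
  - by rewrite cd_zc cpt.
have -> : cd (fun y => w y [:: ea y]) x (eb x) = cd (w^~ [:: ea x]) x (eb x) + w x [:: pt 0 0 (zc x)].
  rewrite (D (eb x) _ _ _ (cM _ cX) (cc 0) cZ); congr (_ + w x [:: pt _ _ _]).
  - by rewrite cdM // cd_cst cd_xc cpt; ring.
  - by rewrite cd_cst.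
  - by rewrite cd_zc cpt.
ring.
Qed.

End Products.

Section Iterates.
Variable R : realType.
Local Notation C := R[i].
Local Notation V := 'rV[C]_3.
Local Notation form := (form R 3).
Variable k : nat.
Hypothesis k2 : (2 <= k)%N.
Local Notation X := (Sk R k).
Local Notation m := k./2.
Local Notation ea := (@ea R k).
Local Notation eb := (@eb R k).
Implicit Types (x p : V) (a b c w : form).

Let mk : (m < k)%N. Proof. by have := half_le k; have := half_gt0 k2; clear; lia. Qed.

(** The local form [w] agrees with [c] on X around [x]; off the zeros of z and of [h'], an open
    condition, it therefore agrees with [c'] too, so derivatives can be computed from a normal form
    of [c]. *)
Lemma is_extd_gen q p c c' dc : is_extd 2 X q p c dc -> meq 2 X q p c c' ->
  generically k p (fun x => exists w, [/\ holo_form q x w,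
    \forall y \near x, X y -> same_at X q y c' w & same_at X q.+1 x dc (extd w)]).
Proof.
move=> [h nh H] /(meq_gen k2)[h' nh' H'].
exists (fun x => h x * h' x); first exact: nonzerodivM.
have hh' : hol h' p by apply/holo_hol; exact: nh'.1.
have H2 := near_join H'.
apply: (near2 (nearI H (hol_near hh')) H2) => x [e1 e2] e3 Xx z0.
rewrite mulf_eq0 negb_or => /andP[hx hx'].
have rx : reg 2 X x by apply/(regP k2); split => //; exact: zc_neq0.
have [w [hw Ew Ed]] := e1 rx hx.
exists w; split=> //.
have n1 := cdf_neq0 (cdf_zc x) z0; have n2 := cdf_neq0 (hol_cdf e2) hx'.
apply: (near2 (nearI e3 Ew) (nearI n1 n2)) => y [e4 e5] [zy hy] Xy s hs ts.
have ry : reg 2 X y by apply/(regP k2); split => //; exact: zc_neq0.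
by rewrite -(e4 Xy zy hy s hs ts) (e5 ry s hs ts).
Qed.

Lemma omega_plus_of_omega q theta p a : Omega_tf 2 X q p a -> Omega_tf_plus 2 X q theta p a.
Proof.
move=> [w hw E]; exists w, (fun=> 0); split => //; first by apply/holo_hol; exact: hol_cst.
by apply: (meq_trans k2 E); apply: (meq_eq k2) => x s _; rewrite mul0r addr0.
Qed.

(** The local representative and [f] coincide on X, and tangent vectors annihilate functions
    vanishing on X, so the two differentials agree along X. *)
Lemma extd_omega0 p c dc : Omega_tf 2 X 0 p c -> is_extd 2 X 0 p c dc -> Omega_tf 2 X 1 p dc.
Proof.
move=> /omega_tf0[//|f hf E1] /is_extd_gen/(_ E1) H.
exists (form1 (fun x => cd f x (b0 R)) (fun x => cd f x (b1 R)) (fun x => cd f x (b2 R))).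
  by apply: holo_form1; exact: hol_cd.
apply/(meq_gen k2).
have hn : generically k p (fun x => hol f x).
  by apply: (generically_near k2); apply: (near1 (hol_near hf)) => x h _ _; exact: h.
have := generically_and H hn; apply: generically_mono => x Xx z0 [[w [hw Ew Ed]] hx] s hs ts.
rewrite Ed //; case/size1: hs ts => v -> ts; rewrite extd0 form1E.
have tv : tangent X x v by apply: ts; rewrite inE.
have E : \forall y \near x, X y -> w y [::] = f y.
  apply: (near1 Ew) => y e Xy; apply: esym; apply: (e Xy [::] erefl) => t.
  by move=> h; exfalso; move: h; rewrite in_nil.
rewrite (tangent_cd tv _ hx E); last exact: holo_form_coef hw _.
rewrite {1}[v](@basisE R) !cd_lin.
have -> : cd f x 0 = 0 by have := cd_lin f x (-1) 0 0; rewrite scaler0 addr0 mulN1r addNr.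
by ring.
Qed.

Lemma extd_xdy p c dc : Omega_tf_plus 2 X 1 (xdy_over_z m) p c -> is_extd 2 X 1 p c dc ->
  Omega_tf_plus 2 X 2 (dxdy_over_z m) p dc.
Proof.
move=> /(omega1_form k2)[f1 [f2 [f3 [f [h1 h2 h3 hf E1]]]]] /is_extd_gen/(_ E1) H.
have kk := kC R k2.
pose u x : C := k%:R * xc x * f1 x + zc x * f3 x.
pose v x : C := k%:R * yc x * f2 x + zc x * f3 x + k%:R * zc x ^+ (k - m) * f x.
pose F12 x := cd f2 x (b0 R) - cd f1 x (b1 R).
pose F13 x := cd f3 x (b0 R) - cd f1 x (b2 R).
pose F23 x := cd f3 x (b1 R) - cd f2 x (b2 R).
(* The derivative of k z^(k-m) f along [ea] is k z^(k-m) ((k - m) f + ea(f)), whereas dx dy/z^m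
   takes the value k^2 z^(k-m). *)
pose F x : C := ((k - m)%:R * f x + (k%:R * xc x * cd f x (b0 R) + zc x * cd f x (b2 R))) * k%:R^-1.
pose G : form := fun x s => form2 F12 F13 F23 x s + F x * dxdy_over_z m x s.
have hk (c0 : C) q : hol (fun=> c0 : C) q by exact: hol_cst.
have hX := hol_xc; have hY := hol_yc; have hZ := hol_zc.
exists (form2 F12 F13 F23), F; split.
- by apply: holo_form2; apply: holB; exact: hol_cd.
- apply/holo_hol; apply: holM => //; apply: holD; first exact: holM.
  by apply: holD; apply: holM; try exact: hol_cd => //; [exact: holM|exact: hZ].
suff : meq 2 X 2 p dc G by [].
apply/(meq_gen k2).
have hn : generically k p (fun x => [/\ hol f1 x, hol f2 x, hol f3 x & hol f x]).
  apply: (generically_near k2).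
  apply: (near2 (nearI (hol_near h1) (hol_near h2)) (nearI (hol_near h3) (hol_near hf))).
  by move=> x [? ?] [? ?] _ _; split.
have := generically_and H hn; apply: generically_mono => x Xx z0 [[w [hw Ew Ed]] [g1 g2 g3 g]] s hs ts.
rewrite Ed //.
suff : same_at X 2 x (extd w) G by apply.
apply: (same_at_coef k2 Xx z0 (isT : (2 <= 2)%N)).
- exact: alternating_extd1.
- by apply: alternatingD; [exact: alternating_form2|apply: alternatingZ; exact: alternating_dxdy].
have nz := cdf_neq0 (cdf_zc x) z0.
have hu : hol u x by apply: holD; apply: holM => //; exact: holM.
have hv : hol v x.
  apply: holD; first by apply: holD; apply: holM => //; exact: holM.
  by apply: holM => //; apply: holM => //; exact: holX.
have Eu : \forall y \near x, X y -> w y [:: ea y] = u y.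
  apply: (near1 Ew) => y e Xy; rewrite -(e Xy [:: ea y] erefl); last first.
    by move=> t; rewrite inE => /eqP ->; exact: tangent_ea.
  by rewrite form1E xdy_ea !cpt /u; ring.
have Ev : \forall y \near x, X y -> w y [:: eb y] = v y.
  apply: (near2 Ew nz) => y e zy Xy; rewrite -(e Xy [:: eb y] erefl); last first.
    by move=> t; rewrite inE => /eqP ->; exact: tangent_eb.
  by rewrite form1E (xdy_eb Xy zy (ltnW mk)) !cpt /v; ring.
rewrite /coef_eq (extd_coef Xx hw hu hv Eu Ev) /G form2E (dxdy_e Xx z0 (ltnW mk)) !cpt.
have c1 := hol_cdf g1; have c2 := hol_cdf g2; have c3 := hol_cdf g3; have c4 := hol_cdf g.
have cX := cdf_xc x; have cY := cdf_yc x; have cZ := cdf_zc x.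
have cc (a0 : C) : cdf (fun=> a0) x by exact: cdf_cst.
have kX : cdf (fun y => k%:R * xc y) x by exact: cdfM.
have kY : cdf (fun y => k%:R * yc y) x by exact: cdfM.
have Zn : cdf (fun y => zc y ^+ (k - m)) x by exact: cdfX.
have kZ : cdf (fun y => k%:R * zc y ^+ (k - m)) x by exact: cdfM.
have cdr (g0 : V -> C) t : cd g0 x t = xc t * cd g0 x (b0 R) + yc t * cd g0 x (b1 R) + zc t * cd g0 x (b2 R).
  rewrite {1}[t](@basisE R) !cd_lin.
  have -> : cd g0 x 0 = 0 by have := cd_lin g0 x (-1) 0 0; rewrite scaler0 addr0 mulN1r addNr.
  by ring.
have -> : cd v x (ea x) = k%:R * yc x * cd f2 x (ea x) + zc x * f3 x + zc x * cd f3 x (ea x) +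
    k%:R * (k - m)%:R * zc x ^+ (k - m) * f x + k%:R * zc x ^+ (k - m) * cd f x (ea x).
  have e : zc x ^+ (k - m) = zc x * zc x ^+ (k - m).-1 by rewrite -exprS prednK // subn_gt0.
  rewrite /v cdD; [|by apply: cdfD; exact: cdfM|exact: cdfM].
  rewrite cdD; [|exact: cdfM|exact: cdfM].
  rewrite (cdM _ kY c2) (cdM _ cZ c3) (cdM _ kZ c4) (cdM _ (cc _) cY) (cdM _ (cc _) Zn) (cdX _ _ cZ).
  by rewrite !cd_cst cd_yc cd_zc !cpt e; ring.
have -> : cd u x (eb x) = k%:R * xc x * cd f1 x (eb x) + zc x * f3 x + zc x * cd f3 x (eb x).
  rewrite /u cdD; [|exact: cdfM|exact: cdfM].
  rewrite (cdM _ kX c1) (cdM _ cZ c3) (cdM _ (cc _) cX).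
  by rewrite !cd_cst cd_xc cd_zc !cpt; ring.
rewrite (cdr f2 (ea x)) (cdr f3 (ea x)) (cdr f (ea x)) (cdr f1 (eb x)) (cdr f3 (eb x)) !cpt.
by rewrite /F12 /F13 /F23 /F; field; rewrite kk.
Qed.

Lemma is_extd_xdy p : is_extd 2 X 1 p (xdy_over_z m)
  (fun x s => (k - m)%:R / k%:R * dxdy_over_z m x s).
Proof.
have kk := kC R k2.
exists (@zc R); first exact: nonzerodiv_zc.
apply: near_all => x /(regP k2)[Xx x0] z0.
(* Where z is nonzero the form is holomorphic as it stands and represents itself; it is 0 on [ea]
   and k z^(k-m) on [eb], and the derivative of the latter along [ea] gives the factor (k - m)/k. *)
pose w : form := form1 (fun=> 0) (fun y => xc y / zc y ^+ m) (fun=> 0).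
have hk (c0 : C) q : hol (fun=> c0 : C) q by exact: hol_cst.
have hw : holo_form 1 x w.
  apply: holo_form1 => //; apply: hol_div; [exact: hol_xc|by apply: holX; exact: hol_zc|].
  by rewrite expf_neq0.
have wE y s : size s = 1%N -> xdy_over_z m y s = w y s.
  by move=> /size1[t ->]; rewrite /w form1E /xdy_over_z /dy /dcoord /= -/(yc t); ring.
exists w; split => //.
  by apply: near_all => y _ s hs _; exact: wE.
apply: (same_at_coef k2 Xx z0 (isT : (2 <= 2)%N)).
- by apply: alternatingZ; exact: alternating_dxdy.
- exact: alternating_extd1.
have nz := cdf_neq0 (cdf_zc x) z0.
have Eu : \forall y \near x, X y -> w y [:: ea y] = 0.
  by apply: near_all => y _; rewrite -wE // xdy_ea.
have Ev : \forall y \near x, X y -> w y [:: eb y] = k%:R * zc y ^+ (k - m).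
  by apply: (near1 nz) => y zy Xy; rewrite -wE // (xdy_eb Xy zy (ltnW mk)).
have hv : hol (fun y : V => k%:R * zc y ^+ (k - m) : C) x.
  by apply: holM => //; apply: holX; exact: hol_zc.
rewrite /coef_eq (extd_coef Xx hw (hk _ 0 x) hv Eu Ev) (dxdy_e Xx z0 (ltnW mk)).
have cZ := cdf_zc x; have Zn : cdf (fun y : V => zc y ^+ (k - m)) x by exact: cdfX.
have e : zc x ^+ (k - m) = zc x * zc x ^+ (k - m).-1 by rewrite -exprS prednK // subn_gt0.
rewrite (cdM _ (cdf_cst _ _) Zn) (cdX _ _ cZ) !cd_cst cd_zc !cpt e.
by field; rewrite kk.
Qed.

Lemma dxdy_weaken p a : Omega_tf_plus 2 X 2 (dxdy_over_z (m - 1)) p a ->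
  Omega_tf_plus 2 X 2 (dxdy_over_z m) p a.
Proof.
move=> [w [f [hw /holo_hol hf E]]]; exists w, (fun x => f x * zc x); split => //.
  by apply/holo_hol; apply: holM => //; exact: hol_zc.
apply: (meq_trans k2 E); apply/(meq_gen k2); apply: (generically_near k2).
apply: near_all => x Xx z0 s hs _; congr (_ + _).
have e : zc x ^+ m = zc x * zc x ^+ (m - 1).
  by rewrite -exprS; congr (_ ^+ _); have := half_gt0 k2; clear; lia.
rewrite /dxdy_over_z e; field.
by rewrite z0 expf_neq0.
Qed.

End Iterates.

(** * The iterated sheaves *)

Section AlphaIter.
Variable R : realType.
Local Notation C := R[i].
Local Notation V := 'rV[C]_3.
Local Notation form := (form R 3).
Variable k : nat.
Hypothesis k2 : (2 <= k)%N.
Local Notation X := (Sk R k).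
Local Notation m := k./2.
Implicit Types (x p : V) (a b c w : form).

Let mk : (m < k)%N. Proof. by have := half_le k; have := half_gt0 k2; clear; lia. Qed.

Definition iter_gen (n q : nat) : form := match q with
  | 0 => fun _ _ => 0
  | 1 => xdy_over_z m
  | _ => if n is 0 then dxdy_over_z (m - 1) else dxdy_over_z m
  end.

Lemma omega_plus0 n p a : Omega_tf_plus 2 X 0 (iter_gen n 0) p a <-> Omega_tf 2 X 0 p a.
Proof.
split=> [[w [f [hw _ E]]]|]; last exact: omega_plus_of_omega.
exists w => //; apply: (meq_trans k2 E); apply: (meq_eq k2) => x s _ /=.
by rewrite mulr0 addr0.
Qed.

Lemma iter_gen_step n p q a : (q <= 2)%N -> Omega_tf_plus 2 X q (iter_gen n q) p a ->
  Omega_tf_plus 2 X q (iter_gen n.+1 q) p a.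
Proof. by case: q => [|[|[|//]]] //; case: n => //= _; exact: dxdy_weaken. Qed.

Lemma one_omega p : Omega_tf 2 X 0 p (fun _ _ => 1).
Proof. by apply/(omega_tf0 k2); exists (fun=> 1); [exact: hol_cst|exact: meq_eq]. Qed.

Lemma alpha_iter_sub n (IH : forall q p a, (q <= 2)%N -> X p ->
    alpha_iter 2 X n q p a -> Omega_tf_plus 2 X q (iter_gen n q) p a) q p a :
  (q <= 2)%N -> X p -> alpha_iter 2 X n.+1 q p a -> Omega_tf_plus 2 X q (iter_gen n.+1 q) p a.
Proof.
move=> q2 Xp [J [t [Ht E]]]; apply: (omega_plus_sum k2 _ E) => j; have {}Ht := Ht j.
case: Ht => [[r [b [c [rq ib ic ->]]]]|[r [b [c [dc [rq ib ic ed ->]]]]]].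
(* In degree at most 2, either one factor is a holomorphic function or both factors have degree
   1. *)
- have [r0|r0] := eqVneq r 0%N.
    rewrite r0 in ib ic *; rewrite subn0 in ic; apply: iter_gen_step => //.
    apply: (omega_plus_mul0 k2 q2); last exact: IH.
    by apply/omega_plus0; exact: IH ib.
  have [rE|rE] := eqVneq r q.
    rewrite rE subnn in ib ic *; apply: iter_gen_step => //.
    apply: (omega_plus_mulq k2 q2); first exact: IH.
    by apply/omega_plus0; exact: IH ic.
  have [r1 qE] : r = 1%N /\ q = 2%N by move: r0 rE rq q2; clear; lia.
  by rewrite r1 qE in ib ic *; apply: (wedge_xdy k2); [exact: IH ib|exact: IH ic].
(* If r is positive then r = 1 and q = 2, and [dc] is the differential of a holomorphic function,
   hence a holomorphic 1-form. *)
- have [r0|r0] := eqVneq r 0%N; last first.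
    have [r1 qE] : r = 1%N /\ q = 2%N by move: r0 rq q2; clear; lia.
    rewrite r1 qE in ib ic ed *; apply: (wedge_xdy k2); first exact: IH ib.
    apply: (omega_plus_of_omega k2); apply: (extd_omega0 k2 _ ed).
    by apply/omega_plus0; exact: IH ic.
  rewrite r0 in ib ic ed rq *.
  have hb : Omega_tf 2 X 0 p b by apply/omega_plus0; exact: IH ib.
  apply: (omega_plus_mul0 k2 q2 hb).
  case: q q2 {E} rq ic ed => [|[|[|//]]] // _ _ ic ed.
    apply: (omega_plus_of_omega k2); apply: (extd_omega0 k2 _ ed).
    by apply/omega_plus0; exact: IH ic.
  by apply: (extd_xdy k2 _ ed); exact: IH ic.
Qed.

(** A section is its own product with the constant function 1. *)
Lemma alpha_iter_mono n q p a : (q <= 2)%N -> alpha_iter 2 X n 0 p (fun _ _ => 1) ->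
  alpha_iter 2 X n q p a -> alpha_iter 2 X n.+1 q p a.
Proof.
move=> q2 i1 ia; exists 1, (fun=> wedge 0 (fun _ _ => 1) a); split.
  by move=> _; left; exists 0, (fun _ _ => 1), a; rewrite subn0.
by apply: (meq_eq k2) => x s hs; rewrite big_ord1 (wedge0E _ _ _ q2 hs) mul1r.
Qed.

Lemma alpha_iter_dxdy p a : X p -> Omega_tf_plus 2 X 2 (dxdy_over_z m) p a -> alpha_iter 2 X 1 2 p a.
Proof.
move=> Xp [w [f [hw /holo_hol hf E]]].
have km0 : (k - m)%:R != 0 :> C by rewrite pnatr_eq0 -lt0n subn_gt0.
have kk := kC R k2.
pose dc : form := fun x s => (k - m)%:R / k%:R * dxdy_over_z m x s.
(* Compensates the nonzero factor (k - m)/k in the derivative of x dy/z^m. *)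
pose b : form := fun x _ => f x * (k%:R / (k - m)%:R).
have hb : alpha 2 X 0 p b.
  apply: (alpha0E k2 _ Xp).2; apply/(omega_tf0 k2); exists (fun x => f x * (k%:R / (k - m)%:R)).
    by apply: holM => //; exact: hol_cst.
  exact: meq_eq.
have h1 : alpha 2 X 0 p (fun _ _ => 1) by apply: (alpha0E k2 _ Xp).2; exact: one_omega.
have hww : alpha 2 X 2 p w.
  apply: (alpha2E k2 _ Xp).2; apply: (omega_plus_of_omega k2); exists w => //; exact: meq_eq.
have hx : alpha 2 X 1 p (xdy_over_z m).
  apply: (alpha1E k2 _ Xp).2; exists (fun _ _ => 0), (fun=> 1); split.
  - have h0 : holo_form 1 p (form1 (fun=> 0) (fun=> 0) (fun=> 0)).
      by apply: holo_form1; exact: hol_cst.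
    rewrite (_ : (fun _ _ => 0) = (fun x s => (fun=> 0) x * form1 (fun=> 0) (fun=> 0) (fun=> 0) x s)).
      by apply: holo_formZ => //; exact: hol_cst.
    by apply/funext => x; apply/funext => s; rewrite mul0r.
  - by apply/holo_hol; exact: hol_cst.
  - by apply: (meq_eq k2) => x s _; rewrite add0r mul1r.
exists 2, (fun j : 'I_2 => if val j is 0 then wedge 0 (fun _ _ => 1) w else wedge 0 b dc); split.
  move=> [[|[|//]] ?] /=.
    by left; exists 0%N, (fun _ _ => 1), w.
  right; exists 0%N, b, (xdy_over_z m), dc; split => //.
  exact: is_extd_xdy.
apply: (meq_trans k2 E); apply: (meq_eq k2) => x s hs.
rewrite big_ord_recl big_ord1 /= !(@wedge0E R 2) // mul1r /b /dc; congr (_ + _).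
by field; rewrite kk km0.
Qed.

(** The generators change only once, in degree 2 at the first step; from then on membership is kept
    by [alpha_iter_mono] and the upper bound is stable under products and derivatives. *)
Lemma alpha_iterE n q p a : (q <= 2)%N -> X p ->
  alpha_iter 2 X n q p a <-> Omega_tf_plus 2 X q (iter_gen n q) p a.
Proof.
elim: n q p a => [|n IH] q p a q2 Xp.
  case: q q2 => [|[|[|//]]] _ /=.
  - by apply: (iff_trans (alpha0E k2 a Xp)); apply: iff_sym; exact: (omega_plus0 0 p a).
  - exact: alpha1E.
  - exact: alpha2E.
split; first by apply: alpha_iter_sub => // q' p' a' q2' Xp'; exact: (IH _ _ _ q2' Xp').1.
have i1 : alpha_iter 2 X n 0 p (fun _ _ => 1).
  by apply/(IH 0%N _ _ (leq0n 2) Xp)/omega_plus0; exact: one_omega.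
have step : Omega_tf_plus 2 X q (iter_gen n q) p a -> alpha_iter 2 X n.+1 q p a.
  by move=> /(IH _ _ _ q2 Xp); exact: alpha_iter_mono.
case: q q2 step => [|[|[|//]]] q2 step; [exact: step|exact: step|].
case: n {IH i1} step => [|n] step; last exact: step.
exact: alpha_iter_dxdy.
Qed.

End AlphaIter.

Theorem lemma3p3p1 (R : realType) (k : nat) (hk : (2 <= k)%N) :
  let m := k./2 in
  let X := Sk R k in
  [/\ subsheaf_eq X (beta 2 X 1) (alpha 2 X 1)
        /\ subsheaf_eq X (alpha 2 X 1) (Omega_tf_plus 2 X 1 (xdy_over_z m)),
      subsheaf_eq X (alpha 2 X 2)
        (Omega_tf_plus 2 X 2 (dxdy_over_z (m - 1)%N)) &
      subsheaf_eq X (beta 2 X 2) (alpha_iter 2 X 1 2)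
        /\ subsheaf_eq X (alpha_iter 2 X 1 2)
             (Omega_tf_plus 2 X 2 (dxdy_over_z m))].
Proof.
move=> m X; split; [split|by move=> p a Xp; exact: alpha2E|split].
- move=> p a Xp; split; last by move=> h; exists 0%N.
  by move=> [n /(alpha_iterE hk _ _ (isT : (1 <= 2)%N) Xp) h]; apply/(alpha1E hk _ Xp).
- by move=> p a Xp; exact: alpha1E.
- move=> p a Xp; split; last by move=> h; exists 1%N.
  move=> [n /(alpha_iterE hk _ _ (isT : (2 <= 2)%N) Xp) h].
  apply/(alpha_iterE hk _ _ (isT : (2 <= 2)%N) Xp); case: n h => [|n] //=.
  exact: dxdy_weaken.
- by move=> p a Xp; exact: (alpha_iterE hk 1 _ (isT : (2 <= 2)%N) Xp).
Qed.
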